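(* Let $\omega<s$. Suppose that the standing assumptions (1)-(3) of the context hold, that $\bar a_2,\bar b_2\neq0$ and $\partial_\omega\|U_0\|_{L^2}^2>0$, that $E_{\mathrm B}(is)=0$, that $\gamma=0$ is a simple zero of $\widetilde E_{\mathrm B}(\gamma)$ with $\lambda_{\mathrm{br}}=is$, that $E_{\mathrm A}(is),E_{\mathrm C}(is)\neq0$, and that $\Delta_1(is)\neq0$ and $\mathcal I_2(is)\neq0$. Then for $\epsilon>0$ sufficiently small, $\mathcal L_\epsilon$ has no eigenvalue in a neighborhood of $\lambda=is$ and no resonance pole at $\lambda=is$.
   Context: Setting. Fix real constants $\omega,s>0$ and a function $F:\mathbb R\times\mathbb R\times\mathbb R\to\mathbb R$, $(\zeta_1,\zeta_2,\mu)\mapsto F(\zeta_1,\zeta_2;\mu)$, with real parameter $\mu$; $\partial_jF$ ($j=1,2$) is the derivative in the $j$-th argument. The coupled nonlinear Schrödinger equations are $$i\partial_tu+\partial_x^2u+\partial_1F(|u|^2,|v|^2;\mu)u=0,\quad i\partial_tv+\partial_x^2v+\partial_2F(|u|^2,|v|^2;\mu)v=0.$$ A real-valued solution $(U,V)$, with $U(x),V(x)\to0$ as $x\to\pm\infty$ (a homoclinic solution), of the stationary system $$-U''+\omega U-\partial_1F(U^2,V^2;\mu)U=0,\quad -V''+sV-\partial_2F(U^2,V^2;\mu)V=0$$ gives the solitary wave $(e^{i\omega t}U(x),e^{ist}V(x))$. Standing assumptions. (1) $F$ is $C^3$ and $F(0,0;\mu)=\partial_1F(0,0;\mu)=\partial_2F(0,0;\mu)=0$,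 $\partial_\mu F(\zeta,0;\mu)=0$ for all $\zeta,\mu\in\mathbb R$. One writes $\partial_1^jF(\zeta,0)$ for $\partial_1^jF(\zeta,0;\mu)$. (2) $-U''+\omega U-\partial_1F(U^2,0)U=0$ has a homoclinic solution $U_0\not\equiv0$ with $\lim_{x\to\pm\infty}U_0(x)=0$ and $U_0'(0)=0$; it is taken positive, even, with $U_0'(x)<0$ for $x>0$. It depends on $\omega$, and $\partial_\omega\|U_0\|_{L^2}^2$ is the derivative of $\|U_0\|_{L^2(\mathbb R)}^2$ in $\omega$ along this family. (3) At $\mu=0$ the equation $-\delta V''+s\,\delta V-\partial_2F(U_0(x)^2,0;0)\delta V=0$ has a nonzero bounded solution $V_1(x)$ with $\lim_{x\to\pm\infty}V_1(x)=0$. Bifurcated waves. Let $\phi_{11},\phi_{12}$ solve $-\phi''+\omega\phi-\bigl(2\partial_1^2F(U_0^2,0)U_0^2+\partial_1F(U_0^2,0)\bigr)\phi=0$ with $\phi_{11}(0)=1,\phi_{11}'(0)=0$, $\phi_{12}(0)=0,\phi_{12}'(0)=1$; let $g=\partial_1\partial_2F(U_0^2,0;0)U_0V_1^2$, $U_2(x)=-\phi_{11}(x)\int_x^\infty\phi_{12}g\,dy-\phi_{12}(x)\int_0^x\phi_{11}g\,dy$, and $$\bar a_2=-\int_{\mathbb R}\partial_2\partial_\mu F(U_0^2,0;0)V_1^2\,dx,\quad \bar b_2=-2\int_{\mathbb R}\partial_1\partial_2F(U_0^2,0;0)U_0U_2V_1^2\,dx-\int_{\mathbb R}\partial_2^2F(U_0^2,0;0)V_1^4\,dx.$$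 If $\bar a_2,\bar b_2\ne0$, a pitchfork bifurcation of $(U_0,0)$ occurs at $\mu=0$: for small $\epsilon>0$ and $\mu=\bar\mu\epsilon^2$, $\bar\mu=-\bar b_2/\bar a_2$, there are homoclinic solutions $(U_\epsilon,V_\epsilon)$ with $U_\epsilon=U_0+\epsilon^2U_2+O(\epsilon^4)$, $V_\epsilon=\pm(\epsilon V_1+O(\epsilon^3))$, giving the bifurcated solitary waves $(e^{i\omega t}U_\epsilon,e^{ist}V_\epsilon)$. Linearized operator. The linearized operator $\mathcal L:H^2(\mathbb R,\mathbb C^4)\subset L^2(\mathbb R,\mathbb C^4)\to L^2(\mathbb R,\mathbb C^4)$ around $(e^{i\omega t}U,e^{ist}V)$ is $$\mathcal L=-i\Sigma_3\left[-\partial_x^2I_4+\begin{pmatrix}\omega I_2&O_2\\O_2&sI_2\end{pmatrix}-\begin{pmatrix}B_{11}&B_{12}\\ B_{21}&B_{22}\end{pmatrix}\right],$$ with $\sigma_1=\begin{pmatrix}0&1\\1&0\end{pmatrix}$, $\sigma_3=\mathrm{diag}(1,-1)$, $\Sigma_3=\mathrm{diag}(\sigma_3,\sigma_3)$, and, all derivatives of $F$ being evaluated at $(U(x)^2,V(x)^2;\mu)$, $B_{11}=\partial_1^2F\,U^2(I_2+\sigma_1)+\partial_1F\,I_2$, $B_{12}=B_{21}=\partial_1\partial_2F\,UV(I_2+\sigma_1)$, $B_{22}=\partial_2^2F\,V^2(I_2+\sigma_1)+\partial_2F\,I_2$. $\mathcal L_\epsilon$ is the linearized operator around the bifurcated wave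 (with $\mu=\bar\mu\epsilon^2$). Exponents. Let $\nu_1=\sqrt{\omega-i\lambda}$, $\nu_2=\sqrt{\omega+i\lambda}$, $\nu_3=\sqrt{s-i\lambda}$, $\nu_4=\sqrt{s+i\lambda}$ with $-3\pi/4<\arg\nu_1,\arg\nu_3<\pi/4$ and $-\pi/4<\arg\nu_2,\arg\nu_4<3\pi/4$; $\pm i\omega,\pm is$ are the branch points. Jost solutions and Evans functions at $\epsilon=0$ (so $\mu=0$). Consider (A) $-p''+\omega p-\partial_1^2F(U_0^2,0)U_0^2(p+q)-\partial_1F(U_0^2,0)p=i\lambda p$, $\ -q''+\omega q-\partial_1^2F(U_0^2,0)U_0^2(p+q)-\partial_1F(U_0^2,0)q=-i\lambda q$; (B) $-p''+sp-\partial_2F(U_0^2,0;0)p=-i\lambda p$; (C) $-p''+sp-\partial_2F(U_0^2,0;0)p=i\lambda p$. Let $(p_j,q_j)(x,\lambda)$, $j=1,2,5,6$, be solutions of (A) such that $e^{-\nu_1x}(p_1,q_1,p_1',q_1')\to(1,0,\nu_1,0)$ and $e^{-\nu_2x}(p_2,q_2,p_2',q_2')\to(0,1,0,\nu_2)$ as $x\to-\infty$, and $e^{\nu_1x}(p_5,q_5,p_5',q_5')\to(1,0,-\nu_1,0)$ and $e^{\nu_2x}(p_6,q_6,p_6',q_6')\to(0,1,0,-\nu_2)$ as $x\to+\infty$. Let $p_4,p_8$ solve (B) and $p_3,p_7$ solve (C), with $e^{-\nu_jx}(p_j,p_j')\to(1,\nu_j)$ as $x\to-\infty$ for $j=3,4$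 and $e^{\nu_jx}(p_{j+4},p_{j+4}')\to(1,-\nu_j)$ as $x\to+\infty$ for $j=3,4$. Define $$E_{\mathrm A}(\lambda)=\det\begin{pmatrix}p_1&p_2&p_5&p_6\\ q_1&q_2&q_5&q_6\\ p_1'&p_2'&p_5'&p_6'\\ q_1'&q_2'&q_5'&q_6'\end{pmatrix}(0,\lambda),\quad E_{\mathrm B}(\lambda)=\det\begin{pmatrix}p_4&p_8\\ p_4'&p_8'\end{pmatrix}(0,\lambda),\quad E_{\mathrm C}(\lambda)=\det\begin{pmatrix}p_3&p_7\\ p_3'&p_7'\end{pmatrix}(0,\lambda).$$ With $\lambda_{\mathrm{br}}=is$ and $\lambda=is-i\gamma^2$ one has $\nu_4=\gamma$ as analytic continuation, and $\widetilde E_{\mathrm B}(\gamma)=E_{\mathrm B}(is-i\gamma^2)$ denotes the determinant $E_{\mathrm B}$ regarded as an analytic function of $\gamma$ near $0$ (with $\nu_4$ replaced by $\gamma$). For $j=1,2$ let $$\Delta_j(\lambda)=p_j(0,\lambda)p_j'(0,\lambda)+q_j(0,\lambda)q_j'(0,\lambda),$$ $$\mathcal I_j(\lambda)=\int_{-\infty}^\infty\partial_1\partial_2F(U_0(x)^2,0;0)U_0(x)V_1(x)\bigl(p_j(x,\lambda)+q_j(x,\lambda)\bigr)p_4(x,\lambda)\,dx.$$ Normalization: at $\lambda=is$ (with $\omega<s$), $(p_1,q_1)$ is uniquely determined and one takes $(p_5,q_5)(x)=(p_1,q_1)(-x)$; $(p_2,q_2)$ is determined only up to adding multiples of $(p_1,q_1)$,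 and when $\Delta_1(is)\ne0$ it is fixed uniquely by the requirement $p_2'p_5+q_2'q_5-p_2p_5'-q_2q_5'=0$ (independent of $x$). $\mathcal I_2$ is formed with this choice. Evans function for $\epsilon>0$ and resonance poles. Write $\mathcal L_\epsilon\psi=\lambda\psi$ as a first-order system for $Y=(\psi,\psi')^{\mathsf T}\in\mathbb C^8$. With $e_j$ the standard basis of $\mathbb C^4$, let $Y_j^-$, $Y_{j+4}^+$ ($j=1,\dots,4$) be Jost solutions with $e^{-\nu_jx}Y_j^-\to(e_j,\nu_je_j)^{\mathsf T}$ as $x\to-\infty$ and $e^{\nu_jx}Y_{j+4}^+\to(e_j,-\nu_je_j)^{\mathsf T}$ as $x\to+\infty$ (exponentially fast), chosen analytic in $\lambda$ and continuous at the branch points. The Evans function is $E(\lambda,\epsilon)=\det(Y_1^-\cdots Y_4^-\,Y_5^+\cdots Y_8^+)$, independent of $x$; at $\epsilon=0$ it equals $E_{\mathrm A}E_{\mathrm B}E_{\mathrm C}$. A zero of $E(\cdot,\epsilon)$ which is not an eigenvalue of $\mathcal L_\epsilon$ is called a resonance pole of $\mathcal L_\epsilon$. *)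

(* Defs.v *)
From HB Require Import structures.
From mathcomp Require Import all_boot all_order all_algebra.
From mathcomp Require Import complex.
From mathcomp Require Import all_classical all_reals all_analysis.

Set Implicit Arguments.
Unset Strict Implicit.
Unset Printing Implicit Defensive.

Import Order.TTheory GRing.Theory Num.Theory.
Import numFieldNormedType.Exports.

Local Open Scope ring_scope.
Local Open Scope classical_set_scope.
Local Open Scope complex_scope.

(* topology and normed module structure of the complex field over itself,
   given by its modulus *)
HB.instance Definition _ (R : rcfType) := GRing.ComAlgebra.copy R[i] R[i]^o.
HB.instance Definition _ (R : rcfType) := Vector.copy R[i] R[i]^o.
HB.instance Definition _ (R : rcfType) := NormedModule.copy R[i] R[i]^o.

Section RealCalculus.
Variable R : realType.
Implicit Types (F : R -> R -> R -> R) (U V W f g : R -> R).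

Definition d1 F : R -> R -> R -> R := fun a b m => derive1 (fun z => F z b m) a.
Definition d2 F : R -> R -> R -> R := fun a b m => derive1 (fun z => F a z m) b.
Definition dmu F : R -> R -> R -> R := fun a b m => derive1 (fun z => F a b z) m.

Fixpoint Ck (k : nat) F : Prop :=
  match k with
  | 0 => continuous (fun z : R * R * R => F z.1.1 z.1.2 z.2)
  | k'.+1 =>
      [/\ forall a b m, [/\ derivable (fun z => F z b m) a 1,
                            derivable (fun z => F a z m) b 1 &
                            derivable (fun z => F a b z) m 1],
          Ck k' (d1 F), Ck k' (d2 F) & Ck k' (dmu F)]
  end.

Definition twice_derivable f : Prop :=
  forall x, derivable f x 1 /\ derivable (derive1 f) x 1.

Definition vanishes_at_infty f : Prop :=
  f x @[x --> +oo] --> (0 : R) /\ f x @[x --> -oo] --> (0 : R).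

Definition int_line f : R := \int[lebesgue_measure]_(x in setT) f x.

(* integral from a to b with sign: one of the two terms vanishes *)
Definition int_ab (a b : R) f : R :=
  \int[lebesgue_measure]_(x in `[a, b]) f x
  - \int[lebesgue_measure]_(x in `[b, a]) f x.

Definition int_from (a : R) f : R :=
  \int[lebesgue_measure]_(x in `[a, +oo[) f x.

Definition standing1 F : Prop :=
  [/\ Ck 3 F,
      forall m, [/\ F 0 0 m = 0, d1 F 0 0 m = 0 & d2 F 0 0 m = 0] &
      forall z m, dmu F z 0 m = 0].

(* F(z, 0; m) and its derivatives in z do not depend on m under [standing1];
   below they are taken at m = 0. *)
Definition ground_state F (om : R) U : Prop :=
  [/\ twice_derivable U,
      forall x, - derive1n 2 U x + om * U x - d1 F (U x ^+ 2) 0 0 * U x = 0,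
      vanishes_at_infty U, derive1 U 0 = 0 &
      [/\ forall x, 0 < U x, forall x, U (- x) = U x &
          forall x, 0 < x -> derive1 U x < 0]].

Definition mass U : R := int_line (fun x => U x ^+ 2).

Definition standing3 F (s : R) U V : Prop :=
  [/\ twice_derivable V,
      forall x, - derive1n 2 V x + s * V x - d2 F (U x ^+ 2) 0 0 * V x = 0,
      exists x, V x != 0,
      exists M : R, forall x, `|V x| <= M &
      vanishes_at_infty V].

Definition variational_U F (om : R) U f : Prop :=
  twice_derivable f /\
  forall x, - derive1n 2 f x + om * f x
    - (2 * d1 (d1 F) (U x ^+ 2) 0 0 * U x ^+ 2 + d1 F (U x ^+ 2) 0 0) * f x = 0.

Definition U2_of F U V (phi11 phi12 : R -> R) : R -> R :=
  let g := fun x => d1 (d2 F) (U x ^+ 2) 0 0 * U x * V x ^+ 2 in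
  fun x => - phi11 x * int_from x (fun y => phi12 y * g y)
           - phi12 x * int_ab 0 x (fun y => phi11 y * g y).

Definition a2bar F U V : R :=
  - int_line (fun x => d2 (dmu F) (U x ^+ 2) 0 0 * V x ^+ 2).

Definition b2bar F U V U2 : R :=
  - 2 * int_line (fun x => d1 (d2 F) (U x ^+ 2) 0 0 * U x * U2 x * V x ^+ 2)
  - int_line (fun x => d2 (d2 F) (U x ^+ 2) 0 0 * V x ^+ 4).

Definition homoclinic F (om s m : R) U V : Prop :=
  [/\ twice_derivable U, twice_derivable V,
      forall x,
        - derive1n 2 U x + om * U x - d1 F (U x ^+ 2) (V x ^+ 2) m * U x = 0
        /\ - derive1n 2 V x + s * V x - d2 F (U x ^+ 2) (V x ^+ 2) m * V x = 0,
      vanishes_at_infty U & vanishes_at_infty V].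

(* the error terms O(eps^4), O(eps^3) are uniform in x *)
Definition bifurcated_family F (om s mubar : R) U V U2
    (Ueps Veps : R -> R -> R) : Prop :=
  exists sg : R, (sg = 1 \/ sg = -1) /\
  exists e0 : R, exists K : R, 0 < e0 /\
    forall e : R, 0 < e < e0 ->
      [/\ homoclinic F om s (mubar * e ^+ 2) (Ueps e) (Veps e),
          forall x, `|Ueps e x - (U x + e ^+ 2 * U2 x)| <= K * e ^+ 4 &
          forall x, `|Veps e x - sg * (e * V x)| <= K * e ^+ 3].

(* f' = g in the sense of distributions on the line *)
Definition test_function (phi : R -> R) : Prop :=
  (forall n x, derivable (derive1n n phi) x 1) /\
  exists M : R, forall x, M < `|x| -> phi x = 0.

Definition weak_deriv f g : Prop :=
  forall phi, test_function phi ->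
    int_line (fun x => f x * derive1 phi x) = - int_line (fun x => g x * phi x).

Definition inL2 f : Prop := f \in Lfun (@lebesgue_measure R) 2%:E.

Definition inH2 f f' f'' : Prop :=
  [/\ inL2 f, inL2 f', inL2 f'', weak_deriv f f' & weak_deriv f' f''].

End RealCalculus.

Section ComplexFunctions.
Variable R : realType.
Notation C := R[i].

Definition reF (f : R -> C) : R -> R := fun x => complex.Re (f x).
Definition imF (f : R -> C) : R -> R := fun x => complex.Im (f x).

(* derivative with respect to the real variable *)
Definition cderiv (f : R -> C) : R -> C :=
  fun x => derive1 (reF f) x +i* derive1 (imF f) x.

Definition ctwice_derivable (f : R -> C) : Prop :=
  twice_derivable (reF f) /\ twice_derivable (imF f).

Definition cint_line (f : R -> C) : C := int_line (reF f) +i* int_line (imF f).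

Definition cexp (z : C) : C :=
  (expR (complex.Re z))%:C * (cos (complex.Im z) +i* sin (complex.Im z)).

Definition arg_in (a b : R) (z : C) : Prop :=
  exists r : R, exists t : R,
    [/\ 0 < r, a < t < b & z = r%:C * (cos t +i* sin t)].

(* the square root of z with argument in ]a, b[ (and 0 if z = 0);
   meaningful when b - a = pi and z is off the corresponding cut *)
Definition sqrt_arg (a b : R) (z : C) : C :=
  xget 0 [set n : C | n ^+ 2 = z /\ (n = 0 \/ arg_in a b n)].

Variables om s : R.

Definition nu1 (lam : C) : C :=
  sqrt_arg (- (3 * pi / 4)) (pi / 4) (om%:C - 'i * lam).
Definition nu2 (lam : C) : C :=
  sqrt_arg (- (pi / 4)) (3 * pi / 4) (om%:C + 'i * lam).
Definition nu3 (lam : C) : C :=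
  sqrt_arg (- (3 * pi / 4)) (pi / 4) (s%:C - 'i * lam).
Definition nu4 (lam : C) : C :=
  sqrt_arg (- (pi / 4)) (3 * pi / 4) (s%:C + 'i * lam).

Definition nu (j : nat) : C -> C := nth nu1 [:: nu1; nu2; nu3; nu4] j.

Definition branch_point (b : C) : Prop :=
  [\/ b = 0 +i* om, b = 0 -i* om, b = 0 +i* s | b = 0 -i* s].

(* The ranges chosen for the arguments put all four cuts on the half-lines
   going from the branch points towards Re = -oo. *)
Definition off_cuts (lam : C) : Prop :=
  forall b (t : R), branch_point b -> 0 < t -> lam <> b - t%:C.

End ComplexFunctions.

Section UnperturbedEvans.
Variable R : realType.
Notation C := R[i].
Variables (om s : R) (F : R -> R -> R -> R) (U0 V1 : R -> R).
Implicit Types (p q : R -> C) (lam n c : C).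

Definition solves_A lam p q : Prop :=
  [/\ ctwice_derivable p, ctwice_derivable q &
      forall x,
        let a := (d1 (d1 F) (U0 x ^+ 2) 0 0 * U0 x ^+ 2)%:C in
        let b := (d1 F (U0 x ^+ 2) 0 0)%:C in
        - cderiv (cderiv p) x + om%:C * p x - a * (p x + q x) - b * p x
          = 'i * lam * p x
        /\ - cderiv (cderiv q) x + om%:C * q x - a * (p x + q x) - b * q x
          = - 'i * lam * q x].

Definition solves_B lam p : Prop :=
  ctwice_derivable p /\
  forall x, - cderiv (cderiv p) x + s%:C * p x
            - (d2 F (U0 x ^+ 2) 0 0)%:C * p x = - 'i * lam * p x.

Definition solves_C lam p : Prop :=
  ctwice_derivable p /\
  forall x, - cderiv (cderiv p) x + s%:C * p x
            - (d2 F (U0 x ^+ 2) 0 0)%:C * p x = 'i * lam * p x.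

Definition lim_minus n p c : Prop :=
  cexp (- n * x%:C) * p x @[x --> -oo] --> c.
Definition lim_plus n p c : Prop :=
  cexp (n * x%:C) * p x @[x --> +oo] --> c.

Definition jost_A_minus lam n (c d : C) p q : Prop :=
  [/\ solves_A lam p q, lim_minus n p c, lim_minus n q d,
      lim_minus n (cderiv p) (n * c) & lim_minus n (cderiv q) (n * d)].
Definition jost_A_plus lam n (c d : C) p q : Prop :=
  [/\ solves_A lam p q, lim_plus n p c, lim_plus n q d,
      lim_plus n (cderiv p) (- n * c) & lim_plus n (cderiv q) (- n * d)].

Definition jost_B_minus lam n p : Prop :=
  [/\ solves_B lam p, lim_minus n p 1 & lim_minus n (cderiv p) n].
Definition jost_B_plus lam n p : Prop :=
  [/\ solves_B lam p, lim_plus n p 1 & lim_plus n (cderiv p) (- n)].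

Definition jost_C_minus lam n p : Prop :=
  [/\ solves_C lam p, lim_minus n p 1 & lim_minus n (cderiv p) n].
Definition jost_C_plus lam n p : Prop :=
  [/\ solves_C lam p, lim_plus n p 1 & lim_plus n (cderiv p) (- n)].

Definition evans_A p1 q1 p2 q2 p5 q5 p6 q6 : C :=
  \det (\matrix_(k < 4, j < 4)
    let p := nth p1 [:: p1; p2; p5; p6] j in
    let q := nth q1 [:: q1; q2; q5; q6] j in
    nth 0 [:: p 0; q 0; cderiv p 0; cderiv q 0] k).

(* used for both E_B and E_C *)
Definition evans_2 (pm pp : R -> C) : C :=
  \det (\matrix_(k < 2, j < 2)
    let p := nth pm [:: pm; pp] j in nth 0 [:: p 0; cderiv p 0] k).

Definition Delta p q : C := p 0 * cderiv p 0 + q 0 * cderiv q 0.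

Definition coupling_int p q (p4 : R -> C) : C :=
  cint_line (fun x =>
    (d1 (d2 F) (U0 x ^+ 2) 0 0 * U0 x * V1 x)%:C * (p x + q x) * p4 x).

(* lam_br - i gam^2 with lam_br = i s, where nu4 = gam *)
Definition lam_of (gam : C) : C := 0 +i* s - 'i * gam ^+ 2.

(* Solutions p4, p8 of (B) at lam_of gam, continued analytically to a full
   neighbourhood of gam = 0.  When Re gam >= 0 the limits alone determine them;
   when Re gam < 0 the analyticity in gam does. *)
Definition jost_B_near (p4 p8 : C -> R -> C) : Prop :=
  \forall gam \near (0 : C),
    [/\ jost_B_minus (lam_of gam) gam (p4 gam),
        jost_B_plus (lam_of gam) gam (p8 gam) &
        forall x,
          [/\ derivable (fun g => p4 g x) gam 1,
              derivable (fun g => cderiv (p4 g) x) gam 1,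
              derivable (fun g => p8 g x) gam 1 &
              derivable (fun g => cderiv (p8 g) x) gam 1]].

End UnperturbedEvans.

Definition simple_zero (R : realType) (f : R[i] -> R[i]) (z : R[i]) : Prop :=
  [/\ \forall w \near z, derivable f w 1, f z = 0 & derive1 f z <> 0].

Section LinearizedOperator.
Variable R : realType.
Notation C := R[i].
Variables (om s : R) (F : R -> R -> R -> R) (m : R) (U V : R -> R).

Definition sigma1 : 'M[C]_2 := \matrix_(i, j) (i != j)%:R.
Definition sigma3 : 'M[C]_2 := \matrix_(i, j) ((i == j)%:R * (-1) ^+ i).
Definition Sigma3 : 'M[C]_(2 + 2) := block_mx sigma3 0 0 sigma3.

Definition freqs : 'M[C]_(2 + 2) := block_mx (om%:C%:M) 0 0 (s%:C%:M).

Definition Bmx (x : R) : 'M[C]_(2 + 2) :=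
  let at_wave (G : R -> R -> R -> R) := G (U x ^+ 2) (V x ^+ 2) m in
  let J : 'M[C]_2 := 1%:M + sigma1 in
  let B11 := (at_wave (d1 (d1 F)) * U x ^+ 2)%:C *: J
             + (at_wave (d1 F))%:C%:M in
  let B12 := (at_wave (d1 (d2 F)) * U x * V x)%:C *: J in
  let B22 := (at_wave (d2 (d2 F)) * V x ^+ 2)%:C *: J
             + (at_wave (d2 F))%:C%:M in
  block_mx B11 B12 B12 B22.

(* value at x of L psi, where psi2 is the second derivative of psi *)
Definition Lop (psi psi2 : R -> 'cV[C]_(2 + 2)) (x : R) : 'cV[C]_(2 + 2) :=
  - 'i *: (Sigma3 *m (- psi2 x + freqs *m psi x - Bmx x *m psi x)).

Definition entry n (psi : R -> 'cV[C]_n) (k : 'I_n) : R -> C :=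
  fun x => psi x k 0.

Definition vinH2 n (psi psi1 psi2 : R -> 'cV[C]_n) : Prop :=
  forall k,
    inH2 (reF (entry psi k)) (reF (entry psi1 k)) (reF (entry psi2 k))
    /\ inH2 (imF (entry psi k)) (imF (entry psi1 k)) (imF (entry psi2 k)).

Definition L_eigenvalue (lam : C) : Prop :=
  exists psi psi1 psi2 : R -> 'cV[C]_(2 + 2),
    [/\ vinH2 psi psi1 psi2,
        ~ {ae lebesgue_measure, forall x, psi x = 0} &
        {ae lebesgue_measure, forall x, Lop psi psi2 x = lam *: psi x}].

Definition vderiv n (psi : R -> 'cV[C]_n) : R -> 'cV[C]_n :=
  fun x => \col_k cderiv (entry psi k) x.

Definition solves_L (lam : C) (psi : R -> 'cV[C]_(2 + 2)) : Prop :=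
  (forall k, ctwice_derivable (entry psi k)) /\
  forall x, Lop psi (vderiv (vderiv psi)) x = lam *: psi x.

Definition jet (psi : R -> 'cV[C]_(2 + 2)) (x : R)
    : 'cV[C]_((2 + 2) + (2 + 2)) := col_mx (psi x) (vderiv psi x).

Definition jost_minus (lam : C) (j : 'I_(2 + 2))
    (psi : R -> 'cV[C]_(2 + 2)) : Prop :=
  let n := nu om s j lam in
  let e : 'cV[C]_(2 + 2) := delta_mx j 0 in
  solves_L lam psi /\
  exists K : R, exists b : R, 0 < b /\
    forall x k, x <= 0 ->
      `| cexp (- n * x%:C) * jet psi x k 0 - col_mx e (n *: e) k 0 |
        <= (K * expR (b * x))%:C.

Definition jost_plus (lam : C) (j : 'I_(2 + 2))
    (psi : R -> 'cV[C]_(2 + 2)) : Prop :=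
  let n := nu om s j lam in
  let e : 'cV[C]_(2 + 2) := delta_mx j 0 in
  solves_L lam psi /\
  exists K : R, exists b : R, 0 < b /\
    forall x k, 0 <= x ->
      `| cexp (n * x%:C) * jet psi x k 0 - col_mx e (- n *: e) k 0 |
        <= (K * expR (- b * x))%:C.

(* A family of Jost solutions is analytic in lam off the cuts and the branch
   points, and continuous at the branch points (along the slit domain D). *)
Definition regular_family (D : set C)
    (psi : C -> R -> 'cV[C]_(2 + 2)) : Prop :=
  forall x k,
    (forall lam, D lam -> ~ branch_point om s lam ->
       derivable (fun l => jet (psi l) x k 0) lam 1) /\
    (forall b, D b -> branch_point om s b ->
       jet (psi l) x k 0 @[l --> within D (nbhs b)] --> jet (psi b) x k 0).

(* E is an Evans function of L near lam0.  For Re lam0 >= 0 its values near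
   lam0 (off the cuts) do not depend on the choice of the Jost solutions. *)
Definition evans_near (lam0 : C) (E : C -> C) : Prop :=
  exists r : R, 0 < r /\
  let D := [set lam : C | `|lam - lam0| < r%:C /\ off_cuts om s lam] in
  exists psim psip : 'I_(2 + 2) -> C -> R -> 'cV[C]_(2 + 2),
    [/\ forall j, regular_family D (psim j) /\ regular_family D (psip j),
        forall j lam, D lam ->
          jost_minus lam j (psim j lam) /\ jost_plus lam j (psip j lam) &
        forall lam, D lam ->
          E lam = \det (row_mx (\matrix_(k, j) jet (psim j lam) 0 k 0)
                               (\matrix_(k, j) jet (psip j lam) 0 k 0))].

Definition resonance_pole (lam : C) : Prop :=
  exists E : C -> C, [/\ evans_near lam E, E lam = 0 & ~ L_eigenvalue lam].

End LinearizedOperator.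

(* Main.v *)
Require Import Defs.
From mathcomp Require Import all_boot all_order all_algebra.
From mathcomp Require Import complex.
From mathcomp Require Import all_classical all_reals all_analysis.
From mathcomp Require Import measurable_realfun.
From mathcomp Require Import ring lra.

(* With [z = i lambda + s], which vanishes at the branch point, the eigenvalue problem
   is a system of four equations with real symmetric coefficients, close to two
   components [psi1, psi2] governed by (A), one, [psi3], by (C) and one, [psi4], by (B);
   the blocks are coupled at order [epsilon].  Consider a bounded outgoing solution with
   [z] and [epsilon] small.

   Pairing [psi1, psi2] and [psi3] with the Jost solutions of (A) and (C) at
   [lambda = i s], and using [E_A, E_C <> 0], shows that these components are of order
   [epsilon] relative to [psi4], which is therefore close to a multiple [a] of [p4] on
   compact sets.  By conjugation one may assume [Im z >= 0].
   If [Im z > 0], an eigenfunction has the flux identity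
   [|psi2|^2 + |psi4|^2 = |psi1|^2 + |psi3|^2] (integrated over the line), which is
   impossible as [psi4] dominates.
   If [Im z = 0], then [psi2] is oscillating at infinity, hence decays exponentially when
   the solution is an eigenfunction.  Pairing with the solution [(p2, q2)] of (A), which
   the normalization makes bounded on the whole line (here [Delta_1 <> 0] enters),
   yields [epsilon a I_2 = o(epsilon a)], so [a = 0] and the solution vanishes.

   A zero of the Evans function at [lambda = i s] gives a bounded outgoing solution there;
   the flux is constant, [<= 0] at one end and [>= 0] at the other, so [psi2] again
   decays and the previous argument applies. *)

Set Implicit Arguments.
Unset Strict Implicit.
Unset Printing Implicit Defensive.

Import Order.TTheory GRing.Theory Num.Theory.
Import numFieldNormedType.Exports.

Local Open Scope ring_scope.
Local Open Scope classical_set_scope.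
Local Open Scope complex_scope.
(** * Complex-valued functions of a real variable *)

(** The Evans function is never expanded in [eps]: every step compares sizes, with constants
    independent of [eps] and [z]. The yardstick is the supremum [M] of the four components,
    controlled in the end by the jet of [psi4] at 0. The obstacle is that [psi4] decays at the rate
    [Re ka4] with [ka4 ^+ 2 = z], hence not uniformly. It is therefore compared with [a p4] on
    bounded intervals only, and the exponential decay of the potentials and of the coupling takes
    care of the rest of the line. Taking [Im z >= 0] fixes the limit problem: the root [ka2] of
    [om - s + z] with nonnegative real part is then close to [i sqrt(s - om)], the exponent used in
    [E_A], whereas for [Im z < 0] it would be close to the opposite number. In the pairing with
    [(p2, q2)] the order of choices matters: the length of the interval, then the accuracy of [a p4]
    on it, then the sizes of [z] and [eps]. Eigenfunctions are given in [H^2] with distributional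
    derivatives, so classical representatives that vanish at infinity with their derivatives are
    constructed as well. *)

Notation cabs := Normc.normc.

Section ComplexModulus.
Variable R : realType.
Implicit Types (x y z : R[i]).

Lemma reM x y : complex.Re (x * y)
  = complex.Re x * complex.Re y - complex.Im x * complex.Im y.
Proof. by case: x => a b; case: y => c d. Qed.

Lemma imM x y : complex.Im (x * y)
  = complex.Re x * complex.Im y + complex.Im x * complex.Re y.
Proof. by case: x => a b; case: y => c d. Qed.

Lemma reD x y : complex.Re (x + y) = complex.Re x + complex.Re y.
Proof. by case: x => a b; case: y => c d. Qed.

Lemma imD x y : complex.Im (x + y) = complex.Im x + complex.Im y.
Proof. by case: x => a b; case: y => c d. Qed.

Lemma reN x : complex.Re (- x) = - complex.Re x.
Proof. by case: x => a b. Qed.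

Lemma imN x : complex.Im (- x) = - complex.Im x.
Proof. by case: x => a b. Qed.

Lemma cabs2 x : cabs x ^+ 2 = complex.Re x ^+ 2 + complex.Im x ^+ 2.
Proof. by case: x => a b /=; rewrite sqr_sqrtr // addr_ge0 ?sqr_ge0. Qed.

Lemma cabs_ge0 x : 0 <= cabs x.
Proof. by case: x => a b; exact: sqrtr_ge0. Qed.

Lemma cabsM x y : cabs (x * y) = cabs x * cabs y.
Proof. exact: Normc.normcM. Qed.

Lemma cabsD x y : cabs (x + y) <= cabs x + cabs y.
Proof. exact: le_normcD. Qed.

Lemma cabsN x : cabs (- x) = cabs x.
Proof. exact: normcN. Qed.

Lemma cabsB x y : cabs (x - y) <= cabs x + cabs y.
Proof. by rewrite (le_trans (cabsD _ _)) // cabsN. Qed.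

Lemma cabs0 : cabs (0 : R[i]) = 0.
Proof. exact: Normc.normc0. Qed.

Lemma cabs1 : cabs (1 : R[i]) = 1.
Proof. exact: Normc.normc1. Qed.

Lemma cabs_real (r : R) : cabs r%:C = `|r|.
Proof. by rewrite /= expr0n /= addr0 sqrtr_sqr. Qed.

Lemma cabs_conj x : cabs x^* = cabs x.
Proof. by case: x => a b /=; rewrite sqrrN. Qed.

(** The norm of [R[i]] takes its values in [R[i]]; the estimates use the real modulus [cabs], and
    this is the bridge to the norms of the statement. *)
Lemma cabs_normE x : `|x| = (cabs x)%:C.
Proof. by case: x. Qed.

Lemma cabs_lt x (r : R) : (`|x| < r%:C) = (cabs x < r).
Proof. by rewrite cabs_normE ltcR. Qed.

Lemma cabs_le x (r : R) : (`|x| <= r%:C) = (cabs x <= r).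
Proof. by rewrite cabs_normE lecR. Qed.

Lemma cabs_eq0 x : cabs x = 0 -> x = 0.
Proof. exact: Normc.eq0_normc. Qed.

Lemma cabs_gt0 x : x <> 0 -> 0 < cabs x.
Proof.
move=> x0; rewrite lt_def cabs_ge0 andbT; apply/eqP => /cabs_eq0; exact: x0.
Qed.

Lemma cabs_sub x y : cabs x - cabs y <= cabs (x - y).
Proof. by rewrite lerBlDr; have := cabsD (x - y) y; rewrite subrK. Qed.

Lemma cabs_subC x y : cabs (x - y) = cabs (y - x).
Proof. by rewrite -cabsN opprB. Qed.

Lemma re_le_cabs x : complex.Re x <= cabs x.
Proof.
rewrite (le_trans (ler_norm _)) // -(@ler_pXn2r _ 2) ?nnegrE ?cabs_ge0 //.
by rewrite cabs2 -normrX ger0_norm ?sqr_ge0 // lerDl sqr_ge0.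
Qed.

Lemma reJM x y : complex.Re (x^* * y)
  = complex.Re x * complex.Re y + complex.Im x * complex.Im y.
Proof. by case: x => a b; case: y => c d /=; ring. Qed.

Lemma reJM_self x : complex.Re (x^* * x) = cabs x ^+ 2.
Proof. by rewrite reJM cabs2 !expr2. Qed.

Lemma cabs_expM x n : cabs (x ^+ n) = cabs x ^+ n.
Proof.
elim: n => [|n IHn]; first by rewrite !expr0 cabs1.
by rewrite !exprS cabsM IHn.
Qed.

Lemma cabs_exp2 x : cabs (x ^+ 2) = cabs x ^+ 2.
Proof. exact: cabs_expM. Qed.

Lemma complexP x y : complex.Re x = complex.Re y -> complex.Im x = complex.Im y ->
  x = y.
Proof. by case: x => a b; case: y => c d /= -> ->. Qed.

Lemma cexp0 : cexp (0 : R[i]) = 1.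
Proof. by rewrite /cexp /= expR0 cos0 sin0 mul1r. Qed.

Lemma re_cexp x : complex.Re (cexp x) = expR (complex.Re x) * cos (complex.Im x).
Proof. by rewrite /cexp /= mul0r subr0. Qed.

Lemma im_cexp x : complex.Im (cexp x) = expR (complex.Re x) * sin (complex.Im x).
Proof. by rewrite /cexp /= mul0r addr0. Qed.

Lemma cexpD x y : cexp (x + y) = cexp x * cexp y.
Proof.
apply: complexP; rewrite !(reM, imM, re_cexp, im_cexp, reD, imD) expRD ?cosD ?sinD;
  ring.
Qed.

Lemma cabs_cexp x : cabs (cexp x) = expR (complex.Re x).
Proof.
rewrite /cexp cabsM cabs_real ger0_norm ?expR_ge0 //=.
by rewrite cos2Dsin2 sqrtr1 mulr1.
Qed.

Lemma cabs_cexpM x y : cabs (cexp x * y) = expR (complex.Re x) * cabs y.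
Proof. by rewrite cabsM cabs_cexp. Qed.

Lemma cexpNK x : cexp (- x) * cexp x = 1.
Proof. by rewrite -cexpD addNr cexp0. Qed.

Lemma cabs_sum (I : Type) (r : seq I) (P : pred I) (f : I -> R[i]) :
  cabs (\sum_(i <- r | P i) f i) <= \sum_(i <- r | P i) cabs (f i).
Proof.
elim/big_ind2: _ => [|a b c d ab cd|//]; first by rewrite cabs0.
by rewrite (le_trans (cabsD _ _)) // lerD.
Qed.

End ComplexModulus.

Notation derR f x d := (is_derive x 1 f d).

Section RealDerivative.
Variable R : realType.
Implicit Types (f g : R -> R) (x a b : R).

Lemma derR_eq f x a b : derR f x a -> a = b -> derR f x b.
Proof. by move=> ? <-. Qed.

Lemma derR_cst c x : derR (fun=> c : R) x (0 : R).
Proof. exact: is_derive_cst. Qed.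

Lemma derR_id x : derR (fun y : R => y) x (1 : R).
Proof. exact: is_derive_id. Qed.

Lemma derRD f g x a b : derR f x a -> derR g x b ->
  derR (fun y => f y + g y) x (a + b).
Proof. by move=> fa gb; exact: is_deriveD. Qed.

Lemma derRN f x a : derR f x a -> derR (fun y => - f y) x (- a).
Proof. by move=> fa; exact: is_deriveN. Qed.

Lemma derRB f g x a b : derR f x a -> derR g x b ->
  derR (fun y => f y - g y) x (a - b).
Proof. by move=> fa gb; exact: is_deriveB. Qed.

Lemma derRM f g x a b : derR f x a -> derR g x b ->
  derR (fun y => f y * g y) x (a * g x + f x * b).
Proof.
move=> fa gb; rewrite -[fun y => _]/(f * g); apply: (is_derive_eq (is_deriveM fa gb)).
by rewrite addrC /GRing.scale /= mulrC.
Qed.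

Lemma derR_comp f g x a b : derR f (g x) a -> derR g x b ->
  derR (fun y => f (g y)) x (a * b).
Proof.
move=> fa gb; rewrite -[fun y => _]/(f \o g).
by apply: (is_derive_eq (is_derive1_comp fa gb)); rewrite mulrC.
Qed.

Lemma derR_exp c x : derR (fun y => expR (c * y)) x (c * expR (c * x)).
Proof.
have h : derR (fun y => c * y) x c.
  by apply: (derR_eq (derRM (derR_cst c x) (derR_id x))); ring.
by apply: (derR_eq (derR_comp (is_derive_expR _) h)); ring.
Qed.

Lemma derR_opp f x a : derR f (- x) a -> derR (fun y => f (- y)) x (- a).
Proof.
move=> fa; apply: (derR_eq (derR_comp fa (derRN (derR_id x)))); ring.
Qed.

Lemma derR_cont f x a : derR f x a -> {for x, continuous f}.
Proof.
move=> fa; apply: differentiable_continuous.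
by apply/derivable1_diffP; exact: ex_derive.
Qed.

Lemma derR_derivable f x a : derR f x a -> derivable f x 1.
Proof. by move=> fa; exact: ex_derive. Qed.

Lemma derR_derive1 f x a : derR f x a -> derive1 f x = a.
Proof. by move=> fa; rewrite derive1E; exact: derive_val. Qed.

Lemma derivable_derR f x : derivable f x 1 -> derR f x (derive1 f x).
Proof. by move=> fa; rewrite derive1E; exact: derivableP. Qed.

Lemma MVT_derR f f' a b : a < b -> (forall x, a <= x <= b -> derR f x (f' x)) ->
  exists2 c, a < c < b & f b - f a = f' c * (b - a).
Proof.
move=> ab df; have [c|x|c] := @MVT R f f' a b ab.
- by rewrite in_itv /= => /andP[ac cb]; apply: df; rewrite !ltW.
- apply: continuous_in_subspaceT x => x; rewrite inE /= in_itv /= => /df.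
  exact: derR_cont.
- by rewrite in_itv /= => cab ->; exists c.
Qed.

Lemma derR_le f g f' g' a b : a <= b ->
  (forall x, a <= x <= b -> derR f x (f' x)) ->
  (forall x, a <= x <= b -> derR g x (g' x)) ->
  (forall x, a <= x <= b -> f' x <= g' x) -> f b - f a <= g b - g a.
Proof.
rewrite le_eqVlt => /orP[/eqP <-|ab] df dg fg; first by rewrite !subrr.
have [|c /andP[ac cb]] := @MVT_derR (fun x => g x - f x) (fun x => g' x - f' x) _ _ ab.
  by move=> x xab; apply: derRB; [exact: dg|exact: df].
have : 0 <= g' c - f' c by rewrite subr_ge0 fg // !ltW.
by nra.
Qed.

Lemma derR_ge0 f f' a b : a <= b -> (forall x, a <= x <= b -> derR f x (f' x)) ->
  (forall x, a <= x <= b -> 0 <= f' x) -> f a <= f b.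
Proof.
move=> ab df f0; have := derR_le ab (fun x _ => derR_cst 0 x) df f0; lra.
Qed.

(** [f x * expR (- M * x)] is nonincreasing. *)
Lemma gronwall f f' M a b : a <= b -> (forall x, a <= x <= b -> derR f x (f' x)) ->
  (forall x, a <= x <= b -> f' x <= M * f x) -> f b <= expR (M * (b - a)) * f a.
Proof.
move=> ab df fM.
pose h := fun x => - (f x * expR (- M * x)).
have dh x : a <= x <= b -> derR h x (expR (- M * x) * (M * f x - f' x)).
  move=> /df dfx; apply: (derR_eq (derRN (derRM dfx (derR_exp (- M) x)))); ring.
have : h a <= h b.
  apply: (derR_ge0 ab dh) => x xab; rewrite mulr_ge0 ?expR_ge0 // subr_ge0.
  exact: fM.
rewrite /h lerN2 => H.
have -> : f b = expR (M * b) * (f b * expR (- M * b)).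
  by rewrite mulrCA -expRD mulNr subrr expR0 mulr1.
rewrite (le_trans (ler_wpM2l (expR_ge0 _) H)) // mulrCA -expRD mulrC.
by rewrite mulNr -mulrBr.
Qed.

End RealDerivative.

Section ComplexDerivative.
Variable R : realType.
Notation C := R[i].
Implicit Types (f g : R -> C) (x y : R) (d e : C).

(** Real and imaginary parts are differentiated separately because [cderiv] and [ctwice_derivable]
    are given in this form. *)
Definition isd f x d : Prop :=
  derR (reF f) x (complex.Re d) /\ derR (imF f) x (complex.Im d).

Lemma isd_eq f x d e : isd f x d -> d = e -> isd f x e.
Proof. by move=> ? <-. Qed.

Lemma isd_cst c x : isd (fun=> c) x 0.
Proof. by split; exact: derR_cst. Qed.

Lemma isdD f g x d e : isd f x d -> isd g x e -> isd (fun y => f y + g y) x (d + e).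
Proof.
move=> [f1 f2] [g1 g2]; split; rewrite ?reD ?imD.
- have -> : reF (fun y => f y + g y) = fun y => reF f y + reF g y.
    by apply/funext => y; rewrite /reF reD.
  exact: derRD.
- have -> : imF (fun y => f y + g y) = fun y => imF f y + imF g y.
    by apply/funext => y; rewrite /imF imD.
  exact: derRD.
Qed.

Lemma isdM f g x d e : isd f x d -> isd g x e ->
  isd (fun y => f y * g y) x (d * g x + f x * e).
Proof.
move=> [f1 f2] [g1 g2]; split; rewrite ?reD ?imD ?reM ?imM.
- have -> : reF (fun y => f y * g y) = fun y => reF f y * reF g y - imF f y * imF g y.
    by apply/funext => y; rewrite /reF reM.
  by apply: (derR_eq (derRB (derRM f1 g1) (derRM f2 g2))); rewrite /reF /imF; ring.
- have -> : imF (fun y => f y * g y) = fun y => reF f y * imF g y + imF f y * reF g y.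
    by apply/funext => y; rewrite /imF imM.
  by apply: (derR_eq (derRD (derRM f1 g2) (derRM f2 g1))); rewrite /reF /imF; ring.
Qed.

Lemma isdZ c f x d : isd f x d -> isd (fun y => c * f y) x (c * d).
Proof.
by move=> fd; apply: (isd_eq (isdM (isd_cst c x) fd)); rewrite mul0r add0r.
Qed.

Lemma isdN f x d : isd f x d -> isd (fun y => - f y) x (- d).
Proof.
move=> fd; rewrite (_ : (fun y => - f y) = (fun y => -1 * f y)); last first.
  by apply/funext => y; rewrite mulN1r.
by apply: (isd_eq (isdZ (-1) fd)); rewrite mulN1r.
Qed.

Lemma isdB f g x d e : isd f x d -> isd g x e -> isd (fun y => f y - g y) x (d - e).
Proof. by move=> fd /isdN; exact: isdD. Qed.

Lemma isd_sum (n : nat) (f : 'I_n -> R -> C) (d : 'I_n -> C) x :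
  (forall j, isd (f j) x (d j)) ->
  isd (fun y => \sum_j f j y) x (\sum_j d j).
Proof.
move=> fd; elim: (index_enum _) => [|j s IHs].
  rewrite big_nil (_ : (fun _ => _) = (fun=> 0)); first exact: isd_cst.
  by apply/funext => y; rewrite big_nil.
rewrite big_cons (_ : (fun _ => _) = (fun y => f j y + \sum_(i <- s) f i y)).
  exact: isdD.
by apply/funext => y; rewrite big_cons.
Qed.

Lemma isd_conj f x d : isd f x d -> isd (fun y => (f y)^*) x d^*.
Proof.
have rec (z : C) : complex.Re z^* = complex.Re z by case: z.
have imc (z : C) : complex.Im z^* = - complex.Im z by case: z.
move=> [f1 f2]; split; rewrite ?rec ?imc.
- have -> : reF (fun y => (f y)^*) = reF f by apply/funext => y; rewrite /reF rec.
  exact: f1.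
- have -> : imF (fun y => (f y)^*) = fun y => - imF f y.
    by apply/funext => y; rewrite /imF imc.
  exact: derRN.
Qed.

Lemma isd_opp f x d : isd f (- x) d -> isd (fun y => f (- y)) x (- d).
Proof. by case=> f1 f2; split; rewrite ?reN ?imN; exact: derR_opp. Qed.

Lemma isd_cexp n x : isd (fun y => cexp (n * y%:C)) x (n * cexp (n * x%:C)).
Proof.
have lin (c : R) : derR (fun y => c * y) x c.
  by apply: (derR_eq (derRM (derR_cst c x) (derR_id x))); ring.
have Ren (y : R) : complex.Re (n * y%:C) = complex.Re n * y.
  by rewrite reM /= mulr0 subr0.
have Imn (y : R) : complex.Im (n * y%:C) = complex.Im n * y.
  by rewrite imM /= mulr0 add0r.
have dc := derR_comp (is_derive_cos (complex.Im n * x)) (lin (complex.Im n)).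
have ds := derR_comp (is_derive_sin (complex.Im n * x)) (lin (complex.Im n)).
split.
- have -> : reF (fun y => cexp (n * y%:C)) =
      fun y => expR (complex.Re n * y) * cos (complex.Im n * y).
    by apply/funext => y; rewrite /reF re_cexp Ren Imn.
  apply: (derR_eq (derRM (derR_exp _ _) dc)).
  by rewrite reM re_cexp im_cexp Ren Imn; ring.
- have -> : imF (fun y => cexp (n * y%:C)) =
      fun y => expR (complex.Re n * y) * sin (complex.Im n * y).
    by apply/funext => y; rewrite /imF im_cexp Ren Imn.
  apply: (derR_eq (derRM (derR_exp _ _) ds)).
  by rewrite imM re_cexp im_cexp Ren Imn; ring.
Qed.

Lemma cderivE f x d : isd f x d -> cderiv f x = d.
Proof.
case: d => a b [/= f1 f2]; rewrite /cderiv.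
by rewrite (derR_derive1 f1) (derR_derive1 f2).
Qed.

Lemma ctwice_isd f x : ctwice_derivable f -> isd f x (cderiv f x).
Proof. by case=> /(_ x)[f1 _] /(_ x)[f2 _]; split; exact: derivable_derR. Qed.

Lemma ctwice_isd2 f x : ctwice_derivable f ->
  isd (cderiv f) x (cderiv (cderiv f) x).
Proof.
case=> /(_ x)[_ f1] /(_ x)[_ f2].
have re : reF (cderiv f) = derive1 (reF f) by [].
have im : imF (cderiv f) = derive1 (imF f) by [].
have e : cderiv (cderiv f) x = derive1 (derive1 (reF f)) x +i* derive1 (derive1 (imF f)) x.
  by rewrite {1}/cderiv re im.
split; rewrite e ?re ?im.
- rewrite -[complex.Re _]/(derive1 (derive1 (reF f)) x); exact: derivable_derR f1.
- rewrite -[complex.Im _]/(derive1 (derive1 (imF f)) x); exact: derivable_derR f2.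
Qed.

Lemma derR_cabs2 f x d : isd f x d ->
  derR (fun y => cabs (f y) ^+ 2) x (2 * complex.Re ((f x)^* * d)).
Proof.
case=> f1 f2; rewrite (_ : (fun y => _) =
  fun y => reF f y * reF f y + imF f y * imF f y); last first.
  by apply/funext => y; rewrite cabs2 !expr2.
apply: (derR_eq (derRD (derRM f1 f1) (derRM f2 f2))).
by rewrite reJM /reF /imF; ring.
Qed.

(* The mean value inequality follows from the real one applied to [Re (u f)],
   where [u] is the conjugate of the direction of [f b - f a]. *)
Lemma isd_le f f' (g g' : R -> R) (a b : R) : a <= b ->
  (forall x, a <= x <= b -> isd f x (f' x)) ->
  (forall x, a <= x <= b -> derR g x (g' x)) ->
  (forall x, a <= x <= b -> cabs (f' x) <= g' x) ->
  cabs (f b - f a) <= g b - g a.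
Proof.
move=> ab df dg fg.
set w := f b - f a; have [w0|w0] := eqVneq (cabs w) 0.
  rewrite w0 -(subrr (cst 0 a : R)).
  apply: (derR_le ab (fun x _ => derR_cst 0 x) dg) => x xab.
  exact: le_trans (cabs_ge0 _) (fg x xab).
pose u : C := w^* * ((cabs w)^-1)%:C.
have wgt0 : 0 < cabs w by rewrite lt_def w0 cabs_ge0.
have u1 : cabs u = 1.
  by rewrite cabsM cabs_conj cabs_real ger0_norm ?invr_ge0 ?cabs_ge0 // divff.
have -> : cabs w = complex.Re (u * f b) - complex.Re (u * f a).
  rewrite -reN -reD -mulrN -mulrDr -/w /u mulrAC reM /= mulr0 subr0 reJM_self.
  by rewrite expr2 mulfK.
apply: (@derR_le R (fun x => complex.Re (u * f x)) g
  (fun x => complex.Re (u * f' x)) g' _ _ ab) => //.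
- by move=> x /df /(isdZ u)[].
- move=> x xab; rewrite (le_trans (re_le_cabs _)) // cabsM u1 mul1r.
  exact: fg.
Qed.

End ComplexDerivative.

(** * Bounds on half-lines *)

Section HalfLine.
Variable R : realType.
Notation C := R[i].

(** Only the end +oo is named; the end -oo is reached by composing with [- x], so that each estimate
    is proved on one half-line. *)
Definition tends0 (f : R -> C) : Prop :=
  forall e : R, 0 < e -> exists X : R, forall x, X <= x -> cabs (f x) <= e.

Lemma tends0D (f g : R -> C) : tends0 f -> tends0 g -> tends0 (fun x => f x + g x).
Proof.
move=> hf hg e e0; have e2 : 0 < e / 2 by rewrite divr_gt0.
have [X XP] := hf _ e2; have [Y YP] := hg _ e2.
exists (Num.max X Y) => x; rewrite ge_max => /andP[/XP xX /YP xY].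
by rewrite (le_trans (cabsD _ _)) //; lra.
Qed.

Lemma tends0Z (c : C) (f : R -> C) : tends0 f -> tends0 (fun x => c * f x).
Proof.
move=> hf e e0; have c0 := cabs_ge0 c.
have e2 : 0 < e / (cabs c + 1) by rewrite divr_gt0 //; lra.
have [X XP] := hf _ e2; exists X => x /XP H; rewrite cabsM.
rewrite (le_trans (ler_wpM2l c0 H)) // mulrCA -[leRHS]mulr1 ler_wpM2l ?(ltW e0) //.
by rewrite ler_pdivrMr; lra.
Qed.

Lemma tends0_eq (f g : R -> C) : f =1 g -> tends0 f -> tends0 g.
Proof. by move=> /funext ->. Qed.

(* [cexp (- ka * y) * (f' + ka f)] has derivative [- cexp (- ka * y) * g], so
   the outgoing part is recovered by integrating from infinity. *)
Lemma outgoing_bound (ka : C) (f f' g : R -> C) (a b G : R) :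
  0 < b -> 0 <= complex.Re ka ->
  (forall x, a <= x -> isd f x (f' x)) ->
  (forall x, a <= x -> isd f' x (ka ^+ 2 * f x - g x)) ->
  (forall x, a <= x -> cabs (g x) <= G * expR (- b * x)) ->
  tends0 (fun x => f' x + ka * f x) ->
  forall x, a <= x -> cabs (f' x + ka * f x) <= G / b * expR (- b * x).
Proof.
move=> b0 ka0 df df' gG h0 x ax; apply/ler_addgt0Pr => e e0.
have [X XP] := h0 e e0.
pose y := Num.max x X.
have xy : x <= y by rewrite le_max lexx.
have Xy : X <= y by rewrite le_max lexx orbT.
pose E (t : R) : C := cexp (ka * x%:C) * (cexp (- ka * t%:C) * (f' t + ka * f t)).
pose E' (t : R) : C := cexp (ka * x%:C) * (cexp (- ka * t%:C) * - g t).
have nE (t : R) : x <= t -> expR (complex.Re (ka * x%:C)) * expR (complex.Re (- ka * t%:C)) <= 1.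
  move=> xt; rewrite -expRD -[leRHS]expR0 ler_expR !reM reN /=.
  rewrite !mulr0 !subr0 mulNr -mulrBr mulr_ge0_le0 //; lra.
have dE t : x <= t <= y -> isd E t (E' t).
  move=> /andP[xt _]; have att := le_trans ax xt.
  apply: (isd_eq (isdZ _ (isdM (isd_cexp _ _)
    (isdD (df' _ att) (isdZ ka (df _ att)))))).
  by rewrite /E'; ring.
have dg t : x <= t <= y ->
    derR (fun t => - (G / b) * expR (- b * t)) t (G * expR (- b * t)).
  move=> _; apply: (derR_eq (derRM (derR_cst _ _) (derR_exp _ _))).
  by field; lra.
have := isd_le xy dE dg; rewrite /E'.
have Exx : E x = f' x + ka * f x.
  by rewrite /E mulrA mulNr [_ * cexp (- _)]mulrC cexpNK mul1r.
rewrite Exx => H.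
have {}H : cabs (E y - (f' x + ka * f x)) <=
    - (G / b) * expR (- b * y) - - (G / b) * expR (- b * x).
  apply: H => t /andP[xt _]; rewrite !cabs_cexpM mulrA cabsN.
  apply: le_trans (gG _ (le_trans ax xt)).
  by rewrite -[leRHS]mul1r; apply: (ler_wpM2r (cabs_ge0 _)); exact: nE.
have G0 : 0 <= G / b * expR (- b * y).
  rewrite mulr_ge0 ?expR_ge0 // divr_ge0 ?(ltW b0) //.
  have := le_trans (cabs_ge0 _) (gG _ ax); rewrite pmulr_lge0 // expR_gt0 //.
have Ey : cabs (E y) <= e.
  rewrite /E !cabs_cexpM mulrA; apply: le_trans (XP _ Xy).
  by rewrite -[leRHS]mul1r; apply: (ler_wpM2r (cabs_ge0 _)); exact: nE.
have := cabs_sub (f' x + ka * f x) (E y); rewrite cabs_subC => H2.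
rewrite !mulNr in H G0 *; lra.
Qed.

(** [cexp (ka t) f] has derivative [cexp (ka t) (f' + ka f)], which is integrated from [a] onwards;
    the rate [th] must be at most [Re ka] and strictly below [b]. With [th = 0] the bound stays
    uniform as [Re ka] tends to 0. *)
Lemma decay_of_outgoing (ka : C) (f f' : R -> C) (a b th H : R) :
  0 <= th < b -> th <= complex.Re ka -> 0 <= H ->
  (forall x, a <= x -> isd f x (f' x)) ->
  (forall x, a <= x -> cabs (f' x + ka * f x) <= H * expR (- b * x)) ->
  forall x, a <= x -> expR (th * x) * cabs (f x) <=
    expR (th * a) * cabs (f a) + H / (b - th) * expR (- (b - th) * a).
Proof.
move=> /andP[th0 thb] kath H0 df hG x ax.
pose E (t : R) : C := cexp ((th%:C - ka) * x%:C) * (cexp (ka * t%:C) * f t).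
pose E' (t : R) : C :=
  cexp ((th%:C - ka) * x%:C) * (cexp (ka * t%:C) * (f' t + ka * f t)).
have dE t : a <= t <= x -> isd E t (E' t).
  move=> /andP[att _].
  apply: (isd_eq (isdZ _ (isdM (isd_cexp _ _) (df _ att)))).
  by rewrite /E'; ring.
have nE (t : R) : t <= x ->
    expR (complex.Re ((th%:C - ka) * x%:C)) * expR (complex.Re (ka * t%:C)) <= expR (th * t).
  move=> tx; rewrite -expRD ler_expR !reM reD reN /=.
  rewrite !mulr0 !subr0 -subr_ge0.
  rewrite (_ : _ - _ = (complex.Re ka - th) * (x - t)); last by ring.
  by rewrite mulr_ge0 ?subr_ge0.
have bth : 0 < b - th by rewrite subr_gt0.
have dg t : a <= t <= x -> derR (fun t => - (H / (b - th)) * expR (- (b - th) * t))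
    t (H * expR (- (b - th) * t)).
  move=> _; apply: (derR_eq (derRM (derR_cst _ _) (derR_exp _ _))).
  by field; lra.
have Hle := isd_le ax dE dg.
have {}Hle : cabs (E x - E a) <= - (H / (b - th)) * expR (- (b - th) * x)
    - - (H / (b - th)) * expR (- (b - th) * a).
  apply: Hle => t /andP[att tx]; rewrite /E' !cabs_cexpM mulrA.
  apply: le_trans (ler_pM _ _ (nE _ tx) (hG _ att)) _; rewrite ?mulr_ge0 ?cabs_ge0 ?expR_ge0 //.
  rewrite mulrCA -expRD (_ : th * t + - b * t = - (b - th) * t) //; ring.
have Ex : cabs (E x) = expR (th * x) * cabs (f x).
  rewrite /E !cabs_cexpM mulrA -expRD; congr (expR _ * _).
  by rewrite !reM reD reN /= !mulr0 !subr0; ring.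
have Ea : cabs (E a) <= expR (th * a) * cabs (f a).
  rewrite /E !cabs_cexpM mulrA; apply: (ler_wpM2r (cabs_ge0 _)); exact: nE.
have G0 : 0 <= H / (b - th) * expR (- (b - th) * x).
  by rewrite mulr_ge0 ?expR_ge0 // divr_ge0 // ltW.
have := cabs_sub (E x) (E a); rewrite -Ex !mulNr in Hle G0 *; lra.
Qed.

Lemma outgoing_decay (ka : C) (f f' g : R -> C) (a b th G : R) :
  0 < b -> 0 <= th < b -> th <= complex.Re ka ->
  (forall x, a <= x -> isd f x (f' x)) ->
  (forall x, a <= x -> isd f' x (ka ^+ 2 * f x - g x)) ->
  (forall x, a <= x -> cabs (g x) <= G * expR (- b * x)) ->
  tends0 (fun x => f' x + ka * f x) ->
  forall x, a <= x -> expR (th * x) * cabs (f x) <=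
    expR (th * a) * cabs (f a) + G / b / (b - th) * expR (- (b - th) * a).
Proof.
move=> b0 thb kath df df' gG h0 x ax; have /andP[th0 _] := thb.
apply: (decay_of_outgoing thb kath _ df _ ax).
  have := le_trans (cabs_ge0 _) (gG _ ax).
  by rewrite pmulr_lge0 ?expR_gt0 // => G0; rewrite divr_ge0 // ltW.
exact: outgoing_bound b0 (le_trans th0 kath) df df' gG h0.
Qed.

Definition jet0 n (f f' : 'I_n -> R -> C) : R :=
  \sum_j (cabs (f j 0) + cabs (f' j 0)).

Lemma jet0_ge0 n (f f' : 'I_n -> R -> C) : 0 <= jet0 f f'.
Proof. by apply: sumr_ge0 => j _; rewrite addr_ge0 ?cabs_ge0. Qed.

Lemma sumr_sqr_le (n : nat) (f : 'I_n -> R) : (forall j, 0 <= f j) ->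
  \sum_j f j ^+ 2 <= (\sum_j f j) ^+ 2.
Proof.
move=> f0; elim: (index_enum _) => [|j s IHs]; first by rewrite !big_nil expr0n.
have s0 : 0 <= \sum_(i <- s) f i by apply: sumr_ge0.
rewrite !big_cons; have := f0 j; nra.
Qed.

Lemma ler_sum1 (n : nat) (f : 'I_n -> R) j : (forall k, 0 <= f k) ->
  f j <= \sum_k f k.
Proof. by move=> f0; rewrite (bigD1 j) //= lerDl sumr_ge0. Qed.

(** The energy is the sum of the [|f|^2 + |f'|^2] plus [f0 ^+ 2]. With the forcing inside the
    energy, [E' <= L E] is homogeneous and [K] depends on [n], [M] and [X] only. *)
Lemma gronwall_system n (M X : R) : 0 <= M -> exists2 K : R, 1 <= K &
  forall (f f' f'' : 'I_n -> R -> C) (f0 : R), 0 <= f0 ->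
  (forall j (x : R), 0 <= x -> isd (f j) x (f' j x)) ->
  (forall j (x : R), 0 <= x -> isd (f' j) x (f'' j x)) ->
  (forall j (x : R), 0 <= x -> cabs (f'' j x) <= M * \sum_k cabs (f k x) + f0) ->
  forall j (x : R), 0 <= x <= X ->
    cabs (f j x) <= K * (jet0 f f' + f0) /\ cabs (f' j x) <= K * (jet0 f f' + f0).
Proof.
move=> M0; pose L := 2 + n%:R * (M * n%:R + 1) ^+ 2.
have L0 : 0 <= L by rewrite addr_ge0 // mulr_ge0 // sqr_ge0.
have LX : 1 <= expR (L * Num.max 0 X).
  by rewrite -expR0 ler_expR mulr_ge0 // le_max lexx.
exists (expR (L * Num.max 0 X)) => // f f' f'' f0 f00 df df' f''M.
pose E x := \sum_j (cabs (f j x) ^+ 2 + cabs (f' j x) ^+ 2) + f0 ^+ 2.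
pose E' x := \sum_j (2 * complex.Re ((f j x)^* * f' j x)
  + 2 * complex.Re ((f' j x)^* * f'' j x)).
have Ege (x : R) : f0 ^+ 2 <= E x.
  by rewrite lerDr sumr_ge0 // => j _; rewrite addr_ge0 ?sqr_ge0.
have E0 (x : R) : 0 <= E x by apply: le_trans (Ege x); exact: sqr_ge0.
have EgeS (x : R) : \sum_j (cabs (f j x) ^+ 2 + cabs (f' j x) ^+ 2) <= E x.
  by rewrite lerDl sqr_ge0.
have Egej (x : R) j : cabs (f j x) ^+ 2 + cabs (f' j x) ^+ 2 <= E x.
  apply: le_trans (EgeS x).
  apply: (@ler_sum1 n (fun j => cabs (f j x) ^+ 2 + cabs (f' j x) ^+ 2)) => k.
  by rewrite addr_ge0 ?sqr_ge0.
have dE (x : R) : 0 <= x -> derR E x (E' x).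
  move=> x0; rewrite -[E' x]addr0.
  apply: (@derRD R (fun x => \sum_j (cabs (f j x) ^+ 2 + cabs (f' j x) ^+ 2))
    (fun=> f0 ^+ 2) x (E' x) 0 _ (derR_cst _ _)).
  rewrite /E'; elim: (index_enum _) => [|j s IHs].
    rewrite big_nil (_ : (fun _ => _) = (fun=> 0)); first exact: derR_cst.
    by apply/funext => y; rewrite big_nil.
  rewrite big_cons (_ : (fun _ => _) = (fun y =>
    (cabs (f j y) ^+ 2 + cabs (f' j y) ^+ 2)
      + \sum_(i <- s) (cabs (f i y) ^+ 2 + cabs (f' i y) ^+ 2))); last first.
    by apply/funext => y; rewrite big_cons.
  by apply: derRD => //; apply: derRD; apply: derR_cabs2; [exact: df|exact: df'].
have E'L (x : R) : 0 <= x -> E' x <= L * E x.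
  move=> x0; pose q := Num.sqrt (E x).
  have q2 : q ^+ 2 = E x by rewrite sqr_sqrtr.
  have q0 : 0 <= q by exact: sqrtr_ge0.
  have leq (r : R) : r ^+ 2 <= E x -> r <= q.
    move=> r2; rewrite (le_trans (ler_norm r)) // -sqrtr_sqr ler_sqrt //.
  have f0q : f0 <= q by exact: leq.
  have fq j : cabs (f j x) <= q.
    by apply: leq; apply: le_trans (Egej x j); rewrite lerDl sqr_ge0.
  have Sq : \sum_k cabs (f k x) <= n%:R * q.
    rewrite mulr_natl -[leRHS](_ : \sum_(k < n) q = _); first exact: ler_sum.
    by rewrite sumr_const card_ord.
  have f''q j : cabs (f'' j x) <= (M * n%:R + 1) * q.
    rewrite (le_trans (f''M j x x0)) // mulrDl mul1r lerD // -mulrA ler_wpM2l //.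
  have ReJ2 (a b : C) : 2 * complex.Re (a^* * b) <= cabs a ^+ 2 + cabs b ^+ 2.
    rewrite reJM !cabs2; have := sqr_ge0 (complex.Re a - complex.Re b).
    by have := sqr_ge0 (complex.Im a - complex.Im b); nra.
  have : E' x <= \sum_j ((cabs (f j x) ^+ 2 + cabs (f' j x) ^+ 2)
      + ((cabs (f j x) ^+ 2 + cabs (f' j x) ^+ 2) + ((M * n%:R + 1) * q) ^+ 2)).
    apply: ler_sum => j _.
    have := ReJ2 (f j x) (f' j x); have := ReJ2 (f' j x) (f'' j x).
    have : cabs (f'' j x) ^+ 2 <= ((M * n%:R + 1) * q) ^+ 2.
      by rewrite ler_pXn2r ?nnegrE ?cabs_ge0 // (le_trans (cabs_ge0 _) (f''q j)).
    have := sqr_ge0 (cabs (f j x)); lra.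
  rewrite !big_split /= => H; apply: (le_trans H).
  rewrite sumr_const card_ord exprMn q2 -[X in _ + (_ + X)]mulr_natl /L.
  by have := EgeS x; rewrite big_split /= => EgeS'; lra.
move=> j x /andP[x0 xX].
have J0 := jet0_ge0 f f'.
have EJ : E 0 <= (jet0 f f' + f0) ^+ 2.
  have : \sum_j (cabs (f j 0) ^+ 2 + cabs (f' j 0) ^+ 2) <= jet0 f f' ^+ 2.
    have H := @sumr_sqr_le n (fun j => cabs (f j 0) + cabs (f' j 0)).
    apply: le_trans (H _) => [|k]; last by rewrite addr_ge0 ?cabs_ge0.
    apply: ler_sum => k _.
    by have := cabs_ge0 (f k 0); have := cabs_ge0 (f' k 0); nra.
  rewrite /E; nra.
have HE : E x <= (expR (L * Num.max 0 X) * (jet0 f f' + f0)) ^+ 2.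
  have := @gronwall R E E' L 0 x x0 _ _.
  move=> /(_ (fun t H => dE t (proj1 (andP H))) (fun t H => E'L t (proj1 (andP H)))).
  rewrite subr0 => H; apply: (le_trans H).
  rewrite exprMn; apply: ler_pM => //; rewrite ?expR_ge0 //.
  rewrite expr2 -expRD ler_expR -mulrDr ler_wpM2l //.
  by rewrite -[leLHS]addr0 lerD // le_max ?xX ?lexx ?orbT.
have rt (r : R) : 0 <= r -> r ^+ 2 <= E x ->
    r <= expR (L * Num.max 0 X) * (jet0 f f' + f0).
  move=> r0 rE; rewrite -(@ler_pXn2r _ 2) ?nnegrE ?(le_trans rE HE) //.
  by rewrite mulr_ge0 ?expR_ge0 // addr_ge0.
split; apply: rt; rewrite ?cabs_ge0 //; apply: le_trans (Egej x j).
  by rewrite lerDl sqr_ge0.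
by rewrite lerDr sqr_ge0.
Qed.

(** From [1 + b x <= expR (b x)], whence the threshold [(b * e)^-1]. *)
Lemma expR_small (b e : R) : 0 < b -> 0 < e ->
  exists X : R, 0 <= X /\ forall x, X <= x -> expR (- b * x) <= e.
Proof.
move=> b0 e0; exists ((b * e)^-1); split => [|x Xx].
  by rewrite invr_ge0 mulr_ge0 // ltW.
have be0 : 0 < b * e by rewrite mulr_gt0.
have x0 : 0 < x by apply: lt_le_trans Xx; rewrite invr_gt0.
rewrite mulNr expRN invf_ple ?posrE ?expR_gt0 //.
have := expR_ge1Dx (b * x).
have : e^-1 <= b * x.
  have -> : e^-1 = b * (b * e)^-1 by field; apply/andP; split; lra.
  by rewrite ler_wpM2l // ltW.
lra.
Qed.

Lemma half_frac (a q t : R) : 0 <= a -> 0 < q -> 0 <= t ->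
  a * t / q * (q / (2 * (a + 1))) <= t / 2.
Proof.
move=> a0 q0 t0; have a1 : 0 < a + 1 by rewrite ltr_wpDl.
have -> : a * t / q * (q / (2 * (a + 1))) = a / (a + 1) * (t / 2).
  by field; rewrite !gt_eqF.
by rewrite ler_piMl ?divr_ge0 // ler_pdivrMr // mul1r lerDl.
Qed.

(** Turns a qualitative bound into one by the jet at 0, uniformly over exponents with nonnegative
    real part and modulus at most [N]. On [[0, X]] this is Gronwall; beyond [X] the decay of the
    coupling makes it a contraction, so the supremum [S] of the tail satisfies an inequality
    [S <= C + S / 2]. *)
Lemma half_line_bound n (c b N : R) : 0 <= c -> 0 < b -> 0 <= N ->
  exists2 K : R, 1 <= K &
  forall (ka : 'I_n -> C) (f f' g : 'I_n -> R -> C) (f0 B : R), 0 <= f0 ->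
  (forall j, 0 <= complex.Re (ka j)) -> (forall j, cabs (ka j) <= N) ->
  (forall j (x : R), 0 <= x -> isd (f j) x (f' j x)) ->
  (forall j (x : R), 0 <= x -> isd (f' j) x (ka j ^+ 2 * f j x - g j x)) ->
  (forall j (x : R), 0 <= x ->
     cabs (g j x) <= (c * \sum_k cabs (f k x) + f0) * expR (- b * x)) ->
  (forall j (x : R), 0 <= x -> cabs (f j x) <= B) ->
  (forall j, tends0 (fun x => f' j x + ka j * f j x)) ->
  forall j (x : R), 0 <= x -> cabs (f j x) <= K * (jet0 f f' + f0) /\
    cabs (f' j x + ka j * f j x) <= K * (jet0 f f' + f0) * expR (- b * x).
Proof.
move=> c0 b0 N0.
have nr0 : 0 <= n%:R :> R by [].
(* Beyond [X] the factor [n c e^(- b X) / b^2] is at most 1/2, which allows the tail to be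
   absorbed. *)
have [X [X0 XP]] := @expR_small b (b ^+ 2 / (2 * (n%:R * c + 1))) b0
  ltac:(apply: divr_gt0; nra).
have [Kg Kg1 KgP] := @gronwall_system n (N ^+ 2 + c) X ltac:(nra).
pose K1 := 2 * (n%:R * Kg + n%:R / b ^+ 2) + n%:R * Kg.
have nb0 : 0 <= n%:R / b ^+ 2 by rewrite divr_ge0 ?sqr_ge0.
have nK0 : 0 <= n%:R * Kg by rewrite mulr_ge0 //; lra.
have K10 : 0 <= K1 by rewrite /K1; lra.
exists (1 + K1 + (c * K1 + 1) / b).
  have : 0 <= (c * K1 + 1) / b by rewrite divr_ge0 ?(ltW b0) //; nra.
  lra.
move=> ka f f' g f0 B f00 ka0 kaN df df' gc fB h0.
set J := jet0 f f'; have J0 : 0 <= J by exact: jet0_ge0.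
have eb1 (x : R) : 0 <= x -> expR (- b * x) <= 1.
  by move=> x0; rewrite -expR0 ler_expR; nra.
have S0 (x : R) : 0 <= \sum_k cabs (f k x) by apply: sumr_ge0 => k _; exact: cabs_ge0.
have near j (x : R) : 0 <= x <= X -> cabs (f j x) <= Kg * (J + f0).
  move=> xX; apply: (proj1 (KgP f f' _ f0 f00 df df' _ j x xX)) => {xX}j {}x x0.
  rewrite (le_trans (cabsB _ _)) // cabsM cabs_exp2 mulrDl -addrA lerD //.
    apply: ler_pM; rewrite ?sqr_ge0 ?cabs_ge0 //.
      by rewrite ler_pXn2r ?nnegrE ?cabs_ge0.
    by apply: (@ler_sum1 n (fun j => cabs (f j x))) => k; exact: cabs_ge0.
  rewrite (le_trans (gc j x x0)) // -[leRHS]mulr1 ler_wpM2l ?eb1 //.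
  by rewrite addr_ge0 // mulr_ge0.
have nearS (x : R) : 0 <= x <= X -> \sum_k cabs (f k x) <= n%:R * Kg * (J + f0).
  move=> xX; rewrite -mulrA mulr_natl -[leRHS](_ : \sum_(k < n) (Kg * (J + f0)) = _).
    by apply: ler_sum => k _; exact: near.
  by rewrite sumr_const card_ord.
(* The bound [B] makes this supremum finite; it does not enter the constant. *)
pose A := [set \sum_k cabs (f k x) | x in [set x | X <= x]].
have AS : has_sup A.
  split; first by exists (\sum_k cabs (f k X)); exists X => //=.
  exists (\sum_(k < n) B) => _ [x /= Xx <-]; apply: ler_sum => k _; apply: fB; lra.
pose S := sup A.
have SP (x : R) : X <= x -> \sum_k cabs (f k x) <= S.
  by move=> Xx; apply: (sup_upper_bound AS); exists x.
(* The rate 0 is taken in [outgoing_decay] because [Re (ka j)] may vanish. *)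
have far j (x : R) : X <= x -> cabs (f j x) <=
    cabs (f j X) + (c * S + f0) / b / b * expR (- b * X).
  move=> Xx.
  have th : (0 : R) <= 0 < b by apply/andP; split.
  have H := @outgoing_decay (ka j) (f j) (f' j) (g j) X b 0 (c * S + f0) b0 th (ka0 j)
    _ _ _ (h0 j) x Xx.
  rewrite !mul0r !expR0 !mul1r subr0 in H; apply: H.
  - by move=> y Xy; apply: df; exact: le_trans X0 Xy.
  - by move=> y Xy; apply: df'; exact: le_trans X0 Xy.
  - move=> y Xy; have y0 := le_trans X0 Xy.
    rewrite (le_trans (gc j y y0)) // ler_wpM2r ?expR_ge0 //.
    by rewrite lerD2r ler_wpM2l // SP.
have S0' : 0 <= S by apply: le_trans (S0 X) (SP X _).
have SS : S <= n%:R * Kg * (J + f0) + n%:R / b ^+ 2 * f0 + S / 2.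
  apply: ge_sup; first exact: AS.1.
  move=> _ [x /= Xx <-].
  have : \sum_k cabs (f k x) <=
      \sum_k (cabs (f k X) + (c * S + f0) / b / b * expR (- b * X)).
    by apply: ler_sum => k _; exact: far.
  rewrite big_split /= sumr_const card_ord -mulr_natl => H.
  have HX := nearS X; rewrite X0 lexx in HX; have {}HX := HX isT.
  have e1 := eb1 X X0.
  have eX := XP X (lexx X).
  have H1 : n%:R * ((c * S + f0) / b / b * expR (- b * X)) <= S / 2 + n%:R / b ^+ 2 * f0.
    have -> : n%:R * ((c * S + f0) / b / b * expR (- b * X)) =
      (n%:R * c * S / b ^+ 2) * expR (- b * X) + n%:R / b ^+ 2 * f0 * expR (- b * X).
      by field; rewrite gt_eqF.
    apply: lerD; last first.
      by rewrite -[leRHS]mulr1 ler_wpM2l // mulr_ge0.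
    have ncS : 0 <= n%:R * c * S / b ^+ 2.
      by rewrite divr_ge0 ?sqr_ge0 // !mulr_ge0.
    apply: (le_trans (ler_wpM2l ncS eX)).
    have nc : 0 <= n%:R * c by rewrite mulr_ge0.
    by apply: half_frac; rewrite ?exprn_gt0.
  by move: H HX H1; clear; move=> *; lra.
have S2 (x : R) : 0 <= x -> \sum_k cabs (f k x) <= K1 * (J + f0).
  move=> x0; have [xX|/ltW Xx] := leP x X.
    rewrite (le_trans (nearS x _)) ?x0 //.
    rewrite ler_wpM2r ?addr_ge0 // /K1 lerDr mulr_ge0 // addr_ge0 //.
  have f0J : n%:R / b ^+ 2 * f0 <= n%:R / b ^+ 2 * (J + f0) by rewrite ler_wpM2l // lerDr.
  have J1 : 0 <= n%:R * Kg * (J + f0) by rewrite mulr_ge0 // addr_ge0.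
  apply: (le_trans (SP x Xx)); rewrite /K1.
  by move: SS f0J J1; clear; move=> *; lra.
have fK1 j (x : R) : 0 <= x -> cabs (f j x) <= K1 * (J + f0).
  move=> x0; apply: le_trans (S2 x x0).
  by apply: (@ler_sum1 n (fun j => cabs (f j x))) => k; exact: cabs_ge0.
have cK1 : 0 <= c * K1 + 1 by rewrite addr_ge0 // mulr_ge0.
have cK : 0 <= (c * K1 + 1) / b by rewrite divr_ge0 // ltW.
move=> j x x0; split.
  rewrite (le_trans (fK1 j x x0)) // ler_wpM2r ?addr_ge0 //.
  by rewrite addrAC lerDr addr_ge0.
have := @outgoing_bound (ka j) (f j) (f' j) (g j) 0 b
  ((c * K1 + 1) * (J + f0)) b0 (ka0 j) (df j) (df' j) _ (h0 j) x x0.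
move=> H; apply: le_trans (H _) _.
  move=> y y0; rewrite (le_trans (gc j y y0)) // ler_wpM2r ?expR_ge0 //.
  have := ler_wpM2l c0 (S2 y y0); rewrite mulrA => /lerD/(_ (lexx f0)) h.
  by rewrite (le_trans h) // mulrDl lerD2l mul1r lerDr.
by rewrite ler_wpM2r ?expR_ge0 // mulrAC ler_wpM2r ?addr_ge0 // lerDr addr_ge0.
Qed.

End HalfLine.

(** * Pairing with Jost solutions *)

Section Line.
Variable R : realType.
Notation C := R[i].

(** The reflection of the line turns a function with derivative [f'] into [refl f] with derivative
    [reflN f']; it reduces the end -oo to the end +oo. *)
Definition refl n (f : 'I_n -> R -> C) : 'I_n -> R -> C := fun j x => f j (- x).
Definition reflN n (f : 'I_n -> R -> C) : 'I_n -> R -> C := fun j x => - f j (- x).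

Lemma jet0_refl n (f f' : 'I_n -> R -> C) : jet0 (refl f) (reflN f') = jet0 f f'.
Proof. by apply: eq_bigr => j _; rewrite /refl /reflN oppr0 cabsN. Qed.

Lemma isd_refl n (f f' : 'I_n -> R -> C) :
  (forall j x, isd (f j) x (f' j x)) ->
  forall j x, isd (refl f j) x (reflN f' j x).
Proof. by move=> df j x; exact: isd_opp. Qed.

Lemma isd_reflN n (f f' : 'I_n -> R -> C) :
  (forall j x, isd (f j) x (f' j x)) ->
  forall j x, isd (reflN f j) x (refl f' j x).
Proof.
move=> df j x; apply: (isd_eq (isdN (isd_opp (df j (- x))))).
by rewrite opprK.
Qed.

Definition decays n (b rho : R) (r : 'I_n -> R -> C) : Prop :=
  forall j x, cabs (r j x) <= rho * expR (- b * `|x|).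

Lemma decays_refl n b rho (r : 'I_n -> R -> C) : decays b rho r ->
  decays b rho (refl r).
Proof. by move=> h j x; have := h j (- x); rewrite normrN. Qed.

(** The last two fields select the behaviour [exp (- ka |x|)] at both ends, which boundedness alone
    does not do when [Re ka = 0]. The bound [M] is qualitative: [line_bound] replaces it by one in
    terms of the jet at 0. *)
Record forced n (ka : 'I_n -> C) (B : 'I_n -> 'I_n -> R -> R)
    (f f' r : 'I_n -> R -> C) : Prop := Forced {
  forced_d : forall j x, isd (f j) x (f' j x);
  forced_d2 : forall j x, isd (f' j) x
    (ka j ^+ 2 * f j x - (\sum_k (B j k x)%:C * f k x + r j x));
  forced_bnd : exists M : R, forall j x, cabs (f j x) <= M;
  forced_y : forall j, tends0 (fun x => f' j x + ka j * f j x);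
  forced_Ny : forall j, tends0 (fun x => f' j (- x) - ka j * f j (- x)) }.

Definition reflB n (B : 'I_n -> 'I_n -> R -> R) : 'I_n -> 'I_n -> R -> R :=
  fun j k x => B j k (- x).

Lemma forced_refl n ka (B : 'I_n -> 'I_n -> R -> R) f f' r :
  forced ka B f f' r -> forced ka (reflB B) (refl f) (reflN f') (refl r).
Proof.
case=> df df' [M fM] fy fNy; split.
- exact: isd_refl.
- exact: (isd_reflN df').
- by exists M => j x; exact: fM.
- move=> j e e0; have [X XP] := fNy j e e0; exists X => x /XP.
  by rewrite /refl /reflN -cabsN opprB addrC.
- move=> j e e0; have [X XP] := fy j e e0; exists X => x /XP.
  by rewrite /refl /reflN opprK -cabsN opprD.
Qed.

(** Outgoing in quantified form: a single size [S] for the solution and, with an exponential weight,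
    for its outgoing parts at both ends. Pairing at a finite point needs such a rate, where [forced]
    offers only a limit. *)
Definition asymp n (ka : 'I_n -> C) (b S : R) (f f' : 'I_n -> R -> C) : Prop :=
  [/\ forall j x, cabs (f j x) <= S,
      forall j x, 0 <= x -> cabs (f' j x + ka j * f j x) <= S * expR (- b * x) &
      forall j x, 0 <= x ->
        cabs (f' j (- x) - ka j * f j (- x)) <= S * expR (- b * x)].

Lemma asymp_refl n ka b S (f f' : 'I_n -> R -> C) :
  asymp ka b S f f' -> asymp ka b S (refl f) (reflN f').
Proof.
case=> fS fy fNy; split.
- by move=> j x; exact: fS.
- by move=> j x /(fNy j); rewrite /refl /reflN -cabsN opprB addrC.
- by move=> j x /(fy j); rewrite /refl /reflN opprK -cabsN opprD.
Qed.

Lemma asymp_le n ka b S S' (f f' : 'I_n -> R -> C) : S <= S' ->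
  asymp ka b S f f' -> asymp ka b S' f f'.
Proof.
move=> SS [fS fy fNy]; split => [j x|j x x0|j x x0].
- exact: le_trans (fS j x) SS.
- by apply: le_trans (fy j x x0) _; rewrite ler_wpM2r ?expR_ge0.
- by apply: le_trans (fNy j x x0) _; rewrite ler_wpM2r ?expR_ge0.
Qed.

(** [half_line_bound] on each half-line, the left one after reflection; the two share the same jet
    at 0. *)
Lemma line_bound n (c b N : R) : 0 <= c -> 0 < b -> 0 <= N ->
  exists2 K : R, 1 <= K &
  forall (ka : 'I_n -> C) B (f f' r : 'I_n -> R -> C) (rho : R), 0 <= rho ->
  (forall j, 0 <= complex.Re (ka j)) -> (forall j, cabs (ka j) <= N) ->
  (forall j k x, `|B j k x| <= c * expR (- b * `|x|)) ->
  decays b rho r -> forced ka B f f' r ->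
  asymp ka b (K * (jet0 f f' + rho)) f f'.
Proof.
move=> c0 b0 N0; have [K K1 KP] := @half_line_bound R n c b N c0 b0 N0.
exists K => // ka B f f' r rho rho0 ka0 kaN.
have right B' g g' r' : (forall j k x, `|B' j k x| <= c * expR (- b * `|x|)) ->
    decays b rho r' -> forced ka B' g g' r' ->
    forall j x, 0 <= x -> cabs (g j x) <= K * (jet0 g g' + rho) /\
      cabs (g' j x + ka j * g j x) <= K * (jet0 g g' + rho) * expR (- b * x).
  move=> Bc rr [dg dg' [M gM] gy _].
  apply: (KP ka g g' (fun j x => \sum_k (B' j k x)%:C * g k x + r' j x) rho M) => //.
    move=> j x x0; rewrite (le_trans (cabsD _ _)) // mulrDl; apply: lerD; last first.
      by have := rr j x; rewrite (ger0_norm x0).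
    rewrite (le_trans (cabs_sum _ _ _)) // mulr_sumr mulr_suml; apply: ler_sum => k _.
    rewrite cabsM cabs_real mulrAC; apply: (ler_wpM2r (cabs_ge0 _)).
    by have := Bc j k x; rewrite (ger0_norm x0).
move=> Bc rr ff.
have H1 := right _ _ _ _ Bc rr ff.
have Bc' j k x : `|reflB B j k x| <= c * expR (- b * `|x|).
  by rewrite -[`|x|]normrN; exact: Bc.
have H2 := right _ _ _ _ Bc' (decays_refl rr) (forced_refl ff).
rewrite jet0_refl in H2.
split.
- move=> j x; have [x0|/ltW x0] := leP 0 x; first exact: (H1 j x x0).1.
  have /H2 : 0 <= - x by rewrite oppr_ge0.
  by move=> /(_ j)[]; rewrite /refl opprK.
- by move=> j x /(H1 j)[].
- by move=> j x /(H2 j)[_]; rewrite /refl /reflN -cabsN opprD opprK.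
Qed.

(** When a bound [M] is already known, the equation estimates the outgoing parts directly, without
    passing through the jet at 0. *)
Lemma asymp_of_bound n (c b M rho : R) (ka : 'I_n -> C) B (f f' r : 'I_n -> R -> C) :
  0 < b -> 0 <= c -> 0 <= M -> 0 <= rho -> (forall j, 0 <= complex.Re (ka j)) ->
  (forall j k x, `|B j k x| <= c * expR (- b * `|x|)) ->
  (forall j x, cabs (f j x) <= M) -> decays b rho r -> forced ka B f f' r ->
  asymp ka b (M + (n%:R * c * M + rho) / b) f f'.
Proof.
move=> b0 c0 M0 rho0 ka0.
have t0 : 0 <= (n%:R * c * M + rho) / b.
  by rewrite divr_ge0 ?(ltW b0) // addr_ge0 // !mulr_ge0.
have right B' g g' r' : (forall j k x, `|B' j k x| <= c * expR (- b * `|x|)) ->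
    (forall j x, cabs (g j x) <= M) -> decays b rho r' -> forced ka B' g g' r' ->
    forall j x, 0 <= x -> cabs (g' j x + ka j * g j x) <=
      (M + (n%:R * c * M + rho) / b) * expR (- b * x).
  move=> Bc gM rr [dg dg' _ gy _] j x x0.
  apply: le_trans (_ : (n%:R * c * M + rho) / b * expR (- b * x) <= _); last first.
    by apply: ler_wpM2r; rewrite ?expR_ge0 // lerDr.
  apply: (outgoing_bound b0 (ka0 j) _ _ _ (gy j) x0) => [y _|y _|y y0].
  - exact: dg.
  - exact: dg'.
  rewrite (le_trans (cabsD _ _)) // mulrDl; apply: lerD; last first.
    by have := rr j y; rewrite (ger0_norm y0).
  rewrite (le_trans (cabs_sum _ _ _)) // -!mulrA mulr_natl.
  rewrite -[leRHS](_ : \sum_(k < n) (c * (M * expR (- b * y))) = _); last first.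
    by rewrite sumr_const card_ord.
  apply: ler_sum => k _; rewrite cabsM cabs_real.
  have Bk := Bc j k y; rewrite (ger0_norm y0) in Bk.
  rewrite (_ : c * (M * expR (- b * y)) = c * expR (- b * y) * M); last by ring.
  by apply: ler_pM; rewrite ?cabs_ge0.
move=> Bc fM rr ff; split.
- by move=> j x; rewrite (le_trans (fM j x)) // lerDl.
- exact: right Bc fM rr ff.
- move=> j x x0.
  have Bc' i k y : `|reflB B i k y| <= c * expR (- b * `|y|).
    by rewrite -[`|y|]normrN; exact: Bc.
  have := right _ _ _ _ Bc' (fun j x => fM j (- x)) (decays_refl rr) (forced_refl ff) j x x0.
  by rewrite /refl /reflN -cabsN opprD opprK.
Qed.

(** The outgoing part is integrated at the rate [b / 2], strictly below [b], which keeps the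
    constant of [decay_of_outgoing] finite. *)
Lemma asymp_decay n (b S : R) (ka : 'I_n -> C) (f f' : 'I_n -> R -> C) :
  0 < b -> 0 <= S -> (forall j x, isd (f j) x (f' j x)) -> asymp ka b S f f' ->
  forall j, b / 2 <= complex.Re (ka j) -> forall x,
    cabs (f j x) <= (1 + 2 / b) * S * expR (- (b / 2) * `|x|).
Proof.
move=> b0 S0 df fa j kaj.
have right g g' : (forall j x, isd (g j) x (g' j x)) -> asymp ka b S g g' ->
    forall x, 0 <= x -> cabs (g j x) <= (1 + 2 / b) * S * expR (- (b / 2) * x).
  move=> dg [gS gy _] x x0.
  have th : 0 <= b / 2 < b by apply/andP; split; lra.
  have := @decay_of_outgoing R (ka j) (g j) (g' j) 0 b (b / 2) S th kaj S0
    (fun y _ => dg j y) (gy j) x x0.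
  rewrite !mulr0 !expR0 mul1r mulr1 => H.
  rewrite mulNr expRN ler_pdivlMr ?expR_gt0 // mulrC (le_trans H) //.
  have -> : S / (b - b / 2) = 2 / b * S.
    by rewrite (_ : b - b / 2 = b / 2); [field; lra|field].
  by have := gS j 0; lra.
move=> x; have [x0|x0] := leP 0 x.
  by have := right _ _ df fa x x0; rewrite (ger0_norm x0).
have := right _ _ (isd_refl df) (asymp_refl fa) (- x).
by rewrite /refl opprK (ltr0_norm x0); apply; rewrite oppr_ge0 ltW.
Qed.

(* Without growth at real frequencies both [f' + ka f] and [f' - ka f] vanish at
   infinity, so an oscillating component is forced to decay. *)
Lemma standing_decay (ka : C) (f f' g : R -> C) (b m G : R) :
  0 < b -> 0 < m -> complex.Re ka = 0 -> m <= cabs ka ->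
  (forall x, 0 <= x -> isd f x (f' x)) ->
  (forall x, 0 <= x -> isd f' x (ka ^+ 2 * f x - g x)) ->
  (forall x, 0 <= x -> cabs (g x) <= G * expR (- b * x)) ->
  tends0 (fun x => f' x + ka * f x) -> tends0 (fun x => f' x - ka * f x) ->
  forall x, 0 <= x -> cabs (f x) <= G / b / m * expR (- b * x) /\
    cabs (f' x) <= G / b * expR (- b * x).
Proof.
move=> b0 m0 ka0 mka df df' gG h1 h2 x x0.
have H1 : cabs (f' x + ka * f x) <= G / b * expR (- b * x).
  by apply: (outgoing_bound b0 _ df df' gG h1) => //; rewrite ka0.
have H2 : cabs (f' x - ka * f x) <= G / b * expR (- b * x).
  rewrite -mulNr; apply: (outgoing_bound b0 _ df _ gG _ x0).
  - by rewrite reN ka0 oppr0.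
  - by move=> y y0; rewrite sqrrN; exact: df'.
  - by move=> e e0; have [X XP] := h2 e e0; exists X => y /XP; rewrite mulNr.
have two (u : C) : 2 * cabs u = cabs (u + u).
  have -> : u + u = (2 : R)%:C * u by rewrite rmorph_nat mulr_natl mulr2n.
  by rewrite cabsM cabs_real gtr0_norm.
have f2 : 2 * cabs (f' x) <= 2 * (G / b * expR (- b * x)).
  rewrite two (_ : f' x + f' x = (f' x + ka * f x) + (f' x - ka * f x)); last by ring.
  by rewrite (le_trans (cabsD _ _)) //; lra.
have f3 : 2 * cabs (ka * f x) <= 2 * (G / b * expR (- b * x)).
  rewrite two (_ : _ + _ = (f' x + ka * f x) - (f' x - ka * f x)); last by ring.
  by rewrite (le_trans (cabsB _ _)) //; lra.
split; last lra.
rewrite mulrAC ler_pdivlMr // mulrC.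
apply: le_trans (_ : cabs (ka * f x) <= _); last lra.
by rewrite cabsM ler_wpM2r ?cabs_ge0.
Qed.

Definition wronsk n (f f' P P' : 'I_n -> R -> C) (x : R) : C :=
  \sum_j (f' j x * P j x - f j x * P' j x).

Lemma wronsk_refl n (f f' P P' : 'I_n -> R -> C) x :
  wronsk (refl f) (reflN f') (refl P) (reflN P') x = - wronsk f f' P P' (- x).
Proof.
rewrite /wronsk -sumrN; apply: eq_bigr => j _; rewrite /refl /reflN; ring.
Qed.

Definition symB n (B : 'I_n -> 'I_n -> R -> R) : Prop :=
  forall j k x, B j k x = B k j x.

(** The symmetry of [B] cancels the potential terms, so only the mismatch of the exponents and the
    forcings drive the Wronskian. *)
Lemma isd_wronsk n (ka nn : 'I_n -> C) B (f f' r P P' s : 'I_n -> R -> C) x :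
  symB B ->
  (forall j, isd (f j) x (f' j x)) ->
  (forall j, isd (f' j) x (ka j ^+ 2 * f j x - (\sum_k (B j k x)%:C * f k x + r j x))) ->
  (forall j, isd (P j) x (P' j x)) ->
  (forall j, isd (P' j) x (nn j ^+ 2 * P j x - (\sum_k (B j k x)%:C * P k x + s j x))) ->
  isd (wronsk f f' P P') x
    (\sum_j ((ka j ^+ 2 - nn j ^+ 2) * f j x * P j x - r j x * P j x + f j x * s j x)).
Proof.
move=> sB df df' dP dP'.
apply: (isd_eq (isd_sum (fun j => isdB (isdM (df' j) (dP j)) (isdM (df j) (dP' j))))).
have E : \sum_j (\sum_k (B j k x)%:C * f k x) * P j x =
    \sum_j f j x * (\sum_k (B j k x)%:C * P k x).
  under eq_bigr do rewrite mulr_suml.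
  rewrite exchange_big /=; apply: eq_bigr => j _; rewrite mulr_sumr.
  by apply: eq_bigr => k _; rewrite sB; ring.
apply/eqP; rewrite -subr_eq0 -sumrB; apply/eqP.
transitivity (\sum_j (f j x * (\sum_k (B j k x)%:C * P k x)
   - (\sum_k (B j k x)%:C * f k x) * P j x)); last by rewrite sumrB E subrr.
by apply: eq_bigr => j _; ring.
Qed.

(* The Jost solutions of (A), (B), (C) at the right end, with [nn] the exponents at
   [lambda = i s]; those at the left end are reflected. *)
Record jost_right n (nn : 'I_n -> C) (B : 'I_n -> 'I_n -> R -> R)
    (P P' : 'I_n -> R -> C) : Prop := JostRight {
  jost_d : forall j x, isd (P j) x (P' j x);
  jost_d2 : forall j x, isd (P' j) x
    (nn j ^+ 2 * P j x - (\sum_k (B j k x)%:C * P k x));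
  jost_bnd : exists M : R, forall j x, 0 <= x -> cabs (P j x) <= M;
  jost_y : forall j, tends0 (fun x => P' j x + nn j * P j x) }.

(** Sums stand in for maxima: the sum of the [K], and the inverse of one plus the sum of the
    [1 / d], which is positive even for an empty family. *)
Lemma finite_uniform m (Q : 'I_m -> R -> R -> Prop) :
  (forall i K K' d d', Q i K d -> K <= K' -> d' <= d -> Q i K' d') ->
  (forall i, exists2 K : R, 0 <= K & exists2 d : R, 0 < d & Q i K d) ->
  exists2 K : R, 0 <= K & exists2 d : R, 0 < d & forall i, Q i K d.
Proof.
move=> mono H.
have /choice[Kf KfP] : forall i, exists K : R, 0 <= K /\ exists2 d : R, 0 < d & Q i K d.
  by move=> i; have [K ? ?] := H i; exists K.
have /choice[df dfP] : forall i, exists d : R, 0 < d /\ Q i (Kf i) d.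
  by move=> i; have [_ [d ? ?]] := KfP i; exists d.
have K0 i : 0 <= Kf i by case: (KfP i).
have d0 i : 0 < (df i)^-1 by rewrite invr_gt0; case: (dfP i).
exists (\sum_i Kf i); first exact: sumr_ge0.
have s0 : 0 < \sum_i (df i)^-1 + 1.
  by rewrite ltr_wpDl // sumr_ge0 // => i _; exact: ltW.
exists (\sum_i (df i)^-1 + 1)^-1 => [|i]; first by rewrite invr_gt0.
apply: mono (dfP i).2 _ _; first exact: (ler_sum1 _ K0).
rewrite -[leRHS]invrK lef_pV2 ?posrE //.
have := ler_sum1 i (fun i => ltW (d0 i)); lra.
Qed.

(** The weight [eta] of the size can be made small at the expense of [del], while the weight [K] of
    the forcing is fixed beforehand. This asymmetry is what lets [nonresonant] absorb the size. *)
Definition wronsk_small n (b : R) (nn : 'I_n -> C) B P P' (eta K del : R) : Prop :=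
  forall (ka : 'I_n -> C) (f f' r : 'I_n -> R -> C) (S rho : R),
  (forall j, cabs (ka j - nn j) <= del) ->
  (forall j, cabs (ka j ^+ 2 - nn j ^+ 2) <= del) ->
  0 <= S -> 0 <= rho -> asymp ka b S f f' -> decays b rho r -> forced ka B f f' r ->
  cabs (wronsk f f' P P' 0) <= eta * S + K * rho.

Lemma quarter_frac (a y t : R) : 0 <= a -> 0 < y -> 0 <= t ->
  a * y * (t / (4 * ((a + 1) * y))) <= t / 4.
Proof.
move=> a0 y0 t0; have a1 : 0 < a + 1 by rewrite ltr_wpDl.
have -> : a * y * (t / (4 * ((a + 1) * y))) = t / 4 * (a / (a + 1)).
  by field; rewrite !gt_eqF.
by rewrite ler_piMr ?divr_ge0 // ler_pdivrMr // mul1r lerDl.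
Qed.

Lemma quarter_frac1 (a t : R) : 0 <= a -> 0 <= t -> a * (t / (4 * (a + 1))) <= t / 4.
Proof. by move=> a0 t0; have := quarter_frac a0 ltr01 t0; rewrite !mulr1. Qed.

(** The Wronskian at 0 is its value at [X] minus its variation on [[0, X]]. At [X] it is the sum
    over the components of [(f' + ka f) P - f (P' + nn P) + (nn - ka) f P], where each term is small
    because [f] and [P] are both outgoing, with close exponents. Only the forcing contributes a term
    without a small factor. *)
Lemma pairing_right n (b : R) (nn : 'I_n -> C) B P P' : 0 < b -> symB B ->
  jost_right nn B P P' ->
  exists2 K : R, 0 <= K & forall eta : R, 0 < eta -> exists2 del : R, 0 < del &
  wronsk_small b nn B P P' eta K del.
Proof.
move=> b0 sB [dP dP' [M0 PM0] Py].
pose M := Num.max 0 M0.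
have M_ge0 : 0 <= M by rewrite le_max lexx.
have PM j x : 0 <= x -> cabs (P j x) <= M.
  by move=> x0; rewrite (le_trans (PM0 j x x0)) // le_max lexx orbT.
pose N : R := n%:R.
have N0 : 0 <= N by rewrite ler0n.
have NM0 : 0 <= N * M by rewrite mulr_ge0.
have sumle (F : 'I_n -> R) (t : R) : (forall j, F j <= t) -> \sum_j F j <= N * t.
  move=> Ft; rewrite mulr_natl -[leRHS](_ : \sum_(k < n) t = _).
    by apply: ler_sum => k _; exact: Ft.
  by rewrite sumr_const card_ord.
exists (N * M / b); first by rewrite divr_ge0 // ltW.
move=> eta eta0.
have [X1 [X10 X1P]] := @expR_small R b (eta / (4 * (N * M + 1))) b0
  ltac:(apply: divr_gt0; lra).
have [X2 X2P] : exists X : R, forall j x, X <= x ->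
    cabs (P' j x + nn j * P j x) <= eta / (4 * (N + 1)).
  have e0 : 0 < eta / (4 * (N + 1)) by apply: divr_gt0; lra.
  have /choice[Xf XfP] : forall j, exists X : R, forall x, X <= x ->
    cabs (P' j x + nn j * P j x) <= eta / (4 * (N + 1)) by move=> j; exact: Py.
  exists (\sum_j `|Xf j|) => j x Xx; apply: XfP; apply: le_trans Xx.
  apply: (le_trans (ler_norm _)).
  by apply: (@ler_sum1 R n (fun j => `|Xf j|)).
pose X := Num.max X1 X2.
have X0 : 0 <= X by rewrite le_max X10.
have X11 : X1 <= X by rewrite le_max lexx.
have X22 : X2 <= X by rewrite le_max lexx orbT.
(* The mismatch of the exponents acts all along [[0, X]] and once more in the boundary term, hence
   the factor [1 + X]. *)
pose del := eta / (4 * ((N * M + 1) * (1 + X))).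
have NMX : 0 < (N * M + 1) * (1 + X) by apply: mulr_gt0; lra.
have del0 : 0 < del by apply: divr_gt0; lra.
exists del => // ka f f' r S rho kan kan2 S0 rho0 [fS fy _] rr [df df' _ _ _].
pose W := wronsk f f' P P'.
have dW x : 0 <= x <= X -> isd W x (\sum_j ((ka j ^+ 2 - nn j ^+ 2) * f j x * P j x
     - r j x * P j x + f j x * 0)).
  move=> _; apply: (@isd_wronsk n ka nn B f f' r P P' (fun _ _ => 0)) => // j.
  by apply: (isd_eq (dP' j x)); rewrite addr0.
pose g (x : R) := N * (del * S * M * x + - (rho * M / b) * expR (- b * x)).
have dg x : 0 <= x <= X ->
    derR g x (N * (del * S * M + rho * M * expR (- b * x))).
  move=> _; apply: (derR_eq (derRM (derR_cst N x) (derRD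
    (derRM (derR_cst _ x) (derR_id x)) (derRM (derR_cst _ x) (derR_exp (- b) x))))).
  by rewrite mul0r add0r; field; rewrite gt_eqF.
have H := isd_le X0 dW dg.
have {}H : cabs (W X - W 0) <= g X - g 0.
  apply: H => x /andP[x0 xX]; rewrite (le_trans (cabs_sum _ _ _)) //.
  apply: sumle => j; rewrite mulr0 addr0 (le_trans (cabsB _ _)) //.
  have Pj := PM j x x0; have rj := rr j x; rewrite (ger0_norm x0) in rj.
  have a0 := cabs_ge0 (P j x); have a1 := cabs_ge0 (r j x).
  have a2 := cabs_ge0 (f j x); have a3 := fS j x.
  rewrite !cabsM; apply: lerD.
    apply: ler_pM => //; first by rewrite mulr_ge0 ?cabs_ge0.
    by apply: ler_pM; rewrite ?cabs_ge0.
  by rewrite mulrAC; apply: ler_pM.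
have WX : cabs (W X) <= N * (S * expR (- b * X) * M + S * (eta / (4 * (N + 1))) + del * S * M).
  rewrite (le_trans (cabs_sum _ _ _)) //; apply: sumle => j.
  rewrite (_ : _ - _ = (f' j X + ka j * f j X) * P j X
     + (- f j X) * (P' j X + nn j * P j X) + (nn j - ka j) * f j X * P j X); last by ring.
  rewrite (le_trans (cabsD _ _)) // lerD //.
    rewrite (le_trans (cabsD _ _)) // lerD // cabsM; last first.
      by rewrite cabsN; apply: ler_pM; rewrite ?cabs_ge0 ?fS ?X2P.
    by apply: ler_pM; rewrite ?cabs_ge0 ?PM ?fy.
  rewrite !cabsM; apply: ler_pM; rewrite ?mulr_ge0 ?cabs_ge0 ?PM //.
  by apply: ler_pM; rewrite ?cabs_ge0 ?fS // cabs_subC.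
have gX : g X - g 0 <= N * (del * S * M * X) + N * M / b * rho.
  rewrite /g !mulr0 expR0 add0r mulr1.
  have : 0 <= N * (rho * M / b) * expR (- b * X).
    by rewrite mulr_ge0 ?expR_ge0 // mulr_ge0 // divr_ge0 ?(ltW b0) // mulr_ge0.
  have -> : N * M / b * rho = N * (rho * M / b) by rewrite -!mulrA; congr (_ * _); ring.
  by clear; move=> *; lra.
have := cabs_sub (W 0) (W X); rewrite cabs_subC => HW.
have t1 : N * M * expR (- b * X) <= eta / 4.
  by apply: le_trans (ler_wpM2l NM0 (X1P _ X11)) _; exact: quarter_frac1 (ltW eta0).
have t2 : N * (eta / (4 * (N + 1))) <= eta / 4 by exact: quarter_frac1 (ltW eta0).
have t3 : N * M * (1 + X) * del <= eta / 4.
  by apply: quarter_frac (ltW eta0) => //; rewrite ltr_pwDl.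
have t4 := ler_wpM2l S0 (lerD (lerD t1 t2) t3).
have t5 : 0 <= S * eta by rewrite mulr_ge0 // ltW.
by move: H WX gX HW t4 t5; clear; move=> *; lra.
Qed.

Lemma pairing_left n (b : R) (nn : 'I_n -> C) B P P' : 0 < b -> symB B ->
  jost_right nn (reflB B) (refl P) (reflN P') ->
  exists2 K : R, 0 <= K & forall eta : R, 0 < eta -> exists2 del : R, 0 < del &
  wronsk_small b nn B P P' eta K del.
Proof.
move=> b0 sB JP.
have sB' : symB (reflB B) by move=> j k x; exact: sB.
have [K K0 KP] := pairing_right b0 sB' JP.
exists K => // eta eta0; have [del del0 delP] := KP eta eta0.
exists del => // ka f f' r S rho k1 k2 S0 rho0 fa rr ff.
have := delP ka _ _ _ S rho k1 k2 S0 rho0 (asymp_refl fa) (decays_refl rr) (forced_refl ff).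
by rewrite wronsk_refl oppr0 cabsN.
Qed.

(* The form in which [E_A <> 0] and [E_C <> 0] enter the estimates. *)
Definition jets_span n (Pm Pm' Pp Pp' : 'I_n -> 'I_n -> R -> C) : Prop :=
  exists2 K : R, 0 <= K & forall (f f' : 'I_n -> R -> C) (t : R),
    (forall i, cabs (wronsk f f' (Pm i) (Pm' i) 0) <= t) ->
    (forall i, cabs (wronsk f f' (Pp i) (Pp' i) 0) <= t) ->
    jet0 f f' <= K * t.

(** Three bounds are chained: the jet by the Wronskians, the Wronskians by [eta] times the size plus
    the forcing, the size by [K1] times the jet plus the forcing. With [K0 * K1 * eta <= 1 / 2] the
    jet is absorbed and the forcing alone controls the solution. *)
Lemma nonresonant n (c b N : R) (nn : 'I_n -> C) B Pm Pm' Pp Pp' :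
  0 <= c -> 0 < b -> 0 <= N -> symB B ->
  (forall j k x, `|B j k x| <= c * expR (- b * `|x|)) ->
  (forall i, jost_right nn (reflB B) (refl (Pm i)) (reflN (Pm' i))) ->
  (forall i, jost_right nn B (Pp i) (Pp' i)) ->
  jets_span Pm Pm' Pp Pp' ->
  exists2 K : R, 1 <= K & exists2 del : R, 0 < del &
  forall (ka : 'I_n -> C) (f f' r : 'I_n -> R -> C) (rho : R),
  (forall j, cabs (ka j - nn j) <= del) ->
  (forall j, cabs (ka j ^+ 2 - nn j ^+ 2) <= del) ->
  (forall j, 0 <= complex.Re (ka j)) -> (forall j, cabs (ka j) <= N) ->
  0 <= rho -> decays b rho r -> forced ka B f f' r ->
  jet0 f f' <= K * rho /\ asymp ka b (K * rho) f f'.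
Proof.
move=> c0 b0 N0 sB Bc Jm Jp [K0 K00 K0P].
have [K1 K11 K1P] := @line_bound n c b N c0 b0 N0.
pose eta : R := (2 * (K0 * K1 + 1))^-1.
have KK0 : 0 <= K0 * K1 by rewrite mulr_ge0 //; lra.
have eta0 : 0 < eta by rewrite invr_gt0; lra.
pose Q (Pj Pj' : 'I_n -> 'I_n -> R -> C) i K d := wronsk_small b nn B (Pj i) (Pj' i) eta K d.
have mono Pj Pj' i K K' d d' : Q Pj Pj' i K d -> K <= K' -> d' <= d -> Q Pj Pj' i K' d'.
  move=> q KK dd ka f f' r S rho h1 h2 S0 rho0 fa rr ff.
  apply: le_trans (q ka f f' r S rho _ _ S0 rho0 fa rr ff) _.
  - by move=> j; exact: le_trans (h1 j) dd.
  - by move=> j; exact: le_trans (h2 j) dd.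
  - by rewrite lerD2l ler_wpM2r.
have [KL KL0 [dL dL0 QL]] := finite_uniform (mono Pm Pm') (fun i =>
  let: ex_intro2 K K0 KP := pairing_left b0 sB (Jm i) in ex_intro2 _ _ K K0 (KP eta eta0)).
have [KR KR0 [dR dR0 QR]] := finite_uniform (mono Pp Pp') (fun i =>
  let: ex_intro2 K K0 KP := pairing_right b0 sB (Jp i) in ex_intro2 _ _ K K0 (KP eta eta0)).
pose K2 := 1 + 2 * K0 * (KL + KR).
have KK2 : 0 <= K0 * (KL + KR) by rewrite mulr_ge0 // addr_ge0.
exists (K1 * (K2 + 1)); first by rewrite /K2; nra.
exists (Num.min dL dR); first by rewrite lt_min dL0.
move=> ka f f' r rho k1 k2 ka0 kaN rho0 rr ff.
have fa := K1P ka B f f' r rho rho0 ka0 kaN Bc rr ff.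
set J := jet0 f f' in fa *.
have J0 : 0 <= J by exact: jet0_ge0.
have S0 : 0 <= K1 * (J + rho) by rewrite mulr_ge0 ?addr_ge0 //; lra.
have JJ : J <= K0 * (eta * (K1 * (J + rho)) + (KL + KR) * rho).
  apply: K0P => i.
  - apply: le_trans (QL i ka f f' r _ rho _ _ S0 rho0 fa rr ff) _.
    + by move=> j; rewrite (le_trans (k1 j)) // ge_min lexx.
    + by move=> j; rewrite (le_trans (k2 j)) // ge_min lexx.
    + by rewrite lerD2l ler_wpM2r // lerDl.
  - apply: le_trans (QR i ka f f' r _ rho _ _ S0 rho0 fa rr ff) _.
    + by move=> j; rewrite (le_trans (k1 j)) // ge_min lexx orbT.
    + by move=> j; rewrite (le_trans (k2 j)) // ge_min lexx orbT.
    + by rewrite lerD2l ler_wpM2r // lerDr.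
have e2 : K0 * K1 * eta <= 1 / 2.
  have -> : K0 * K1 * eta = (K0 * K1) / (K0 * K1 + 1) / 2 by rewrite /eta; field; lra.
  by rewrite ler_wpM2r ?invr_ge0 // ler_pdivrMr; lra.
have JK : J <= K2 * rho.
  have : K0 * K1 * eta * (J + rho) <= 1 / 2 * (J + rho) by rewrite ler_wpM2r // addr_ge0.
  by rewrite /K2; lra.
have K1K2 : K1 * (J + rho) <= K1 * (K2 + 1) * rho.
  by rewrite -mulrA ler_wpM2l //; lra.
split; last exact: asymp_le fa.
apply: le_trans JK _; rewrite ler_wpM2r // /K2; nra.
Qed.

End Line.

(** * The perturbed system near the threshold *)

Definition cpair (T : Type) (u v : T) : 'I_2 -> T :=
  fun j => if val j is 0%N then u else v.
Definition csingle (T : Type) (u : T) : 'I_1 -> T := fun=> u.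

Lemma ord2P (P : 'I_2 -> Prop) : P ord0 -> P ord_max -> forall j, P j.
Proof.
move=> P0 P1 [[|[|//]] jlt].
- by rewrite (_ : Ordinal jlt = ord0) //; apply: val_inj.
- by rewrite (_ : Ordinal jlt = ord_max) //; apply: val_inj.
Qed.

Lemma sum_ord2 (V : nmodType) (F : 'I_2 -> V) : \sum_j F j = F ord0 + F ord_max.
Proof. by rewrite big_ord_recr /= big_ord1; congr (F _ + _); apply: val_inj. Qed.

(** In (A) the coefficient [al] multiplies [p + q] in both equations, and [be] the component to
    which the equation belongs. *)
Definition BA (R : realType) (al be : R -> R) : 'I_2 -> 'I_2 -> R -> R :=
  fun j k x => if j == k then al x + be x else al x.

Lemma symBA (R : realType) (al be : R -> R) : symB (BA al be).
Proof. by move=> j k x; rewrite /BA eq_sym. Qed.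
Arguments symBA {R} al be.

Definition BS (R : realType) (e : R -> R) : 'I_1 -> 'I_1 -> R -> R := fun _ _ => e.

(** * Perturbation of the exponents *)

Section Roots.
Variable R : realType.
Implicit Types (k n z : R[i]).

Lemma near_root k n z (m : R) : 0 < m -> k ^+ 2 = n ^+ 2 + z -> m <= cabs (k + n) ->
  cabs (k - n) <= cabs z / m.
Proof.
move=> m0 kn mk; rewrite ler_pdivlMr //.
have -> : z = (k - n) * (k + n) by rewrite -subr_sqr kn; ring.
by rewrite cabsM ler_wpM2l ?cabs_ge0.
Qed.

Lemma im_le_cabs z : complex.Im z <= cabs z.
Proof.
rewrite (le_trans (ler_norm _)) // -(@ler_pXn2r _ 2) ?nnegrE ?cabs_ge0 //.
by rewrite cabs2 -normrX ger0_norm ?sqr_ge0 // lerDr sqr_ge0.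
Qed.

Lemma cabsZ (t : R) z : cabs (t%:C * z) = `|t| * cabs z.
Proof. by rewrite cabsM cabs_real. Qed.

(** With [k = x + i y], the imaginary part gives [x y = 0], and [y = 0] would make [k ^+ 2]
    nonnegative although its real part is at most [- m ^+ 2 / 2]. *)
Lemma root_neg k z (m : R) : 0 < m -> k ^+ 2 = (- m ^+ 2)%:C + z ->
  complex.Im z = 0 -> cabs z <= m ^+ 2 / 2 -> complex.Re k = 0 /\ m / 2 <= cabs k.
Proof.
move=> m0 kk z0 zm; split; last first.
  rewrite -(@ler_pXn2r _ 2) ?nnegrE ?cabs_ge0 // ?divr_ge0 ?(ltW m0) // -cabs_exp2 kk.
  have := cabsB ((- m ^+ 2)%:C + z) z; rewrite addrK.
  rewrite cabs_real normrN ger0_norm ?sqr_ge0 // expr_div_n.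
  by have := sqr_ge0 m; lra.
have := re_le_cabs z; move: kk z0 zm; case: k => x y; case: z => u t /= kk t0 zm uz.
have re := congr1 (@complex.Re R) kk; have im := congr1 (@complex.Im R) kk.
rewrite expr2 /= in re im.
have xy : x * y = 0 by lra.
apply/eqP; apply/negPn/negP => xn0.
have y0 : y = 0 by move/eqP: xy; rewrite mulf_eq0 (negPf xn0) => /eqP.
have := sqr_ge0 x; have : 0 < m ^+ 2 by rewrite exprn_gt0.
by rewrite y0 in re; lra.
Qed.

Lemma ler_chain4 (x y i n t N : R) : x <= y + n -> y <= t -> t <= i -> n + i <= N ->
  x <= N.
Proof. lra. Qed.

Lemma cabs_sqJ z : (cabs z ^+ 2)%:C = z * z^*.
Proof. by rewrite cabs2; case: z => x y; apply: complexP => /=; ring. Qed.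

Lemma eqc_real_complex0 (t : R) : (t%:C == 0 :> R[i]) = (t == 0).
Proof. by rewrite eq_complex /= eqxx andbT. Qed.

End Roots.

(** * A priori estimates for waves, and triviality for [Im z > 0] and for [Im z = 0] *)

Section Core.
Variable R : realType.
Notation C := R[i].
Variables (om s b C0 e1 sg : R).
Variables (al0 be0 c0 e0 : R -> R) (al be c d e : R -> R -> R).
Let w (x : R) : R := expR (- b * `|x|).
Let n1 : R := Num.sqrt (om + s).
Let n2 : R := Num.sqrt (s - om).
Let n3 : R := Num.sqrt (2 * s).
Let nnA : 'I_2 -> C := cpair n1%:C ('i * n2%:C).
Let nnC : 'I_1 -> C := csingle n3%:C.
Let nnB : 'I_1 -> C := csingle 0.
Hypotheses (om0 : 0 < om) (oms : om < s) (b0 : 0 < b) (bn1 : b <= n1) (bn3 : b <= n3).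
Hypotheses (C00 : 0 <= C0) (e10 : 0 < e1) (e11 : e1 <= 1) (sg1 : `|sg| = 1).
Hypothesis unperturbed : forall x,
  [/\ `|al0 x| <= C0 * w x, `|be0 x| <= C0 * w x, `|c0 x| <= C0 * w x &
      `|e0 x| <= C0 * w x].
(** The coupling [c] between the blocks is the only coefficient whose first order in [eps] must be
    known, with an error of order [eps ^+ 2]: this first order produces the integral [I_2]. The sign
    [sg] is that of the chosen branch [V_eps]. *)
Hypothesis perturbed : forall eps, 0 < eps < e1 -> forall x,
  [/\ `|al eps x - al0 x| <= C0 * eps * w x,
      `|be eps x - be0 x| <= C0 * eps * w x,
      `|c eps x - sg * eps * c0 x| <= C0 * eps ^+ 2 * w x,
      `|d eps x| <= C0 * eps * w x &
      `|e eps x - e0 x| <= C0 * eps * w x].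
Variables (PmA PmA' PpA PpA' : 'I_2 -> 'I_2 -> R -> C).
Variables (PmC PmC' PpC PpC' : 'I_1 -> 'I_1 -> R -> C) (p4 p4' : R -> C).
Hypothesis jostmA : forall i,
  jost_right nnA (reflB (BA al0 be0)) (refl (PmA i)) (reflN (PmA' i)).
Hypothesis jostpA : forall i, jost_right nnA (BA al0 be0) (PpA i) (PpA' i).
Hypothesis spanA : jets_span PmA PmA' PpA PpA'.
Hypothesis jostmC : forall i,
  jost_right nnC (reflB (BS e0)) (refl (PmC i)) (reflN (PmC' i)).
Hypothesis jostpC : forall i, jost_right nnC (BS e0) (PpC i) (PpC' i).
Hypothesis spanC : jets_span PmC PmC' PpC PpC'.
Hypothesis jostB : jost_right nnB (reflB (BS e0)) (refl (csingle p4)) (reflN (csingle p4')).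
Hypothesis dp4 : forall x, isd p4 x (p4' x).
Hypothesis ddp4 : forall x, isd p4' x (- ((e0 x)%:C * p4 x)).
Hypothesis p4jet : 0 < cabs (p4 0) ^+ 2 + cabs (p4' 0) ^+ 2.
Hypothesis p4far : exists X : R, 0 <= X /\ forall x, x <= - X -> 1 / 2 <= cabs (p4 x).

(* Bounded outgoing solutions of [L psi = lambda psi]: here [z = i lambda + s], which
   vanishes at the branch point, and [ka1], ..., [ka4] are the square roots playing
   the role of [nu1], ..., [nu4]. *)
Record wave (eps : R) (z ka1 ka2 ka3 ka4 : C)
    (f1 f2 f3 f4 f1' f2' f3' f4' : R -> C) : Prop := Wave {
  wave_d : forall x, [/\ isd f1 x (f1' x), isd f2 x (f2' x),
    isd f3 x (f3' x) & isd f4 x (f4' x)];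
  wave_e : forall x, [/\
    isd f1' x (ka1 ^+ 2 * f1 x - ((al eps x)%:C * (f1 x + f2 x)
      + (be eps x)%:C * f1 x + (c eps x)%:C * (f3 x + f4 x))),
    isd f2' x (ka2 ^+ 2 * f2 x - ((al eps x)%:C * (f1 x + f2 x)
      + (be eps x)%:C * f2 x + (c eps x)%:C * (f3 x + f4 x))),
    isd f3' x (ka3 ^+ 2 * f3 x - ((c eps x)%:C * (f1 x + f2 x)
      + (d eps x)%:C * (f3 x + f4 x) + (e eps x)%:C * f3 x)) &
    isd f4' x (ka4 ^+ 2 * f4 x - ((c eps x)%:C * (f1 x + f2 x)
      + (d eps x)%:C * (f3 x + f4 x) + (e eps x)%:C * f4 x))];
  wave_k : [/\ ka1 ^+ 2 = (om + s)%:C - z, ka2 ^+ 2 = (om - s)%:C + z,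
    ka3 ^+ 2 = (2 * s)%:C - z & ka4 ^+ 2 = z];
  wave_re : [/\ 0 <= complex.Re ka1, 0 <= complex.Re ka2, 0 <= complex.Re ka3 &
    0 <= complex.Re ka4];
  wave_im : 0 <= complex.Im ka2;
  wave_bnd : exists M : R, forall x, [/\ cabs (f1 x) <= M, cabs (f2 x) <= M,
    cabs (f3 x) <= M & cabs (f4 x) <= M];
  wave_y : [/\ tends0 (fun x => f1' x + ka1 * f1 x),
    tends0 (fun x => f2' x + ka2 * f2 x), tends0 (fun x => f3' x + ka3 * f3 x) &
    tends0 (fun x => f4' x + ka4 * f4 x)];
  wave_Ny : [/\ tends0 (fun x => f1' (- x) - ka1 * f1 (- x)),
    tends0 (fun x => f2' (- x) - ka2 * f2 (- x)),
    tends0 (fun x => f3' (- x) - ka3 * f3 (- x)) &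
    tends0 (fun x => f4' (- x) - ka4 * f4 (- x))] }.

Let w0 x : 0 <= w x. Proof. exact: expR_ge0. Qed.
Let w1 x : w x <= 1.
Proof. by rewrite /w -expR0 ler_expR mulNr oppr_le0 mulr_ge0 // ltW. Qed.
Let n10 : 0 < n1. Proof. by have ? := om0; have ? := oms; rewrite sqrtr_gt0; lra. Qed.
Let n20 : 0 < n2. Proof. by have ? := om0; have ? := oms; rewrite sqrtr_gt0; lra. Qed.
Let n30 : 0 < n3. Proof. by have ? := om0; have ? := oms; rewrite sqrtr_gt0; lra. Qed.
Let n1E : n1 ^+ 2 = om + s. Proof. by have ? := om0; have ? := oms; rewrite sqr_sqrtr //; lra. Qed.
Let n2E : n2 ^+ 2 = s - om. Proof. by have ? := om0; have ? := oms; rewrite sqr_sqrtr //; lra. Qed.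
Let n3E : n3 ^+ 2 = 2 * s. Proof. by have ? := om0; have ? := oms; rewrite sqr_sqrtr //; lra. Qed.
Let in2E : ('i * n2%:C) ^+ 2 = (om - s)%:C :> C.
Proof.
by rewrite exprMn sqr_i -rmorphXn /= n2E mulN1r -rmorphN /= opprB.
Qed.

(** The sign conditions on the roots, in particular [Im ka2 >= 0], keep [ka + n] away from 0, so
    [near_root] applies to the first three exponents; at the threshold only [|ka4|^2 = |z|] is
    available. *)
Lemma exponents_near eps z ka1 ka2 ka3 ka4 f1 f2 f3 f4 f1' f2' f3' f4' :
  wave eps z ka1 ka2 ka3 ka4 f1 f2 f3 f4 f1' f2' f3' f4' ->
  [/\ cabs (ka1 - n1%:C) <= cabs z / n1, cabs (ka2 - 'i * n2%:C) <= cabs z / n2,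
      cabs (ka3 - n3%:C) <= cabs z / n3 & cabs ka4 ^+ 2 = cabs z].
Proof.
case=> _ _ [k1 k2 k3 k4] [r1 r2 r3 r4] i2 _ _ _.
have ? := n10; have ? := n20; have ? := n30.
split; last by rewrite -cabs_exp2 k4.
- rewrite -[cabs z]cabsN; apply: near_root => //.
    by rewrite k1 -rmorphXn /= n1E.
  apply: le_trans (re_le_cabs _); rewrite reD /=; lra.
- apply: near_root => //; first by rewrite k2 in2E.
  by apply: le_trans (im_le_cabs _); rewrite imD imM /=; lra.
- rewrite -[cabs z]cabsN; apply: near_root => //.
    by rewrite k3 -rmorphXn /= n3E.
  by apply: le_trans (re_le_cabs _); rewrite reD /=; lra.
Qed.

Let c_bound eps x : 0 < eps < e1 -> `|c eps x| <= 2 * C0 * eps * w x.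
Proof.
move=> He; have ? := C00; have ? := e11; have /andP[ep0 ep1] := He; have [_ _ h _ _] := perturbed He x.
have [_ _ h0 _] := unperturbed x.
have : `|c eps x| <= `|c eps x - sg * eps * c0 x| + `|sg * eps * c0 x|.
  by rewrite -[X in `|X| <= _](subrK (sg * eps * c0 x)) ler_normD.
rewrite !normrM sg1 mul1r (gtr0_norm ep0) => H.
have : eps * `|c0 x| <= eps * (C0 * w x) by rewrite ler_wpM2l // ltW.
have : C0 * eps ^+ 2 * w x <= C0 * eps * w x.
  rewrite ler_wpM2r // ler_wpM2l // expr2; nra.
lra.
Qed.

Ltac small_lra := clear -R om s b C0 e1 sg al0 be0 c0 e0 al be c d e w n1 n2 n3
  nnA nnC nnB om0 oms b0 bn1 bn3 C00 e10 e11 sg1 unperturbed perturbed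
  PmA PmA' PpA PpA' PmC PmC' PpC PpC' p4 p4' jostmA jostpA spanA jostmC jostpC spanC
  jostB dp4 ddp4 p4jet p4far w0 w1 n10 n20 n30 n1E n2E n3E in2E c_bound; lra.

Ltac small_nra := clear -R om s b C0 e1 sg al0 be0 c0 e0 al be c d e w n1 n2 n3
  nnA nnC nnB om0 oms b0 bn1 bn3 C00 e10 e11 sg1 unperturbed perturbed
  PmA PmA' PpA PpA' PmC PmC' PpC PpC' p4 p4' jostmA jostpA spanA jostmC jostpC spanC
  jostB dp4 ddp4 p4jet p4far w0 w1 n10 n20 n30 n1E n2E n3E in2E c_bound; nra.

(** All that the perturbation adds to the equations, the coupling with the other block included, is
    put on the right as a forcing of size [eps M w], as if the blocks were independent. *)
Definition remA (eps : R) (f1 f2 f3 f4 f : R -> C) (x : R) : C :=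
  (al eps x - al0 x)%:C * (f1 x + f2 x) + (be eps x - be0 x)%:C * f x
  + (c eps x)%:C * (f3 x + f4 x).
Definition remC (eps : R) (f1 f2 f3 f4 f : R -> C) (x : R) : C :=
  (c eps x)%:C * (f1 x + f2 x) + (d eps x)%:C * (f3 x + f4 x)
  + (e eps x - e0 x)%:C * f x.

Lemma remA_bound eps f1 f2 f3 f4 f M x : 0 < eps < e1 ->
  cabs (f1 x) <= M -> cabs (f2 x) <= M -> cabs (f3 x) <= M -> cabs (f4 x) <= M ->
  cabs (f x) <= M -> cabs (remA eps f1 f2 f3 f4 f x) <= 8 * C0 * eps * M * w x.
Proof.
have ? := C00; move=> He h1 h2 h3 h4 h; have M0 := le_trans (cabs_ge0 _) h1.
have [ha hb _ _ _] := perturbed He x; have hc := c_bound x He.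
have t1 : cabs ((al eps x - al0 x)%:C * (f1 x + f2 x)) <= C0 * eps * w x * (2 * M).
  rewrite cabsZ; apply: ler_pM => //; rewrite ?cabs_ge0 //.
  by rewrite (le_trans (cabsD _ _)) //; lra.
have t2 : cabs ((be eps x - be0 x)%:C * f x) <= C0 * eps * w x * M.
  by rewrite cabsZ; apply: ler_pM => //; rewrite cabs_ge0.
have t3 : cabs ((c eps x)%:C * (f3 x + f4 x)) <= 2 * C0 * eps * w x * (2 * M).
  rewrite cabsZ; apply: ler_pM => //; rewrite ?cabs_ge0 //.
  by rewrite (le_trans (cabsD _ _)) //; lra.
have : 0 <= C0 * eps * w x * M.
  by rewrite !mulr_ge0 // ltW; case/andP: He.
have := cabsD ((al eps x - al0 x)%:C * (f1 x + f2 x) + (be eps x - be0 x)%:C * f x)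
  ((c eps x)%:C * (f3 x + f4 x)).
have := cabsD ((al eps x - al0 x)%:C * (f1 x + f2 x)) ((be eps x - be0 x)%:C * f x).
rewrite /remA; lra.
Qed.

Lemma remC_bound eps f1 f2 f3 f4 f M x : 0 < eps < e1 ->
  cabs (f1 x) <= M -> cabs (f2 x) <= M -> cabs (f3 x) <= M -> cabs (f4 x) <= M ->
  cabs (f x) <= M -> cabs (remC eps f1 f2 f3 f4 f x) <= 8 * C0 * eps * M * w x.
Proof.
have ? := C00; move=> He h1 h2 h3 h4 h; have M0 := le_trans (cabs_ge0 _) h1.
have [_ _ _ hd he] := perturbed He x; have hc := c_bound x He.
have t1 : cabs ((c eps x)%:C * (f1 x + f2 x)) <= 2 * C0 * eps * w x * (2 * M).
  rewrite cabsZ; apply: ler_pM => //; rewrite ?cabs_ge0 //.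
  by rewrite (le_trans (cabsD _ _)) //; lra.
have t2 : cabs ((d eps x)%:C * (f3 x + f4 x)) <= C0 * eps * w x * (2 * M).
  rewrite cabsZ; apply: ler_pM => //; rewrite ?cabs_ge0 //.
  by rewrite (le_trans (cabsD _ _)) //; lra.
have t3 : cabs ((e eps x - e0 x)%:C * f x) <= C0 * eps * w x * M.
  by rewrite cabsZ; apply: ler_pM => //; rewrite cabs_ge0.
have : 0 <= C0 * eps * w x * M.
  by rewrite !mulr_ge0 // ltW; case/andP: He.
have := cabsD ((c eps x)%:C * (f1 x + f2 x) + (d eps x)%:C * (f3 x + f4 x))
  ((e eps x - e0 x)%:C * f x).
have := cabsD ((c eps x)%:C * (f1 x + f2 x)) ((d eps x)%:C * (f3 x + f4 x)).
rewrite /remC; lra.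
Qed.

Lemma forcedA eps z ka1 ka2 ka3 ka4 f1 f2 f3 f4 f1' f2' f3' f4' :
  wave eps z ka1 ka2 ka3 ka4 f1 f2 f3 f4 f1' f2' f3' f4' ->
  forced (cpair ka1 ka2) (BA al0 be0) (cpair f1 f2) (cpair f1' f2')
    (cpair (remA eps f1 f2 f3 f4 f1) (remA eps f1 f2 f3 f4 f2)).
Proof.
case=> wd we _ _ _ [M wM] [y1 y2 _ _] [z1 z2 _ _]; split.
- by apply: ord2P => x; have [] := wd x.
- apply: ord2P => x; have [h1 h2 _ _] := we x; rewrite sum_ord2 /BA /cpair /=.
    by apply: (isd_eq h1); rewrite /remA !(rmorphD, rmorphN) /=; ring.
  by apply: (isd_eq h2); rewrite /remA !(rmorphD, rmorphN) /=; ring.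
- by exists M; apply: ord2P => x; have [] := wM x.
- exact: ord2P.
- exact: ord2P.
Qed.

Lemma forcedC eps z ka1 ka2 ka3 ka4 f1 f2 f3 f4 f1' f2' f3' f4' :
  wave eps z ka1 ka2 ka3 ka4 f1 f2 f3 f4 f1' f2' f3' f4' ->
  forced (csingle ka3) (BS e0) (csingle f3) (csingle f3')
    (csingle (remC eps f1 f2 f3 f4 f3)).
Proof.
case=> wd we _ _ _ [M wM] [_ _ y3 _] [_ _ z3 _]; split => //.
- by move=> j x; have [] := wd x.
- move=> j x; have [_ _ h _] := we x; rewrite big_ord1 /BS /csingle.
  by apply: (isd_eq h); rewrite /remC !(rmorphD, rmorphN) /=; ring.
- by exists M => j x; have [] := wM x.
Qed.

Lemma forcedB eps z ka1 ka2 ka3 ka4 f1 f2 f3 f4 f1' f2' f3' f4' :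
  wave eps z ka1 ka2 ka3 ka4 f1 f2 f3 f4 f1' f2' f3' f4' ->
  forced (csingle ka4) (BS e0) (csingle f4) (csingle f4')
    (csingle (remC eps f1 f2 f3 f4 f4)).
Proof.
case=> wd we _ _ _ [M wM] [_ _ _ y3] [_ _ _ z3]; split => //.
- by move=> j x; have [] := wd x.
- move=> j x; have [_ _ _ h] := we x; rewrite big_ord1 /BS /csingle.
  by apply: (isd_eq h); rewrite /remC !(rmorphD, rmorphN) /=; ring.
- by exists M => j x; have [] := wM x.
Qed.

(** [M] plays the role of the supremum of all components: three of them are smaller by a factor
    [eps], and the jet of the fourth controls [M]. *)
Definition small_parts (K eps M : R) (ka1 ka2 ka3 ka4 : C)
    (f1 f2 f3 f4 f1' f2' f3' f4' : R -> C) : Prop :=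
  [/\ forall x, [/\ cabs (f1 x) <= M, cabs (f2 x) <= M, cabs (f3 x) <= M &
        cabs (f4 x) <= M],
      asymp (cpair ka1 ka2) b (K * eps * M) (cpair f1 f2) (cpair f1' f2'),
      asymp (csingle ka3) b (K * eps * M) (csingle f3) (csingle f3'),
      asymp (csingle ka4) b (K * M) (csingle f4) (csingle f4') &
      M <= K * (cabs (f4 0) + cabs (f4' 0))].

(** [nonresonant] bounds the blocks (A) and (C) by their forcing, of order [eps M]; the resonant
    block (B) is bounded by its own jet. What is not due to this jet is then at most [M / 2]. *)
Lemma wave_small : exists2 K : R, 1 <= K & exists2 del : R, 0 < del <= 1 &
  exists2 eps0 : R, 0 < eps0 <= e1 &
  forall eps z ka1 ka2 ka3 ka4 f1 f2 f3 f4 f1' f2' f3' f4',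
  0 < eps < eps0 -> cabs z <= del ->
  wave eps z ka1 ka2 ka3 ka4 f1 f2 f3 f4 f1' f2' f3' f4' ->
  exists2 M, 0 <= M & small_parts K eps M ka1 ka2 ka3 ka4 f1 f2 f3 f4 f1' f2' f3' f4'.
Proof.
have ? := C00; have ? := b0; have ? := e11; have ? := n10; have ? := n20; have ? := n30.
(* Bounds all four exponents as soon as [|z| <= 1]. *)
pose N := n1 + n1^-1 + (n2 + n2^-1) + (n3 + n3^-1) + 1.
have i1 : 0 < n1^-1 by rewrite invr_gt0.
have i2 : 0 < n2^-1 by rewrite invr_gt0.
have i3 : 0 < n3^-1 by rewrite invr_gt0.
have N0 : 0 <= N by rewrite /N; have := n10; have := n20; have := n30; lra.
have Nn1 : n1 + n1^-1 <= N by rewrite /N; lra.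
have Nn2 : n2 + n2^-1 <= N by rewrite /N; lra.
have Nn3 : n3 + n3^-1 <= N by rewrite /N; lra.
have N11 : 1 <= N by rewrite /N; lra.
have BAb j k x : `|BA al0 be0 j k x| <= 2 * C0 * expR (- b * `|x|).
  have [ha hb _ _] := unperturbed x; rewrite -/(w x) /BA.
  case: ifP => _; last by have := w0 x; nra.
  by rewrite (le_trans (ler_normD _ _)) //; lra.
have BSb (j k : 'I_1) x : `|BS e0 j k x| <= C0 * expR (- b * `|x|).
  by have [] := unperturbed x.
have BSs : symB (BS e0) by [].
have [KA KA1 [dA dA0 HA]] := @nonresonant R 2 (2 * C0) b N nnA (BA al0 be0) _ _ _ _
   ltac:(nra) b0 N0 (symBA al0 be0) BAb jostmA jostpA spanA.
have [KC KC1 [dC dC0 HC]] := @nonresonant R 1 C0 b N nnC (BS e0) _ _ _ _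
   C00 b0 N0 BSs BSb jostmC jostpC spanC.
have [KB KB1 HB] := @line_bound R 1 C0 b N C00 b0 N0.
pose K := 8 * C0 * (KA + KC) + 2 * KB + 9 * C0 / b.
have K8 : 0 <= C0 * KA /\ 0 <= C0 * KC /\ 0 <= C0 * KB.
  by split; [|split]; rewrite mulr_ge0 // (le_trans ler01).
case: K8 => [K8A [K8C K8B]].
have Cb : 0 <= 9 * C0 / b by rewrite divr_ge0 ?(ltW b0) // mulr_ge0.
have K1 : 1 <= K by rewrite /K; move: K8A K8C KB1 Cb; small_lra.
exists K => //.
have d1 : 0 < Num.min 1 (Num.min (Num.min dA (dA * n1)) (Num.min (dA * n2)
    (Num.min dC (dC * n3)))).
  by rewrite !lt_min ltr01 dA0 dC0 !mulr_gt0.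
exists (Num.min 1 (Num.min (Num.min dA (dA * n1)) (Num.min (dA * n2)
    (Num.min dC (dC * n3))))).
  by rewrite d1 ge_min lexx.
(* The forcing has size [8 C0 eps M]; [eps D <= 1 / 2] makes its total effect at most [M / 2]. *)
pose D := 8 * C0 * (KA + KC + KB) + 1.
have D1 : 1 <= D by rewrite /D; move: K8A K8C K8B; small_lra.
exists (Num.min e1 (2 * D)^-1).
  rewrite lt_min e10 invr_gt0 mulr_gt0 //=; last exact: lt_le_trans D1.
  by rewrite ge_min lexx.
move=> eps z ka1 ka2 ka3 ka4 f1 f2 f3 f4 f1' f2' f3' f4'.
rewrite !lt_min !le_min => /andP[ep0 /andP[epe1 epD]].
move=> /andP[z1 /andP[/andP[zA zA1] /andP[zA2 /andP[zC zC3]]]] wv.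
have He : 0 < eps < e1 by rewrite ep0.
have [x1 x2 x3 x4] := exponents_near wv.
have [k1 k2 k3 k4] := wave_k wv; have [r1 r2 r3 r4] := wave_re wv.
have cz := cabs_ge0 z.
have zn1 : cabs z / n1 <= n1^-1 by rewrite ler_pdivrMr // mulVf // gt_eqF.
have zn2 : cabs z / n2 <= n2^-1 by rewrite ler_pdivrMr // mulVf // gt_eqF.
have zn3 : cabs z / n3 <= n3^-1 by rewrite ler_pdivrMr // mulVf // gt_eqF.
have N1 : cabs ka1 <= N.
  have := cabsD (ka1 - n1%:C) n1%:C; rewrite subrK cabs_real gtr0_norm // => h.
  exact: ler_chain4 h x1 zn1 Nn1.
have N2 : cabs ka2 <= N.
  have := cabsD (ka2 - 'i * n2%:C) ('i * n2%:C); rewrite subrK cabsM cabs_real.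
  rewrite gtr0_norm // (_ : cabs 'i = 1) ?mul1r; last first.
    by rewrite /= expr0n /= add0r expr1n sqrtr1.
  by move=> h; exact: ler_chain4 h x2 zn2 Nn2.
have N3 : cabs ka3 <= N.
  have := cabsD (ka3 - n3%:C) n3%:C; rewrite subrK cabs_real gtr0_norm // => h.
  exact: ler_chain4 h x3 zn3 Nn3.
have N4 : cabs ka4 <= N.
  apply: le_trans _ N11.
  by rewrite -(@ler_pXn2r _ 2) ?nnegrE ?cabs_ge0 // x4 expr1n.
have [M0 wM0] := wave_bnd wv.
pose A := [set y | exists x, [\/ y = cabs (f1 x), y = cabs (f2 x), y = cabs (f3 x)
  | y = cabs (f4 x)]].
have AS : has_sup A.
  split; first by exists (cabs (f1 0)); exists 0; constructor 1.
  by exists M0 => _ [x [] ->]; have [] := wM0 x.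
pose M := sup A.
have MP x : [/\ cabs (f1 x) <= M, cabs (f2 x) <= M, cabs (f3 x) <= M & cabs (f4 x) <= M].
  by split; apply: (sup_upper_bound AS); exists x;
    [constructor 1|constructor 2|constructor 3|constructor 4].
have M_ge0 : 0 <= M by have [h _ _ _] := MP 0; exact: le_trans (cabs_ge0 _) h.
pose rho := 8 * C0 * eps * M.
have rho0 : 0 <= rho by rewrite /rho !mulr_ge0 // ltW.
have rA : decays b rho (cpair (remA eps f1 f2 f3 f4 f1) (remA eps f1 f2 f3 f4 f2)).
  by apply: ord2P => x; have [] := MP x => *; apply: remA_bound.
have rC : decays b rho (csingle (remC eps f1 f2 f3 f4 f3)).
  by move=> j x; have [] := MP x => *; apply: remC_bound.
have rB : decays b rho (csingle (remC eps f1 f2 f3 f4 f4)).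
  by move=> j x; have [] := MP x => *; apply: remC_bound.
have [_ asA] := HA (cpair ka1 ka2) _ _ _ rho
   ltac:(apply: ord2P; rewrite /nnA /cpair /=; [apply: (le_trans x1)|apply: (le_trans x2)];
         by rewrite ler_pdivrMr)
   ltac:(apply: ord2P; rewrite /nnA /cpair /=;
     [rewrite k1 -rmorphXn /= n1E|rewrite k2 in2E]; rewrite addrC addKr ?cabsN //)
   ltac:(exact: ord2P) ltac:(exact: ord2P) rho0 rA (forcedA wv).
have [_ asC] := HC (csingle ka3) _ _ _ rho
   ltac:(move=> j; apply: (le_trans x3); by rewrite ler_pdivrMr)
   ltac:(move=> j; rewrite /nnC /csingle k3 -rmorphXn /= n3E addrC addKr cabsN //)
   ltac:(by move=> j) ltac:(by move=> j) rho0 rC (forcedC wv).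
have asB := HB (csingle ka4) _ _ _ _ rho rho0 ltac:(by move=> j) ltac:(by move=> j)
  BSb rB (forcedB wv).
rewrite /jet0 big_ord1 /csingle in asB.
set J := cabs (f4 0) + cabs (f4' 0) in asB *.
have J0 : 0 <= J by rewrite addr_ge0 ?cabs_ge0.
have epD2 : eps * D <= 1 / 2.
  have D0 : 0 < D by apply: lt_le_trans D1.
  apply: le_trans (ler_wpM2r (ltW D0) (ltW epD)) _.
  by rewrite invfM mulfVK ?gt_eqF // mul1r.
have epDM : eps * D * M <= 1 / 2 * M by rewrite ler_wpM2r.
have KB0 : 0 <= KB by apply: le_trans KB1.
have eM : 0 <= eps * M by rewrite mulr_ge0 // ltW.
have tA : 0 <= C0 * KA * (eps * M) by rewrite mulr_ge0.
have tC : 0 <= C0 * KC * (eps * M) by rewrite mulr_ge0.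
have tB : 0 <= C0 * KB * (eps * M) by rewrite mulr_ge0.
have tb : 0 <= 9 * C0 / b * (eps * M) by rewrite mulr_ge0.
have KBJ : 0 <= KB * J by rewrite mulr_ge0.
have KBM : 0 <= KB * (eps * M) by rewrite mulr_ge0.
(* Components 1, 2, 3 and the forcing of component 4 each fit into [M / 2]; the rest of component 4
   is its jet [J]. *)
have MM : M <= M / 2 + KB * J.
  apply: ge_sup; first exact: AS.1.
  have [hA _ _] := asA; have [hC _ _] := asC; have [hB _ _] := asB.
  rewrite /rho /D in hA hC hB epDM.
  move=> _ [x [] ->].
  - by move: (hA ord0 x) epDM tC tB KBJ eM; rewrite /cpair /=; small_lra.
  - by move: (hA ord_max x) epDM tC tB KBJ eM; rewrite /cpair /=; small_lra.
  - by move: (hC ord0 x) epDM tA tB KBJ eM; rewrite /csingle /=; small_lra.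
  - by move: (hB ord0 x) epDM tA tC KBJ eM; rewrite /csingle /=; small_lra.
exists M => //; split => //.
- apply: asymp_le asA; rewrite /rho /K; move: tC tb KBM; small_lra.
- apply: asymp_le asC; rewrite /rho /K; move: tA tb KBM; small_lra.
- apply: asymp_le (@asymp_of_bound R 1 C0 b M rho (csingle ka4) (BS e0) _ _ _
    b0 C00 M_ge0 rho0 _ BSb _ rB (forcedB wv)) => //; last first.
    by move=> j x; have [] := MP x.
  have -> : M + (1%:R * C0 * M + rho) / b = (1 + (C0 + 8 * C0 * eps) / b) * M.
    by rewrite /rho; field; rewrite gt_eqF.
  apply: ler_wpM2r => //.
  have : (C0 + 8 * C0 * eps) / b <= 9 * C0 / b.
    apply: ler_wpM2r; first by rewrite invr_ge0 ltW.
    have : C0 * eps <= C0 * 1 by rewrite ler_wpM2l // ltW // (lt_le_trans epe1).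
    small_lra.
  move: K8A K8C KB1; rewrite /K; small_lra.
- have : 0 <= C0 * KA * J /\ 0 <= C0 * KC * J by split; rewrite mulr_ge0.
  have : 0 <= 9 * C0 / b * J by rewrite mulr_ge0.
  by move=> h1 [h2 h3]; rewrite -/J; move: h1 h2 h3 MM KBJ; rewrite /K; small_lra.
Qed.

Lemma small_parts_le K K' eps M ka1 ka2 ka3 ka4 f1 f2 f3 f4 f1' f2' f3' f4' :
  0 <= eps -> 0 <= M -> K <= K' ->
  small_parts K eps M ka1 ka2 ka3 ka4 f1 f2 f3 f4 f1' f2' f3' f4' ->
  small_parts K' eps M ka1 ka2 ka3 ka4 f1 f2 f3 f4 f1' f2' f3' f4'.
Proof.
move=> ep0 M0 KK [hM hA hC hB hJ]; split => //.
- by apply: asymp_le hA; rewrite ler_wpM2r // ler_wpM2r.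
- by apply: asymp_le hC; rewrite ler_wpM2r // ler_wpM2r.
- by apply: asymp_le hB; rewrite ler_wpM2r.
- by apply: le_trans hJ _; rewrite ler_wpM2r // addr_ge0 ?cabs_ge0.
Qed.

Lemma small_times (t h : R) : 0 <= t -> 0 < h -> t * (h / (t + 1)) <= h.
Proof.
move=> t0 h0; rewrite mulrCA -[leRHS]mulr1 ler_wpM2l ?(ltW h0) //.
by rewrite ler_pdivrMr; lra.
Qed.

(* Along [csingle p4] the Wronskian is all that separates the jet of [f4] from a
   multiple of the jet of the threshold solution. *)
Lemma near_threshold : exists2 K : R, 1 <= K & forall eta X : R, 0 < eta -> 0 <= X ->
  exists2 del : R, 0 < del <= 1 & exists2 eps0 : R, 0 < eps0 <= e1 &
  forall eps z ka1 ka2 ka3 ka4 f1 f2 f3 f4 f1' f2' f3' f4',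
  0 < eps < eps0 -> cabs z <= del ->
  wave eps z ka1 ka2 ka3 ka4 f1 f2 f3 f4 f1' f2' f3' f4' ->
  exists M : R, exists cc : C, [/\ 0 <= M,
    small_parts K eps M ka1 ka2 ka3 ka4 f1 f2 f3 f4 f1' f2' f3' f4',
    cabs cc <= K * M, M <= K * cabs cc &
    forall x, `|x| <= X -> cabs (f4 x - cc * p4 x) <= eta * M].
Proof.
have C0' := C00.
have [K0 K01 [d0 /andP[d00 d01] [ep0 /andP[ep00 ep01] H0]]] := wave_small.
have BSs : symB (BS e0) by [].
have [K' K'0 HP] := pairing_left b0 BSs jostB.
pose N4 := cabs (p4 0) ^+ 2 + cabs (p4' 0) ^+ 2.
pose s4 := cabs (p4 0) + cabs (p4' 0).
have s40 : 0 <= s4 by rewrite addr_ge0 ?cabs_ge0.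
have N40 : 0 < N4 := p4jet.
have [q q0 qE] : exists2 q, 0 <= q & q = s4 / N4.
  by exists (s4 / N4) => //; rewrite divr_ge0 // ltW.
have K00 : 0 <= K0 by apply: le_trans K01.
have Ks : 0 <= K0 * s4 by rewrite mulr_ge0.
have qK : 0 <= q * (2 + K0) by rewrite mulr_ge0 // addr_ge0.
exists (K0 + 2 * (K0 * s4) + q * (2 + K0)).
  by move: K01 Ks qK; small_lra.
move=> eta_ X eta_0 X0.
(* The second term of the minimum leaves room to pass from the control of [M] by the jet of [f4] to
   its control by [cc]. *)
pose eta := Num.min eta_ (2 * K0)^-1.
have eta0 : 0 < eta.
  by rewrite lt_min eta_0 invr_gt0 mulr_gt0 // (lt_le_trans ltr01).
have [KX KX1 HG] := @gronwall_system R 1 C0 X C00.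
have KX0 : 0 <= KX by apply: le_trans KX1.
have e4 : 0 < eta / 4 by apply: divr_gt0.
pose h := eta / 4.
pose t1 := KX * q * K0.
have t10 : 0 <= t1 by rewrite /t1 !mulr_ge0.
have eta1 : 0 < h / (t1 + 1) by rewrite divr_gt0 // ltr_wpDl.
have [d1 d10 HW] := HP _ eta1.
pose t3 := KX * (q * K' * 8 * C0 + 8 * C0).
have t30 : 0 <= t3 by rewrite /t3 mulr_ge0 // addr_ge0 // !mulr_ge0.
exists (Num.min d0 (Num.min (h / (KX + 1)) (Num.min d1 (d1 ^+ 2)))).
  rewrite !lt_min !ge_min d00 d01 d10 exprn_gt0 // divr_gt0 //.
  by rewrite ltr_wpDl.
exists (Num.min ep0 (h / (t3 + 1))).
  by rewrite !lt_min !ge_min ep00 ep01 divr_gt0 // ltr_wpDl.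
move=> eps z ka1 ka2 ka3 ka4 f1 f2 f3 f4 f1' f2' f3' f4'.
rewrite !lt_min !le_min => /andP[ep1 /andP[ep2 ep3]] /andP[z0 /andP[zX /andP[z1 z2]]] wv.
have He0 : 0 < eps < ep0 by rewrite ep1.
have [M M0 sp] := H0 _ _ _ _ _ _ _ _ _ _ _ _ _ _ He0 z0 wv.
have He : 0 < eps < e1 by rewrite ep1 (lt_le_trans ep2).
have [hM hA hC hB hJ] := sp.
pose rho := 8 * C0 * eps * M.
have rho0 : 0 <= rho by rewrite /rho !mulr_ge0 // ltW.
have rB : decays b rho (csingle (remC eps f1 f2 f3 f4 f4)).
  by move=> j x; have [] := hM x => *; apply: remC_bound.
have [_ _ _ x4] := exponents_near wv; have [_ _ _ k4] := wave_k wv.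
have ka4d : cabs ka4 <= d1.
  by rewrite -(@ler_pXn2r _ 2) ?nnegrE ?cabs_ge0 ?(ltW d10) // x4.
have HWM := HW (csingle ka4) (csingle f4) (csingle f4') _ (K0 * M) rho
  ltac:(move=> j; by rewrite /nnB /csingle subr0)
  ltac:(move=> j; by rewrite /nnB /csingle expr0n subr0 k4)
  ltac:(by rewrite mulr_ge0) rho0 hB rB (forcedB wv).
rewrite /wronsk big_ord1 /csingle in HWM.
set W := _ - _ in HWM.
(* [cc] is the coefficient of the orthogonal projection of the jet of [f4] at 0 onto that of [p4].
   What remains of the jet is [W / N4] times the conjugate jet of [p4] turned by a right angle. *)
have [cc ccE] : exists cc, cc = (f4 0 * (p4 0)^* + f4' 0 * (p4' 0)^*) / N4%:C by eexists.
have N4C : N4%:C != 0 :> C by rewrite eqc_real_complex0 gt_eqF.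
have N4E : N4%:C = p4 0 * (p4 0)^* + p4' 0 * (p4' 0)^* :> C.
  by rewrite rmorphD /= -!cabs_sqJ.
have D0 : f4 0 - cc * p4 0 = - (W * (p4' 0)^*) / N4%:C.
  by apply: (mulIf N4C); rewrite ccE mulrBl !mulfVK // mulrAC mulfVK // N4E /W; ring.
have D'0 : f4' 0 - cc * p4' 0 = (W * (p4 0)^*) / N4%:C.
  by apply: (mulIf N4C); rewrite ccE mulrBl !mulfVK // mulrAC mulfVK // N4E /W; ring.
have cN (u v : C) : cabs (u * v^* / N4%:C) = cabs u * cabs v / N4.
  by rewrite !cabsM cabs_conj Normc.normcV cabs_real gtr0_norm.
have qW : cabs (f4 0 - cc * p4 0) + cabs (f4' 0 - cc * p4' 0) = q * cabs W.
  rewrite D0 D'0 mulNr cabsN !cN qE /s4; ring.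
have cW := cabs_ge0 W.
have Wle : KX * (q * cabs W) <= KX * (q * (h / (t1 + 1) * (K0 * M) + K' * rho)).
  by rewrite !ler_wpM2l.
have s1 : KX * (q * (h / (t1 + 1) * (K0 * M))) <= h * M.
  have -> : KX * (q * (h / (t1 + 1) * (K0 * M))) = t1 * (h / (t1 + 1)) * M.
    by rewrite /t1; ring.
  by rewrite ler_wpM2r // small_times.
have s2 : KX * (cabs z * M) <= h * M.
  rewrite mulrA ler_wpM2r //; apply: le_trans (ler_wpM2l KX0 zX) _.
  exact: small_times.
have s3 : KX * (q * (K' * rho)) + KX * rho <= h * M.
  have -> : KX * (q * (K' * rho)) + KX * rho = t3 * eps * M by rewrite /rho /t3; ring.
  rewrite ler_wpM2r //; apply: le_trans (ler_wpM2l t30 (ltW ep3)) _.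
  exact: small_times.
have s4' : 0 <= KX * rho by rewrite mulr_ge0.
have zM : 0 <= KX * (cabs z * M) by rewrite !mulr_ge0 ?cabs_ge0.
have qWM : q * cabs W <= eta / 2 * M.
  apply: le_trans (_ : KX * (q * cabs W) <= _); first by rewrite ler_peMl ?mulr_ge0.
  by move: Wle s1 s3 s4'; rewrite /h; small_lra.
have etaK : eta * K0 <= 1 / 2.
  apply: le_trans (_ : (2 * K0)^-1 * K0 <= _).
    by rewrite ler_wpM2r // ge_min lexx orbT.
  by rewrite invfM mulfVK ?mul1r // gt_eqF // (lt_le_trans ltr01).
exists M, cc; split => //.
- apply: small_parts_le sp => //; first exact: ltW.
  by move: Ks qK; small_lra.
- have cb : cabs cc <= q * (cabs (f4 0) + cabs (f4' 0)).
    rewrite ccE cabsM Normc.normcV cabs_real gtr0_norm // qE mulrAC.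
    rewrite ler_wpM2r ?invr_ge0 ?(ltW N40) // (le_trans (cabsD _ _)) //.
    rewrite !cabsM !cabs_conj /s4.
    have := cabs_ge0 (f4 0); have := cabs_ge0 (f4' 0).
    have := cabs_ge0 (p4 0); have := cabs_ge0 (p4' 0); small_nra.
  have f4'b : cabs (f4' 0) <= (K0 + 1) * M.
    have [_ hy _] := hB; have := hy ord0 0 (lexx 0).
    rewrite mulr0 expR0 mulr1 /csingle => hy0.
    have : cabs (ka4 * f4 0) <= 1 * M.
      rewrite cabsM; apply: ler_pM; rewrite ?cabs_ge0 //; last by have [] := hM 0.
      rewrite -(@ler_pXn2r _ 2) ?nnegrE ?cabs_ge0 // x4 expr1n.
      exact: le_trans z0 d01.
    have := cabs_sub (f4' 0) (- (ka4 * f4 0)); rewrite opprK cabsN.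
    by move: hy0; small_lra.
  apply: le_trans cb _; have [_ _ _ f4M] := hM 0.
  apply: le_trans (_ : q * (2 + K0) * M <= _); last first.
    by rewrite ler_wpM2r //; move: K01 Ks; small_lra.
  rewrite -mulrA ler_wpM2l //; move: f4M f4'b; small_lra.
- have f0 := cabs_sub (f4 0) (cc * p4 0); have f0' := cabs_sub (f4' 0) (cc * p4' 0).
  rewrite !cabsM in f0 f0'.
  have : M <= K0 * (cabs cc * s4 + eta / 2 * M).
    apply: le_trans hJ _; rewrite ler_wpM2l // /s4.
    by move: f0 f0' qW qWM; small_lra.
  have : eta * K0 * M <= 1 / 2 * M by rewrite ler_wpM2r.
  have : 0 <= K0 * cabs cc by rewrite mulr_ge0 ?cabs_ge0.
  have : 0 <= q * (2 + K0) * cabs cc by rewrite mulr_ge0 ?cabs_ge0.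
  by move: M0; small_lra.
(* The difference solves the equation of [p4] with the forcing [z f4] and the remainder, so Gronwall
   carries its smallness from 0 to the whole of [[- X, X]]. *)
- pose D (x : R) := f4 x - cc * p4 x; pose D' (x : R) := f4' x - cc * p4' x.
  pose D'' (x : R) := z * f4 x - ((e0 x)%:C * D x + remC eps f1 f2 f3 f4 f4 x).
  have dD x : isd D x (D' x).
    have [_ _ _ d4] := wave_d wv x; exact: (isdB d4 (isdZ cc (dp4 x))).
  have dD' x : isd D' x (D'' x).
    have [_ _ _ d4] := wave_e wv x; apply: (isd_eq (isdB d4 (isdZ cc (ddp4 x)))).
    by rewrite k4 /D'' /D /remC !(rmorphD, rmorphN) /=; ring.
  have D''b x : cabs (D'' x) <= C0 * cabs (D x) + (cabs z * M + rho).
    rewrite /D'' opprD addrCA (le_trans (cabsD _ _)) // lerD //.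
      rewrite cabsN cabsZ ler_wpM2r ?cabs_ge0 //.
      have [_ _ _ he] := unperturbed x; rewrite (le_trans he) //.
      by rewrite -[leRHS]mulr1 ler_wpM2l.
    rewrite (le_trans (cabsB _ _)) // lerD //.
      by rewrite cabsM ler_wpM2l ?cabs_ge0 //; have [] := hM x.
    by rewrite (le_trans (rB ord0 x)) // -[leRHS]mulr1; apply: ler_wpM2l => //; exact: w1.
  have F0 : 0 <= cabs z * M + rho by rewrite addr_ge0 // mulr_ge0 ?cabs_ge0.
  have JD : jet0 (csingle D) (csingle D') = q * cabs W by rewrite /jet0 big_ord1.
  have fin : KX * (q * cabs W + (cabs z * M + rho)) <= eta_ * M.
    apply: le_trans (_ : eta * M <= _); last by rewrite ler_wpM2r // ge_min lexx.
    have : 0 <= eta * M by rewrite mulr_ge0 // ltW.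
    by move: Wle s1 s2 s3; rewrite /h; small_lra.
  move=> x xX; apply: le_trans fin; rewrite -JD -/(D x).
  have [x0|x0] := leP 0 x.
    have [] := HG (csingle D) (csingle D') (csingle D'') _ F0
      (fun j x _ => dD x) (fun j x _ => dD' x) _ ord0 x ltac:(by rewrite x0 -(ger0_norm x0)).
      by move=> j y _; rewrite big_ord1.
    by [].
  have nx0 : 0 <= - x by rewrite oppr_ge0 ltW.
  rewrite -jet0_refl.
  have dDl := @isd_refl R 1 _ _ (fun _ => dD); have dDl' := @isd_reflN R 1 _ _ (fun _ => dD').
  have [] := HG (refl (csingle D)) (reflN (csingle D')) (refl (csingle D'')) _ F0
      (fun j x _ => dDl j x) (fun j x _ => dDl' j x) _ ord0 (- x)
      ltac:(by rewrite nx0 -(ltr0_norm x0)).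
    by move=> j y _; rewrite big_ord1; exact: D''b.
  by rewrite /refl opprK.
Qed.

(** The real symmetric potentials contribute nothing to the imaginary part. Among the squared
    exponents only [z] is not real; it enters with sign + for components 2 and 4 and - for
    components 1 and 3. *)
Lemma flux eps z ka1 ka2 ka3 ka4 f1 f2 f3 f4 f1' f2' f3' f4' (x : R) :
  wave eps z ka1 ka2 ka3 ka4 f1 f2 f3 f4 f1' f2' f3' f4' ->
  derR (imF (fun x => (f1 x)^* * f1' x + (f2 x)^* * f2' x
                      + ((f3 x)^* * f3' x + (f4 x)^* * f4' x))) x
    (complex.Im z * (cabs (f2 x) ^+ 2 + cabs (f4 x) ^+ 2
       - cabs (f1 x) ^+ 2 - cabs (f3 x) ^+ 2)).
Proof.
move=> wv; have [d1 d2 d3 d4] := wave_d wv x; have [g1 g2 g3 g4] := wave_e wv x.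
have [k1 k2 k3 k4] := wave_k wv.
have [_ H] := isdD
  (isdD (isdM (isd_conj d1) g1) (isdM (isd_conj d2) g2))
  (isdD (isdM (isd_conj d3) g3) (isdM (isd_conj d4) g4)).
apply: (derR_eq H); rewrite k1 k2 k3 k4 !cabs2.
move: (f1 x) (f2 x) (f3 x) (f4 x) (f1' x) (f2' x) (f3' x) (f4' x) => [? ?] [? ?] [? ?]
  [? ?] [? ?] [? ?] [? ?] [? ?].
by move: z {wv k1 k2 k3 k4 H} => [? ?] /=; ring.
Qed.

Lemma re_exponents eps z ka1 ka2 ka3 ka4 f1 f2 f3 f4 f1' f2' f3' f4' :
  wave eps z ka1 ka2 ka3 ka4 f1 f2 f3 f4 f1' f2' f3' f4' ->
  cabs z <= n1 ^+ 2 / 2 -> cabs z <= n3 ^+ 2 / 2 ->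
  b / 2 <= complex.Re ka1 /\ b / 2 <= complex.Re ka3.
Proof.
move=> wv z1 z3; have [x1 _ x3 _] := exponents_near wv.
have key (n : R) (ka : C) : 0 < n -> b <= n -> cabs z <= n ^+ 2 / 2 ->
    cabs (ka - n%:C) <= cabs z / n -> b / 2 <= complex.Re ka.
  move=> n0 bn zn kn.
  have : cabs z / n <= n / 2 by rewrite ler_pdivrMr //; move: zn; small_lra.
  have := re_le_cabs (- (ka - n%:C)); rewrite cabsN reN reD reN /=.
  by move: kn bn; small_lra.
by split; [apply: key n10 bn1 z1 x1|apply: key n30 bn3 z3 x3].
Qed.

(** The flux [Phi] vanishes at both ends, and its derivative is [Im z] times a quantity whose
    negative part is at most [Q e^(- b |x|)], with [Q] of order [eps^2 M^2]. So [Phi] can lose only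
    a few multiples of [q]. On an interval of length one far to the left, however, [|f4|] is at
    least [M / (4 K)], and [Phi] must gain [Im z] times a fixed multiple of [M^2], up to [Q]. *)
Lemma unstable_trivial : exists2 del : R, 0 < del & exists2 eps0 : R, 0 < eps0 &
  forall eps z ka1 ka2 ka3 ka4 f1 f2 f3 f4 f1' f2' f3' f4',
  0 < eps < eps0 -> cabs z <= del -> 0 < complex.Im z ->
  wave eps z ka1 ka2 ka3 ka4 f1 f2 f3 f4 f1' f2' f3' f4' ->
  [/\ tends0 f1', tends0 f2', tends0 f3' & tends0 f4'] ->
  [/\ tends0 (fun x => f1' (- x)), tends0 (fun x => f2' (- x)),
      tends0 (fun x => f3' (- x)) & tends0 (fun x => f4' (- x))] ->
  forall x, [/\ f1 x = 0, f2 x = 0, f3 x = 0 & f4 x = 0].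
Proof.
have ? := b0.
have [K K1 HK] := near_threshold.
have [X [X0 XP]] := p4far.
have K0 : 0 < K by apply: lt_le_trans K1.
(* Far to the left [|cc p4|] is at least [M / (2 K)], so this accuracy leaves
   [|f4| >= M / (4 K)]. *)
have eta0 : 0 < (4 * K)^-1 by rewrite invr_gt0 mulr_gt0.
have X10 : 0 <= X + 1 by rewrite addr_ge0.
have [d0 /andP[d00 _] [ep0 /andP[ep00 ep01] H]] := HK _ (X + 1) eta0 X10.
(* [T eps^2] is the ratio of [Q (1 + 3 / b)] to [M^2 / (16 K^2)]. *)
pose T := 32 * (1 + 2 / b) ^+ 2 * K ^+ 4 * (1 + 3 / b).
have b3 : 0 <= 1 + 3 / b by rewrite addr_ge0 // divr_ge0 // ltW.
have K40 : 0 <= K ^+ 4 by rewrite exprn_ge0 // ltW.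
have T0 : 0 <= T by apply: mulr_ge0 => //; apply: mulr_ge0 => //; rewrite mulr_ge0 ?sqr_ge0.
exists (Num.min d0 (Num.min (n1 ^+ 2 / 2) (n3 ^+ 2 / 2))).
  by rewrite !lt_min d00 !divr_gt0 ?exprn_gt0.
exists (Num.min ep0 (T + 1)^-1).
  by rewrite lt_min ep00 invr_gt0 ltr_wpDl.
move=> eps z ka1 ka2 ka3 ka4 f1 f2 f3 f4 f1' f2' f3' f4'.
rewrite !lt_min !le_min => /andP[ep1 /andP[ep2 ep3]] /andP[z0 /andP[z1 z3]] y0 wv.
move=> [ty1 ty2 ty3 ty4] [tn1 tn2 tn3 tn4].
have [M [cc [M0 sp ccK Mcc f4p4]]] := H _ _ _ _ _ _ _ _ _ _ _ _ _ _
  (introT andP (conj ep1 ep2)) z0 wv.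
have [hM hA hC hB hJ] := sp.
have [r1 r3] := re_exponents wv z1 z3.
suff M00 : M = 0.
  move=> x; have [] := hM x; rewrite M00 => h1 h2 h3 h4.
  by split; apply: cabs_eq0; apply/eqP; rewrite eq_le cabs_ge0 andbT.
apply/eqP; rewrite eq_le M0 andbT leNgt; apply/negP => Mpos.
pose y := complex.Im z.
pose Phi := imF (fun x => (f1 x)^* * f1' x + (f2 x)^* * f2' x
                      + ((f3 x)^* * f3' x + (f4 x)^* * f4' x)).
have [S SE] : exists S, S = (1 + 2 / b) * (K * eps * M) by eexists.
have KeM : 0 <= K * eps * M by rewrite !mulr_ge0 // ltW.
pose Q := 2 * S ^+ 2.
have fQ (x : R) : cabs (f1 x) ^+ 2 + cabs (f3 x) ^+ 2 <= Q * expR (- b * `|x|).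
  have h1 := @asymp_decay R 2 b _ _ _ _ b0 KeM (forced_d (forcedA wv)) hA ord0 r1 x; rewrite -SE in h1.
  have h3 := @asymp_decay R 1 b _ _ _ _ b0 KeM (forced_d (forcedC wv)) hC ord0 r3 x; rewrite -SE in h3.
  have sq (t : R) : 0 <= t -> t <= S * expR (- (b / 2) * `|x|) ->
      t ^+ 2 <= S ^+ 2 * expR (- b * `|x|).
    move=> t0 tS; have -> : S ^+ 2 * expR (- b * `|x|) = (S * expR (- (b / 2) * `|x|)) ^+ 2.
      rewrite exprMn; congr (_ * _); rewrite expr2 -expRD; congr expR.
      by field.
    by rewrite ler_pXn2r ?nnegrE // (le_trans t0).
  have := sq _ (cabs_ge0 _) h1; have := sq _ (cabs_ge0 _) h3.
  by rewrite /cpair /csingle /Q /=; small_lra.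
have Q0 : 0 <= Q by rewrite mulr_ge0 ?sqr_ge0.
have dPhi x := flux x wv.
have Phib (x : R) : `|Phi x| <= M * (cabs (f1' x) + cabs (f2' x) + cabs (f3' x) + cabs (f4' x)).
  have imn (u : C) : `|complex.Im u| <= cabs u.
    by rewrite ler_norml im_le_cabs andbT lerNl -imN -(cabsN u) im_le_cabs.
  rewrite (le_trans (imn _)) // (le_trans (cabsD _ _)) //.
  have [m1 m2 m3 m4] := hM x.
  have pr (u v : C) : cabs u <= M -> cabs (u^* * v) <= M * cabs v.
    by move=> uM; rewrite cabsM cabs_conj ler_wpM2r ?cabs_ge0.
  have := cabsD ((f1 x)^* * f1' x) ((f2 x)^* * f2' x).
  have := cabsD ((f3 x)^* * f3' x) ((f4 x)^* * f4' x).
  move: (pr _ (f1' x) m1) (pr _ (f2' x) m2) (pr _ (f3' x) m3) (pr _ (f4' x) m4).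
  by small_lra.
have Phi_y (e_ : R) : 0 < e_ -> exists X : R, forall x, X <= x -> `|Phi x| <= e_.
  move=> e_0; have e4 : 0 < e_ / (4 * M) by rewrite divr_gt0 // mulr_gt0.
  have [X1 P1] := ty1 _ e4; have [X2 P2] := ty2 _ e4.
  have [X3 P3] := ty3 _ e4; have [X4 P4] := ty4 _ e4.
  exists (Num.max (Num.max X1 X2) (Num.max X3 X4)) => x; rewrite !ge_max.
  move=> /andP[/andP[x1 x2] /andP[x3 x4]]; apply: le_trans (Phib x) _.
  rewrite mulrC -ler_pdivlMr // (_ : e_ / M = 4 * (e_ / (4 * M))); last first.
    by field; rewrite gt_eqF.
  by move: (P1 _ x1) (P2 _ x2) (P3 _ x3) (P4 _ x4); small_lra.
have Phi_Ny (e_ : R) : 0 < e_ -> exists X : R, forall x, X <= x -> `|Phi (- x)| <= e_.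
  move=> e_0; have e4 : 0 < e_ / (4 * M) by rewrite divr_gt0 // mulr_gt0.
  have [X1 P1] := tn1 _ e4; have [X2 P2] := tn2 _ e4.
  have [X3 P3] := tn3 _ e4; have [X4 P4] := tn4 _ e4.
  exists (Num.max (Num.max X1 X2) (Num.max X3 X4)) => x; rewrite !ge_max.
  move=> /andP[/andP[x1 x2] /andP[x3 x4]]; apply: le_trans (Phib (- x)) _.
  rewrite mulrC -ler_pdivlMr // (_ : e_ / M = 4 * (e_ / (4 * M))); last first.
    by field; rewrite gt_eqF.
  by move: (P1 _ x1) (P2 _ x2) (P3 _ x3) (P4 _ x4); small_lra.
(* The integral over a half-line of the bound on the negative part of the derivative of the flux. *)
pose q := y * Q / b.
have yQ : 0 <= y * Q by rewrite mulr_ge0 // ltW.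
have dlow (x : R) : - (y * Q * expR (- b * `|x|)) <= y * (cabs (f2 x) ^+ 2 + cabs (f4 x) ^+ 2
       - cabs (f1 x) ^+ 2 - cabs (f3 x) ^+ 2).
  rewrite -mulrA -mulrN ler_wpM2l ?(ltW y0) //.
  by move: (fQ x) (sqr_ge0 (cabs (f2 x))) (sqr_ge0 (cabs (f4 x))); small_lra.
have right (x Y : R) : 0 <= x -> x <= Y -> Phi x <= Phi Y + q.
  move=> x0 xY.
  have du t : x <= t <= Y -> derR (fun t => q * expR (- b * t)) t (- (y * Q * expR (- b * t))).
    move=> _; apply: (derR_eq (derRM (derR_cst q t) (derR_exp (- b) t))).
    by rewrite /q; field; rewrite gt_eqF.
  have := derR_le xY du (fun t _ => dPhi t) => HH.
  have {}HH := HH (fun t ht => let: conj xt _ := andP ht in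
    eq_ind _ (fun r => - (y * Q * expR (- b * r)) <= _) (dlow t) _
      (ger0_norm (le_trans x0 xt))).
  have ex1 : q * expR (- b * Y) >= 0 by rewrite mulr_ge0 ?expR_ge0 // divr_ge0 // ltW.
  have ex2 : q * expR (- b * x) <= q.
    rewrite -[leRHS]mulr1 ler_wpM2l ?divr_ge0 ?(ltW b0) //.
    by rewrite -expR0 ler_expR mulNr oppr_le0 mulr_ge0 // ltW.
  by move: HH ex1 ex2; rewrite -/Phi; small_lra.
have left (x Y : R) : x <= Y -> Y <= 0 -> Phi x <= Phi Y + q.
  move=> xY Y0.
  have du t : x <= t <= Y -> derR (fun t => - q * expR (b * t)) t (- (y * Q * expR (b * t))).
    move=> _; apply: (derR_eq (derRM (derR_cst (- q) t) (derR_exp b t))).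
    by rewrite /q; field; rewrite gt_eqF.
  have HH : - q * expR (b * Y) - - q * expR (b * x) <= Phi Y - Phi x.
    apply: (derR_le xY du (fun t _ => dPhi t)) => t /andP[_ tY].
    by have := dlow t; rewrite (ler0_norm (le_trans tY Y0)) mulrNN.
  have ex1 : q * expR (b * x) >= 0 by rewrite mulr_ge0 ?expR_ge0 // divr_ge0 // ltW.
  have ex2 : q * expR (b * Y) <= q.
    rewrite -[leRHS]mulr1 ler_wpM2l ?divr_ge0 ?(ltW b0) //.
    by rewrite -expR0 ler_expR mulr_ge0_le0 // ltW.
  by move: HH ex1 ex2; small_lra.
have Phi0 : Phi 0 <= q.
  apply/ler_addgt0Pr => e_ e_0; have [Y YP] := Phi_y _ e_0.
  have := right 0 (Num.max 0 Y) (lexx 0) ltac:(by rewrite le_max lexx).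
  have := YP (Num.max 0 Y) ltac:(by rewrite le_max lexx orbT).
  by rewrite ler_norml => /andP[_]; small_lra.
have PhiN (x : R) : x <= 0 -> - q <= Phi x.
  move=> x0; apply/ler_addgt0Pr => e_ e_0; have [Y YP] := Phi_Ny _ e_0.
  have := left (- Num.max (- x) Y) x ltac:(by rewrite lerNl le_max lexx) x0.
  have := YP (Num.max (- x) Y) ltac:(by rewrite le_max lexx orbT).
  by rewrite ler_norml => /andP[+ _]; small_lra.
have nX0 : - X <= 0 by rewrite oppr_le0.
have XX : - (X + 1) <= - X by rewrite lerN2 lerDl.
have up := left (- X) 0 nX0 (lexx 0).
have lo := PhiN (- (X + 1)) (le_trans XX nX0).
have main : y * (M ^+ 2 / (16 * K ^+ 2) - Q) <= Phi (- X) - Phi (- (X + 1)).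
  have du t : - (X + 1) <= t <= - X -> derR (fun t => y * (M ^+ 2 / (16 * K ^+ 2) - Q) * t) t
      (y * (M ^+ 2 / (16 * K ^+ 2) - Q)).
    by move=> _; apply: (derR_eq (derRM (derR_cst _ t) (derR_id t))); ring.
  have := derR_le XX du (fun t _ => dPhi t) => HH.
  apply: le_trans (HH _); first by move: (lexx (0 : R)); small_lra.
  move=> t /andP[Xt tX]; rewrite ler_wpM2l ?(ltW y0) //.
  have tt : `|t| <= X + 1.
    by rewrite ler_norml Xt /= (le_trans tX) // (le_trans nX0) // addr_ge0.
  have h4 := f4p4 t tt; have hp := XP t tX.
  have c1 : M / K <= cabs cc by rewrite ler_pdivrMr // mulrC.
  have MK0 : 0 <= M / K by rewrite divr_ge0 // ltW.
  have f4l : M / (4 * K) <= cabs (f4 t).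
    have := cabs_sub (cc * p4 t) (f4 t); rewrite cabs_subC cabsM.
    have : M / K * (1 / 2) <= cabs cc * cabs (p4 t) by apply: ler_pM => //; rewrite divr_ge0.
    have -> : M / (4 * K) = M / K / 4 by field; rewrite gt_eqF.
    move: h4; have -> : (4 * K)^-1 * M = M / K / 4 by field; rewrite gt_eqF.
    by small_lra.
  have f4s : M ^+ 2 / (16 * K ^+ 2) <= cabs (f4 t) ^+ 2.
    have -> : M ^+ 2 / (16 * K ^+ 2) = (M / (4 * K)) ^+ 2 by field; rewrite gt_eqF.
    by rewrite ler_pXn2r ?nnegrE ?cabs_ge0 // divr_ge0 // mulr_ge0 // ltW.
  have w1t : Q * expR (- b * `|t|) <= Q by rewrite -[leRHS]mulr1 ler_wpM2l ?w1.
  by move: (fQ t) w1t f4s (sqr_ge0 (cabs (f2 t))); small_lra.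
have yle : y * (M ^+ 2 / (16 * K ^+ 2)) <= y * (Q * (1 + 3 / b)).
  have -> : y * (Q * (1 + 3 / b)) = y * Q + 3 * q by rewrite /q; field; rewrite gt_eqF.
  by move: main up lo Phi0; small_lra.
(* The factor [Im z] cancels, so the estimate is uniform down to [Im z = 0]. *)
have {}yle : M ^+ 2 / (16 * K ^+ 2) <= Q * (1 + 3 / b) by rewrite -(ler_pM2l y0).
have Qle : Q * (1 + 3 / b) = M ^+ 2 / (16 * K ^+ 2) * (T * eps ^+ 2).
  by rewrite /Q SE /T; field; rewrite !gt_eqF.
have MK : 0 < M ^+ 2 / (16 * K ^+ 2) by rewrite divr_gt0 ?exprn_gt0 // mulr_gt0 ?exprn_gt0.
have {}yle : 1 <= T * eps ^+ 2.
  by rewrite -(ler_pM2l MK) mulr1 -Qle.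
have epT : T * eps < 1.
  apply: le_lt_trans (ler_wpM2l T0 (ltW ep3)) _.
  by rewrite ltr_pdivrMr ?ltr_wpDl // mul1r ltrDl.
have ep1' : eps < 1 by rewrite (lt_le_trans ep2) // (le_trans ep01) ?e11.
suff : T * eps ^+ 2 < 1 by rewrite ltNge yle.
rewrite expr2 mulrA; apply: le_lt_trans epT.
rewrite -[leRHS]mulr1; apply: ler_wpM2l (ltW ep1'); apply: mulr_ge0 => //; exact: ltW.
Qed.

(* The wave is paired with the bounded solution [P2] of the unperturbed system:
   in [T] the Wronskian compensates the leading part of the coupling integral. *)
Lemma embedded_trivial (P2 P2' : 'I_2 -> R -> C) (G : R -> C) (Bp : R) (I0 : C) :
  (forall j x, isd (P2 j) x (P2' j x)) ->
  (forall j x, isd (P2' j) x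
     (nnA j ^+ 2 * P2 j x - (\sum_k (BA al0 be0 j k x)%:C * P2 k x))) ->
  (forall j x, cabs (P2 j x) <= Bp /\ cabs (P2' j x) <= Bp) ->
  (forall x, isd G x ((c0 x)%:C * (P2 ord0 x + P2 ord_max x) * p4 x)) ->
  tends0 (fun x => G x - G (- x) - I0) -> I0 <> 0 ->
  exists2 del : R, 0 < del & exists2 eps0 : R, 0 < eps0 &
  forall eps z ka1 ka2 ka3 ka4 f1 f2 f3 f4 f1' f2' f3' f4',
  0 < eps < eps0 -> cabs z <= del -> complex.Im z = 0 ->
  wave eps z ka1 ka2 ka3 ka4 f1 f2 f3 f4 f1' f2' f3' f4' ->
  tends0 f2 -> tends0 f2' ->
  tends0 (fun x => f2 (- x)) -> tends0 (fun x => f2' (- x)) ->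
  forall x, [/\ f1 x = 0, f2 x = 0, f3 x = 0 & f4 x = 0].
Proof.
move=> dP2 dP2' P2B dG GI I00.
have [K K1 HK] := near_threshold.
have K0 : 0 < K by apply: lt_le_trans K1.
have Bp0 : 0 <= Bp by have [h _] := P2B ord0 0; exact: le_trans (cabs_ge0 _) h.
have b1 : 0 <= b^-1 by rewrite invr_ge0 ltW.
(* In units of [eps M] and with the weight [v], the three lower bounds on [A] serve [f1] and [f3],
   then [f1'], then [f2] and [f2']. *)
have [A [A1 A2 A3 A0]] : exists A : R, [/\ (1 + 2 / b) * K <= A,
    (1 + 1 + n1^-1 + n1) * (1 + 2 / b) * K + K <= A,
    12 * C0 * K / b * (1 + 2 / n2) <= A & 0 <= A].
  have t1 : 0 <= (1 + 2 / b) * K by rewrite mulr_ge0 ?(ltW K0) // addr_ge0 // mulr_ge0.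
  have t2 : 0 <= (1 + 1 + n1^-1 + n1) * (1 + 2 / b) * K + K.
    rewrite -mulrA addr_ge0 ?(ltW K0) // mulr_ge0 //.
    by rewrite !addr_ge0 ?invr_ge0 ?(ltW n10).
  have t3 : 0 <= 12 * C0 * K / b * (1 + 2 / n2).
    rewrite mulr_ge0 //; last by rewrite addr_ge0 // divr_ge0 // ltW.
    by rewrite mulr_ge0 // mulr_ge0 ?(ltW K0) // mulr_ge0.
  exists ((1 + 2 / b) * K + ((1 + 1 + n1^-1 + n1) * (1 + 2 / b) * K + K)
    + 12 * C0 * K / b * (1 + 2 / n2)).
  by split; move: t1 t2 t3; small_lra.
have i0 : 0 < cabs I0 / 2 by rewrite divr_gt0 // cabs_gt0.
(* Four error terms of this size stand against a main term of at least [|I0| / 2]: the boundary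
   terms, the accuracy of [f4] on [[- X, X]], [z] and [eps]. *)
pose i8 := cabs I0 / 16.
have i80 : 0 < i8 by rewrite divr_gt0 // cabs_gt0.
have [E1 E10] : exists2 E1 : R, 0 <= E1 & E1 = K * Bp * (8 * A).
  by eexists; last reflexivity; rewrite !mulr_ge0 // ltW.
move=> E1E.
have [E2 E20 E2E] : exists2 E2 : R, 0 <= E2 & E2 = K * Bp * (4 / b) * (2 * C0).
  by eexists; last reflexivity; rewrite !mulr_ge0 // ltW.
have [E3 E30 E3E] : exists2 E3 : R, 0 <= E3 & E3 = K * Bp * (4 / b) * (2 * A).
  by eexists; last reflexivity; rewrite !mulr_ge0 // ltW.
have [E4 E40 E4E] : exists2 E4 : R, 0 <= E4 &
    E4 = K * Bp * (4 / b) * (10 * C0 * A + 2 * C0).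
  by eexists; last reflexivity; rewrite !mulr_ge0 ?addr_ge0 ?mulr_ge0 // ltW.
have b2 : 0 < b / 2 by rewrite divr_gt0.
have [X1 [X10 X1P]] := @expR_small R (b / 2) (i8 / (E1 + 1)) b2
  (divr_gt0 i80 (ltr_wpDl E10 ltr01)).
have [X2 X2P] := GI _ i0.
pose X := Num.max X1 X2.
have X0 : 0 <= X by rewrite le_max X10.
have [d0 /andP[d00 _] [ep0 /andP[ep00 ep01] H]] :=
  HK (i8 / (E2 + 1)) X (divr_gt0 i80 (ltr_wpDl E20 ltr01)) X0.
exists (Num.min d0 (Num.min (Num.min (n1 ^+ 2 / 2) (n3 ^+ 2 / 2))
    (Num.min (Num.min 1 (n2 ^+ 2 / 2)) (i8 / (E3 + 1))))).
  have E3p : 0 < E3 + 1 by rewrite ltr_wpDl.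
  have g3 := divr_gt0 i80 E3p.
  by rewrite !lt_min d00 g3 !divr_gt0 ?exprn_gt0 ?ltr01.
exists (Num.min ep0 (i8 / (E4 + 1))).
  by have g4 := divr_gt0 i80 (ltr_wpDl E40 ltr01); rewrite lt_min ep00 g4.
move=> eps z ka1 ka2 ka3 ka4 f1 f2 f3 f4 f1' f2' f3' f4'.
rewrite !lt_min !le_min => /andP[ep1 /andP[ep2 ep3]].
move=> /andP[z0 /andP[/andP[z1 z3] /andP[/andP[z11 z2] zE]]] zi wv y2 y2' ny2 ny2'.
have He : 0 < eps < e1 by rewrite ep1 (lt_le_trans ep2).
have [M [cc [M0 sp ccK Mcc f4p4]]] := H _ _ _ _ _ _ _ _ _ _ _ _ _ _
  (introT andP (conj ep1 ep2)) z0 wv.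
have [hM hA hC hB hJ] := sp.
have [r1 r3] := re_exponents wv z1 z3.
suff M00 : M = 0.
  move=> x; have [] := hM x; rewrite M00 => h1 h2 h3 h4.
  by split; apply: cabs_eq0; apply/eqP; rewrite eq_le cabs_ge0 andbT.
apply/eqP; rewrite eq_le M0 andbT leNgt; apply/negP => Mpos.
have [S S0 SE] : exists2 S, 0 <= S & S = eps * M.
  by exists (eps * M) => //; rewrite mulr_ge0 // ltW.
have KS : K * eps * M = K * S by rewrite SE mulrA.
rewrite KS in hA hC.
have KS0 : 0 <= K * S by rewrite mulr_ge0 // ltW.
have AS0 : 0 <= A * S by rewrite mulr_ge0.
pose v (x : R) := expR (- (b / 2) * `|x|).
have v0 x : 0 <= v x by exact: expR_ge0.
have wv1 x : w x <= v x.
  rewrite /w /v ler_expR ler_wpM2r // lerN2; have := b0; small_lra.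
have v1 x : v x <= 1.
  by rewrite /v -[leRHS]expR0 ler_expR mulNr oppr_le0 mulr_ge0 ?(ltW b2).
have [x1 x2 x3 x4] := exponents_near wv.
have [k1 k2 k3 k4] := wave_k wv.
have f1A x : cabs (f1 x) <= (1 + 2 / b) * K * S * v x.
  have := @asymp_decay R 2 b _ _ _ _ b0 KS0 (forced_d (forcedA wv)) hA ord0 r1 x.
  by rewrite !mulrA.
have f3A x : cabs (f3 x) <= A * S * v x.
  have h := @asymp_decay R 1 b _ _ _ _ b0 KS0 (forced_d (forcedC wv)) hC ord0 r3 x.
  apply: le_trans h _; rewrite ler_wpM2r // mulrA ler_wpM2r //.
have ka1b : cabs ka1 <= 1 + n1^-1 + n1.
  have := cabsD (ka1 - n1%:C) n1%:C; rewrite subrK cabs_real (gtr0_norm n10).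
  have : cabs z / n1 <= n1^-1.
    by rewrite -[leRHS]mul1r ler_wpM2r // invr_ge0 ltW.
  by move: x1; small_lra.
have f1'A x : cabs (f1' x) <= A * S * v x.
  have h0 : cabs (ka1 * f1 x) <= (1 + n1^-1 + n1) * ((1 + 2 / b) * K * S * v x).
    by rewrite cabsM; apply: ler_pM => //; rewrite cabs_ge0.
  have hv : K * S * w x <= K * S * v x by rewrite ler_wpM2l.
  have Av : ((1 + 1 + n1^-1 + n1) * (1 + 2 / b) * K + K) * (S * v x) <= A * (S * v x).
    by rewrite ler_wpM2r // mulr_ge0.
  have t0 : 0 <= (1 + 2 / b) * K * (S * v x).
    by rewrite mulr_ge0 ?mulr_ge0 ?(ltW K0) // addr_ge0 // mulr_ge0.
  have [_ hy hNy] := hA.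
  have hs : cabs (f1' x) <= K * S * w x + cabs (ka1 * f1 x).
    have [xge|xlt] := leP 0 x.
      have wx : w x = expR (- b * x) by rewrite /w (ger0_norm xge).
      have := hy ord0 x xge; rewrite /cpair /= -wx.
      by have := cabs_sub (f1' x) (- (ka1 * f1 x)); rewrite opprK cabsN; small_lra.
    have := hNy ord0 (- x); rewrite oppr_ge0 opprK => /(_ (ltW xlt)).
    have wx : w x = expR (- b * - x) by rewrite /w (ltr0_norm xlt).
    rewrite /cpair /= -wx.
    by have := cabs_sub (f1' x) (ka1 * f1 x); small_lra.
  by move: hs hv h0 Av t0; small_lra.
(* For real [z] the exponent [ka2] is purely imaginary, the case covered by [standing_decay]. *)
have [re2 ka2m] : complex.Re ka2 = 0 /\ n2 / 2 <= cabs ka2.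
  apply: (root_neg n20 _ zi z2); rewrite k2 n2E; congr (_%:C + _); ring.
have f2A x : cabs (f2 x) <= A * S * v x /\ cabs (f2' x) <= A * S * v x.
  have g2b y : cabs (\sum_k (BA al0 be0 ord_max k y)%:C * cpair f1 f2 k y
      + cpair (remA eps f1 f2 f3 f4 f1) (remA eps f1 f2 f3 f4 f2) ord_max y)
      <= 12 * C0 * (K * S) * w y.
    have [m1 m2 m3 m4] := hM y; have [a1 a2 _ _] := unperturbed y.
    have [hfA _ _] := hA; have c1 := hfA ord0 y; have c2 := hfA ord_max y.
    have hr := @remA_bound eps f1 f2 f3 f4 f2 M y He m1 m2 m3 m4 m2.
    rewrite sum_ord2 /BA /cpair /= in c1 c2 *.
    have t1 : cabs ((al0 y)%:C * f1 y) <= C0 * w y * (K * S).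
      by rewrite cabsZ; apply: ler_pM; rewrite ?cabs_ge0.
    have t2 : cabs ((al0 y + be0 y)%:C * f2 y) <= 2 * (C0 * w y) * (K * S).
      rewrite cabsZ; apply: ler_pM; rewrite ?cabs_ge0 //.
      by rewrite (le_trans (ler_normD _ _)) //; move: a1 a2; small_lra.
    have t3 : C0 * w y * S <= C0 * w y * (K * S).
      by rewrite ler_wpM2l ?mulr_ge0 // ler_peMl.
    have t4 : 8 * C0 * eps * M * w y = 8 * (C0 * w y * S) by rewrite SE; ring.
    have t5 : 0 <= C0 * w y * (K * S) by rewrite !mulr_ge0 ?(ltW K0).
    rewrite t4 in hr.
    have := cabsD ((al0 y)%:C * f1 y + (al0 y + be0 y)%:C * f2 y)
      (remA eps f1 f2 f3 f4 f2 y).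
    have := cabsD ((al0 y)%:C * f1 y) ((al0 y + be0 y)%:C * f2 y).
    by move: t1 t2 t3 hr t5; small_lra.
  have fin (u u' : C) (t : R) :
      cabs u <= 12 * C0 * (K * S) / b / (n2 / 2) * expR (- b * `|t|) /\
      cabs u' <= 12 * C0 * (K * S) / b * expR (- b * `|t|) ->
      cabs u <= A * S * v t /\ cabs u' <= A * S * v t.
    have tA : 12 * C0 * K / b * (1 + 2 / n2) * (S * v t) <= A * (S * v t).
      by rewrite ler_wpM2r // mulr_ge0.
    have CK : 0 <= 12 * C0 * K by rewrite mulr_ge0 ?(ltW K0) // mulr_ge0.
    have CKb : 0 <= 12 * C0 * K / b by rewrite divr_ge0 ?(ltW b0).
    have nn2 : 0 <= 2 / n2 by rewrite divr_ge0 ?(ltW n20).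
    have Sv : 0 <= S * v t by rewrite mulr_ge0.
    have t0 : 0 <= 12 * C0 * K / b * (S * v t) by apply: mulr_ge0.
    have t1 : 0 <= 12 * C0 * K / b * (2 / n2) * (S * v t).
      by apply: mulr_ge0 => //; apply: mulr_ge0.
    have wvt := wv1 t; rewrite /w in wvt.
    have CKS : 0 <= 12 * C0 * (K * S) / b.
      by rewrite divr_ge0 ?(ltW b0) // mulr_ge0 // mulr_ge0.
    have q1 : 12 * C0 * (K * S) / b / (n2 / 2) * expR (- b * `|t|)
        <= 12 * C0 * (K * S) / b / (n2 / 2) * v t.
      by apply: ler_wpM2l => //; rewrite divr_ge0 // divr_ge0 // ltW.
    have q2 : 12 * C0 * (K * S) / b * expR (- b * `|t|) <= 12 * C0 * (K * S) / b * v t.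
      exact: ler_wpM2l.
    have e3 : 12 * C0 * (K * S) / b / (n2 / 2) * v t
        = 12 * C0 * K / b * (2 / n2) * (S * v t).
      by field; rewrite !gt_eqF.
    have e4 : 12 * C0 * (K * S) / b * v t = 12 * C0 * K / b * (S * v t) by field; rewrite gt_eqF.
    rewrite e3 in q1; rewrite e4 in q2.
    by case=> ha hb; split; move: tA t0 t1 q1 q2 ha hb; small_lra.
  have n22 : 0 < n2 / 2 by rewrite divr_gt0.
  have dA := forcedA wv.
  have [t1 _ _ _] := wave_y wv; have [_ q2 _ _] := wave_y wv.
  have [_ nq2 _ _] := wave_Ny wv.
  apply: fin; have [xge|xlt] := leP 0 x.
    rewrite (ger0_norm xge).
    apply: (standing_decay b0 n22 re2 ka2m (fun y _ => forced_d dA ord_max y)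
      (fun y _ => forced_d2 dA ord_max y) _ q2 _ xge).
    - by move=> y yge; have h := g2b y; rewrite /w (ger0_norm yge) in h.
    - by apply: tends0_eq (tends0D y2' (tends0Z (- ka2) y2)) => y; rewrite mulNr.
  rewrite (ltr0_norm xlt).
  have dR := forced_refl dA.
  have nx0 : 0 <= - x by rewrite oppr_ge0 ltW.
  have := standing_decay b0 n22 re2 ka2m (fun y _ => forced_d dR ord_max y)
      (fun y _ => forced_d2 dR ord_max y) _ (forced_y dR ord_max) _ nx0.
  rewrite /refl /reflN opprK cabsN; apply.
  - by move=> y yge; have h := g2b (- y); rewrite /w normrN (ger0_norm yge) in h.
  - apply: tends0_eq (tends0D (tends0Z (-1) ny2') (tends0Z (- ka2) ny2)) => y.
    by rewrite /cpair /=; ring.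
have f1A' x : cabs (f1 x) <= A * S * v x.
  by apply: le_trans (f1A x) _; rewrite ler_wpM2r // ler_wpM2r.
pose h2 := i8 / (E2 + 1).
pose sge : C := (sg * eps)%:C.
(* What is left of the coupling once its leading part [sg eps cc c0 p4] is removed: the error of the
   coefficient and the error of [f4]. *)
pose q (x : R) := (c eps x - sg * eps * c0 x)%:C * f4 x
  + (sg * eps * c0 x)%:C * (f4 x - cc * p4 x).
pose rr (f : R -> C) (x : R) := (al eps x - al0 x)%:C * (f1 x + f2 x)
  + (be eps x - be0 x)%:C * f x + (c eps x)%:C * f3 x.
pose T (x : R) := wronsk (cpair f1 f2) (cpair f1' f2') P2 P2' x + sge * cc * G x.
pose T' (x : R) := P2 ord0 x * (- z * f1 x - rr f1 x - q x)
  + P2 ord_max x * (z * f2 x - rr f2 x - q x).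
have dT x : isd T x (T' x).
  have dA := forcedA wv.
  have dP2z j : isd (P2' j) x (nnA j ^+ 2 * P2 j x
      - (\sum_k (BA al0 be0 j k x)%:C * P2 k x + (fun _ _ => 0 : C) j x)).
    by rewrite addr0.
  have dW := isd_wronsk (symBA al0 be0) (fun j => forced_d dA j x) (fun j => forced_d2 dA j x)
    (fun j => dP2 j x) dP2z.
  apply: (isd_eq (isdD dW (isdZ (sge * cc) (dG x)))).
  rewrite sum_ord2 /nnA /cpair /= k1 k2 in2E -rmorphXn /= n1E /T' /rr /q /remA /sge.
  rewrite !(rmorphD, rmorphN, rmorphM) /=; ring.
have eS : eps * M = S by [].
have qb x : `|x| <= X -> cabs (q x) <= C0 * (eps + h2) * S * v x.
  move=> xX; have [_ _ hc _ _] := perturbed He x; have [_ _ hc0 _] := unperturbed x.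
  have [_ _ _ m4] := hM x; have hp := f4p4 x xX.
  have t1 : cabs ((c eps x - sg * eps * c0 x)%:C * f4 x) <= C0 * eps ^+ 2 * w x * M.
    by rewrite cabsZ; apply: ler_pM; rewrite ?cabs_ge0.
  have t2 : cabs ((sg * eps * c0 x)%:C * (f4 x - cc * p4 x)) <= (eps * (C0 * w x)) * (h2 * M).
    rewrite cabsZ; apply: ler_pM; rewrite ?cabs_ge0 //.
    by rewrite !normrM sg1 mul1r (gtr0_norm ep1) ler_wpM2l // ltW.
  have t3 : C0 * (eps + h2) * S * w x <= C0 * (eps + h2) * S * v x.
    apply: ler_wpM2l => //; rewrite !mulr_ge0 // addr_ge0 ?(ltW ep1) //.
    by apply: ltW; exact: divr_gt0 i80 (ltr_wpDl E20 ltr01).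
  have e3 : C0 * eps ^+ 2 * w x * M + (eps * (C0 * w x)) * (h2 * M)
      = C0 * (eps + h2) * S * w x by rewrite SE; ring.
  by rewrite (le_trans (cabsD _ _)) //; move: t1 t2 t3 e3; small_lra.
have rb f x : cabs (f x) <= A * S * v x -> cabs (rr f x) <= 5 * C0 * A * eps * S * v x.
  move=> fb; have [ha hb _ _ _] := perturbed He x; have hc := c_bound x He.
  have [f2b _] := f2A x.
  have ASv : 0 <= A * S * v x by rewrite mulr_ge0.
  have Ce : 0 <= C0 * eps by rewrite mulr_ge0 // ltW.
  have u1 (t u : R) : 0 <= t -> u <= t * w x -> u <= t.
    by move=> t0 ut; rewrite (le_trans ut) // -[leRHS]mulr1 ler_wpM2l ?w1.
  have t1 : cabs ((al eps x - al0 x)%:C * (f1 x + f2 x)) <= C0 * eps * (2 * (A * S * v x)).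
    rewrite cabsZ; apply: ler_pM; rewrite ?cabs_ge0 //; first exact: u1.
    by rewrite (le_trans (cabsD _ _)) //; move: (f1A' x) f2b; small_lra.
  have t2 : cabs ((be eps x - be0 x)%:C * f x) <= C0 * eps * (A * S * v x).
    by rewrite cabsZ; apply: ler_pM; rewrite ?cabs_ge0 //; exact: u1.
  have t3 : cabs ((c eps x)%:C * f3 x) <= 2 * C0 * eps * (A * S * v x).
    rewrite cabsZ; apply: ler_pM; rewrite ?cabs_ge0 //; apply: u1 => //.
    by rewrite -mulrA mulr_ge0.
  have := cabsD ((al eps x - al0 x)%:C * (f1 x + f2 x) + (be eps x - be0 x)%:C * f x)
    ((c eps x)%:C * f3 x).
  have := cabsD ((al eps x - al0 x)%:C * (f1 x + f2 x)) ((be eps x - be0 x)%:C * f x).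
  by rewrite /rr; move: t1 t2 t3; small_lra.
pose g3 := cabs z * A + 5 * C0 * A * eps + C0 * (eps + h2).
have T'b x : `|x| <= X -> cabs (T' x) <= 2 * Bp * g3 * S * v x.
  move=> xX; have [f2b _] := f2A x.
  have key2 (P u r : C) : cabs P <= Bp -> cabs u <= cabs z * (A * S * v x) ->
      cabs r <= 5 * C0 * A * eps * S * v x ->
      cabs (P * (u - r - q x)) <= Bp * (g3 * S * v x).
    move=> hP hu hr; rewrite cabsM; apply: ler_pM; rewrite ?cabs_ge0 //.
    have := cabsB (u - r) (q x); have := cabsB u r; have := qb x xX.
    by rewrite /g3; move: hu hr; small_lra.
  have k_1 := key2 (P2 ord0 x) (- z * f1 x) (rr f1 x) (P2B ord0 x).1
    ltac:(rewrite cabsM cabsN ler_wpM2l ?cabs_ge0 //) (rb f1 x (f1A' x)).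
  have k_2 := key2 (P2 ord_max x) (z * f2 x) (rr f2 x) (P2B ord_max x).1
    ltac:(rewrite cabsM ler_wpM2l ?cabs_ge0 //) (rb f2 x f2b).
  rewrite /T' (le_trans (cabsD _ _)) //; move: k_1 k_2; small_lra.
have Wb x : cabs (wronsk (cpair f1 f2) (cpair f1' f2') P2 P2' x) <= 4 * Bp * A * S * v x.
  have [f2b f2'b] := f2A x.
  have key (f P : C) : cabs f <= A * S * v x -> cabs P <= Bp ->
      cabs (f * P) <= A * S * v x * Bp.
    by move=> *; rewrite cabsM; apply: ler_pM; rewrite ?cabs_ge0.
  have [a1 a2] := P2B ord0 x; have [a3 a4] := P2B ord_max x.
  rewrite /wronsk sum_ord2 /cpair /=.
  have := cabsD (f1' x * P2 ord0 x - f1 x * P2' ord0 x)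
    (f2' x * P2 ord_max x - f2 x * P2' ord_max x).
  have := cabsB (f1' x * P2 ord0 x) (f1 x * P2' ord0 x).
  have := cabsB (f2' x * P2 ord_max x) (f2 x * P2' ord_max x).
  move: (key _ _ (f1'A x) a1) (key _ _ (f1A' x) a2) (key _ _ f2'b a3) (key _ _ f2b a4).
  by small_lra.
have g30 : 0 <= g3.
  rewrite /g3 !addr_ge0 ?mulr_ge0 ?cabs_ge0 ?(ltW ep1) // addr_ge0 ?(ltW ep1) //.
  by apply: ltW; exact: divr_gt0 i80 (ltr_wpDl E20 ltr01).
have [H3 H30 H3E] : exists2 H3 : R, 0 <= H3 & H3 = 2 * Bp * g3 * S * (2 / b).
  eexists; last reflexivity.
  by rewrite mulr_ge0 ?divr_ge0 ?(ltW b0) // mulr_ge0 // mulr_ge0 // mulr_ge0.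
have TX : cabs (T X - T 0) <= H3.
  have du t : 0 <= t <= X -> derR (fun t => - H3 * expR (- (b / 2) * t)) t
      (2 * Bp * g3 * S * expR (- (b / 2) * t)).
    move=> _; apply: (derR_eq (derRM (derR_cst _ t) (derR_exp _ t))).
    by rewrite H3E; field; rewrite gt_eqF.
  apply: le_trans (isd_le X0 (fun t _ => dT t) du _) _.
    move=> t /andP[tge tX]; have := T'b t; rewrite /v (ger0_norm tge); exact.
  rewrite mulr0 expR0 mulr1 opprK.
  have : 0 <= H3 * expR (- (b / 2) * X) by rewrite mulr_ge0 // expR_ge0.
  by small_lra.
have TNX : cabs (T 0 - T (- X)) <= H3.
  have nX0 : - X <= 0 by rewrite oppr_le0.
  have du t : - X <= t <= 0 -> derR (fun t => H3 * expR (b / 2 * t)) t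
      (2 * Bp * g3 * S * expR (b / 2 * t)).
    move=> _; apply: (derR_eq (derRM (derR_cst _ t) (derR_exp _ t))).
    by rewrite H3E; field; rewrite gt_eqF.
  apply: le_trans (isd_le nX0 (fun t _ => dT t) du _) _.
    move=> t /andP[tge tX]; have := T'b t; rewrite /v (ler0_norm tX) mulrNN.
    by apply; rewrite lerNl.
  rewrite mulr0 expR0 mulr1.
  have : 0 <= H3 * expR (b / 2 * - X) by rewrite mulr_ge0 // expR_ge0.
  by small_lra.
have vX : v X = expR (- (b / 2) * X) by rewrite /v (ger0_norm X0).
have vNX : v (- X) = v X by rewrite /v normrN.
have GX : cabs I0 / 2 <= cabs (G X - G (- X)).
  have := X2P X ltac:(by rewrite le_max lexx orbT).
  by have := cabs_sub I0 (G X - G (- X)); rewrite (cabs_subC I0); small_lra.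
have sc : cabs (sge * cc * (G X - G (- X))) = eps * cabs cc * cabs (G X - G (- X)).
  by rewrite !cabsM cabs_real normrM sg1 mul1r (gtr0_norm ep1).
(* The coupling integral over [[- X, X]] is the variation of [T], which is small, minus that of the
   Wronskian, which is small at both ends. *)
have main : eps * cabs cc * cabs (G X - G (- X)) <= 2 * H3 + 8 * Bp * A * S * v X.
  rewrite -sc.
  have -> : sge * cc * (G X - G (- X)) = (T X - T 0) + (T 0 - T (- X))
    - (wronsk (cpair f1 f2) (cpair f1' f2') P2 P2' X)
    + (wronsk (cpair f1 f2) (cpair f1' f2') P2 P2' (- X)).
    by rewrite /T; ring.
  set Wp := wronsk _ _ _ _ X; set Wm := wronsk _ _ _ _ (- X).
  have := cabsD ((T X - T 0) + (T 0 - T (- X)) - Wp) Wm.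
  have := cabsB ((T X - T 0) + (T 0 - T (- X))) Wp.
  have := cabsD (T X - T 0) (T 0 - T (- X)).
  move: TX TNX (Wb X) (Wb (- X)); rewrite vNX -/Wp -/Wm; small_lra.
have ccS : S <= eps * cabs cc * K by rewrite SE -mulrA ler_wpM2l ?(ltW ep1) // mulrC.
have Spos : 0 < S by rewrite SE mulr_gt0.
have low : S * (cabs I0 / 2) <= K * (2 * H3 + 8 * Bp * A * S * v X).
  apply: le_trans (_ : eps * cabs cc * K * cabs (G X - G (- X)) <= _).
    by apply: ler_pM => //; exact: ltW.
  by rewrite mulrAC mulrC ler_wpM2l ?(ltW K0).
have {}low : cabs I0 / 2 <= E1 * v X + E2 * h2 + E3 * cabs z + E4 * eps.
  rewrite -(ler_pM2l Spos) (le_trans low) //.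
  rewrite H3E E1E E2E E3E E4E /g3 le_eqVlt; apply/orP; left; apply/eqP.
  by field; rewrite gt_eqF.
have s1 : E1 * v X <= i8.
  rewrite vX; apply: le_trans (ler_wpM2l E10 (X1P X _)) _; first by rewrite le_max lexx.
  exact: small_times.
have s2 : E2 * h2 <= i8 by exact: small_times.
have s3 : E3 * cabs z <= i8.
  by apply: le_trans (ler_wpM2l E30 zE) _; exact: small_times.
have s4 : E4 * eps <= i8.
  by apply: le_trans (ler_wpM2l E40 (ltW ep3)) _; exact: small_times.
have : 0 < cabs I0 by rewrite cabs_gt0.
by move: low s1 s2 s3 s4; rewrite /i8; small_lra.
Qed.

End Core.

(** * Weak derivatives on the line *)

Section Bump.
Variable R : realType.

(** The functions [x^(-k) e^(-1/x)], extended by 0, are such that their derivatives are again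
    combinations of members of the family ([derR_flat]). Smoothness of the bump then requires only
    one first-order study at 0. *)
Definition flat (k : nat) (x : R) : R :=
  if 0 < x then x^-1 ^+ k * expR (- x^-1) else 0.

(** From [t^(k+2) / (k+2)! <= e^t] at [t = 1 / x]. A quadratic bound suffices for the derivative at
    0. *)
Lemma flat_le k x : `|flat k x| <= (k.+2)`!%:R * x ^+ 2.
Proof.
rewrite /flat; case: ifPn => x0; last by rewrite normr0 mulr_ge0 ?sqr_ge0 ?ler0n.
have t0 : 0 < x^-1 by rewrite invr_gt0.
rewrite ger0_norm ?mulr_ge0 ?expR_ge0 ?exprn_ge0 ?(ltW t0) //.
have := expR_ge1Dxn k.+1 (ltW t0).
have f0 : 0 < (k.+2)`!%:R :> R by rewrite ltr0n fact_gt0.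
move=> H; have {}H : x^-1 ^+ k.+2 / (k.+2)`!%:R <= expR x^-1 by lra.
rewrite expRN ler_pdivrMr ?expR_gt0 //.
have Kx : 0 <= (k.+2)`!%:R * x ^+ 2 by rewrite mulr_ge0 ?sqr_ge0 // ltW.
apply: le_trans (ler_wpM2l Kx H).
have -> : x^-1 ^+ k.+2 = x^-1 ^+ k * x^-1 ^+ 2 by rewrite -exprD addn2.
rewrite le_eqVlt; apply/orP; left; apply/eqP; move: (x^-1 ^+ k) => u.
by field; rewrite !gt_eqF.
Qed.

Lemma derR_quadratic (f : R -> R) (K : R) : (forall x, `|f x| <= K * x ^+ 2) ->
  derR f (0 : R) 0.
Proof.
move=> fK; have f0 : f 0 = 0.
  by apply/eqP; rewrite -normr_le0; have := fK 0; rewrite expr0n mulr0.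
apply/is_derive1_caratheodory; exists (fun z => f z / z); split.
- move=> z; rewrite f0 !subr0; have [->|z0] := eqVneq z 0; first by rewrite f0 mulr0.
  by rewrite divfK.
- apply/cvgrPdist_le => e e0 /=; rewrite invr0 mulr0.
  have K0 : 0 <= K by have := le_trans (normr_ge0 _) (fK 1); rewrite expr1n mulr1.
  near=> z; rewrite sub0r normrN normrM normfV.
  have [->|z0] := eqVneq z 0; first by rewrite f0 normr0 mul0r ltW.
  rewrite ler_pdivrMr ?normr_gt0 // (le_trans (fK z)) // -real_normK ?num_real //.
  rewrite expr2 mulrA ler_wpM2r //.
  have : `|z| <= e / (K + 1).
    near: z; apply: (@nbhs0_le R R^o); rewrite divr_gt0 //; lra.
  move=> zK; apply: le_trans (ler_wpM2l K0 zK) _.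
  by rewrite mulrCA -[leRHS]mulr1 ler_wpM2l ?(ltW e0) // ler_pdivrMr; lra.
- by rewrite invr0 mulr0.
Unshelve. all: by end_near. Qed.

Lemma derR_flat k (x : R) : derR (flat k) x (flat k.+2 x - k%:R * flat k.+1 x).
Proof.
have [x0|x0|->] := ltgtP x 0.
- rewrite /flat (lt_gtF x0) mulr0 subr0.
  apply: near_eq_is_derive (derR_cst 0 x).
  by near=> y; rewrite ifF //; apply/negbTE; rewrite -leNgt ltW //;
    near: y; exact: lt_nbhsl.
- rewrite /flat x0.
  have xn0 : x != 0 by rewrite gt_eqF.
  have dinv : derR (fun y : R => y^-1) x (- x^-1 ^+ 2).
    apply: (derR_eq (is_deriveV xn0 (derR_id x))).
    by rewrite /GRing.scale /= mulr1 exprVn.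
  have dpow n : derR (fun y : R => y^-1 ^+ n) x (- n%:R * x^-1 ^+ n.+1).
    elim: n => [|n IHn].
      rewrite oppr0 mul0r (_ : (fun _ => _) = fun=> 1); first exact: derR_cst.
      by apply/funext => y; rewrite expr0.
    rewrite (_ : (fun _ => _) = fun y => y^-1 * y^-1 ^+ n); last first.
      by apply/funext => y; rewrite exprS.
    apply: (derR_eq (derRM dinv IHn)); rewrite -natr1 !exprS; ring.
  have dexp := @derR_comp R expR (fun y => - y^-1) x _ _ (is_derive_expR _) (derRN dinv).
  apply: near_eq_is_derive (derR_eq (derRM (dpow k) dexp) _); last by rewrite !exprS; ring.
  by near=> y; rewrite ifT //; near: y; exact: lt_nbhsr.
- rewrite /flat ltxx mulr0 subr0.
  exact: derR_quadratic (flat_le k).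
Unshelve. all: by end_near. Qed.

(** Closed under differentiation ([bumpy_der]), so its members have derivatives of all orders. *)
Inductive bumpy : (R -> R) -> Prop :=
| bumpy_base n a k l : bumpy (fun x => flat k (n * (x - a)) * flat l (1 - n * (x - a)))
| bumpy_lin c f g : bumpy f -> bumpy g -> bumpy (fun x => c * f x + g x).

Lemma bumpy_der f : bumpy f -> exists2 g, bumpy g & forall x : R, derR f x (g x).
Proof.
elim=> [n a k l|c {}f g _ [f' bf' df] _ [g' bg' dg]]; last first.
  exists (fun x => c * f' x + g' x); first exact: bumpy_lin.
  move=> x; apply: (derR_eq (derRD (derRM (derR_cst c x) (df x)) (dg x))).
  by rewrite mul0r add0r.
pose B i j (x : R) := flat i (n * (x - a)) * flat j (1 - n * (x - a)).
have bB i j : bumpy (B i j) by exact: bumpy_base.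
(* [bumpy_lin] ends with a summand of coefficient one, hence the splitting of the coefficient [n l]
   of the last term. *)
exists (fun x => n * B k.+2 l x + ((- n * k%:R) * B k.+1 l x
  + (- n * B k l.+2 x + ((n * l%:R - 1) * B k l.+1 x + B k l.+1 x)))).
  by do !apply: bumpy_lin => //.
move=> x; have d1 : derR (fun y => n * (y - a)) x n.
  apply: (derR_eq (derRM (derR_cst n x) (derRB (derR_id x) (derR_cst a x)))); ring.
have d2 : derR (fun y => 1 - n * (y - a)) x (- n).
  by apply: (derR_eq (derRB (derR_cst 1 x) d1)); rewrite sub0r.
apply: (derR_eq (derRM (derR_comp (derR_flat k _) d1) (derR_comp (derR_flat l _) d2))).
by rewrite /B; ring.
Qed.

Lemma bumpy_derivable f n x : bumpy f -> derivable (derive1n n f) x 1.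
Proof.
elim: n f => [|n IHn] f bf; have [g bg dg] := bumpy_der bf.
  exact: derR_derivable (dg x).
rewrite derive1Sn (_ : derive1 f = g); first exact: IHn.
by apply/funext => y; exact: derR_derive1.
Qed.

Lemma primitive_derivable (f g : R -> R) n x : (forall x : R, derR f x (g x)) -> bumpy g ->
  derivable (derive1n n f) x 1.
Proof.
case: n => [|n] df bg; first exact: derR_derivable (df x).
rewrite derive1Sn (_ : derive1 f = g); first exact: bumpy_derivable.
by apply/funext => y; exact: derR_derive1.
Qed.

Definition sbump (x : R) : R := flat 0 x * flat 0 (1 - x).

Lemma flat0_le1 x : 0 <= flat 0 x <= 1.
Proof.
rewrite /flat; case: ifPn => [x0|_]; last by rewrite lexx ler01.
by rewrite expr0 mul1r expR_ge0 /= -expR0 ler_expR oppr_le0 invr_ge0 ltW.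
Qed.

Lemma sbump_le1 x : 0 <= sbump x <= 1.
Proof.
have /andP[a0 a1] := flat0_le1 x; have /andP[b0 b1] := flat0_le1 (1 - x).
rewrite /sbump mulr_ge0 //=; nra.
Qed.

Lemma sbump_gt0 x : 0 < x < 1 -> 0 < sbump x.
Proof.
move=> /andP[x0 x1]; rewrite /sbump /flat x0 subr_gt0 x1 !expr0 !mul1r.
by rewrite mulr_gt0 // expR_gt0.
Qed.

Lemma sbump_out x : x <= 0 \/ 1 <= x -> sbump x = 0.
Proof.
rewrite /sbump /flat => -[x0|x1]; first by rewrite ltNge x0 mul0r.
by rewrite subr_gt0 (ltNge x) x1 mulr0.
Qed.

Lemma derR_sbump (x : R) : exists d, derR sbump x d.
Proof.
have [g _ dg] := bumpy_der (bumpy_base 1 0 0 0); exists (g x).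
have := dg x; rewrite (_ : (fun _ => _) = sbump) //.
by apply/funext => y; rewrite mul1r subr0.
Qed.

End Bump.

(** * Integrable functions on the line and their primitives *)

Section LineIntegral.
Variable R : realType.
Notation mu := (@lebesgue_measure R).
Implicit Types f g : R -> R.

Lemma cvgy_eps (f : R -> R) (l : R) : f x @[x --> +oo] --> l ->
  forall e, 0 < e -> exists X : R, forall x, X <= x -> `|f x - l| <= e.
Proof.
move=> /cvgrPdist_le fl e e0; have [X [_ XP]] := fl e e0.
by exists (X + 1) => x Xx; rewrite distrC; apply: XP; rewrite (lt_le_trans _ Xx) // ltrDl.
Qed.

Lemma cvgNy_eps (f : R -> R) (l : R) : f x @[x --> -oo] --> l ->
  forall e, 0 < e -> exists X : R, forall x, x <= X -> `|f x - l| <= e.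
Proof.
move=> /cvgrPdist_le fl e e0; have [X [_ XP]] := fl e e0.
by exists (X - 1) => x Xx; rewrite distrC; apply: XP; rewrite (le_lt_trans Xx) // ltrBlDr ltrDl.
Qed.

Lemma integrable_expabs (b : R) : 0 < b ->
  mu.-integrable setT (EFin \o (fun x => expR (- b * `|x|))).
Proof.
move=> b0; pose f (x : R) : R := expR (- b * `|x|).
have cf : continuous f.
  move=> x; apply: continuous_comp; last exact: continuous_expR.
  by apply: continuousM; [exact: cst_continuous|exact: norm_continuous].
have f0 x : 0 <= f x by exact: expR_ge0.
apply/integrableP; split.
  by apply/measurable_EFinP; exact: continuous_measurable_fun.
under eq_integral do rewrite /= ger0_norm ?expR_ge0 //.
rewrite (ge0_symfun_integralT f0 cf); last by move=> x; rewrite /f /= normrN.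
rewrite -set_itvcy (@ge0_continuous_FTC2y _ f (fun x => - b^-1 * expR (- b * x)) 0 0).
- by rewrite -EFinB -EFinM ltry.
- by move=> x _; exact: f0.
- exact: continuous_subspaceT.
- apply/cvgrPdist_le => e e0.
  have be0 : 0 < b * e by rewrite mulr_gt0.
  have [X [_ XP]] := expR_small b0 be0.
  exists X; split; first exact: num_real.
  move=> x Xx; rewrite sub0r mulNr opprK ger0_norm ?mulr_ge0 ?expR_ge0 ?invr_ge0 ?(ltW b0) //.
  by rewrite ler_pdivrMl //; apply: XP; exact: ltW.
- move=> x _; exact: derR_derivable (derRM (derR_cst _ x) (derR_exp _ x)).
- apply: cvg_at_right_filter.
  exact: derR_cont (derRM (derR_cst _ 0) (derR_exp _ 0)).
- move=> x; rewrite in_itv /= andbT => x0.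
  rewrite (derR_derive1 (derRM (derR_cst _ x) (derR_exp _ x))) /f gtr0_norm //.
  by field; rewrite gt_eqF.
Qed.

Lemma integrable_decay f (c b : R) : 0 < b -> continuous f ->
  (forall x, `|f x| <= c * expR (- b * `|x|)) -> mu.-integrable setT (EFin \o f).
Proof.
move=> b0 cf fc.
have := integrableZl measurableT c (integrable_expabs b0).
apply: le_integrable => //.
  by apply/measurable_EFinP; exact: continuous_measurable_fun.
move=> x _ /=; rewrite lee_fin (le_trans (fc x)) // (le_trans (ler_norm _)) //.
Qed.

(** The primitive is the integral over []-oo, x]]; both limits come from dominated convergence along
    sequences. *)
Lemma line_primitive f : continuous f -> mu.-integrable setT (EFin \o f) ->
  exists F : R -> R, [/\ forall x : R, derR F x (f x),
    F x @[x --> +oo] --> int_line f & F x @[x --> -oo] --> (0 : R)].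
Proof.
move=> cf fi; have mf : measurable_fun setT f by exact: continuous_measurable_fun.
have fiS (D : set R) : measurable D -> mu.-integrable D (EFin \o f).
  by move=> mD; apply: integrableS fi.
pose F (x : R) : R := \int[mu]_(t in `]-oo, x]) f t.
have dom (u : R^nat) (h : R -> R) : measurable_fun setT h ->
    (forall x, `|h x| <= `|f x|) ->
    (forall x, (f \_ `]-oo, u n]) x @[n --> \oo] --> h x) ->
    F (u n) @[n --> \oo] --> int_line h.
  move=> mh hf uh.
  have /= := @dominated_convergence _ _ _ mu setT measurableT
    (fun n => EFin \o (f \_ `]-oo, u n])) (EFin \o h) (EFin \o (fun x => `|f x|)).
  case.
  - move=> n; apply/measurable_EFinP; apply/(measurable_restrictT _ _).1 => //.
    exact: measurable_funTS.
  - exact/measurable_EFinP.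
  - by apply: aeW => x _; apply: cvg_EFin; [exact: nearW|exact: uh].
  - exact: integrable_abse fi.
  - apply: aeW => x n _ /=; rewrite lee_fin patchE; case: ifP => // _.
    by rewrite normr0.
  move=> hi _ H.
  have {}H : [sequence (\int[mu]_(x in setT) ((f \_ `]-oo, u n]) x)%:E)%E]_n @ \oo
      --> (int_line h)%:E.
    by rewrite /int_line /Rintegral fineK //; exact: integrable_fin_num.
  have {}H := fine_cvg H.
  suff -> : (fun n => F (u n)) = fine \o
    [sequence (\int[mu]_(x in setT) ((f \_ `]-oo, u n]) x)%:E)%E]_n.
    exact: H.
  by apply/funext => n; rewrite /F Rintegral_mkcond.
exists F; split.
- move=> x; have xu : x < x + 1 by rewrite ltrDl.
  have fx : mu.-integrable [set` Interval -oo%O (BRight (x + 1))] (EFin \o f).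
    exact: fiS (measurable_itv _).
  have [] := continuous_FTC1 xu fx (ltNyr _) (cf x).
  by move=> /derivable_derR dF fE; apply: (derR_eq dF).
- apply/cvg_pinftyP => u uy; apply: dom => // x.
  apply: cvg_near_cst; move/cvgryPge: uy => /(_ x); apply: filterS => n xn.
  by rewrite patchE mem_set //= in_itv.
- apply/cvg_ninftyP => u uy; rewrite [X in _ --> X](_ : 0 = int_line (fun=> 0)); last first.
    by rewrite /int_line /Rintegral integral0.
  apply: dom => // [x|x]; first by rewrite normr0.
  apply: cvg_near_cst; move/cvgrNyPlt: uy => /(_ x); apply: filterS => n xn.
  by rewrite patchE memNset //= in_itv /= leNgt xn.
Qed.

End LineIntegral.

(** * Weak derivatives and continuous representatives *)

Section WeakDerivative.
Variable R : realType.
Notation mu := (@lebesgue_measure R).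
Implicit Types f g : R -> R.

(** A primitive of [sbump] normalized to rise from 0 to 1; [c] is the inverse of the total mass of
    [sbump]. *)
Lemma smooth_step : exists2 c : R, 0 < c & exists S : R -> R,
  [/\ forall x : R, derR S x (c * sbump x), forall x, x <= 0 -> S x = 0,
      forall x, 1 <= x -> S x = 1 & forall x, 0 <= S x <= 1].
Proof.
have cb : continuous (@sbump R).
  by move=> x; have [d db] := derR_sbump x; exact: derR_cont db.
have ib : mu.-integrable setT (EFin \o @sbump R).
  apply: (integrable_decay (c := expR 1) ltr01 cb) => x.
  have /andP[b0 b1] := sbump_le1 x; rewrite ger0_norm // -expRD.
  have [x1|x1] := leP `|x| 1.
    apply: le_trans b1 _; rewrite -[leLHS]expR0 ler_expR; lra.
  rewrite sbump_out ?expR_ge0 //.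
  by have [x0|x0] := leP 0 x; [right|left]; [rewrite ger0_norm in x1|]; lra.
have [F [dF _ _]] := line_primitive cb ib.
have F01 : 0 < F 1 - F 0.
  have [x x01 ->] := MVT_derR (ltr01 : (0 : R) < 1) (fun x _ => dF x).
  by rewrite subr0 mulr1; exact: sbump_gt0.
exists (F 1 - F 0)^-1; first by rewrite invr_gt0.
have mono x y : x <= y -> F x <= F y.
  by move=> xy; apply: (derR_ge0 xy (fun t _ => dF t)) => t _; case/andP: (sbump_le1 t).
have low x : x <= 0 -> F x = F 0.
  rewrite le_eqVlt => /orP[/eqP -> //|x0].
  have [t /andP[_ t0]] := MVT_derR x0 (fun x _ => dF x).
  by rewrite sbump_out ?mul0r; [move/eqP; rewrite subr_eq0 => /eqP|left; exact: ltW].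
have high x : 1 <= x -> F x = F 1.
  rewrite le_eqVlt => /orP[/eqP -> //|x1].
  have [t /andP[t1 _]] := MVT_derR x1 (fun x _ => dF x).
  by rewrite sbump_out ?mul0r; [move/eqP; rewrite subr_eq0 => /eqP|right; exact: ltW].
exists (fun x => (F 1 - F 0)^-1 * (F x - F 0)); split.
- move=> x; apply: (derR_eq (derRM (derR_cst _ x) (derRB (dF x) (derR_cst (F 0) x)))).
  by rewrite mul0r add0r subr0.
- by move=> x /low ->; rewrite subrr mulr0.
- by move=> x /high ->; rewrite mulVf // gt_eqF.
- move=> x; rewrite mulr_ge0 ?invr_ge0 ?(ltW F01) //=; last first.
    have [x0|/ltW x0] := leP x 0; first by rewrite (low _ x0) subrr.
    by rewrite subr_ge0; exact: mono.
  rewrite ler_pdivrMl // mulr1 lerD2r.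
  have [x1|/ltW x1] := leP 1 x; first by rewrite (high _ x1).
  exact: mono.
Qed.

Lemma inL2_measurable f : inL2 f -> measurable_fun setT f.
Proof. by rewrite /inL2 inE => /andP[+ _]; rewrite inE. Qed.

(** [|f| <= 1 + f ^+ 2], and both terms are integrable on a bounded interval. *)
Lemma inL2_itv f (a b : R) : inL2 f -> mu.-integrable `[a, b] (EFin \o f).
Proof.
move=> f2; have mf := inL2_measurable f2.
have i2 : mu.-integrable `[a, b] (EFin \o (fun x => f x ^+ 2)).
  have h := Lfun2_integrable_sqr f2; apply: (@integrableS _ _ _ mu setT _ _ _ _ _ h).
  - exact: measurableT.
  - exact: measurable_itv.
  - exact: subsetT.
have i1 : mu.-integrable `[a, b] (EFin \o (fun _ : R => 1 : R)).
  apply: continuous_compact_integrable; first exact: segment_compact.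
  by apply: continuous_subspaceT => x; exact: cst_continuous.
have := integrableD _ i1 i2; move=> /(_ ltac:(exact: measurable_itv)).
apply: le_integrable => //.
  by apply/measurable_EFinP; exact: measurable_funTS.
move=> x _ /=; rewrite lee_fin [leRHS]ger0_norm ?addr_ge0 ?sqr_ge0 //.
by rewrite -(real_normK (num_real (f x))); have := normr_ge0 (f x); nra.
Qed.

Lemma inL2_loc f : inL2 f -> locally_integrable setT f.
Proof.
move=> f2; have mf := inL2_measurable f2.
split; [exact: mf|exact: openT|move=> K _ cK].
have [M [_ MP]] := compact_bounded cK.
have KM : K `<=` `[- (`|M| + 1), `|M| + 1].
  move=> x Kx; rewrite /= in_itv /= -ler_norml; apply: MP => //.
  by rewrite (le_lt_trans (ler_norm M)) // ltrDl.
have /integrableP[_] := inL2_itv (- (`|M| + 1)) (`|M| + 1) f2.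
apply: le_lt_trans; apply: ge0_subset_integral => //.
- exact: compact_measurable.
- by apply/measurable_EFinP; apply: measurableT_comp => //; exact: measurable_funTS.
Qed.

Section Kernel.
Variables (c : R) (S : R -> R).
Hypothesis c0 : 0 < c.
Hypothesis dS : forall x : R, derR S x (c * sbump x).
Hypothesis Slow : forall x, x <= 0 -> S x = 0.
Hypothesis Shigh : forall x, 1 <= x -> S x = 1.
Hypothesis S01 : forall x, 0 <= S x <= 1.

(** The derivative of the step rescaled to [[a, a + 1/n]]: mass one and height at most [n c], an
    approximate identity at [a]. *)
Definition kern (n a : R) (x : R) : R := n * c * sbump (n * (x - a)).

Let dstep (n a x : R) : derR (fun x => S (n * (x - a))) x (kern n a x).
Proof.
have d1 : derR (fun y => n * (y - a)) x n.
  apply: (derR_eq (derRM (derR_cst n x) (derRB (derR_id x) (derR_cst a x)))); ring.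
by apply: (derR_eq (@derR_comp R S (fun y => n * (y - a)) x _ _ (dS _) d1)); rewrite /kern; ring.
Qed.

Let kern_cont n a : continuous (kern n a).
Proof.
move=> x; have [d db] := derR_sbump (n * (x - a)).
have d1 : derR (fun y => n * (y - a)) x n.
  apply: (derR_eq (derRM (derR_cst n x) (derRB (derR_id x) (derR_cst a x)))); ring.
have d2 := @derR_comp R (@sbump R) (fun y => n * (y - a)) x _ _ db d1.
exact: derR_cont (derRM (derR_cst (n * c) x) d2).
Qed.

Let kern_le n a x : 0 < n -> 0 <= kern n a x <= n * c.
Proof.
move=> n0; have /andP[b0 b1] := sbump_le1 (n * (x - a)).
have nc : 0 <= n * c by apply: mulr_ge0; exact: ltW.
rewrite /kern; apply/andP; split; first exact: mulr_ge0.
by rewrite -[leRHS]mulr1; exact: ler_wpM2l.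
Qed.

Let kern_out n a x : 0 < n -> ~ (a <= x <= a + n^-1) -> kern n a x = 0.
Proof.
move=> n0 xA; rewrite /kern sbump_out ?mulr0 //.
have [xa|xa] := leP x a; first by left; rewrite mulr_ge0_le0 ?(ltW n0) ?subr_le0.
right; rewrite leNgt; apply/negP => H; apply: xA; rewrite (ltW xa) /=.
by rewrite -lerBlDl -(ler_pM2l n0) divff ?gt_eqF // ltW.
Qed.

Let fkern_mk f n a : 0 < n ->
  (fun x => f x * kern n a x) = (fun x => f x * kern n a x) \_ `[a, a + n^-1].
Proof.
move=> n0; apply/funext => x; rewrite patchE; case: ifPn => // /negP xA.
by rewrite kern_out ?mulr0 // => H; apply: xA; rewrite inE /= in_itv.
Qed.

Let fkern_int_itv f n a : 0 < n -> inL2 f ->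
  mu.-integrable `[a, a + n^-1] (EFin \o (fun x => f x * kern n a x)).
Proof.
move=> n0 f2; have mf := inL2_measurable f2.
have := integrableZl _ (n * c) (inL2_itv a (a + n^-1) f2).
move=> /(_ ltac:(exact: measurable_itv)).
apply: le_integrable => //.
  apply/measurable_EFinP; apply: measurable_funTS; apply: measurable_funM => //.
  exact: continuous_measurable_fun.
move=> x _ /=; rewrite lee_fin normrM [leRHS]normrM mulrC; apply: ler_wpM2r => //.
have /andP[k0 k1] := kern_le a x n0; rewrite (ger0_norm k0) (le_trans k1) //.
by rewrite ler_norm.
Qed.

Lemma fkern_int f n a : 0 < n -> inL2 f ->
  mu.-integrable setT (EFin \o (fun x => f x * kern n a x)).
Proof.
move=> n0 f2; rewrite (fkern_mk f a n0).
have /integrable_mkcond := fkern_int_itv a n0 f2.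
by rewrite restrict_EFin; apply.
Qed.

Lemma kern_mass n a : 0 < n -> \int[mu]_(x in `[a, a + n^-1]) kern n a x = 1.
Proof.
move=> n0; have n1 : 0 < n^-1 by rewrite invr_gt0.
have an : a < a + n^-1 by rewrite ltrDl.
rewrite /Rintegral (@continuous_FTC2 _ (kern n a) (fun x => S (n * (x - a))) _ _ an).
- rewrite /= subrr mulr0 (Slow (lexx 0)) addrAC subrr add0r divff ?gt_eqF //.
  by rewrite (Shigh (lexx 1)) subr0.
- by apply: continuous_subspaceT; exact: kern_cont.
- split=> [x _| |].
  + exact: derR_derivable (dstep n a x).
  + by apply: cvg_at_right_filter; exact: derR_cont (dstep n a a).
  + by apply: cvg_at_left_filter; exact: derR_cont (dstep n a (a + n^-1)).
- by move=> x _; exact: derR_derive1 (dstep n a x).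
Qed.

(** The kernel lives on [[a, a + 1/n]], inside the ball of radius [2 / n] and measure [4 / n]; its
    height is at most [n c], and the product of the last two numbers gives the factor [4 c]. *)
Lemma kern_dev f n a e : 0 < n -> inL2 f -> (davg f a (2 / n) < e%:E)%E ->
  `|int_line (fun x => f x * kern n a x) - f a| <= 4 * c * e.
Proof.
move=> n0 f2 fe; have mf := inL2_measurable f2.
have n2 : 0 < 2 / n by rewrite divr_gt0.
rewrite /int_line (fkern_mk f a n0) -Rintegral_mkcond.
set A := `[a, a + n^-1]%classic.
have mA : measurable (A : set (measurableTypeR R)) by exact: measurable_itv.
have kint : mu.-integrable A (EFin \o kern n a).
  apply: continuous_compact_integrable; first exact: segment_compact.
  by apply: continuous_subspaceT; exact: kern_cont.
have kfa : mu.-integrable A (EFin \o (fun x => f a * kern n a x)).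
  by have := integrableZl mA (f a) kint.
have -> : f a = \int[mu]_(x in A) (f a * kern n a x).
  by rewrite RintegralZl // kern_mass // mulr1.
rewrite -RintegralB //; last exact: fkern_int_itv.
have dint : mu.-integrable A (EFin \o (fun x => f x * kern n a x - f a * kern n a x)).
  by have := integrableB mA (fkern_int_itv a n0 f2) kfa.
apply: le_trans (le_normr_Rintegral mA dint) _.
have mu2 : mu (ball a (2 / n)) = (4 / n)%:E.
  rewrite lebesgue_measure_ball ?(ltW n2) //; congr _%:E.
  by rewrite -mulr_natl; field; rewrite gt_eqF.
have n4 : 0 < 4 / n by rewrite divr_gt0.
rewrite /davg /iavg mu2 inver gt_eqF // lte_pdivrMl // in fe.
rewrite -lee_fin /Rintegral fineK; last first.
  apply: integrable_fin_num => //.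
  exact: (integrable_norm dint).
apply: le_trans (_ : \int[mu]_(x in A) ((n * c)%:E * `|f x - f a|%:E) <= _)%E.
  apply: ge0_le_integral => //.
  - by apply/measurable_EFinP; have /integrableP[/measurable_EFinP h _] := dint;
      exact: measurableT_comp.
  - apply: emeasurable_funM => //; apply/measurable_EFinP.
    by apply: measurable_funTS; apply: measurableT_comp => //; exact: measurable_funB.
  - move=> x _; rewrite -EFinM lee_fin -mulrBl normrM mulrC ler_wpM2r //.
    by have /andP[k0 k1] := kern_le a x n0; rewrite (ger0_norm k0).
rewrite ge0_integralZl //; last 2 first.
- apply/measurable_EFinP; apply: measurable_funTS; apply: measurableT_comp => //.
  exact: measurable_funB.
- by rewrite lee_fin mulr_ge0 ?(ltW n0) ?(ltW c0).
have sub : (\int[mu]_(x in A) `|f x - f a|%:E <= ((4 / n) * e)%:E)%E.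
  apply: le_trans (ltW fe); apply: ge0_subset_integral => //.
  - exact: measurable_ball.
  - apply: measurableT_comp => //; apply/measurable_EFinP; apply: measurable_funTS.
    by apply/measurable_EFinP; apply: measurableT_comp => //; exact: measurable_funB.
  - move=> x; rewrite /A /= in_itv /= => /andP[ax xa]; rewrite /ball /= distrC ger0_norm ?subr_ge0 //.
    rewrite ltrBlDl (le_lt_trans xa) // ltrD2l mulrC ltr_pMr ?invr_gt0 //.
    by rewrite ltr1n.
apply: le_trans (lee_pmul _ _ (lexx _) sub) _.
- by rewrite lee_fin mulr_ge0 ?(ltW n0) ?(ltW c0).
- by apply: integral_ge0 => x _; rewrite lee_fin.
by rewrite -EFinM lee_fin le_eqVlt; apply/orP; left; apply/eqP; field; rewrite gt_eqF.
Qed.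

Lemma kern_cvg f a : inL2 f -> lebesgue_pt f a ->
  int_line (fun x => f x * kern k.+1%:R a x) @[k --> \oo] --> f a.
Proof.
move=> f2 fa; apply/cvgrPdist_le => e e0.
have e4 : 0 < e / (4 * c) by rewrite divr_gt0 // mulr_gt0.
have u0 : (fun k : nat => 2 / k.+1%:R : R) @ \oo --> (0 : R).
  rewrite -(mulr0 2); apply: cvgM; first exact: cvg_cst.
  exact: cvg_harmonic.
have H : davg f a (2 / k.+1%:R) @[k --> \oo] --> 0%E.
  by move/cvge_at_rightP: fa; apply; split => // k; rewrite divr_gt0.
have N : nbhs (0%E : \bar R) [set y | (y < (e / (4 * c))%:E)%E].
  by apply: open_nbhs_nbhs; split; [exact: open_ereal_lt_ereal|rewrite /= lte_fin].
have H2 : \forall k \near \oo, (davg f a (2 / k.+1%:R) < (e / (4 * c))%:E)%E := H _ N.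
near=> k; have fe : (davg f a (2 / k.+1%:R) < (e / (4 * c))%:E)%E by near: k.
rewrite distrC; apply: le_trans (kern_dev _ f2 fe) _; first by rewrite ltr0n.
by rewrite mulrC divfK // gt_eqF // mulr_gt0.
Unshelve. all: by end_near. Qed.

(** The test functions [phi k] tend pointwise to the indicator of []a, b]]; the interval is
    half-open because [S 0 = 0]. Their derivatives are differences of two kernels, so the pairing
    with [f] tends to [f a - f b]. *)
Lemma weak_deriv_increment f g a b : inL2 f -> inL2 g -> weak_deriv f g ->
  lebesgue_pt f a -> lebesgue_pt f b -> a < b ->
  f b - f a = \int[mu]_(x in `]a, b]) g x.
Proof.
move=> f2 g2 fg fa fb ab.
pose phi (k : nat) (x : R) := S (k.+1%:R * (x - a)) - S (k.+1%:R * (x - b)).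
have n0 (k : nat) : 0 < k.+1%:R :> R by rewrite ltr0n.
have dphi k (x : R) : derR (phi k) x (kern k.+1%:R a x - kern k.+1%:R b x).
  exact: derRB (dstep _ _ _) (dstep _ _ _).
(* The transition layer at [b] has width [1 / (k + 1)], which is at most 1. *)
have phi0 k x : ~ (a <= x <= b + 1) -> phi k x = 0.
  move=> xA; rewrite /phi; have [xa|ax] := ltP x a.
    have xb := lt_trans xa ab.
    by rewrite !Slow ?subrr // mulr_ge0_le0 ?ler0n // subr_le0 ltW.
  have bx : b + 1 < x by rewrite ltNge; apply/negP => xb; apply: xA; rewrite ax xb.
  have k1 : 1 <= k.+1%:R :> R by rewrite ler1n.
  rewrite !Shigh ?subrr //; nra.
have phi1 k x : `|phi k x| <= 1.
  have /andP[s0 s1] := S01 (k.+1%:R * (x - a)); have /andP[t0 t1] := S01 (k.+1%:R * (x - b)).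
  by rewrite ler_norml /phi; apply/andP; split; lra.
have tphi k : test_function (phi k).
  split=> [n x|].
    apply: (@primitive_derivable R (phi k) _ n x (dphi k)).
    pose B d (x : R) := flat 0 (k.+1%:R * (x - d)) * flat 0 (1 - k.+1%:R * (x - d)).
    have -> : (fun x => kern k.+1%:R a x - kern k.+1%:R b x) =
        fun x => (k.+1%:R * c) * B a x + ((- (k.+1%:R * c) - 1) * B b x + B b x).
      by apply/funext => y; rewrite /kern /sbump /B; ring.
    by do 2![apply: bumpy_lin; first exact: bumpy_base]; exact: bumpy_base.
  exists (`|a| + `|b + 1|) => x xM; apply: phi0 => /andP[ax xb].
  move: xM; rewrite ltNge => /negP; apply; rewrite ler_norml.
  by have := ler_norm (- a); have := ler_norm (b + 1); rewrite normrN;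
    have := normr_ge0 a; have := normr_ge0 (b + 1); move=> *; apply/andP; split; lra.
have lhs k : int_line (fun x => f x * derive1 (phi k) x) =
    int_line (fun x => f x * kern k.+1%:R a x) - int_line (fun x => f x * kern k.+1%:R b x).
  rewrite /int_line -RintegralB //; try exact: fkern_int.
  by congr (Rintegral _ _ _); apply/funext => x; rewrite (derR_derive1 (dphi k x)) mulrBr.
have rhs : int_line (fun x => g x * phi k x) @[k --> \oo] --> \int[mu]_(x in `]a, b]) g x.
  have mg := inL2_measurable g2.
  have mphi k : measurable_fun setT (phi k).
    by apply: continuous_measurable_fun => x; exact: derR_cont (dphi k x).
  have /= := @dominated_convergence _ _ _ mu setT measurableT
    (fun k => EFin \o (fun x => g x * phi k x)) (EFin \o (g \_ `]a, b]))
    (abse \o (EFin \o (g \_ `[a, b + 1]))).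
  case.
  - move=> k; apply/measurable_EFinP; apply: measurable_funM; [exact: mg|exact: mphi].
  - apply/measurable_EFinP; apply/(measurable_restrictT _ _).1 => //.
    exact: measurable_funTS.
  - apply: aeW => x _; apply: cvg_EFin; first exact: nearW.
    apply: cvg_near_cst.
    have ev (t : R) : 0 < t -> exists N, forall k, (N <= k)%N -> S (k.+1%:R * t) = 1.
      move=> t0; have [N _ NP] := nbhs_infty_ger t^-1.
      exists N => k Nk; apply: Shigh; rewrite -ler_pdivrMr //.
      by have := NP k Nk; rewrite /= div1r -natr1; lra.
    have [xa|ax] := leP x a.
      exists 0%N => // k _ /=; rewrite patchE memNset /=; last first.
        by rewrite in_itv /= ltNge xa.
      have xb := le_trans xa (ltW ab).
      by rewrite /phi !Slow ?subrr ?mulr0 // mulr_ge0_le0 ?ler0n // subr_le0.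
    have [Na NaP] := ev (x - a) ltac:(by rewrite subr_gt0).
    have [xb|bx] := leP x b.
      exists Na => // k /= Nk; rewrite patchE mem_set /=; last by rewrite in_itv /= ax.
      rewrite /phi NaP //.
      by rewrite Slow ?subr0 ?mulr1 // mulr_ge0_le0 ?ler0n // subr_le0.
    have [Nb NbP] := ev (x - b) ltac:(by rewrite subr_gt0).
    exists (maxn Na Nb) => // k /=; rewrite geq_max => /andP[ka kb].
    rewrite patchE memNset /=; last by rewrite in_itv /= ax leNgt bx.
    by rewrite /phi NaP // NbP // subrr mulr0.
  - apply: integrable_abse; have /integrable_mkcond := inL2_itv a (b + 1) g2.
    by rewrite restrict_EFin; apply.
  - apply: aeW => x k _ /=; rewrite lee_fin patchE; case: ifPn => [_|/negP xA].
      by rewrite normrM -[leRHS]mulr1 ler_wpM2l.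
    rewrite phi0 ?mulr0 ?normr0 // => H; apply: xA.
    by rewrite inE /= in_itv.
  move=> hi _ H.
  have {}H : [sequence (\int[mu]_(x in setT) (g x * phi k x)%:E)%E]_k @ \oo
      --> (\int[mu]_(x in `]a, b]) g x)%:E.
    rewrite Rintegral_mkcond /Rintegral fineK //; exact: integrable_fin_num.
  have {}H := fine_cvg H.
  suff -> : (fun k => int_line (fun x => g x * phi k x)) = fine \o
    [sequence (\int[mu]_(x in setT) (g x * phi k x)%:E)%E]_k by exact: H.
  by [].
have eqs k : int_line (fun x => f x * kern k.+1%:R b x) -
    int_line (fun x => f x * kern k.+1%:R a x) = int_line (fun x => g x * phi k x).
  by have := fg _ (tphi k); rewrite lhs => /eqP; rewrite -eqr_oppLR opprB => /eqP.
have L := cvgB (kern_cvg f2 fb) (kern_cvg f2 fa).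
have L' : int_line (fun x => g x * phi k x) @[k --> \oo] --> f b - f a.
  suff -> : (fun k => int_line (fun x => g x * phi k x)) = fun k =>
      int_line (fun x => f x * kern k.+1%:R b x) - int_line (fun x => f x * kern k.+1%:R a x).
    exact: L.
  by apply/funext => k; rewrite eqs.
exact: (cvg_unique (@Rhausdorff R) L' rhs).
Qed.

End Kernel.

Lemma Rintegral_itv_split g (x y z : R) : inL2 g -> x <= y -> y <= z ->
  \int[mu]_(t in `]x, z]) g t = \int[mu]_(t in `]x, y]) g t + \int[mu]_(t in `]y, z]) g t.
Proof.
move=> g2 xy yz.
have gi : mu.-integrable `]x, z] (EFin \o g).
  apply: integrableS (inL2_itv x z g2) => //.
  by move=> t /=; rewrite !in_itv /= => /andP[/ltW -> ->].
rewrite -(@Rintegral_itvB _ g _ _ y gi) ?bnd_simp //.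
by rewrite addrC subrK.
Qed.

(* At two Lebesgue points of [f], the increment is obtained by testing the weak
   derivative against the difference of two smooth steps concentrating at these points. *)
Lemma weak_deriv_rep f g : inL2 f -> inL2 g -> weak_deriv f g ->
  exists F : R -> R, [/\ {ae mu, forall x, f x = F x}, continuous F &
    forall x y, x <= y -> F y - F x = \int[mu]_(t in `]x, y]) g t].
Proof.
move=> f2 g2 fg.
have [c c0 [S [dS Slow Shigh S01]]] := smooth_step.
have aeL := lebesgue_differentiation (inL2_loc f2).
have inc (x y : R) : lebesgue_pt f x -> lebesgue_pt f y -> x < y ->
    f y - f x = \int[mu]_(t in `]x, y]) g t.
  by move=> fx fy xy; exact: (weak_deriv_increment c0 dS Slow Shigh S01 f2 g2 fg fx fy xy).
have [a fa] : exists a, lebesgue_pt f a.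
  have mT : (0 < mu setT)%E.
    apply: (@lt_le_trans _ _ (mu `[0, 1]%classic)).
      by rewrite lebesgue_measure_itv /= lte01 oppr0 addr0 lte01.
    by apply: le_measure; rewrite ?inE.
  by have PF := ae_properfilter_algebraOfSetsType mT; exact: filter_ex aeL.
(* At most one of the two integrals is over a nonempty interval: together they are the integral from
   [a] to [x] with sign. *)
pose F (x : R) := f a + (\int[mu]_(t in `]a, x]) g t - \int[mu]_(t in `]x, a]) g t).
have e0 (x y : R) : y <= x -> \int[mu]_(t in `]x, y]) g t = 0.
  by move=> yx; rewrite set_itv_ge ?Rintegral_set0 // bnd_simp -leNgt.
have Fxy (x y : R) : x <= y -> F y - F x = \int[mu]_(t in `]x, y]) g t.
  move=> xy; rewrite /F; have [ax|/ltW xa] := leP a x.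
    have ay := le_trans ax xy.
    by rewrite (e0 x a) // (e0 y a) // (Rintegral_itv_split g2 ax xy); ring.
  have [ay|/ltW ya] := leP a y.
    by rewrite (e0 a x) // (e0 y a) // (Rintegral_itv_split g2 xa ay); ring.
  by rewrite (e0 a x) // (e0 a y) // (Rintegral_itv_split g2 xy ya); ring.
exists F; split => //.
- move: aeL; apply: filterS; first exact: (ae_filter_ringOfSetsType mu).
  move=> x fx; rewrite /F.
  have [ax|xa|<-] := ltgtP a x.
  + by rewrite (e0 x a) ?(ltW ax) // -(inc a x) //; ring.
  + by rewrite (e0 a x) ?(ltW xa) // -(inc x a) //; ring.
  + by rewrite e0 // subr0 addr0.
- move=> x; have x1 : x - 1 <= x + 1 by lra.
  have xx1 : x - 1 < x + 1 by lra.
  have ci := parameterized_integral_continuous x1 (inL2_itv (x - 1) (x + 1) g2).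
  have [cG _ _] := (continuous_within_itvP _ xx1).1 ci.
  have {}cG := cG x ltac:(rewrite in_itv /=; apply/andP; split; lra).
  have FG (y : R) : x - 1 <= y ->
      F y = F (x - 1) + parameterized_integral mu (x - 1) y g.
    move=> xy; rewrite /parameterized_integral -Rintegral_itv_obnd_cbnd.
      by rewrite -Fxy // addrC subrK.
    apply: integrableS (inL2_itv (x - 1) y g2) => //.
    by move=> t /=; rewrite !in_itv /= => /andP[/ltW -> ->].
  apply/cvgrPdist_le => e e_0; move/cvgrPdist_le: cG => /(_ e e_0) cG.
  near=> y; rewrite (FG x) ?(FG y); last 2 first.
  - have : x - 1 < y by near: y; apply: lt_nbhsr; lra.
    exact: ltW.
  - lra.
  by rewrite opprD addrACA subrr add0r; near: y.
Unshelve. all: by end_near. Qed.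

(** Changing [g] on a null set does not alter its integrals, and the fundamental theorem of calculus
    applies to the continuous [gam]. *)
Lemma derR_weak_rep f g (gam : R -> R) : inL2 g -> measurable_fun setT g ->
  continuous gam -> {ae mu, forall x, g x = gam x} ->
  (forall x y, x <= y -> f y - f x = \int[mu]_(t in `]x, y]) g t) ->
  forall x : R, derR f x (gam x).
Proof.
move=> g2 mg cg ggam fxy x.
have gi (a b : R) : mu.-integrable `[a, b] (EFin \o gam).
  apply: continuous_compact_integrable; first exact: segment_compact.
  exact: continuous_subspaceT.
have ge (a b : R) : \int[mu]_(t in `]a, b]) g t = \int[mu]_(t in `[a, b]) gam t.
  rewrite -Rintegral_itv_obnd_cbnd; last first.
    apply: integrableS (gi a b) => //.
    by move=> t /=; rewrite !in_itv /= => /andP[/ltW -> ->].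
  congr fine; apply: ae_eq_integral => //.
  - by apply/measurable_EFinP; exact: measurable_funTS.
  - by apply/measurable_EFinP; apply: measurable_funTS; exact: continuous_measurable_fun.
  - move: ggam; apply: filterS; first exact: (ae_filter_ringOfSetsType mu).
    by move=> t /= -> _.
have x1 : x < x + 1 by rewrite ltrDl.
have [] := continuous_FTC1_closed x1 (gi (x - 1) (x + 1)) _ (cg x); first by lra.
move=> /derivable_derR dG GE; rewrite GE in dG.
apply: near_eq_is_derive (derR_eq (derRD (derR_cst (f (x - 1)) x) dG) (add0r _)).
near=> y; rewrite -ge -fxy; first by ring.
have : x - 1 < y by near: y; apply: lt_nbhsr; lra.
exact: ltW.
Unshelve. all: by end_near. Qed.

End WeakDerivative.

(** * Eigenfunctions are classical *)

Section Vanish.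
Variable R : realType.
Notation mu := (@lebesgue_measure R).

Definition vanishes (f : R -> R) : Prop :=
  forall e : R, 0 < e -> exists X : R, forall x, X <= `|x| -> `|f x| <= e.

(** Somewhere in [[x, x + 1]] the function [h = 2 f^2 + g^2] takes its mean value, and [f^2]
    decreases by at most the integral of [h] in between. Hence [f(x)^2] is at most twice the
    integral of [h] over the interval, which tends to 0 at both ends. *)
Lemma L2_vanish (f g : R -> R) : (forall x : R, derR f x (g x)) -> continuous g ->
  mu.-integrable setT (EFin \o (fun x => f x ^+ 2)) ->
  mu.-integrable setT (EFin \o (fun x => g x ^+ 2)) -> vanishes f.
Proof.
move=> df cg if2 ig2.
have cf : continuous f by move=> x; exact: derR_cont (df x).
pose h x := f x ^+ 2 + f x ^+ 2 + g x ^+ 2.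
have sq (k : R -> R) : continuous k -> continuous (fun x => k x ^+ 2).
  move=> ck x; rewrite (_ : (fun x => k x ^+ 2) = (fun x => k x * k x)).
    by apply: continuousM; exact: ck.
  by apply/funext => y; rewrite expr2.
have ch : continuous h.
  move=> x; apply: (@continuousD _ _ _ (fun x => f x ^+ 2 + f x ^+ 2)); last exact: sq.
  by apply: (@continuousD _ _ _ (fun x => f x ^+ 2)); exact: sq.
have ih : mu.-integrable setT (EFin \o h).
  by have := integrableD measurableT (integrableD measurableT if2 if2) ig2.
have [P [dP Py PNy]] := line_primitive ch ih.
have mono x y : x <= y -> P x <= P y.
  move=> xy; apply: (derR_ge0 xy (fun t _ => dP t)) => t _.
  by rewrite /h !addr_ge0 ?sqr_ge0.
have key x : f x ^+ 2 <= 2 * (P (x + 1) - P x).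
  have x1 : x < x + 1 by rewrite ltrDl.
  have [y /andP[/ltW xy /ltW y1]] := MVT_derR x1 (fun t _ => dP t).
  rewrite addrAC subrr add0r mulr1 => hy.
  have dsq (t : R) : derR (fun t : R => - (f t * f t)) t (- (g t * f t + f t * g t)).
    exact: derRN (derRM (df t) (df t)).
  have H : - (f y * f y) - - (f x * f x) <= P y - P x.
    apply: (derR_le xy (fun t _ => dsq t) (fun t _ => dP t)) => t _.
    rewrite /h !expr2; nra.
  have h2 := mono _ _ y1; have h3 : f y * f y <= h y.
    by rewrite /h !expr2; nra.
  rewrite expr2; lra.
have small (a b e : R) : 0 < e -> a ^+ 2 <= 2 * b -> b <= e ^+ 2 / 2 -> `|a| <= e.
  move=> e0 ab be; rewrite -(@ler_pXn2r _ 2) ?nnegrE ?(ltW e0) //.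
  by rewrite real_normK ?num_real //; lra.
move=> e e0; have e2 : 0 < e ^+ 2 / 4 by rewrite divr_gt0 ?exprn_gt0.
have [X XP] := cvgy_eps Py e2; have [Y YP] := cvgNy_eps PNy e2.
exists (Num.max 0 (Num.max X (1 - Y))) => x; rewrite !ge_max => /andP[_ /andP[xX xY]].
have [x0|x0] := leP 0 x.
  rewrite (ger0_norm x0) in xX; apply: small e0 (key x) _.
  have := XP x xX; have := XP (x + 1) ltac:(lra).
  by rewrite !ler_norml => /andP[? ?] /andP[? ?]; lra.
rewrite (ltr0_norm x0) in xY; apply: small e0 (key x) _.
have := YP x ltac:(lra); have := YP (x + 1) ltac:(lra).
by rewrite !subr0 !ler_norml => /andP[? ?] /andP[? ?]; lra.
Qed.

Lemma inL2_ae_sqr (f F : R -> R) : inL2 f -> {ae mu, forall x, f x = F x} ->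
  continuous F -> mu.-integrable setT (EFin \o (fun x => F x ^+ 2)).
Proof.
move=> f2 fF cF; have mf := inL2_measurable f2.
have mF := continuous_measurable_fun cF.
have /integrableP[_ H] := Lfun2_integrable_sqr f2.
apply/integrableP; split.
  by apply/measurable_EFinP; exact: measurable_funX.
rewrite (@ae_eq_integral _ _ _ mu setT (fun x => `|((f x ^+ 2)%R)%:E|%E)) //.
- apply: measurableT_comp => //; apply/measurable_EFinP; exact: measurable_funX.
- apply: measurableT_comp => //; apply/measurable_EFinP; exact: measurable_funX.
- move: fF; apply: filterS; first exact: (ae_filter_ringOfSetsType mu).
  by move=> x /= -> _.
Qed.

Lemma vanishes_tends0 (f : R -> R[i]) : vanishes (reF f) -> vanishes (imF f) ->
  tends0 f /\ tends0 (fun x => f (- x)).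
Proof.
move=> hr hi.
have H e : 0 < e -> exists X : R, forall x, X <= `|x| -> cabs (f x) <= e.
  move=> e0; have e2 : 0 < e / 2 by rewrite divr_gt0.
  have [X XP] := hr _ e2; have [Y YP] := hi _ e2.
  exists (Num.max X Y) => x; rewrite ge_max => /andP[/XP xX /YP xY].
  have := xX; have := xY; rewrite /reF /imF => h1 h2.
  rewrite -(@ler_pXn2r _ 2) ?nnegrE ?cabs_ge0 ?(ltW e0) // cabs2.
  rewrite -(real_normK (num_real (complex.Re _))) -(real_normK (num_real (complex.Im _))).
  by have := normr_ge0 (complex.Re (f x)); have := normr_ge0 (complex.Im (f x)); nra.
split=> e e0; have [X XP] := H e e0; exists (Num.max X 0) => x; rewrite ge_max => /andP[Xx x0];
  by apply: XP; rewrite ?normrN ger0_norm.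
Qed.

End Vanish.

Definition i4_0 : 'I_(2 + 2) := lshift 2 ord0.
Definition i4_1 : 'I_(2 + 2) := lshift 2 ord_max.
Definition i4_2 : 'I_(2 + 2) := rshift 2 ord0.
Definition i4_3 : 'I_(2 + 2) := rshift 2 ord_max.

Lemma ord4P (P : 'I_(2 + 2) -> Prop) : P i4_0 -> P i4_1 -> P i4_2 -> P i4_3 ->
  forall j, P j.
Proof.
move=> P0 P1 P2 P3 j; case: (split_ordP j) => k ->.
  by move: k; exact: ord2P.
by move: k; exact: ord2P.
Qed.

Lemma sum_ord4 (V : nmodType) (F : 'I_(2 + 2) -> V) :
  \sum_j F j = F i4_0 + F i4_1 + (F i4_2 + F i4_3).
Proof. by rewrite big_split_ord /= !sum_ord2. Qed.

(** * The eigenvalue equation written in components *)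

Section Components.
Variable R : realType.
Notation C := R[i].
Variables (om s : R) (F : R -> R -> R -> R) (m : R) (U V : R -> R) (lam : C).

Definition alF x := d1 (d1 F) (U x ^+ 2) (V x ^+ 2) m * U x ^+ 2.
Definition beF x := d1 F (U x ^+ 2) (V x ^+ 2) m.
Definition cF x := d1 (d2 F) (U x ^+ 2) (V x ^+ 2) m * U x * V x.
Definition dF x := d2 (d2 F) (U x ^+ 2) (V x ^+ 2) m * V x ^+ 2.
Definition eF x := d2 F (U x ^+ 2) (V x ^+ 2) m.

(** The factors [om - i lam], [om + i lam], [s - i lam], [s + i lam] here and below are the squares
    of [nu1], ..., [nu4]. *)
Definition rhs0 (x : R) (v0 v1 v2 v3 : C) : C := (om%:C - 'i * lam) * v0
  - ((alF x)%:C * (v0 + v1) + (beF x)%:C * v0 + (cF x)%:C * (v2 + v3)).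
Definition rhs1 (x : R) (v0 v1 v2 v3 : C) : C := (om%:C + 'i * lam) * v1
  - ((alF x)%:C * (v0 + v1) + (beF x)%:C * v1 + (cF x)%:C * (v2 + v3)).
Definition rhs2 (x : R) (v0 v1 v2 v3 : C) : C := (s%:C - 'i * lam) * v2
  - ((cF x)%:C * (v0 + v1) + (dF x)%:C * (v2 + v3) + (eF x)%:C * v2).
Definition rhs3 (x : R) (v0 v1 v2 v3 : C) : C := (s%:C + 'i * lam) * v3
  - ((cF x)%:C * (v0 + v1) + (dF x)%:C * (v2 + v3) + (eF x)%:C * v3).

Lemma i_cancel (u v : C) : - 'i * u = lam * v -> u = 'i * lam * v.
Proof.
move=> /(congr1 (fun t => 'i * t)); rewrite mulrA mulrN -expr2 sqr_i opprK mul1r mulrA.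
by [].
Qed.

Lemma block_col0 (M11 M12 M21 M22 : 'M[C]_2) (v : 'cV[C]_(2 + 2)) :
  (block_mx M11 M12 M21 M22 *m v) i4_0 0 =
  M11 ord0 ord0 * v i4_0 0 + M11 ord0 ord_max * v i4_1 0
  + (M12 ord0 ord0 * v i4_2 0 + M12 ord0 ord_max * v i4_3 0).
Proof. by rewrite mxE sum_ord4 /i4_0 /i4_1 /i4_2 /i4_3 !block_mxEul !block_mxEur. Qed.

Lemma block_col1 (M11 M12 M21 M22 : 'M[C]_2) (v : 'cV[C]_(2 + 2)) :
  (block_mx M11 M12 M21 M22 *m v) i4_1 0 =
  M11 ord_max ord0 * v i4_0 0 + M11 ord_max ord_max * v i4_1 0
  + (M12 ord_max ord0 * v i4_2 0 + M12 ord_max ord_max * v i4_3 0).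
Proof. by rewrite mxE sum_ord4 /i4_0 /i4_1 /i4_2 /i4_3 !block_mxEul !block_mxEur. Qed.

Lemma block_col2 (M11 M12 M21 M22 : 'M[C]_2) (v : 'cV[C]_(2 + 2)) :
  (block_mx M11 M12 M21 M22 *m v) i4_2 0 =
  M21 ord0 ord0 * v i4_0 0 + M21 ord0 ord_max * v i4_1 0
  + (M22 ord0 ord0 * v i4_2 0 + M22 ord0 ord_max * v i4_3 0).
Proof. by rewrite mxE sum_ord4 /i4_0 /i4_1 /i4_2 /i4_3 !block_mxEdl !block_mxEdr. Qed.

Lemma block_col3 (M11 M12 M21 M22 : 'M[C]_2) (v : 'cV[C]_(2 + 2)) :
  (block_mx M11 M12 M21 M22 *m v) i4_3 0 =
  M21 ord_max ord0 * v i4_0 0 + M21 ord_max ord_max * v i4_1 0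
  + (M22 ord_max ord0 * v i4_2 0 + M22 ord_max ord_max * v i4_3 0).
Proof. by rewrite mxE sum_ord4 /i4_0 /i4_1 /i4_2 /i4_3 !block_mxEdl !block_mxEdr. Qed.

Lemma sigma3E : [/\ sigma3 R ord0 ord0 = 1, sigma3 R ord0 ord_max = 0,
  sigma3 R ord_max ord0 = 0 & sigma3 R ord_max ord_max = -1].
Proof. by rewrite /sigma3 !mxE /= !expr0 expr1 !mul1r !mul0r. Qed.

Lemma scalar2E (a : C) : [/\ (a%:M : 'M[C]_2) ord0 ord0 = a, (a%:M : 'M[C]_2) ord0 ord_max = 0,
  (a%:M : 'M[C]_2) ord_max ord0 = 0 & (a%:M : 'M[C]_2) ord_max ord_max = a].
Proof. by rewrite !mxE /= !mulr1n !mulr0n. Qed.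

Lemma JE (i j : 'I_2) : (1%:M + sigma1 R : 'M[C]_2) i j = 1.
Proof. by rewrite !mxE; case: eqP => _ /=; rewrite ?mulr1n ?mulr0n ?addr0 ?add0r. Qed.

Lemma scaleJE (a : C) (i j : 'I_2) : (a *: (1%:M + sigma1 R) : 'M[C]_2) i j = a.
Proof. by rewrite mxE JE mulr1. Qed.

Lemma block_coef (a b : C) : [/\ (a *: (1%:M + sigma1 R) + b%:M : 'M[C]_2) ord0 ord0 = a + b,
  (a *: (1%:M + sigma1 R) + b%:M : 'M[C]_2) ord0 ord_max = a,
  (a *: (1%:M + sigma1 R) + b%:M : 'M[C]_2) ord_max ord0 = a &
  (a *: (1%:M + sigma1 R) + b%:M : 'M[C]_2) ord_max ord_max = a + b].
Proof.
have [b00 b01 b10 b11] := scalar2E b.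
have D2 (A B : 'M[C]_2) i j : (A + B) i j = A i j + B i j by rewrite mxE.
by split; rewrite D2 scaleJE ?b00 ?b01 ?b10 ?b11 ?addr0.
Qed.

Lemma BmxE x : Bmx F m U V x = block_mx ((alF x)%:C *: (1%:M + sigma1 R) + (beF x)%:C%:M)
  ((cF x)%:C *: (1%:M + sigma1 R)) ((cF x)%:C *: (1%:M + sigma1 R))
  ((dF x)%:C *: (1%:M + sigma1 R) + (eF x)%:C%:M).
Proof. by []. Qed.

(** [Sigma3] is diagonal with entries 1 and -1, so each row can be solved for the second derivative;
    the entry decides between [- i lam] and [+ i lam]. *)
Lemma Lop_components (psi psi2 : R -> 'cV[C]_(2 + 2)) x :
  Lop om s F m U V psi psi2 x = lam *: psi x ->
  let v k := psi x k 0 in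
  [/\ psi2 x i4_0 0 = rhs0 x (v i4_0) (v i4_1) (v i4_2) (v i4_3),
      psi2 x i4_1 0 = rhs1 x (v i4_0) (v i4_1) (v i4_2) (v i4_3),
      psi2 x i4_2 0 = rhs2 x (v i4_0) (v i4_1) (v i4_2) (v i4_3) &
      psi2 x i4_3 0 = rhs3 x (v i4_0) (v i4_1) (v i4_2) (v i4_3)].
Proof.
have [s00 s01 s10 s11] := sigma3E.
have [a00 a01 a10 a11] := scalar2E om%:C.
have [z00 z01 z10 z11] := scalar2E s%:C.
have [p00 p01 p10 p11] := block_coef (alF x)%:C (beF x)%:C.
have [r00 r01 r10 r11] := block_coef (dF x)%:C (eF x)%:C.
have Z2 (i j : 'I_2) : (0 : 'M[C]_2) i j = 0 by rewrite mxE.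
have S0 (w : 'cV[C]_(2 + 2)) : (Sigma3 R *m w) i4_0 0 = w i4_0 0.
  by rewrite /Sigma3 block_col0 !Z2 s00 s01 !mul0r !addr0 mul1r.
have S1 (w : 'cV[C]_(2 + 2)) : (Sigma3 R *m w) i4_1 0 = - w i4_1 0.
  by rewrite /Sigma3 block_col1 !Z2 s10 s11 !mul0r !addr0 add0r mulN1r.
have S2 (w : 'cV[C]_(2 + 2)) : (Sigma3 R *m w) i4_2 0 = w i4_2 0.
  by rewrite /Sigma3 block_col2 !Z2 s00 s01 !mul0r !addr0 add0r mul1r.
have S3 (w : 'cV[C]_(2 + 2)) : (Sigma3 R *m w) i4_3 0 = - w i4_3 0.
  by rewrite /Sigma3 block_col3 !Z2 s10 s11 !mul0r !add0r mulN1r.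
have H0 (w : 'cV[C]_(2 + 2)) : (freqs om s *m w) i4_0 0 = om%:C * w i4_0 0.
  by rewrite /freqs block_col0 !Z2 a00 a01 !mul0r !addr0.
have H1 (w : 'cV[C]_(2 + 2)) : (freqs om s *m w) i4_1 0 = om%:C * w i4_1 0.
  by rewrite /freqs block_col1 !Z2 a10 a11 !mul0r !addr0 add0r.
have H2 (w : 'cV[C]_(2 + 2)) : (freqs om s *m w) i4_2 0 = s%:C * w i4_2 0.
  by rewrite /freqs block_col2 !Z2 z00 z01 !mul0r !addr0 add0r.
have H3 (w : 'cV[C]_(2 + 2)) : (freqs om s *m w) i4_3 0 = s%:C * w i4_3 0.
  by rewrite /freqs block_col3 !Z2 z10 z11 !mul0r !add0r.
have B0 (w : 'cV[C]_(2 + 2)) : (Bmx F m U V x *m w) i4_0 0 = (alF x)%:C * (w i4_0 0 + w i4_1 0)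
    + (beF x)%:C * w i4_0 0 + (cF x)%:C * (w i4_2 0 + w i4_3 0).
  rewrite BmxE block_col0 p00 p01 !scaleJE.
  move: (w i4_0 0) (w i4_1 0) (w i4_2 0) (w i4_3 0) (alF x)%:C (beF x)%:C (cF x)%:C (dF x)%:C (eF x)%:C.
  by move=> *; ring.
have B1 (w : 'cV[C]_(2 + 2)) : (Bmx F m U V x *m w) i4_1 0 = (alF x)%:C * (w i4_0 0 + w i4_1 0)
    + (beF x)%:C * w i4_1 0 + (cF x)%:C * (w i4_2 0 + w i4_3 0).
  rewrite BmxE block_col1 p10 p11 !scaleJE.
  move: (w i4_0 0) (w i4_1 0) (w i4_2 0) (w i4_3 0) (alF x)%:C (beF x)%:C (cF x)%:C (dF x)%:C (eF x)%:C.
  by move=> *; ring.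
have B2 (w : 'cV[C]_(2 + 2)) : (Bmx F m U V x *m w) i4_2 0 = (cF x)%:C * (w i4_0 0 + w i4_1 0)
    + (dF x)%:C * (w i4_2 0 + w i4_3 0) + (eF x)%:C * w i4_2 0.
  rewrite BmxE block_col2 r00 r01 !scaleJE.
  move: (w i4_0 0) (w i4_1 0) (w i4_2 0) (w i4_3 0) (alF x)%:C (beF x)%:C (cF x)%:C (dF x)%:C (eF x)%:C.
  by move=> *; ring.
have B3 (w : 'cV[C]_(2 + 2)) : (Bmx F m U V x *m w) i4_3 0 = (cF x)%:C * (w i4_0 0 + w i4_1 0)
    + (dF x)%:C * (w i4_2 0 + w i4_3 0) + (eF x)%:C * w i4_3 0.
  rewrite BmxE block_col3 r10 r11 !scaleJE.
  move: (w i4_0 0) (w i4_1 0) (w i4_2 0) (w i4_3 0) (alF x)%:C (beF x)%:C (cF x)%:C (dF x)%:C (eF x)%:C.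
  by move=> *; ring.
have A3 (u v w : 'cV[C]_(2 + 2)) k : (- u + v - w) k 0 = - u k 0 + v k 0 - w k 0.
  by rewrite !mxE.
move=> H v.
have E k : - 'i * (Sigma3 R *m (- psi2 x + freqs om s *m psi x
    - Bmx F m U V x *m psi x)) k 0 = lam * v k.
  have := congr1 (fun M : 'cV[C]_(2 + 2) => M k 0) H.
  by rewrite /Lop mxE => ->; rewrite mxE.
have /i_cancel := E i4_0; have /i_cancel := E i4_1; have /i_cancel := E i4_2; have /i_cancel := E i4_3.
rewrite S0 S1 S2 S3 !A3 H0 H1 H2 H3 B0 B1 B2 B3 -!/(v _) => h3 h2 h1 h0.
have solve (u w r t : C) : - u + w - r = t -> u = w - r - t.
  by move=> <-; ring.
have solveN (u w r t : C) : - (- u + w - r) = t -> u = w - r + t.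
  by move=> <-; ring.
split; [rewrite (solve _ _ _ _ h0) /rhs0|rewrite (solveN _ _ _ _ h1) /rhs1
  |rewrite (solve _ _ _ _ h2) /rhs2|rewrite (solveN _ _ _ _ h3) /rhs3];
  move: (v i4_0) (v i4_1) (v i4_2) (v i4_3) (alF x)%:C (beF x)%:C (cF x)%:C (dF x)%:C (eF x)%:C om%:C s%:C;
  by move=> *; ring.
Qed.

End Components.

Section ContinuousReal.
Variable R : realType.
Implicit Types f g : R -> R.

Lemma rcontD f g : continuous f -> continuous g -> continuous (fun x => f x + g x).
Proof. by move=> cf cg x; apply: (@continuousD _ _ _ f g); [exact: cf|exact: cg]. Qed.

Lemma rcontB f g : continuous f -> continuous g -> continuous (fun x => f x - g x).
Proof. by move=> cf cg x; apply: (@continuousB _ _ _ f g); [exact: cf|exact: cg]. Qed.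

Lemma rcontM f g : continuous f -> continuous g -> continuous (fun x => f x * g x).
Proof. by move=> cf cg x; apply: (@continuousM _ _ f g); [exact: cf|exact: cg]. Qed.

Lemma rcontX f n : continuous f -> continuous (fun x => f x ^+ n).
Proof.
move=> cf; elim: n => [|n IHn].
  rewrite (_ : (fun x => _) = fun=> 1); last by apply/funext => x; rewrite expr0.
  by move=> x; exact: cst_continuous.
rewrite (_ : (fun x => _) = fun x => f x * f x ^+ n); first exact: rcontM.
by apply/funext => x; rewrite exprS.
Qed.

End ContinuousReal.

Section ContinuousComplex.
Variable R : realType.
Notation C := R[i].
Implicit Types f g : R -> C.

Definition ccont f : Prop := continuous (reF f) /\ continuous (imF f).

Lemma ccont_cst (c : C) : ccont (fun=> c).
Proof. by split => x; exact: cst_continuous. Qed.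

Lemma ccont_real (h : R -> R) : continuous h -> ccont (fun x => (h x)%:C).
Proof. by move=> ch; split => x; [exact: ch|exact: cst_continuous]. Qed.

Lemma ccontD f g : ccont f -> ccont g -> ccont (fun x => f x + g x).
Proof.
move=> [f1 f2] [g1 g2]; split.
- rewrite (_ : reF _ = fun x => reF f x + reF g x); first exact: rcontD.
  by apply/funext => y; rewrite /reF reD.
- rewrite (_ : imF _ = fun x => imF f x + imF g x); first exact: rcontD.
  by apply/funext => y; rewrite /imF imD.
Qed.

Lemma ccontM f g : ccont f -> ccont g -> ccont (fun x => f x * g x).
Proof.
move=> [f1 f2] [g1 g2]; split.
- rewrite (_ : reF _ = fun x => reF f x * reF g x - imF f x * imF g x).
    by apply: rcontB; exact: rcontM.
  by apply/funext => y; rewrite /reF reM.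
- rewrite (_ : imF _ = fun x => reF f x * imF g x + imF f x * reF g x).
    by apply: rcontD; exact: rcontM.
  by apply/funext => y; rewrite /imF imM.
Qed.

Lemma ccontB f g : ccont f -> ccont g -> ccont (fun x => f x - g x).
Proof.
move=> cf cg; rewrite (_ : (fun x => f x - g x) = (fun x => f x + -1 * g x)).
  by apply: ccontD => //; apply: ccontM => //; exact: ccont_cst.
by apply/funext => x; rewrite mulN1r.
Qed.

Lemma isd_ccont f f' : (forall x, isd f x (f' x)) -> ccont f.
Proof. by move=> df; split => x; have [h1 h2] := df x; [exact: derR_cont h1|exact: derR_cont h2]. Qed.

End ContinuousComplex.

(** * Classical representatives of eigenfunctions *)

Section ClassicalEigenfunctions.
Variable R : realType.
Notation C := R[i].
Notation mu := (@lebesgue_measure R).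

(** [gam] is quantified last: the second derivative is identified with a continuous function through
    the eigenvalue equation, which involves the representatives of all components. *)
Lemma inH2_rep (f f1 f2 : R -> R) : inH2 f f1 f2 -> exists P P1 : R -> R,
  [/\ {ae mu, forall x, f x = P x}, forall x : R, derR P x (P1 x), continuous P1,
      mu.-integrable setT (EFin \o (fun x => P1 x ^+ 2)) &
      forall gam : R -> R, continuous gam -> {ae mu, forall x, f2 x = gam x} ->
        [/\ forall x : R, derR P1 x (gam x), vanishes P & vanishes P1]].
Proof.
move=> [h0 h1 h2 w1 w2].
have [P [fP cP Pi]] := weak_deriv_rep h0 h1 w1.
have [P1 [fP1 cP1 Pi1]] := weak_deriv_rep h1 h2 w2.
have dP : forall x : R, derR P x (P1 x).
  exact: derR_weak_rep h1 (inL2_measurable h1) cP1 fP1 Pi.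
have i0 := inL2_ae_sqr h0 fP cP; have i1 := inL2_ae_sqr h1 fP1 cP1.
exists P, P1; split => // gam cg fg.
have dP1 : forall x : R, derR P1 x (gam x).
  exact: derR_weak_rep h2 (inL2_measurable h2) cg fg Pi1.
split => //; first exact: (L2_vanish dP cP1 i0 i1).
exact: (L2_vanish dP1 cg i1 (inL2_ae_sqr h2 fg cg)).
Qed.

Variables (om s : R) (F : R -> R -> R -> R) (m : R) (U V : R -> R) (lam : C).
Notation al := (alF F m U V).
Notation be := (beF F m U V).
Notation c := (cF F m U V).
Notation d := (dF F m U V).
Notation e := (eF F m U V).
Hypotheses (cal : continuous al) (cbe : continuous be) (cc : continuous c)
  (cd : continuous d) (ce : continuous e).

Definition rhsk (k : 'I_(2 + 2)) x (v : 'I_(2 + 2) -> C) : C :=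
  match val k with
  | 0%N => rhs0 om F m U V lam x (v i4_0) (v i4_1) (v i4_2) (v i4_3)
  | 1%N => rhs1 om F m U V lam x (v i4_0) (v i4_1) (v i4_2) (v i4_3)
  | 2%N => rhs2 s F m U V lam x (v i4_0) (v i4_1) (v i4_2) (v i4_3)
  | _ => rhs3 s F m U V lam x (v i4_0) (v i4_1) (v i4_2) (v i4_3)
  end.

Lemma ccont_rhs k (f : 'I_(2 + 2) -> R -> C) : (forall k, ccont (f k)) ->
  ccont (fun x => rhsk k x (fun j => f j x)).
Proof.
move=> cf.
have H (g u1 u2 u3 : R -> C) (z : C) : ccont g -> ccont u1 -> ccont u2 -> ccont u3 ->
    ccont (fun x => z * g x - (u1 x + u2 x + u3 x)).
  move=> ? ? ? ?; apply: ccontB; first by apply: ccontM => //; exact: ccont_cst.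
  by apply: ccontD => //; exact: ccontD.
have L (a : R -> R) (g : R -> C) : continuous a -> ccont g -> ccont (fun x => (a x)%:C * g x).
  by move=> ? ?; apply: ccontM => //; exact: ccont_real.
have c01 := ccontD (cf i4_0) (cf i4_1); have c23 := ccontD (cf i4_2) (cf i4_3).
move: k; apply: ord4P; rewrite /rhsk /=.
- exact: (H _ _ _ _ _ (cf _) (L _ _ cal c01) (L _ _ cbe (cf _)) (L _ _ cc c23)).
- exact: (H _ _ _ _ _ (cf _) (L _ _ cal c01) (L _ _ cbe (cf _)) (L _ _ cc c23)).
- exact: (H _ _ _ _ _ (cf _) (L _ _ cc c01) (L _ _ cd c23) (L _ _ ce (cf _))).
- exact: (H _ _ _ _ _ (cf _) (L _ _ cc c01) (L _ _ cd c23) (L _ _ ce (cf _))).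
Qed.

Lemma Lop_rhsk (psi psi2 : R -> 'cV[C]_(2 + 2)) x :
  Lop om s F m U V psi psi2 x = lam *: psi x ->
  forall k, psi2 x k 0 = rhsk k x (fun j => psi x j 0).
Proof. by move=> /Lop_components[? ? ? ?]; apply: ord4P. Qed.

(** Each component has a continuously differentiable representative. The equation makes the second
    weak derivatives equal, almost everywhere, to continuous functions of these representatives,
    hence classical. The limits at infinity come from square integrability of a function together
    with its derivative. *)
Lemma eigen_classical : L_eigenvalue om s F m U V lam ->
  exists f f' : 'I_(2 + 2) -> R -> C,
  [/\ forall k x, isd (f k) x (f' k x),
      forall k x, isd (f' k) x (rhsk k x (fun j => f j x)),
      forall k, [/\ tends0 (f k), tends0 (fun x => f k (- x)), tends0 (f' k) &
                    tends0 (fun x => f' k (- x))] &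
      ~ forall k x, f k x = 0].
Proof.
move=> [psi [psi1 [psi2 [H2 nz Leq]]]].
have /choice[P PP] : forall k, exists P : (R -> R) * (R -> R),
  [/\ {ae mu, forall x, reF (entry psi k) x = P.1 x}, forall x : R, derR P.1 x (P.2 x),
      continuous P.2,
      mu.-integrable setT (EFin \o (fun x => P.2 x ^+ 2)) &
      forall gam : R -> R, continuous gam ->
        {ae mu, forall x, reF (entry psi2 k) x = gam x} ->
        [/\ forall x : R, derR P.2 x (gam x), vanishes P.1 & vanishes P.2]].
  by move=> k; have [/inH2_rep[P [P1 HP]] _] := H2 k; exists (P, P1).
have /choice[Q QQ] : forall k, exists P : (R -> R) * (R -> R),
  [/\ {ae mu, forall x, imF (entry psi k) x = P.1 x}, forall x : R, derR P.1 x (P.2 x),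
      continuous P.2,
      mu.-integrable setT (EFin \o (fun x => P.2 x ^+ 2)) &
      forall gam : R -> R, continuous gam ->
        {ae mu, forall x, imF (entry psi2 k) x = gam x} ->
        [/\ forall x : R, derR P.2 x (gam x), vanishes P.1 & vanishes P.2]].
  by move=> k; have [_ /inH2_rep[Q [Q1 HQ]]] := H2 k; exists (Q, Q1).
pose f k x : C := (P k).1 x +i* (Q k).1 x.
pose f' k x : C := (P k).2 x +i* (Q k).2 x.
have df k x : isd (f k) x (f' k x).
  by split; [have [_ h _ _ _] := PP k; exact: h|have [_ h _ _ _] := QQ k; exact: h].
have FF := ae_filter_ringOfSetsType mu.
have eqk k : {ae mu, forall x, psi x k 0 = f k x}.
  have [h1 _ _ _ _] := PP k; have [h2 _ _ _ _] := QQ k.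
  apply: filterS2 h1 h2 => x h1 h2; apply: complexP; [exact: h1|exact: h2].
have eqf : {ae mu, forall x, forall k, psi x k 0 = f k x}.
  apply: filterS2 (filterI (eqk i4_0) (eqk i4_1)) (filterI (eqk i4_2) (eqk i4_3)).
  by move=> x [? ?] [? ?]; apply: ord4P.
have eq2 k : {ae mu, forall x, psi2 x k 0 = rhsk k x (fun j => f j x)}.
  apply: filterS2 eqf Leq => x h /Lop_rhsk/(_ k) ->; congr rhsk.
  by apply/funext => j; exact: h.
have cf k : ccont (f k) by exact: isd_ccont (df k).
have R1 k : [/\ forall x : R, derR (P k).2 x (complex.Re (rhsk k x (fun j => f j x))),
    vanishes (P k).1 & vanishes (P k).2].
  have [_ _ _ _] := PP k; apply; first by have [] := ccont_rhs k cf.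
  by move: (eq2 k); apply: filterS => x h; rewrite /reF /entry h.
have I1 k : [/\ forall x : R, derR (Q k).2 x (complex.Im (rhsk k x (fun j => f j x))),
    vanishes (Q k).1 & vanishes (Q k).2].
  have [_ _ _ _] := QQ k; apply; first by have [] := ccont_rhs k cf.
  by move: (eq2 k); apply: filterS => x h; rewrite /imF /entry h.
exists f, f'; split => //.
- by move=> k x; have [a _ _] := R1 k; have [b _ _] := I1 k; split; [exact: a|exact: b].
- move=> k; have [_ a1 a2] := R1 k; have [_ b1 b2] := I1 k.
  have [] := @vanishes_tends0 _ (f k) a1 b1; have [] := @vanishes_tends0 _ (f' k) a2 b2.
  by split.
- move=> f0; apply: nz; move: eqf; apply: filterS => x h; apply/matrixP => k j.
  by rewrite ord1 mxE h f0.
Qed.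

End ClassicalEigenfunctions.

(** * Size and decay of the coefficients *)

Section Regularity.
Variable R : realType.
Implicit Types (G : R -> R -> R -> R) (a b m x : R).

Definition box (M : R) : set (R * R * R) := (`[- M, M] `*` `[- M, M]) `*` `[- M, M].

Lemma continuous_box_bounded G (M : R) : Ck 0 G ->
  exists2 L : R, 0 <= L & forall a b m, `|a| <= M -> `|b| <= M -> `|m| <= M ->
    `|G a b m| <= L.
Proof.
move=> cG; have cB : compact (box M).
  by apply: compact_setX; [apply: compact_setX|]; exact: segment_compact.
have := @continuous_compact _ _ (fun z : R * R * R => G z.1.1 z.1.2 z.2) _
  (continuous_subspaceT cG) cB.
move=> /compact_bounded[L [_ LP]]; exists (`|L| + 1); first by rewrite addr_ge0.
move=> a b m aM bM mM; apply: (LP (`|L| + 1)); first by rewrite (le_lt_trans (ler_norm L)) // ltrDl.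
by exists ((a, b), m) => //; rewrite /box /= !in_itv /= -!ler_norml.
Qed.

Lemma MVT_lip (f f' : R -> R) (L M : R) : (forall x, derR f x (f' x)) ->
  (forall x, `|x| <= M -> `|f' x| <= L) ->
  forall x y, `|x| <= M -> `|y| <= M -> `|f x - f y| <= L * `|x - y|.
Proof.
move=> df fL.
have key x y : y < x -> `|x| <= M -> `|y| <= M -> `|f x - f y| <= L * `|x - y|.
  move=> yx xM yM; have [c /andP[yc cx] ->] := MVT_derR yx (fun t _ => df t).
  rewrite normrM ler_wpM2r // fL //.
  by move: xM yM; rewrite !ler_norml => /andP[? ?] /andP[? ?]; apply/andP; split; lra.
move=> x y xM yM; case: (ltgtP y x) => yx.
- exact: key.
- by rewrite distrC [`|x - y|]distrC; exact: key.
- by rewrite yx !subrr !normr0 mulr0.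
Qed.

(** One argument is moved at a time, with the mean value theorem for each. *)
Lemma Ck1_lip G (M : R) : Ck 1 G -> exists2 L : R, 0 <= L &
  forall a b m a' b' m', `|a| <= M -> `|b| <= M -> `|m| <= M ->
    `|a'| <= M -> `|b'| <= M -> `|m'| <= M ->
    `|G a b m - G a' b' m'| <= L * (`|a - a'| + `|b - b'| + `|m - m'|).
Proof.
move=> [dG c1 c2 c3].
have [L1 L10 H1] := continuous_box_bounded M c1.
have [L2 L20 H2] := continuous_box_bounded M c2.
have [L3 L30 H3] := continuous_box_bounded M c3.
exists (L1 + L2 + L3); first by rewrite !addr_ge0.
move=> a b m a' b' m' aM bM mM aM' bM' mM'.
have D1 := @MVT_lip (fun z => G z b m) (fun z => d1 G z b m) L1 M
  (fun x => let: And3 h _ _ := dG x b m in derivable_derR h) (fun x xM => H1 x b m xM bM mM)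
  a a' aM aM'.
have D2 := @MVT_lip (fun z => G a' z m) (fun z => d2 G a' z m) L2 M
  (fun x => let: And3 _ h _ := dG a' x m in derivable_derR h) (fun x xM => H2 a' x m aM' xM mM)
  b b' bM bM'.
have D3 := @MVT_lip (fun z => G a' b' z) (fun z => dmu G a' b' z) L3 M
  (fun x => let: And3 _ _ h := dG a' b' x in derivable_derR h) (fun x xM => H3 a' b' x aM' bM' xM)
  m m' mM mM'.
have -> : G a b m - G a' b' m' = (G a b m - G a' b m) + (G a' b m - G a' b' m)
  + (G a' b' m - G a' b' m') by ring.
rewrite (le_trans (ler_normD _ _)) // (le_trans (lerD (ler_normD _ _) (lexx _))) //.
have n1 := normr_ge0 (a - a'); have n2 := normr_ge0 (b - b'); have n3 := normr_ge0 (m - m').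
by move: D1 D2 D3 => /= D1 D2 D3; nra.
Qed.

(** [Ck k.+1] asks continuity of partial derivatives only; that of the function itself is recovered
    from the Lipschitz bound on boxes. *)
Lemma Ck1_cont G : Ck 1 G -> Ck 0 G.
Proof.
move=> G1 [[a b] m] /=.
have [L L0 LP] := Ck1_lip (`|a| + `|b| + `|m| + 1) G1.
apply/cvgrPdist_le => /= e e0; have L1 : 0 < 3 * L + 1 by rewrite ltr_wpDl // mulr_ge0.
have d0 : 0 < Num.min 1 (e / (3 * L + 1)) by rewrite lt_min ltr01 divr_gt0.
exists ([set u | ball (a, b) (Num.min 1 (e / (3 * L + 1))) u], [set t | ball m (Num.min 1 (e / (3 * L + 1))) t]).
  by split; exact: nbhsx_ballx.
move=> [[a' b'] m'] /= [[h1 h2] h3]; move: h1 h2 h3; rewrite /ball /=.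
rewrite !lt_min => /andP[a1 a2] /andP[b1 b2] /andP[m1 m2].
have bnd (u u' : R) : `|u - u'| < 1 -> `|u'| <= `|u| + 1.
  move=> h; have := ler_normB u (u - u'); rewrite opprB addrCA subrr addr0.
  by move: h; lra.
have := bnd _ _ a1; have := bnd _ _ b1; have := bnd _ _ m1.
have na := normr_ge0 a; have nb := normr_ge0 b; have nm := normr_ge0 m.
move=> b3 b2' b1'; have [s1 s2 s3] : [/\ forall t, t <= `|a| + 1 -> t <= `|a| + `|b| + `|m| + 1,
    forall t, t <= `|b| + 1 -> t <= `|a| + `|b| + `|m| + 1 &
    forall t, t <= `|m| + 1 -> t <= `|a| + `|b| + `|m| + 1].
  by clear -na nb nm; split=> t; lra.
have self (t : R) : t <= t + 1 by rewrite lerDl.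
apply: (le_trans (LP a b m a' b' m' (s1 _ (self _)) (s2 _ (self _)) (s3 _ (self _))
  (s1 _ b1') (s2 _ b2') (s3 _ b3))).
have E : e = (e / (3 * L + 1)) * (3 * L + 1) by rewrite divfK // gt_eqF.
have x0 := normr_ge0 (a - a').
move: x0 a2 b2 m2 E; move: (e / _) => t; move: `|a - a'| `|b - b'| `|m - m'| => x y z.
clear -L0; move=> x0 xt yt zt ->; have h : x + y + z <= 3 * t by lra.
by rewrite (le_trans (ler_wpM2l L0 h)) //; lra.
Qed.

Lemma Ck_le k G : Ck k.+1 G -> Ck k G.
Proof.
elim: k G => [|k IHk] G; first exact: Ck1_cont.
by move=> [dG h1 h2 h3]; split; [exact: dG|exact: IHk h1|exact: IHk h2|exact: IHk h3].
Qed.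

Lemma Ck0_comp G (u v : R -> R) m : Ck 0 G -> continuous u -> continuous v ->
  continuous (fun x => G (u x) (v x) m).
Proof.
move=> cG cu cv x.
have H : ((u y, v y), m) @[y --> x] --> ((u x, v x), m).
  exact: (cvg_pair (cvg_pair (cu x) (cv x)) (cvg_cst m)).
exact: (cvg_comp _ (fun z : R * R * R => G z.1.1 z.1.2 z.2) H (cG ((u x, v x), m))).
Qed.

End Regularity.

(** * Exponential decay of solutions of [f'' = Q f] *)

Section ExponentialDecay.
Variable R : realType.

Lemma bounded_of_vanishing (f : R -> R) : continuous f -> vanishes_at_infty f ->
  exists2 M : R, 0 <= M & forall x, `|f x| <= M.
Proof.
move=> cf [/cvgy_eps fy /cvgNy_eps fNy].
have [X XP] := fy 1 ltr01; have [Y YP] := fNy 1 ltr01.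
have /compact_bounded[L [_ LP]] := @continuous_compact _ _ f _
  (continuous_subspaceT cf) (@segment_compact _ Y X).
exists (`|L| + 1) => [|x]; first by rewrite addr_ge0.
have l0 := normr_ge0 L.
have [/XP|xX] := leP X x; first by rewrite subr0; lra.
have [/YP|xY] := leP x Y; first by rewrite subr0; lra.
apply: (LP (`|L| + 1)); first by rewrite (le_lt_trans (ler_norm L)) // ltrDl.
by exists x => //; rewrite /= in_itv /= (ltW xX) (ltW xY).
Qed.

(* [f f'] is nondecreasing, hence [<= 0] as [f -> 0]; therefore [f'^2 - m^2 f^2] is
   nonincreasing, hence [>= 0], and so [(f^2)' <= - 2 m f^2]. *)
Lemma decay_right (f f' Q : R -> R) (m X M : R) : 0 < m ->
  (forall x, X <= x -> derR f x (f' x)) ->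
  (forall x, X <= x -> derR f' x (Q x * f x)) -> (forall x, X <= x -> m ^+ 2 <= Q x) ->
  f x @[x --> +oo] --> (0 : R) -> `|f X| <= M ->
  forall x, X <= x -> `|f x| <= M * expR (- m * (x - X)).
Proof.
move=> m0 df df' Qm /cvgy_eps fy fM.
have dff (x : R) : X <= x -> derR (fun t => f t * f' t) x (f' x * f' x + f x * (Q x * f x)).
  by move=> Xx; exact: derRM (df x Xx) (df' x Xx).
have m2 : 0 < m ^+ 2 by rewrite exprn_gt0.
have ff_le (x : R) : X <= x -> f x * f' x <= 0.
  move=> Xx; rewrite leNgt; apply/negP => d0.
  have mono y : x <= y -> f x * f' x <= f y * f' y.
    move=> xy; apply: (@derR_ge0 R (fun t => f t * f' t) (fun t => f' t * f' t + f t * (Q t * f t)) _ _ xy) => t /andP[xt _].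
      exact: dff (le_trans Xx xt).
    by have := Qm t (le_trans Xx xt); have := sqr_ge0 (f t); have := sqr_ge0 (f' t); rewrite !expr2; nra.
  have [Y YP] := fy 1 ltr01.
  (* From [x] on [f^2] grows with slope at least [2 D], so after a time [1 / D] it is at least 2,
     against the bound 1. *)
  pose D := f x * f' x; pose y := Num.max x Y + D^-1.
  have xy : x <= y by rewrite /y (le_trans (_ : x <= Num.max x Y)) ?le_max ?lexx // lerDl invr_ge0 ltW.
  have h := @derR_le R (fun t => 2 * D * t) (fun t => f t * f t) (fun=> 2 * D)
    (fun t => f' t * f t + f t * f' t) x y xy.
  have {}h : 2 * D * y - 2 * D * x <= f y * f y - f x * f x.
    apply: h => [t _|t /andP[xt _]|t /andP[xt _]].
    - by apply: (derR_eq (derRM (derR_cst (2 * D) t) (derR_id t))); ring.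
    - by have dt := df t (le_trans Xx xt); exact: (derRM dt dt).
    - by have := mono t xt; rewrite -/D; lra.
  have : `|f y - 0| <= 1.
    by apply: YP; rewrite /y (le_trans (_ : Y <= Num.max x Y)) ?le_max ?lexx ?orbT // lerDl invr_ge0 ltW.
  rewrite subr0 ler_norml => /andP[y1 y2].
  have yx : 1 <= D * (y - x).
    have : D * (D^-1) = 1 by rewrite mulfV // gt_eqF.
    have : x <= Num.max x Y by rewrite le_max lexx.
    by move: d0; rewrite -/D /y; move: (Num.max _ _) (D^-1) => u v; nra.
  by have := sqr_ge0 (f x); rewrite expr2; nra.
have key (x : R) : X <= x -> m ^+ 2 * f x ^+ 2 <= f' x ^+ 2.
  move=> Xx; rewrite leNgt; apply/negP => d0.
  pose D := m ^+ 2 * f x ^+ 2 - f' x ^+ 2.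
  have D0 : 0 < D by rewrite subr_gt0.
  have mono y : x <= y -> D <= m ^+ 2 * f y ^+ 2 - f' y ^+ 2.
    move=> xy; apply: (@derR_ge0 R (fun t => m ^+ 2 * f t ^+ 2 - f' t ^+ 2)
       (fun t => m ^+ 2 * (2 * (f t * f' t)) - (2 * (f t * f' t)) * Q t) _ _ xy).
    - move=> t /andP[xt _]; have dt := df t (le_trans Xx xt); have dt' := df' t (le_trans Xx xt).
      rewrite (_ : (fun t => _) = (fun t => m ^+ 2 * (f t * f t) - f' t * f' t)).
        apply: (derR_eq (derRB (derRM (derR_cst (m ^+ 2) t) (derRM dt dt)) (derRM dt' dt'))).
        by ring.
      by apply/funext => u; rewrite !(expr2 (_ u)).
    - move=> t /andP[xt _]; have := Qm t (le_trans Xx xt); have := ff_le t (le_trans Xx xt).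
      by nra.
  have e0 : 0 < Num.min 1 (D / (2 * m ^+ 2)) by rewrite lt_min ltr01 divr_gt0 // mulr_gt0.
  have [Y YP] := fy _ e0; pose y := Num.max x Y.
  have := mono y; rewrite le_max lexx => /(_ isT).
  have : `|f y - 0| <= Num.min 1 (D / (2 * m ^+ 2)) by apply: YP; rewrite le_max lexx orbT.
  rewrite subr0 le_min => /andP[y1 y2].
  have : m ^+ 2 * `|f y| <= D / 2.
    rewrite ler_pdivlMr ?mulr_gt0 // in y2; rewrite ler_pdivlMr //.
    by move: y2; lra.
  have hy : m ^+ 2 * f y ^+ 2 <= m ^+ 2 * `|f y|.
    rewrite -(real_normK (num_real (f y))) ler_wpM2l ?(ltW m2) // expr2.
    by rewrite ler_piMl.
  have := sqr_ge0 (f' y); move: hy D0; rewrite /D; clear; move=> *; lra.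
move=> x Xx.
have H := @gronwall R (fun t => f t * f t) (fun t => f' t * f t + f t * f' t) (- (2 * m)) X x Xx.
have {}H : f x * f x <= expR (- (2 * m) * (x - X)) * (f X * f X).
  apply: H => t /andP[Xt _]; first by have dt := df t Xt; exact: (derRM dt dt).
  have h := key t Xt; have g := ff_le t Xt.
  have : m * (f t * f t) <= - (f t * f' t).
    have ft0 : 0 <= f t * f t by rewrite -expr2 sqr_ge0.
    have l0 : 0 <= m * (f t * f t) by rewrite mulr_ge0 // ltW.
    have r0 : 0 <= - (f t * f' t) by rewrite oppr_ge0.
    rewrite -(@ler_pXn2r _ 2) ?nnegrE // sqrrN.
    have -> : (m * (f t * f t)) ^+ 2 = f t ^+ 2 * (m ^+ 2 * f t ^+ 2) by ring.
    by rewrite exprMn ler_wpM2l ?sqr_ge0.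
  by lra.
have M0 : 0 <= M by exact: le_trans (normr_ge0 _) fM.
rewrite -(@ler_pXn2r _ 2) ?nnegrE ?mulr_ge0 ?expR_ge0 //.
rewrite exprMn [expR _ ^+ 2]expr2 -expRD real_normK ?num_real // [f x ^+ 2]expr2 (le_trans H) //.
have -> : - m * (x - X) + - m * (x - X) = - (2 * m) * (x - X) by ring.
rewrite mulrC ler_wpM2r ?expR_ge0 // -expr2 -real_normK ?num_real //.
by rewrite ler_pXn2r ?nnegrE.
Qed.

(** Beyond [X] this is [decay_right] at both ends; inside, the factor [expR (m * X)] compensates the
    weight. *)
Lemma decay_line (f f' Q : R -> R) (m X M : R) : 0 < m -> 0 <= X ->
  (forall x : R, derR f x (f' x)) -> (forall x : R, derR f' x (Q x * f x)) ->
  (forall x, X <= `|x| -> m ^+ 2 <= Q x) -> vanishes_at_infty f ->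
  (forall x, `|f x| <= M) ->
  forall x, `|f x| <= M * expR (m * X) * expR (- m * `|x|).
Proof.
move=> m0 X0 df df' Qm [fy fNy] fM x.
have M0 : 0 <= M by exact: le_trans (normr_ge0 _) (fM 0).
rewrite -mulrA -expRD.
have [xX|Xx] := leP `|x| X.
  rewrite (le_trans (fM x)) // -[leLHS]mulr1 ler_wpM2l //.
  by rewrite -expR0 ler_expR; nra.
have -> : m * X + - m * `|x| = - m * (`|x| - X) by ring.
have [x0|x0] := leP 0 x.
  rewrite (ger0_norm x0) in Xx *.
  apply: (@decay_right f f' Q) => //; last exact: ltW.
  by move=> y Xy; apply: Qm; rewrite ger0_norm // (le_trans X0).
rewrite (ltr0_norm x0) in Xx *; rewrite -[x in leLHS]opprK.
apply: (@decay_right (fun t => f (- t)) (fun t => - f' (- t)) (fun t => Q (- t)) m X M) => //.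
- by move=> y _; exact: derR_opp (df (- y)).
- by move=> y _; apply: (derR_eq (derRN (derR_opp (df' (- y))))); rewrite opprK.
- by move=> y Xy; apply: Qm; rewrite normrN ger0_norm // (le_trans X0).
- by move/cvgNy_compNP: fNy.
- exact: ltW.
Qed.

End ExponentialDecay.

(** * Pointwise comparison of perturbed and unperturbed coefficients *)

Section PointwiseEstimates.
Variable R : realType.
Variables (F : R -> R -> R -> R) (M A L S : R).
Hypothesis F1 : standing1 F.
Hypotheses (A1 : 1 <= A) (L0 : 0 <= L) (S0 : 0 <= S).

Definition lip_bound (G : R -> R -> R -> R) : Prop := forall a b m a' b' m',
  `|a| <= M -> `|b| <= M -> `|m| <= M -> `|a'| <= M -> `|b'| <= M -> `|m'| <= M ->
  `|G a b m| <= S /\ `|G a b m - G a' b' m'| <= L * (`|a - a'| + `|b - b'| + `|m - m'|).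

Hypotheses (H1 : lip_bound (d1 F)) (H2 : lip_bound (d2 F)) (H11 : lip_bound (d1 (d1 F)))
  (H12 : lip_bound (d1 (d2 F))) (H22 : lip_bound (d2 (d2 F))).

Lemma normB_prod (x y x0 y0 : R) : `|x * y - x0 * y0| <= `|x - x0| * `|y| + `|x0| * `|y - y0|.
Proof.
have -> : x * y - x0 * y0 = (x - x0) * y + x0 * (y - y0) by ring.
by rewrite (le_trans (ler_normD _ _)) // !normrM.
Qed.

(** [F z 0 m] has zero derivative in [m], hence does not depend on [m], and neither does its
    derivative in [z]. *)
Lemma d1F_mu z m : d1 F z 0 m = d1 F z 0 0.
Proof.
have [[dF _ _ _] _ Fm] := F1; rewrite /d1; congr (derive1 _ z); apply/funext => y.
have D (x : R) : derR (fun t : R => F y 0 t) x (0 : R).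
  have [_ _ h] := dF y 0 x; apply: (derR_eq (derivable_derR h)); exact: (Fm y x).
have H : `|F y 0 m - F y 0 0| <= 0 * `|m - 0|.
  apply: (MVT_lip (M := `|m|) D) => [x _| |]; rewrite ?normr0 //.
by rewrite mul0r normr_le0 subr_eq0 in H; exact/eqP.
Qed.

Lemma sum3_le (x y z p q r k : R) : x <= p -> y <= q -> z <= r -> p + q + r = k ->
  x + y + z <= k.
Proof. by move=> xp yq zr <-; rewrite !lerD. Qed.

Variables (eps w u v u0 v1 mu sg : R).
Hypotheses (eps01 : 0 < eps <= 1) (w01 : 0 < w <= 1) (sg1 : `|sg| = 1).
Hypotheses (uu0 : `|u - u0| <= A * eps ^+ 2) (vv1 : `|v - sg * (eps * v1)| <= A * eps ^+ 3)
  (uw : `|u| <= A * w) (u0w : `|u0| <= A * w) (vw : `|v| <= A * w) (v1w : `|v1| <= A * w)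
  (ve : `|v| <= A * eps) (mue : `|mu| <= A * eps ^+ 2).
Hypotheses (uM : u ^+ 2 <= M) (u0M : u0 ^+ 2 <= M) (vM : v ^+ 2 <= M) (muM : `|mu| <= M).

Let A0 : 0 <= A. Proof. by rewrite (le_trans ler01). Qed.
Let e0 : 0 <= eps. Proof. by have /andP[/ltW ? _] := eps01. Qed.
Let w0 : 0 <= w. Proof. by have /andP[/ltW ? _] := w01. Qed.
Let e_le1 : eps <= 1. Proof. by have /andP[_ ?] := eps01. Qed.
Let w_le1 : w <= 1. Proof. by have /andP[_ ?] := w01. Qed.
Let e2 : 0 <= eps ^+ 2. Proof. exact: sqr_ge0. Qed.
Let sqn (t : R) : `|t ^+ 2| = t ^+ 2. Proof. by rewrite ger0_norm ?sqr_ge0. Qed.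
Let M0 : 0 <= M. Proof. by rewrite (le_trans _ uM) // sqr_ge0. Qed.
Let n0 : `|0 : R| <= M. Proof. by rewrite normr0. Qed.
Let nu : `|u ^+ 2| <= M. Proof. by rewrite sqn. Qed.
Let nu0 : `|u0 ^+ 2| <= M. Proof. by rewrite sqn. Qed.
Let nv : `|v ^+ 2| <= M. Proof. by rewrite sqn. Qed.

Let e2_le : eps ^+ 2 <= eps. Proof. by rewrite expr2 ler_piMl. Qed.
Let w2_le : w ^+ 2 <= w. Proof. by rewrite expr2 ler_piMl. Qed.

Let sq_le (t r : R) : 0 <= r -> `|t| <= A * r -> t ^+ 2 <= A ^+ 2 * r ^+ 2.
Proof.
move=> r0 tr; rewrite -exprMn -(real_normK (num_real t)).
by rewrite ler_pXn2r ?nnegrE // mulr_ge0.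
Qed.

Let A2 : 0 <= A ^+ 2. Proof. exact: sqr_ge0. Qed.

Lemma sqr_diff : `|u ^+ 2 - u0 ^+ 2| <= 2 * A ^+ 2 * eps ^+ 2 * w.
Proof.
have -> : u ^+ 2 - u0 ^+ 2 = (u - u0) * (u + u0) by ring.
rewrite normrM; have -> : 2 * A ^+ 2 * eps ^+ 2 * w = (A * eps ^+ 2) * (A * w + A * w) by ring.
by rewrite ler_pM // (le_trans (ler_normD _ _)) // lerD.
Qed.

Lemma sqr_diff1 : `|u ^+ 2 - u0 ^+ 2| <= 2 * A ^+ 2 * eps * w.
Proof.
rewrite (le_trans sqr_diff) // ler_wpM2r // ler_wpM2l // mulr_ge0 //.
Qed.

(** One factor [v] is bounded by [A eps], the other by [A w]: the product has both smallness and
    decay. *)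
Lemma sqr_v : v ^+ 2 <= A ^+ 2 * eps * w.
Proof.
rewrite -(real_normK (num_real v)) expr2.
have -> : A ^+ 2 * eps * w = (A * eps) * (A * w) by ring.
by rewrite ler_pM.
Qed.

Lemma sqr_u : u ^+ 2 <= A ^+ 2 * w.
Proof. by rewrite (le_trans (sq_le w0 uw)) // ler_wpM2l. Qed.

Lemma sqr_u0 : u0 ^+ 2 <= A ^+ 2 * w.
Proof. by rewrite (le_trans (sq_le w0 u0w)) // ler_wpM2l. Qed.

Lemma G_diff G : lip_bound G ->
  `|G (u ^+ 2) (v ^+ 2) mu - G (u0 ^+ 2) 0 0| <= L * (4 * A ^+ 2) * eps ^+ 2.
Proof.
move=> HG; have [_ h] := HG _ _ _ _ _ _ nu nv muM nu0 n0 n0.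
rewrite (le_trans h) // -mulrA ler_wpM2l // !subr0 sqn.
have := sq_le e0 ve; have := sqr_diff.
have : 2 * A ^+ 2 * eps ^+ 2 * w <= 2 * A ^+ 2 * eps ^+ 2.
  by rewrite ler_piMr // mulr_ge0 // mulr_ge0.
have : A * eps ^+ 2 <= A ^+ 2 * eps ^+ 2 by rewrite ler_wpM2r // expr2 ler_peMl.
by move: mue; move=> *; lra.
Qed.

(** The factors [u ^+ 2] and [u ^+ 2 - u0 ^+ 2] supply the decay, so the difference of the second
    derivatives of [F] need only be small in [eps]. *)
Lemma al_estimate : `|d1 (d1 F) (u ^+ 2) (v ^+ 2) mu * u ^+ 2
   - d1 (d1 F) (u0 ^+ 2) 0 0 * u0 ^+ 2| <= (4 * L * A ^+ 4 + 2 * S * A ^+ 2) * eps * w.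
Proof.
rewrite (le_trans (normB_prod _ _ _ _)) // sqn.
have h := G_diff H11; have [g _] := H11 nu0 n0 n0 nu0 n0 n0.
have t1 : `|d1 (d1 F) (u ^+ 2) (v ^+ 2) mu - d1 (d1 F) (u0 ^+ 2) 0 0| * u ^+ 2
   <= (L * (4 * A ^+ 2) * eps) * (A ^+ 2 * w).
  rewrite ler_pM ?sqr_ge0 ?sqr_u // (le_trans h) // ler_wpM2l // !mulr_ge0 //.
have t2 := ler_pM (normr_ge0 _) (normr_ge0 _) g sqr_diff1.
rewrite (le_trans (lerD t1 t2)) // le_eqVlt; apply/orP; left; apply/eqP; ring.
Qed.

(** No factor carries the decay here. It comes from the increments [v ^+ 2] and [u ^+ 2 - u0 ^+ 2],
    both of order [eps w]; the dependence on [mu] drops out by [d1F_mu]. *)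
Lemma be_estimate : `|d1 F (u ^+ 2) (v ^+ 2) mu - d1 F (u0 ^+ 2) 0 0|
  <= 3 * L * A ^+ 2 * eps * w.
Proof.
have -> : d1 F (u ^+ 2) (v ^+ 2) mu - d1 F (u0 ^+ 2) 0 0 =
  (d1 F (u ^+ 2) (v ^+ 2) mu - d1 F (u ^+ 2) 0 mu) + (d1 F (u ^+ 2) 0 0 - d1 F (u0 ^+ 2) 0 0).
  by rewrite (d1F_mu (u ^+ 2) mu); ring.
have [_ h1] := H1 nu nv muM nu n0 muM; have [_ h2] := H1 nu n0 n0 nu0 n0 n0.
rewrite (le_trans (ler_normD _ _)) // (le_trans (lerD h1 h2)) //.
rewrite !subrr !normr0 !addr0 add0r subr0 sqn.
have := ler_wpM2l L0 sqr_v; have := ler_wpM2l L0 sqr_diff1.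
by move=> *; lra.
Qed.

(** [d2 F (u0 ^+ 2) 0 mu] may depend on [mu]. Its variation is of order [eps^2] by the Lipschitz
    bound in [mu], and of order [w^2] since [d2 F] vanishes at the origin; the smaller of the two is
    at most of order [eps w]. *)
Lemma e_estimate : `|d2 F (u ^+ 2) (v ^+ 2) mu - d2 F (u0 ^+ 2) 0 0|
  <= 5 * L * A ^+ 2 * eps * w.
Proof.
have -> : d2 F (u ^+ 2) (v ^+ 2) mu - d2 F (u0 ^+ 2) 0 0 =
  (d2 F (u ^+ 2) (v ^+ 2) mu - d2 F (u ^+ 2) 0 mu) + (d2 F (u ^+ 2) 0 mu - d2 F (u0 ^+ 2) 0 mu)
  + (d2 F (u0 ^+ 2) 0 mu - d2 F (u0 ^+ 2) 0 0) by ring.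
have [_ Z _] := F1; have [_ _ z1] := Z mu; have [_ _ z2] := Z 0.
have [_ h1] := H2 nu nv muM nu n0 muM; have [_ h2] := H2 nu n0 muM nu0 n0 muM.
have [_ h3] := H2 nu0 n0 muM nu0 n0 n0.
have [_ h4] := H2 nu0 n0 muM n0 n0 muM; have [_ h5] := H2 nu0 n0 n0 n0 n0 n0.
rewrite z1 in h4; rewrite z2 in h5; move: h1 h2 h3 h4 h5.
rewrite !subrr !normr0 !addr0 !add0r !subr0 !sqn => h1 h2 h3 h4 h5.
have h6 : `|d2 F (u0 ^+ 2) 0 mu - d2 F (u0 ^+ 2) 0 0| <= 2 * L * A ^+ 2 * (eps * w).
  have [ew|we] := leP eps w.
    rewrite (le_trans h3) // (le_trans (ler_wpM2l L0 mue)) //.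
    have : A * eps ^+ 2 <= A ^+ 2 * (eps * w).
      by rewrite ler_pM // ?expr2 ?ler_peMl // ler_wpM2l.
    have t0 : 0 <= L * (A ^+ 2 * (eps * w)) by rewrite !mulr_ge0.
    move=> /(ler_wpM2l L0) t1; rewrite (le_trans t1) //.
    have -> : 2 * L * A ^+ 2 * (eps * w) = L * (A ^+ 2 * (eps * w)) + L * (A ^+ 2 * (eps * w)).
      by ring.
    by rewrite lerDl.
  rewrite (le_trans (ler_normB _ _)) // (le_trans (lerD h4 h5)) //.
  have : u0 ^+ 2 <= A ^+ 2 * (eps * w).
    by rewrite (le_trans (sq_le w0 u0w)) // ler_wpM2l // expr2 ler_wpM2r // ltW.
  have -> : 2 * L * A ^+ 2 * (eps * w) = L * (A ^+ 2 * (eps * w)) + L * (A ^+ 2 * (eps * w)).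
    by ring.
  by move=> /(ler_wpM2l L0) t1; exact: lerD.
rewrite (le_trans (ler_normD _ _)) // (le_trans (lerD (ler_normD _ _) (lexx _))) //.
apply: (sum3_le (le_trans h1 (ler_wpM2l L0 sqr_v)) (le_trans h2 (ler_wpM2l L0 sqr_diff1)) h6).
by ring.
Qed.

Lemma d_estimate : `|d2 (d2 F) (u ^+ 2) (v ^+ 2) mu * v ^+ 2| <= S * A ^+ 2 * eps * w.
Proof.
have [g _] := H22 nu nv muM nu n0 n0.
have := ler_pM (normr_ge0 _) (sqr_ge0 v) g sqr_v.
by rewrite normrM sqn !mulrA.
Qed.

(** The difference is telescoped so that each term keeps a decaying factor and is at least of second
    order: [D - D0] is of order [eps^2], [v - sg eps v1] of order [eps^3], and [u - u0], of order
    [eps^2], multiplies [eps v1]. *)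
Lemma c_estimate : `|d1 (d2 F) (u ^+ 2) (v ^+ 2) mu * u * v
    - sg * eps * (d1 (d2 F) (u0 ^+ 2) 0 0 * u0 * v1)|
  <= (4 * L * A ^+ 4 + 2 * S * A ^+ 2) * eps ^+ 2 * w.
Proof.
have [g _] := H12 nu0 n0 n0 nu0 n0 n0; have h := G_diff H12.
move: g h; move: (d1 (d2 F) (u ^+ 2) (v ^+ 2) mu) (d1 (d2 F) (u0 ^+ 2) 0 0) => D D0 g h.
have -> : D * u * v - sg * eps * (D0 * u0 * v1) = (D - D0) * (u * v)
  + D0 * (u * (v - sg * (eps * v1)) + (u - u0) * (sg * (eps * v1))) by ring.
have t1 : `|(D - D0) * (u * v)| <= L * (4 * A ^+ 2) * eps ^+ 2 * (A ^+ 2 * w).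
  rewrite normrM ler_pM // normrM.
  rewrite (le_trans (ler_pM (normr_ge0 _) (normr_ge0 _) uw vw)) //.
  have -> : A * w * (A * w) = A ^+ 2 * w * w by ring.
  by rewrite ler_piMr // mulr_ge0.
have t2 : `|u * (v - sg * (eps * v1))| <= A ^+ 2 * eps ^+ 2 * w.
  rewrite normrM (le_trans (ler_pM (normr_ge0 _) (normr_ge0 _) uw vv1)) //.
  have -> : A * w * (A * eps ^+ 3) = A ^+ 2 * eps ^+ 2 * w * eps by ring.
  by rewrite ler_piMr // !mulr_ge0.
have t3 : `|(u - u0) * (sg * (eps * v1))| <= A ^+ 2 * eps ^+ 2 * w.
  rewrite !normrM sg1 mul1r (ger0_norm e0).
  rewrite (le_trans (ler_pM (normr_ge0 _) _ uu0 (ler_wpM2l e0 v1w))) ?mulr_ge0 //.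
  have -> : A * eps ^+ 2 * (eps * (A * w)) = A ^+ 2 * eps ^+ 2 * w * eps by ring.
  by rewrite ler_piMr // !mulr_ge0.
have t4 : `|D0 * (u * (v - sg * (eps * v1)) + (u - u0) * (sg * (eps * v1)))|
    <= S * (A ^+ 2 * eps ^+ 2 * w + A ^+ 2 * eps ^+ 2 * w).
  by rewrite normrM ler_pM // (le_trans (ler_normD _ _)) // lerD.
rewrite (le_trans (ler_normD _ _)) // (le_trans (lerD t1 t4)) //.
rewrite le_eqVlt; apply/orP; left; apply/eqP; ring.
Qed.

Lemma unperturbed_estimates : [/\ `|d1 (d1 F) (u0 ^+ 2) 0 0 * u0 ^+ 2| <= S * A ^+ 2 * w,
  `|d1 F (u0 ^+ 2) 0 0| <= L * A ^+ 2 * w,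
  `|d1 (d2 F) (u0 ^+ 2) 0 0 * u0 * v1| <= S * A ^+ 2 * w &
  `|d2 F (u0 ^+ 2) 0 0| <= L * A ^+ 2 * w].
Proof.
have [_ Z _] := F1; have [_ z1 z2] := Z 0.
have [_ h1] := H1 nu0 n0 n0 n0 n0 n0; have [_ h2] := H2 nu0 n0 n0 n0 n0 n0.
have [g11 _] := H11 nu0 n0 n0 nu0 n0 n0; have [g12 _] := H12 nu0 n0 n0 nu0 n0 n0.
rewrite z1 !subrr normr0 !addr0 !subr0 sqn in h1; rewrite z2 !subrr normr0 !addr0 !subr0 sqn in h2.
move: g11 g12 h1 h2; move: (d1 (d1 F) _ _ _) (d1 (d2 F) _ _ _) (d1 F _ _ _) (d2 F _ _ _).
move=> D11 D12 D1 D2 g11 g12 h1 h2; split.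
- by rewrite normrM sqn -[leRHS]mulrA ler_pM ?sqr_ge0 ?sqr_u0.
- by rewrite (le_trans h1) // -[leRHS]mulrA ler_wpM2l ?sqr_u0.
- rewrite -mulrA normrM -[leRHS]mulrA ler_pM // normrM.
  rewrite (le_trans (ler_pM (normr_ge0 _) (normr_ge0 _) u0w v1w)) //.
  have -> : A * w * (A * w) = A ^+ 2 * w * w by ring.
  by rewrite ler_piMr // mulr_ge0.
- by rewrite (le_trans h2) // -[leRHS]mulrA ler_wpM2l ?sqr_u0.
Qed.

End PointwiseEstimates.

(** * Uniform size and decay of the coefficients along the bifurcated family *)

Section Coefficients.
Variable R : realType.

Lemma Ck1_lip_bound (M : R) (G : R -> R -> R -> R) : Ck 1 G -> exists2 K : R, 0 <= K &
  forall L S, K <= L -> K <= S -> lip_bound M L S G.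
Proof.
move=> G1; have [L L0 LP] := Ck1_lip M G1.
have [S S0 SP] := continuous_box_bounded M (Ck1_cont G1).
exists (L + S) => [|L' S' h1 h2 a b m a' b' m' aM bM mM aM' bM' mM'].
  by rewrite addr_ge0.
split; first by rewrite (le_trans (SP _ _ _ aM bM mM)) // (le_trans _ h2) // lerDr.
rewrite (le_trans (LP _ _ _ _ _ _ aM bM mM aM' bM' mM')) // ler_wpM2r ?addr_ge0 //.
by rewrite (le_trans _ h1) // lerDl.
Qed.

Lemma standing1_Ck (F : R -> R -> R -> R) : standing1 F ->
  [/\ Ck 1 (d1 F), Ck 1 (d2 F), Ck 1 (d1 (d1 F)), Ck 1 (d1 (d2 F)) & Ck 1 (d2 (d2 F))].
Proof.
move=> [[_ F1 F2 _] _ _]; have [_ F11 _ _] := F1; have [_ F12 F22 _] := F2.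
split; [exact: (@Ck_le R 1 (d1 F) F1)|exact: (@Ck_le R 1 (d2 F) F2)|exact: F11|exact: F12|exact: F22].
Qed.

Lemma standing1_bounds (F : R -> R -> R -> R) (M : R) : standing1 F -> exists2 L : R, 0 <= L &
  [/\ lip_bound M L L (d1 F), lip_bound M L L (d2 F), lip_bound M L L (d1 (d1 F)),
      lip_bound M L L (d1 (d2 F)) & lip_bound M L L (d2 (d2 F))].
Proof.
move=> /standing1_Ck[F1 F2 F11 F12 F22].
have [k1 k10 h1] := Ck1_lip_bound M F1.
have [k2 k20 h2] := Ck1_lip_bound M F2.
have [k3 k30 h3] := Ck1_lip_bound M F11.
have [k4 k40 h4] := Ck1_lip_bound M F12.
have [k5 k50 h5] := Ck1_lip_bound M F22.
exists (k1 + k2 + k3 + k4 + k5); first by rewrite !addr_ge0.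
split; [apply: h1|apply: h2|apply: h3|apply: h4|apply: h5]; lra.
Qed.

Lemma second_derivative (f q : R -> R) (om : R) : twice_derivable f ->
  (forall x, - derive1n 2 f x + om * f x - q x * f x = 0) ->
  (forall x : R, derR f x (derive1 f x)) /\
  (forall x : R, derR (derive1 f) x ((om - q x) * f x)).
Proof.
move=> df e; split => x; have [h1 h2] := df x; first exact: derivable_derR.
apply: (derR_eq (derivable_derR h2)); have := e x.
by rewrite -[derive1n 2 f x]/(derive1 (derive1 f) x); lra.
Qed.

Lemma twice_cont (f : R -> R) : twice_derivable f -> continuous f.
Proof. by move=> df x; have [h _] := df x; exact: derR_cont (derivable_derR h). Qed.

Lemma small_tail (f : R -> R) (q : R) : vanishes_at_infty f -> 0 < q ->
  exists2 X : R, 0 <= X & forall x, X <= `|x| -> f x ^+ 2 <= q.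
Proof.
move=> [/cvgy_eps fy /cvgNy_eps fNy] q0.
have e0 : 0 < Num.min 1 q by rewrite lt_min ltr01.
have [X XP] := fy _ e0; have [Y YP] := fNy _ e0.
exists (Num.max 0 (Num.max X (- Y))) => [|x]; first by rewrite le_max lexx.
rewrite !ge_max => /and3P[_ xX xY].
have H : `|f x| <= Num.min 1 q.
  have [x0|x0] := leP 0 x.
    by rewrite ger0_norm // in xX; have := XP x xX; rewrite subr0.
  by rewrite ltr0_norm // lerN2 in xY; have := YP x xY; rewrite subr0.
rewrite le_min in H; case/andP: H => f1 fq.
rewrite -(real_normK (num_real (f x))) expr2 (le_trans _ fq) //.
by rewrite ler_piMl.
Qed.

Lemma sqr_le_abs (t B : R) : `|t| <= B -> t ^+ 2 <= B ^+ 2.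
Proof.
move=> tB; rewrite -(real_normK (num_real t)) ler_pXn2r ?nnegrE //.
exact: le_trans (normr_ge0 _) tB.
Qed.

Lemma sqr_split (a b : R) : a ^+ 2 <= 2 * b ^+ 2 + 2 * (a - b) ^+ 2.
Proof. by have := sqr_ge0 (a - 2 * b); rewrite !expr2; nra. Qed.

Lemma le_sum4 (a b c d : R) : 0 <= a -> 0 <= b -> 0 <= c -> 0 <= d ->
  [/\ a <= 1 + a + b + c + d, b <= 1 + a + b + c + d, c <= 1 + a + b + c + d &
      d <= 1 + a + b + c + d].
Proof. by move=> ? ? ? ?; split; lra. Qed.

Lemma le_weights (P Q C : R) : 0 <= P -> 0 <= Q -> C = 4 * P + 8 * Q ->
  [/\ 0 <= C, 4 * P + 2 * Q <= C, 3 * Q <= C, 5 * Q <= C & Q <= C].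
Proof. by move=> ? ? ->; split; lra. Qed.

Lemma half_le (a c : R) : 0 < a -> a < c -> a / 2 <= a + c /\ a / 2 <= 2 * c.
Proof. by move=> ? ?; split; lra. Qed.

Lemma le_quarter (n e a : R) : 0 <= e -> e * (4 * (n + 1)) <= a -> n * e * 4 <= a.
Proof. by move=> ? ?; lra. Qed.

Lemma above_half (a c q : R) : 0 < a -> a <= c -> `|q| <= a / 2 -> a / 2 <= c - q.
Proof. by move=> ? ? /(le_trans (ler_norm _)) ?; lra. Qed.

Lemma eighth_le (l a t : R) : 0 <= l -> 0 <= a -> t <= a / (8 * (l + 1)) -> l * t <= a / 8.
Proof.
move=> l0 a0 h; have l1 : 0 < l + 1 by rewrite ltr_wpDl.
apply: (le_trans (ler_wpM2l l0 h)).
have -> : l * (a / (8 * (l + 1))) = a / 8 * (l / (l + 1)) by field; rewrite !gt_eqF.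
by rewrite ler_piMr ?divr_ge0 // ler_pdivrMr // mul1r lerDl.
Qed.

Lemma tail_sum (u v p q a c e : R) : u <= 2 * p + 2 * q -> q <= a * e -> v <= c * e ->
  u + v <= 2 * p + (2 * a + c) * e.
Proof. by move=> ? ? ?; lra. Qed.

Variables (om s : R) (F : R -> R -> R -> R) (mubar : R) (U0 V1 U2 : R -> R)
  (Ueps Veps : R -> R -> R).
Hypotheses (om0 : 0 < om) (oms : om < s) (F1 : standing1 F) (gs : ground_state F om U0)
  (st3 : standing3 F s U0 V1)
  (bif : bifurcated_family F om s mubar U0 V1 U2 Ueps Veps).

(** At the fixed value [e = ee / 2] the expansion of [Ueps] expresses [U2] through [Ueps e], [U0]
    and a bounded error, which bypasses the integrals that define it. *)
Lemma second_profile_bounded : exists2 M : R, 0 <= M & forall x, `|U2 x| <= M.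
Proof.
have [sg [_ [ee [K [ee0 H]]]]] := bif.
have [dU0 _ vU0 _ _] := gs.
have [M0 M00 U0M] := bounded_of_vanishing (twice_cont dU0) vU0.
pose e := ee / 2; have e0 : 0 < e by rewrite divr_gt0.
have eR : 0 < e < ee by rewrite e0 /= /e ltr_pdivrMr //; have ? := ee0; lra.
have [[dUe _ _ vUe _] HU _] := H e eR.
have [M1 M10 U1M] := bounded_of_vanishing (twice_cont dUe) vUe.
have e2 : 0 < e ^+ 2 by rewrite exprn_gt0.
exists ((M1 + M0 + `|K| * e ^+ 4) / e ^+ 2).
  by rewrite divr_ge0 ?(ltW e2) // !addr_ge0 // mulr_ge0 // exprn_ge0 // ltW.
move=> x; rewrite ler_pdivlMr // -[X in _ * X](gtr0_norm e2) -normrM mulrC.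
have -> : e ^+ 2 * U2 x = Ueps e x - U0 x - (Ueps e x - (U0 x + e ^+ 2 * U2 x)) by ring.
rewrite (le_trans (ler_normB _ _)) // lerD //.
  by rewrite (le_trans (ler_normB _ _)) // lerD.
by rewrite (le_trans (HU x)) // ler_wpM2r ?ler_norm // exprn_ge0 // ltW.
Qed.

(** The decay rate is uniform in [eps] because the perturbed profiles are uniformly close to the
    unperturbed ones: all potentials are at most [om / 2] outside one compact set, and [decay_line]
    applies to every profile there. The coefficients are then compared pointwise. *)
Lemma coefficient_estimates : exists b C0 e1 sg : R,
  [/\ [/\ 0 < b, b <= Num.sqrt (om + s) & b <= Num.sqrt (2 * s)],
      [/\ 0 <= C0, 0 < e1, e1 <= 1 & `|sg| = 1],
      forall x, let w := expR (- b * `|x|) in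
      [/\ `|d1 (d1 F) (U0 x ^+ 2) 0 0 * U0 x ^+ 2| <= C0 * w,
          `|d1 F (U0 x ^+ 2) 0 0| <= C0 * w,
          `|d1 (d2 F) (U0 x ^+ 2) 0 0 * U0 x * V1 x| <= C0 * w &
          `|d2 F (U0 x ^+ 2) 0 0| <= C0 * w],
      forall eps, 0 < eps < e1 -> forall x,
      let w := expR (- b * `|x|) in let mu := mubar * eps ^+ 2 in
      [/\ `|alF F mu (Ueps eps) (Veps eps) x - d1 (d1 F) (U0 x ^+ 2) 0 0 * U0 x ^+ 2|
             <= C0 * eps * w,
          `|beF F mu (Ueps eps) (Veps eps) x - d1 F (U0 x ^+ 2) 0 0| <= C0 * eps * w,
          `|cF F mu (Ueps eps) (Veps eps) x
             - sg * eps * (d1 (d2 F) (U0 x ^+ 2) 0 0 * U0 x * V1 x)| <= C0 * eps ^+ 2 * w,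
          `|dF F mu (Ueps eps) (Veps eps) x| <= C0 * eps * w &
          `|eF F mu (Ueps eps) (Veps eps) x - d2 F (U0 x ^+ 2) 0 0| <= C0 * eps * w] &
      forall eps, 0 < eps < e1 -> continuous (Ueps eps) /\ continuous (Veps eps)].
Proof.
have [sg [sgP [ee [K [ee0 H]]]]] := bif.
have sg1 : `|sg| = 1 by case: sgP => ->; rewrite ?normrN normr1.
have [dU0 eU0 vU0 _ _] := gs; have [dV1 eV1 _ _ vV1] := st3.
have [M0 M00 U0M] := bounded_of_vanishing (twice_cont dU0) vU0.
have [M1 M10 V1M] := bounded_of_vanishing (twice_cont dV1) vV1.
have [M2 M20 U2M] := second_profile_bounded.
have [A_ A_E] : exists A_ : R, A_ = M2 + `|K| by eexists.
have [B BE] : exists B : R, B = M1 + `|K| by eexists.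
have A_0 : 0 <= A_ by rewrite A_E addr_ge0.
have B0 : 0 <= B by rewrite BE addr_ge0.
have [Mb MbE] : exists Mb : R, Mb = (M0 + A_) ^+ 2 + B ^+ 2 + `|mubar| by eexists.
have Mb0 : 0 <= Mb by rewrite MbE !addr_ge0 ?sqr_ge0.
have [L L0 [H1 H2 H11 H12 H22]] := standing1_bounds Mb F1.
(* [b ^+ 2 = om / 2] keeps the other half of [om], which is less than [s], as a margin for the
   potentials. *)
pose b := Num.sqrt (om / 2).
have o2 : 0 < om / 2 by rewrite divr_gt0.
have b0 : 0 < b by rewrite sqrtr_gt0.
have b2 : b ^+ 2 = om / 2 by rewrite sqr_sqrtr // ltW.
(* Once [U0 ^+ 2] is below this level, the potentials at the unperturbed wave are at most
   [om / 8]. *)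
have q0 : 0 < om / (8 * (L + 1)) by rewrite divr_gt0 // mulr_gt0 // ltr_wpDl.
have [X X0 XP] := small_tail vU0 q0.
have Lq (t : R) : t <= om / (8 * (L + 1)) -> L * t <= om / 8.
  exact: (eighth_le L0 (ltW om0)).
have [N NE] : exists N : R, N = L * (2 * A_ ^+ 2 + B ^+ 2) by eexists.
have N0 : 0 <= N by rewrite NE mulr_ge0 // addr_ge0 ?sqr_ge0 // mulr_ge0 ?sqr_ge0.
(* This makes [N eps^2] at most [om / 4]; with twice [om / 8] it fills the budget [om / 2] of the
   perturbed potentials. *)
have p0 : 0 < om / (4 * (N + 1)) by rewrite divr_gt0 // mulr_gt0 // ltr_wpDl.
pose e1 := Num.min ee (Num.min 1 (om / (4 * (N + 1)))).
have e10 : 0 < e1 by rewrite !lt_min ee0 ltr01.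
have [_ Z _] := F1.
have zb : `|0 : R| <= Mb by rewrite normr0.
have dist1 u v m : `|u ^+ 2| <= Mb -> `|v ^+ 2| <= Mb -> `|m| <= Mb ->
    `|d1 F (u ^+ 2) (v ^+ 2) m| <= L * (u ^+ 2 + v ^+ 2) /\
    `|d2 F (u ^+ 2) (v ^+ 2) m| <= L * (u ^+ 2 + v ^+ 2).
  move=> uM vM mM; have [_ z1 z2] := Z m.
  have [_ h1] := H1 _ _ _ _ _ _ uM vM mM zb zb mM.
  have [_ h2] := H2 _ _ _ _ _ _ uM vM mM zb zb mM.
  rewrite z1 !subr0 subrr normr0 addr0 !(ger0_norm (sqr_ge0 _)) in h1.
  by rewrite z2 !subr0 subrr normr0 addr0 !(ger0_norm (sqr_ge0 _)) in h2; split.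
have u0b x : `|U0 x ^+ 2| <= Mb.
  rewrite ger0_norm ?sqr_ge0 // (le_trans (sqr_le_abs (le_trans (U0M x) _ : _ <= M0 + A_))) //.
    by rewrite lerDl.
  by rewrite MbE -addrA lerDl addr_ge0 ?sqr_ge0.
have E1 : 1 <= expR (b * X) by rewrite -expR0 ler_expR mulr_ge0 // ltW.
have E0 : 0 <= expR (b * X) by exact: expR_ge0.
have om8 : om / 8 <= om / 2 by rewrite ler_pM2l // lef_pV2 ?posrE // ler_nat.
have half (t : R) : L * t <= om / 8 -> `|d1 F t 0 0| <= L * t -> b ^+ 2 <= om - d1 F t 0 0.
  move=> h1 h2; rewrite b2; apply: (above_half om0 (lexx om)).
  exact: (le_trans h2 (le_trans h1 om8)).
have halfs (t : R) : L * t <= om / 8 -> `|d2 F t 0 0| <= L * t -> b ^+ 2 <= s - d2 F t 0 0.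
  move=> h1 h2; rewrite b2; apply: (above_half om0 (ltW oms)).
  exact: (le_trans h2 (le_trans h1 om8)).
have zer : (0 : R) ^+ 2 = 0 by rewrite expr0n.
have [D0 D0'] := second_derivative dU0 eU0.
have [D1 D1'] := second_derivative dV1 eV1.
have z2b : `|(0 : R) ^+ 2| <= Mb by rewrite zer.
have U0w := @decay_line R U0 _ _ b X M0 b0 X0 D0 D0' _ vU0 U0M.
have {}U0w x : `|U0 x| <= M0 * expR (b * X) * expR (- b * `|x|).
  apply: U0w => y Xy; have [+ _] := dist1 (U0 y) 0 0 (u0b y) z2b zb.
  by rewrite zer addr0; apply: half; exact: Lq (XP y Xy).
have V1w := @decay_line R V1 _ _ b X M1 b0 X0 D1 D1' _ vV1 V1M.
have {}V1w x : `|V1 x| <= M1 * expR (b * X) * expR (- b * `|x|).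
  apply: V1w => y Xy; have [_ +] := dist1 (U0 y) 0 0 (u0b y) z2b zb.
  by rewrite zer addr0; apply: halfs; exact: Lq (XP y Xy).
have [A AE] : exists A : R, A = 1 + (M0 + A_) * expR (b * X) + B * expR (b * X)
  + M1 * expR (b * X) + `|mubar| by eexists.
have [Aa Ab Ac Ad] : [/\ (M0 + A_) * expR (b * X) <= A, B * expR (b * X) <= A,
    M1 * expR (b * X) <= A & `|mubar| <= A].
  have h1 : 0 <= (M0 + A_) * expR (b * X) by rewrite mulr_ge0 ?addr_ge0.
  have h2 : 0 <= B * expR (b * X) by rewrite mulr_ge0.
  have h3 : 0 <= M1 * expR (b * X) by rewrite mulr_ge0.
  by have := le_sum4 h1 h2 h3 (normr_ge0 mubar); rewrite -AE.
have A1 : 1 <= A by rewrite AE -!addrA lerDl !addr_ge0 // mulr_ge0 // addr_ge0.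
have Ae : A_ <= A.
  rewrite (le_trans _ Aa) // (le_trans (_ : _ <= M0 + A_)) ?lerDr //.
  by rewrite ler_peMr // addr_ge0.
have Af : B <= A by rewrite (le_trans _ Ab) // ler_peMr.
have Ag : M0 * expR (b * X) <= A by rewrite (le_trans _ Aa) // ler_wpM2r // lerDl.
have w01 (x : R) : 0 < expR (- b * `|x|) <= 1.
  by rewrite expR_gt0 /= -expR0 ler_expR mulNr oppr_le0 mulr_ge0 // ltW.
have w0 (x : R) : 0 <= expR (- b * `|x|) by exact: expR_ge0.
have A20 : 0 <= L * A ^+ 2 by rewrite mulr_ge0 ?sqr_ge0.
have A40 : 0 <= L * A ^+ 4 by rewrite mulr_ge0 // exprn_ge0 // (le_trans ler01).
have [C0 C0E] : exists C0 : R, C0 = 4 * (L * A ^+ 4) + 8 * (L * A ^+ 2) by eexists.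
have [C0_ c1 c2 c3 c4] := le_weights A40 A20 C0E; rewrite !(mulrA _ L) in c1 c2 c3.
have e1P eps : 0 < eps < e1 ->
  [/\ 0 < eps < ee, 0 < eps <= 1, eps ^+ 2 <= eps & N * eps ^+ 2 <= om / 4].
  rewrite !lt_min => /andP[p /and3P[pe p1 pN]]; have p2 : eps ^+ 2 <= eps.
    by rewrite expr2 ler_piMl ?(ltW p) // ltW.
  split => //; [by rewrite p|by rewrite p ltW|].
  rewrite (le_trans (ler_wpM2l N0 p2)) //.
  have := ltW pN; rewrite ler_pdivlMr ?mulr_gt0 ?ltr_wpDl // ler_pdivlMr //.
  exact: le_quarter (ltW p).
have near eps x : 0 < eps < e1 -> [/\ `|Ueps eps x - U0 x| <= A_ * eps ^+ 2,
    `|Veps eps x - sg * (eps * V1 x)| <= `|K| * eps ^+ 3, `|Ueps eps x| <= M0 + A_ &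
    `|Veps eps x| <= B * eps].
  move=> pe; have [pe1 /andP[p p1] p2 _] := e1P eps pe; have [_ h1 h2] := H eps pe1.
  have e2 := sqr_ge0 eps; have e20 := ltW p.
  have n1 : `|Ueps eps x - U0 x| <= A_ * eps ^+ 2.
    have -> : Ueps eps x - U0 x = (Ueps eps x - (U0 x + eps ^+ 2 * U2 x)) + eps ^+ 2 * U2 x.
      by ring.
    rewrite (le_trans (ler_normD _ _)) // A_E mulrDl addrC lerD //.
      by rewrite normrM (ger0_norm e2) mulrC ler_wpM2r.
    rewrite (le_trans (h1 x)) // (le_trans (ler_wpM2r _ (ler_norm K))) ?exprn_ge0 //.
    rewrite ler_wpM2l // (_ : eps ^+ 4 = eps ^+ 2 * eps ^+ 2); last by ring.
    by rewrite ler_piMr // (le_trans p2).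
  have n2 : `|Veps eps x - sg * (eps * V1 x)| <= `|K| * eps ^+ 3.
    by rewrite (le_trans (h2 x)) // ler_wpM2r ?ler_norm // exprn_ge0.
  split => //.
    have -> : Ueps eps x = U0 x + (Ueps eps x - U0 x) by ring.
    rewrite (le_trans (ler_normD _ _)) // lerD // (le_trans n1) // ler_piMr //.
    by rewrite (le_trans p2).
  have -> : Veps eps x = sg * (eps * V1 x) + (Veps eps x - sg * (eps * V1 x)) by ring.
  rewrite (le_trans (ler_normD _ _)) // BE mulrDl lerD //.
    by rewrite !normrM sg1 mul1r (ger0_norm e20) mulrC ler_wpM2r.
  rewrite (le_trans n2) // ler_wpM2l // (_ : eps ^+ 3 = eps ^+ 2 * eps); last by ring.
  by rewrite ler_piMl // (le_trans p2).
exists b, C0, e1, sg; split.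
- have s0 := lt_trans om0 oms.
  split => //; rewrite ler_sqrt ?addr_ge0 ?mulr_ge0 ?(ltW om0) ?(ltW s0) //.
    exact: (half_le om0 oms).1.
  exact: (half_le om0 oms).2.
- split => //; by rewrite !ge_min lexx orbT.
- move=> x w; have Mu := u0b x; rewrite (ger0_norm (sqr_ge0 _)) in Mu.
  have [h1 h2 h3 h4] := unperturbed_estimates F1 A1 L0 H1 H2 H11 H12 (w01 x)
    (le_trans (U0w x) (ler_wpM2r (w0 x) Ag)) (le_trans (V1w x) (ler_wpM2r (w0 x) Ac)) Mu Mu.
  have le_C0 := ler_wpM2r (w0 x) c4.
  by split; [exact: le_trans h1 le_C0|exact: le_trans h2 le_C0|exact: le_trans h3 le_C0
    |exact: le_trans h4 le_C0].
- move=> eps pe x w mu; have [pe1 p01 p2 pN] := e1P eps pe.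
  have [p p1] := andP p01; have e20 := sqr_ge0 eps.
  have Mu0 := u0b x; rewrite (ger0_norm (sqr_ge0 _)) in Mu0.
  have abnd (y : R) : Ueps eps y ^+ 2 <= Mb /\ Veps eps y ^+ 2 <= Mb.
    have [_ _ h3 h4] := near eps y pe; split.
      rewrite (le_trans (sqr_le_abs h3)) // MbE -addrA lerDl addr_ge0 ?sqr_ge0 //.
    have h5 : `|Veps eps y| <= B by rewrite (le_trans h4) // ler_piMr.
    by rewrite (le_trans (sqr_le_abs h5)) // MbE addrAC lerDr addr_ge0 ?sqr_ge0.
  have muM : `|mu| <= Mb.
    rewrite normrM (ger0_norm e20) MbE (le_trans (_ : _ <= `|mubar|)) ?ler_piMr //.
      by rewrite (le_trans p2).
    by rewrite lerDr addr_ge0 ?sqr_ge0.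
  have muE : `|mu| <= A * eps ^+ 2.
    by rewrite normrM (ger0_norm e20) ler_wpM2r.
  have small y : X <= `|y| -> L * (Ueps eps y ^+ 2 + Veps eps y ^+ 2) <= om / 2.
    move=> Xy; have [h1 _ _ h4] := near eps y pe.
    have s1 := sqr_split (Ueps eps y) (U0 y); have s2 := sqr_le_abs h1; have s3 := sqr_le_abs h4.
    have s4 := Lq _ (XP y Xy).
    have s5 : (A_ * eps ^+ 2) ^+ 2 <= A_ ^+ 2 * eps ^+ 2.
      by rewrite exprMn ler_wpM2l ?sqr_ge0 // expr2 ler_piMr // (le_trans p2).
    have s6 : Ueps eps y ^+ 2 + Veps eps y ^+ 2 <=
        2 * U0 y ^+ 2 + (2 * A_ ^+ 2 + B ^+ 2) * eps ^+ 2.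
      by rewrite exprMn in s3; exact: tail_sum s1 (le_trans s2 s5) s3.
    apply: (le_trans (ler_wpM2l L0 s6)).
    have -> : om / 2 = 2 * (om / 8) + om / 4 by field.
    have -> : L * (2 * U0 y ^+ 2 + (2 * A_ ^+ 2 + B ^+ 2) * eps ^+ 2) =
      2 * (L * U0 y ^+ 2) + N * eps ^+ 2 by rewrite NE; ring.
    by rewrite lerD // ler_wpM2l.
  have [[dUe dVe eUV vUe vVe] _ _] := H eps pe1.
  have [Du Du'] := @second_derivative (Ueps eps)
    (fun y => d1 F (Ueps eps y ^+ 2) (Veps eps y ^+ 2) mu) om dUe (fun y => (eUV y).1).
  have [Dv Dv'] := @second_derivative (Veps eps)
    (fun y => d2 F (Ueps eps y ^+ 2) (Veps eps y ^+ 2) mu) s dVe (fun y => (eUV y).2).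
  have dd y : X <= `|y| -> `|d1 F (Ueps eps y ^+ 2) (Veps eps y ^+ 2) mu| <= om / 2 /\
      `|d2 F (Ueps eps y ^+ 2) (Veps eps y ^+ 2) mu| <= om / 2.
    move=> Xy; have [m1 m2] := abnd y; have [] := dist1 (Ueps eps y) (Veps eps y) mu.
    - by rewrite ger0_norm ?sqr_ge0.
    - by rewrite ger0_norm ?sqr_ge0.
    - exact: muM.
    by move=> h1 h2; split; [exact: le_trans h1 (small y Xy)|exact: le_trans h2 (small y Xy)].
  have Uw : `|Ueps eps x| <= A * w.
    have Ub y : `|Ueps eps y| <= M0 + A_ by have [] := near eps y pe.
    apply: (le_trans (decay_line b0 X0 Du Du' _ vUe Ub x)); last exact: ler_wpM2r.
    by move=> y /dd[h _]; rewrite b2; exact: (above_half om0 (lexx om) h).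
  have Vw : `|Veps eps x| <= A * w.
    have Vb y : `|Veps eps y| <= B.
      by have [_ _ _ h] := near eps y pe; rewrite (le_trans h) // ler_piMr.
    apply: (le_trans (decay_line b0 X0 Dv Dv' _ vVe Vb x)); last exact: ler_wpM2r.
    by move=> y /dd[_ h]; rewrite b2; exact: (above_half om0 (ltW oms) h).
  have [n1 n2 _ n4] := near eps x pe; have [uM vM] := abnd x.
  have n1' : `|Ueps eps x - U0 x| <= A * eps ^+ 2 by rewrite (le_trans n1) // ler_wpM2r.
  have n2' : `|Veps eps x - sg * (eps * V1 x)| <= A * eps ^+ 3.
    rewrite (le_trans n2) // ler_wpM2r ?exprn_ge0 ?(ltW p) // (le_trans _ Af) //.
    by rewrite BE lerDr.
  have n4' : `|Veps eps x| <= A * eps by rewrite (le_trans n4) // ler_wpM2r // ltW.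
  have u0w := le_trans (U0w x) (ler_wpM2r (w0 x) Ag).
  have v1w := le_trans (V1w x) (ler_wpM2r (w0 x) Ac).
  have lift (t c : R) : c <= C0 -> t <= c * eps * w -> t <= C0 * eps * w.
    by move=> cC h; apply: (le_trans h); rewrite ler_wpM2r ?w0 ?ler_wpM2r ?(ltW p).
  split.
  - exact: lift c1 (al_estimate A1 L0 H11 p01 (w01 x) n1' Uw u0w n4' muE uM Mu0 vM muM).
  - exact: lift c2 (be_estimate F1 L0 H1 p01 (w01 x) n1' Uw u0w Vw n4' uM Mu0 vM muM).
  - rewrite (le_trans (c_estimate A1 L0 H12 p01 (w01 x) sg1 n1' n2' Uw u0w Vw v1w n4' muE
      uM Mu0 vM muM)) // ler_wpM2r // ler_wpM2r //.
  - exact: lift c4 (d_estimate H22 Vw n4' uM vM muM).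
  - exact: lift c3 (e_estimate F1 A1 L0 H2 p01 (w01 x) n1' Uw u0w Vw n4' muE uM Mu0 vM muM).
move=> eps /e1P[/H[[dU dV _ _ _] _ _] _ _ _]; split; exact: twice_cont.
Qed.

End Coefficients.

(** * Jost solutions at the branch point *)

Section Exponents.
Variable R : realType.
Notation C := R[i].

(** The other root [- n] is ruled out by the last hypothesis, so the choice made by [xget] is
    forced. *)
Lemma sqrt_argE (a b : R) (z n : C) : n ^+ 2 = z -> arg_in a b n -> ~ arg_in a b (- n) ->
  sqrt_arg a b z = n.
Proof.
move=> nz an nan; rewrite /sqrt_arg.
have H : [set n : C | n ^+ 2 = z /\ (n = 0 \/ arg_in a b n)] n by split=> //; right.
have n0 : n <> 0.
  move=> n0; apply: nan; rewrite n0 oppr0; by rewrite n0 in an.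
case: (xgetPex 0 (ex_intro _ n H)); set m := xget _ _ => m2 am.
have /eqP : m ^+ 2 = n ^+ 2 by rewrite m2 nz.
rewrite eqf_sqr => /orP[/eqP//|/eqP mn]; exfalso; case: am => [m0|]; last by rewrite mn.
by apply: n0; apply/eqP; rewrite -oppr_eq0 -mn m0.
Qed.

Lemma sqrt_arg0 (a b : R) : sqrt_arg a b (0 : C) = 0.
Proof.
have H : [set n : C | n ^+ 2 = 0 /\ (n = 0 \/ arg_in a b n)] 0.
  by split; [rewrite expr0n|left].
have [/eqP + _] := xgetPex 0 (ex_intro _ (0 : C) H).
by rewrite expf_eq0 /= => /eqP.
Qed.

Lemma sqrt_arg_pos (r : R) : 0 < r ->
  sqrt_arg (- (3 * pi / 4)) (pi / 4) (r ^+ 2)%:C = r%:C.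
Proof.
move=> r0; have p0 := pi_gt0 R; apply: sqrt_argE.
- by rewrite -rmorphXn.
- exists r, 0; split => //; first by apply/andP; split; lra.
  by rewrite cos0 sin0; apply: complexP; rewrite !(reM, imM) /=; ring.
case=> q [t [q0 /andP[t1 t2] E]].
have := congr1 (@complex.Re R) E; have := congr1 (@complex.Im R) E.
rewrite !(reM, imM, reN, imN) /= !mul0r subr0 addr0 oppr0 => hi hr.
have s0 : sin t = 0.
  by apply/eqP; move/esym/eqP: hi; rewrite mulf_eq0 (gt_eqF q0).
have c0 : cos t < 0 by rewrite -(pmulr_rlt0 _ q0) -hr oppr_lt0.
have [t0|t0|t0] := ltgtP t 0.
- have := @sin_gt0_pi R (- t); rewrite sinN s0 oppr0 ltxx => H.
  by have := H ltac:(apply/andP; split; lra).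
- have := @sin_gt0_pi R t; rewrite s0 ltxx => H.
  by have := H ltac:(apply/andP; split; lra).
- by rewrite t0 cos0 in c0; lra.
Qed.

(** The range of arguments contains [pi / 2] and not [- pi / 2], so a negative number has its root
    on the positive imaginary axis. *)
Lemma sqrt_arg_neg (r : R) : 0 < r ->
  sqrt_arg (- (pi / 4)) (3 * pi / 4) (- r ^+ 2)%:C = 'i * r%:C.
Proof.
move=> r0; have p0 := pi_gt0 R; apply: sqrt_argE.
- by rewrite exprMn sqr_i mulN1r -rmorphXn -rmorphN.
- exists r, (pi / 2); split => //; first by apply/andP; split; lra.
  by rewrite cos_pihalf sin_pihalf; apply: complexP; rewrite !(reM, imM) /=; ring.
case=> q [t [q0 /andP[t1 t2] E]].
have := congr1 (@complex.Re R) E; have := congr1 (@complex.Im R) E.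
rewrite !(reM, imM, reN, imN) /= !mul0r !mul1r ?subr0 ?addr0 ?add0r ?oppr0 => hi hr.
have c0 : cos t = 0.
  by apply/eqP; move/esym/eqP: hr; rewrite ?sub0r ?oppr0 mulf_eq0 (gt_eqF q0).
have s0 : sin t < 0 by rewrite -(pmulr_rlt0 _ q0) -hi oppr_lt0.
have [t0|t0|t0] := ltgtP t 0.
- have := @cos_gt0_pihalf R t; rewrite c0 ltxx => H.
  by have := H ltac:(apply/andP; split; lra).
- have := @sin_gt0_pi R t; move=> /(_ ltac:(apply/andP; split; lra)) ?; lra.
- by rewrite t0 sin0 in s0; lra.
Qed.

Variables (om s : R).
Hypotheses (om0 : 0 < om) (oms : om < s).
Let lbr : C := 0 +i* s.

Lemma i_lbr : 'i * lbr = (- s)%:C.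
Proof. by apply: complexP; rewrite !(reM, imM) /=; ring. Qed.

Lemma nu1_br : nu1 om lbr = (Num.sqrt (om + s))%:C.
Proof.
have s0 := lt_trans om0 oms; have p : 0 < om + s by rewrite addr_gt0.
rewrite /nu1 i_lbr -(@sqrt_arg_pos (Num.sqrt (om + s))) ?sqrtr_gt0 // sqr_sqrtr ?(ltW p) //.
by congr sqrt_arg; rewrite -rmorphB /= opprK.
Qed.

Lemma nu3_br : nu3 s lbr = (Num.sqrt (2 * s))%:C.
Proof.
have s0 := lt_trans om0 oms; have p : 0 < 2 * s by rewrite mulr_gt0.
rewrite /nu3 i_lbr -(@sqrt_arg_pos (Num.sqrt (2 * s))) ?sqrtr_gt0 // sqr_sqrtr ?(ltW p) //.
by congr sqrt_arg; rewrite -rmorphB /= opprK mulr_natl mulr2n.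
Qed.

Lemma nu2_br : nu2 om lbr = 'i * (Num.sqrt (s - om))%:C.
Proof.
have p : 0 < s - om by rewrite subr_gt0.
rewrite /nu2 i_lbr -(@sqrt_arg_neg (Num.sqrt (s - om))) ?sqrtr_gt0 // sqr_sqrtr ?(ltW p) //.
by congr sqrt_arg; rewrite -rmorphD /= opprB.
Qed.

Lemma nu4_br : nu4 s lbr = 0.
Proof. by rewrite /nu4 i_lbr -rmorphD /= subrr sqrt_arg0. Qed.

End Exponents.

(** * Functions with an exponential behaviour at infinity *)

Section Asymptotics.
Variable R : realType.
Notation C := R[i].
Implicit Types (f : R -> C) (n c : C).

Lemma lim_minus_eps n f c : lim_minus n f c -> forall e : R, 0 < e ->
  exists X : R, forall x, X <= x -> cabs (cexp (n * x%:C) * f (- x) - c) <= e.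
Proof.
move=> H e e0; have eC : 0 < e%:C :> C by rewrite ltcR.
have /cvgrPdist_le/(_ _ eC)[M [_ MP]] := H.
exists (1 - M) => x Mx; have := MP (- x); rewrite cabs_le cabs_subC => /(_ ltac:(lra)).
by rewrite rmorphN /= mulrN mulNr opprK.
Qed.

Lemma lim_plus_eps n f c : lim_plus n f c -> forall e : R, 0 < e ->
  exists X : R, forall x, X <= x -> cabs (cexp (n * x%:C) * f x - c) <= e.
Proof.
move=> H e e0; have eC : 0 < e%:C :> C by rewrite ltcR.
have /cvgrPdist_le/(_ _ eC)[M [_ MP]] := H.
by exists (M + 1) => x Mx; have := MP x; rewrite cabs_le cabs_subC => /(_ ltac:(lra)).
Qed.

(** [lim_plus] in a form suited to estimates; a limit at -oo is expressed through the reflected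
    function, with the same [n]. *)
Definition like_exp n f c : Prop := forall e : R, 0 < e ->
  exists X : R, forall x, X <= x -> cabs (cexp (n * x%:C) * f x - c) <= e.

Lemma like_expD n f g c d : like_exp n f c -> like_exp n g d ->
  like_exp n (fun x => f x + g x) (c + d).
Proof.
move=> hf hg e e0; have e2 : 0 < e / 2 by rewrite divr_gt0.
have [X XP] := hf _ e2; have [Y YP] := hg _ e2.
exists (Num.max X Y) => x; rewrite ge_max => /andP[/XP h1 /YP h2].
rewrite mulrDr opprD addrACA (le_trans (cabsD _ _)) //; lra.
Qed.

Lemma like_expZ n f c k : like_exp n f c -> like_exp n (fun x => k * f x) (k * c).
Proof.
move=> hf e e0; have k0 := cabs_ge0 k.
have e2 : 0 < e / (cabs k + 1) by rewrite divr_gt0 //; lra.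
have [X XP] := hf _ e2; exists X => x /XP H.
rewrite mulrCA -mulrBr cabsM (le_trans (ler_wpM2l k0 H)) // mulrCA -[leRHS]mulr1.
by rewrite ler_wpM2l ?(ltW e0) // ler_pdivrMr; lra.
Qed.

Lemma like_exp_conj n f c : like_exp n f c -> like_exp n^* (fun x => (f x)^*) c^*.
Proof.
move=> hf e e0; have [X XP] := hf _ e0; exists X => x /XP H.
have E : cexp (n^* * x%:C) = (cexp (n * x%:C))^*.
  case: n {hf H XP} => u v; have -> : (u +i* v)^* * x%:C = (u * x) -i* (v * x) :> C.
    by apply: complexP; rewrite !(reM, imM) /=; ring.
  have -> : (u +i* v) * x%:C = (u * x) +i* (v * x) :> C.
    by apply: complexP; rewrite !(reM, imM) /=; ring.
  have rec (z : C) : complex.Re z^* = complex.Re z by case: z.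
  have imc (z : C) : complex.Im z^* = - complex.Im z by case: z.
  apply: complexP; rewrite ?rec ?imc ?re_cexp ?im_cexp.
    by rewrite [complex.Im (_ -i* _)]/= cosN.
  by rewrite [complex.Im (_ -i* _)]/= sinN mulrN.
rewrite (_ : _ - _ = (cexp (n * x%:C) * f x - c)^*) ?cabs_conj //.
by rewrite rmorphB rmorphM E.
Qed.

Lemma like_exp_tends0 n f : 0 <= complex.Re n -> like_exp n f 0 -> tends0 f.
Proof.
move=> n0 hf e e0; have [X XP] := hf _ e0; exists (Num.max 0 X) => x.
rewrite ge_max => /andP[x0 /XP]; rewrite subr0 cabs_cexpM reM /= mulr0 subr0 => H.
rewrite (le_trans _ H) // ler_peMl ?cabs_ge0 // -expR0 ler_expR mulr_ge0 //.
Qed.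

Lemma like_exp_tail n f c : 0 <= complex.Re n -> like_exp n f c ->
  exists X : R, 0 <= X /\ forall x, X <= x -> cabs (f x) <= (cabs c + 1) * expR (- complex.Re n * x).
Proof.
move=> n0 hf; have [X XP] := hf _ ltr01; exists (Num.max 0 X); rewrite le_max lexx; split=> // x.
rewrite ge_max => /andP[x0 /XP H].
have := cabsD (cexp (n * x%:C) * f x - c) c; rewrite subrK cabs_cexpM reM /= mulr0 subr0 => H2.
rewrite mulNr expRN ler_pdivlMr ?expR_gt0 // mulrC.
by rewrite (le_trans H2) // addrC lerD2l.
Qed.

Lemma like_exp_decay n f c : 0 < complex.Re n -> like_exp n f c -> tends0 f.
Proof.
move=> n0 hf e e0; have [X [X0 XP]] := like_exp_tail (ltW n0) hf.
have c0 : 0 < cabs c + 1 by rewrite ltr_wpDl ?cabs_ge0.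
have [Y [Y0 YP]] := expR_small n0 (divr_gt0 e0 c0).
exists (Num.max X Y) => x; rewrite ge_max => /andP[/XP h1 /YP h2].
by rewrite (le_trans h1) // mulrC -ler_pdivlMr.
Qed.

Lemma bounded_half f (df : forall x, exists d, isd f x d) (X M : R) :
  (forall x, X <= x -> cabs (f x) <= M) ->
  exists K : R, forall x, 0 <= x -> cabs (f x) <= K.
Proof.
move=> fM.
have cr : continuous (reF f) by move=> x; have [d [h _]] := df x; exact: derR_cont h.
have ci : continuous (imF f) by move=> x; have [d [_ h]] := df x; exact: derR_cont h.
have bnd (g : R -> R) : continuous g -> exists K : R, forall x, 0 <= x <= X -> `|g x| <= K.
  move=> cg; have /compact_bounded[L [_ LP]] := @continuous_compact _ _ g _
    (continuous_subspaceT cg) (@segment_compact _ 0 X).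
  exists (`|L| + 1) => x xX; apply: (LP (`|L| + 1)).
    by rewrite (le_lt_trans (ler_norm L)) // ltrDl.
  by exists x => //; rewrite /= in_itv.
have [K1 H1] := bnd _ cr; have [K2 H2] := bnd _ ci.
exists (Num.max M (K1 + K2)) => x x0; rewrite le_max; have [/fM ->//|xX] := leP X x.
apply/orP; right; have xI : 0 <= x <= X by rewrite x0 ltW.
have -> : f x = (reF f x)%:C + 'i * (imF f x)%:C.
  by apply: complexP; rewrite /reF /imF !(reD, imD, reM, imM) /=; ring.
rewrite (le_trans (cabsD _ _)) // cabsM !cabs_real.
have -> : cabs ('i : C) = 1 by rewrite /= expr0n expr1n add0r sqrtr1.
by rewrite mul1r lerD ?H1 ?H2.
Qed.

Lemma like_exp_bounded n f c : 0 <= complex.Re n -> (forall x, exists d, isd f x d) ->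
  like_exp n f c -> exists K : R, forall x, 0 <= x -> cabs (f x) <= K.
Proof.
move=> n0 df hf; have [X [X0 XP]] := like_exp_tail n0 hf.
apply: (bounded_half df (X := X) (M := cabs c + 1)) => x Xx.
rewrite (le_trans (XP x Xx)) // ler_piMr ?addr_ge0 ?cabs_ge0 // -expR0 ler_expR.
by rewrite mulNr oppr_le0 mulr_ge0 // (le_trans X0).
Qed.

End Asymptotics.

(** * Linear second-order systems: conjugation, Wronskians, uniqueness *)

Section LinearSystems.
Variable R : realType.
Notation C := R[i].
Variable n : nat.
Implicit Types (nn : 'I_n -> C) (B : 'I_n -> 'I_n -> R -> R) (P Q : 'I_n -> R -> C).

Definition sys nn B P P' : Prop := (forall j x, isd (P j) x (P' j x)) /\
  (forall j x, isd (P' j) x (nn j ^+ 2 * P j x - \sum_k (B j k x)%:C * P k x)).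

Lemma sys_refl nn B P P' : sys nn B P P' -> sys nn (reflB B) (refl P) (reflN P').
Proof. by case=> h1 h2; split; [exact: isd_refl|exact: (isd_reflN h2)]. Qed.

Lemma sysZ nn B P P' (a : C) : sys nn B P P' ->
  sys nn B (fun j x => a * P j x) (fun j x => a * P' j x).
Proof.
case=> h1 h2; split => j x; first exact: isdZ (h1 j x).
apply: (isd_eq (isdZ a (h2 j x))); rewrite mulrBr mulr_sumr; congr (_ - _); first by ring.
by apply: eq_bigr => k _; ring.
Qed.

Lemma sysD nn B P P' Q Q' : sys nn B P P' -> sys nn B Q Q' ->
  sys nn B (fun j x => P j x + Q j x) (fun j x => P' j x + Q' j x).
Proof.
move=> [h1 h2] [g1 g2]; split => j x; first exact: isdD (h1 j x) (g1 j x).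
apply: (isd_eq (isdD (h2 j x) (g2 j x))).
rewrite addrACA -opprD -mulrDr -big_split /=; congr (_ - _).
by apply: eq_bigr => k _; rewrite mulrDr.
Qed.

Lemma sys_conj nn B P P' : (forall j, conjc (nn j ^+ 2) = nn j ^+ 2) -> sys nn B P P' ->
  sys nn B (fun j x => conjc (P j x)) (fun j x => conjc (P' j x)).
Proof.
move=> nr [h1 h2]; split => j x; first exact: isd_conj (h1 j x).
have cB (u v : C) : conjc (u - v) = conjc u - conjc v by exact: rmorphB.
have cM (u v : C) : conjc (u * v) = conjc u * conjc v by exact: rmorphM.
have cS (f : 'I_n -> C) : conjc (\sum_k f k) = \sum_k conjc (f k) by exact: rmorph_sum.
apply: (isd_eq (isd_conj (h2 j x))); rewrite cB cM nr cS.
congr (_ - _); apply: eq_bigr => k _; rewrite cM; congr (_ * _).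
exact: conjc_real.
Qed.

Lemma sys_forced nn ka B P P' : sys nn B P P' -> symB B -> forall Q Q', sys ka B Q Q' ->
  forall x, isd (wronsk P P' Q Q') x (\sum_j ((nn j ^+ 2 - ka j ^+ 2) * P j x * Q j x)).
Proof.
move=> [h1 h2] sB Q Q' [g1 g2] x.
have := @isd_wronsk R n nn ka B P P' (fun _ _ => 0) Q Q' (fun _ _ => 0) x sB
  (fun j => h1 j x) _ (fun j => g1 j x) _.
move=> H; apply: (isd_eq (H _ _)).
- by move=> j; apply: (isd_eq (h2 j x)); rewrite addr0.
- by move=> j; apply: (isd_eq (g2 j x)); rewrite addr0.
- by apply: eq_bigr => j _; rewrite mul0r mulr0 subr0 addr0.
Qed.

Lemma isd0_const (f : R -> C) : (forall x, isd f x 0) -> forall x, f x = f 0.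
Proof.
move=> df x.
have key (a b : R) : a <= b -> f b = f a.
  move=> ab; apply: complexP.
  - have h1 := derR_ge0 ab (fun t _ => (df t).1) (fun t _ => lexx _).
    have h2 := derR_ge0 ab (fun t _ => derRN (df t).1) (fun t _ => _ : 0 <= - (0 : R)).
    by apply/eqP; rewrite eq_le h1 andbT -lerN2 h2 //= ?oppr0.
  - have h1 := derR_ge0 ab (fun t _ => (df t).2) (fun t _ => lexx _).
    have h2 := derR_ge0 ab (fun t _ => derRN (df t).2) (fun t _ => _ : 0 <= - (0 : R)).
    by apply/eqP; rewrite eq_le h1 andbT -lerN2 h2 //= ?oppr0.
by have [/key|/ltW/key] := leP 0 x.
Qed.

Lemma wronsk_const nn B P P' Q Q' : symB B -> sys nn B P P' -> sys nn B Q Q' ->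
  forall x, wronsk P P' Q Q' x = wronsk P P' Q Q' 0.
Proof.
move=> sB sP sQ; apply: isd0_const => x; apply: (isd_eq (sys_forced sP sB sQ x)).
by apply: big1 => j _; rewrite subrr !mul0r.
Qed.

(** Gronwall with zero jet and zero forcing, on both half-lines. *)
Lemma sys_unique nn B P P' (c : R) : (forall j k x, `|B j k x| <= c) -> sys nn B P P' ->
  (forall j, P j 0 = 0 /\ P' j 0 = 0) -> forall j x, P j x = 0 /\ P' j x = 0.
Proof.
move=> Bc sP P0.
have key B1 Q Q' : (forall j k x, `|B1 j k x| <= c) -> sys nn B1 Q Q' ->
    (forall j, Q j 0 = 0 /\ Q' j 0 = 0) -> forall j x, 0 <= x -> Q j x = 0 /\ Q' j x = 0.
  move=> Bc1 [h1 h2] Q0 j x x0.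
  pose N := \sum_j cabs (nn j ^+ 2).
  have N0 : 0 <= N by apply: sumr_ge0 => k _; exact: cabs_ge0.
  have c0 : 0 <= c by exact: le_trans (normr_ge0 _) (Bc1 j j 0).
  have M0 : 0 <= N + c by rewrite addr_ge0.
  have [K K1 HK] := gronwall_system n x M0.
  have := HK Q Q' (fun j x => nn j ^+ 2 * Q j x - \sum_k (B1 j k x)%:C * Q k x) 0 (lexx 0)
    (fun j x _ => h1 j x) (fun j x _ => h2 j x) _ j x.
  rewrite x0 lexx => /(_ _ isT).
  have -> : jet0 Q Q' = 0.
    by apply: big1 => k _; have [-> ->] := Q0 k; rewrite !cabs0 addr0.
  rewrite addr0 mulr0 => H.
  have z (t : C) : cabs t <= 0 -> t = 0.
    by move=> t0; apply: cabs_eq0; apply/eqP; rewrite eq_le t0 cabs_ge0.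
  have [|/z q1 /z q2] := H; last by split.
  move=> k y y0; rewrite addr0 (le_trans (cabsB _ _)) // mulrDl lerD //.
    rewrite cabsM ler_pM ?cabs_ge0 //.
      exact: (@ler_sum1 R n (fun j => cabs (nn j ^+ 2)) k (fun i => cabs_ge0 _)).
    exact: (@ler_sum1 R n (fun j => cabs (Q j y)) k (fun i => cabs_ge0 _)).
  rewrite (le_trans (cabs_sum _ _ _)) // mulr_sumr ler_sum // => i _.
  by rewrite cabsM cabs_real ler_wpM2r ?cabs_ge0.
move=> j x; have [|/ltW x0] := leP 0 x; first exact: key sP P0 j x.
have [|||h1 h2] := @key (reflB B) (refl P) (reflN P') _ (sys_refl sP) _ j (- x).
- by move=> i k y; exact: Bc.
- by move=> k; have [h1 h2] := P0 k; rewrite /refl /reflN oppr0 h1 h2 oppr0.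
- by rewrite oppr_ge0.
by split; [move: h1|move: h2]; rewrite /refl /reflN opprK // => /eqP; rewrite oppr_eq0 => /eqP.
Qed.

(** The condition on [c] says that a component whose own exponent differs from [n0] has leading
    coefficient zero. Then [P' + nn P] has leading coefficient zero at the rate [n0], hence tends to
    0. *)
Lemma jost_right_of_like nn B P P' (n0 : C) (c : 'I_n -> C) : sys nn B P P' ->
  0 <= complex.Re n0 -> (forall j, (nn j - n0) * c j = 0) ->
  (forall j, like_exp n0 (P j) (c j)) -> (forall j, like_exp n0 (P' j) (- (n0 * c j))) ->
  jost_right nn B P P'.
Proof.
move=> [h1 h2] n00 nc lP lP'; split => //.
- have /choice[K KP] : forall j, exists K : R, forall x, 0 <= x -> cabs (P j x) <= K.
    move=> j; apply: (like_exp_bounded n00 _ (lP j)) => x; by exists (P' j x).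
  exists (\sum_j `|K j|) => j x x0; rewrite (le_trans (KP j x x0)) // (le_trans (ler_norm _)) //.
  exact: (@ler_sum1 R n (fun j => `|K j|) j).
- move=> j; apply: (like_exp_tends0 n00).
  have := like_expD (lP' j) (like_expZ (nn j) (lP j)).
  by rewrite -mulNr -mulrDl addrC nc.
Qed.

End LinearSystems.

Section LinearAlgebra.
Variable R : realType.
Notation C := R[i].

Lemma det_neq0_bound m (M : 'M[C]_m) : \det M <> 0 -> exists2 K : R, 0 <= K &
  forall (y : 'rV[C]_m) (t : R), (forall i, cabs ((y *m M) 0 i) <= t) ->
    forall k, cabs (y 0 k) <= K * t.
Proof.
move=> dM; have uM : M \in unitmx by rewrite unitmxE unitfE; apply/eqP.
exists (\sum_k \sum_i cabs (invmx M i k)).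
  by apply: sumr_ge0 => k _; apply: sumr_ge0 => i _; exact: cabs_ge0.
move=> y t yt k; rewrite -[y](mulmxK uM) mxE (le_trans (cabs_sum _ _ _)) //.
apply: (@le_trans _ _ (\sum_i cabs (invmx M i k) * t)).
  by apply: ler_sum => i _; rewrite cabsM mulrC ler_wpM2l ?cabs_ge0.
rewrite -mulr_suml ler_wpM2r ?(le_trans (cabs_ge0 _) (yt k)) //.
by apply: (@ler_sum1 R m (fun k => \sum_i cabs (invmx M i k)) k) => l;
  apply: sumr_ge0 => i _; exact: cabs_ge0.
Qed.

Lemma det_neq0_solve m (M : 'M[C]_m) (b : 'cV[C]_m) : \det M <> 0 ->
  exists a : 'I_m -> C, forall k, b k 0 = \sum_j M k j * a j.
Proof.
move=> dM; have uM : M \in unitmx by rewrite unitmxE unitfE; apply/eqP.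
exists (fun j => (invmx M *m b) j 0) => k.
by rewrite -{1}[b](mulKVmx uM) mxE.
Qed.

Lemma det_eq0_dependent m (M : 'M[C]_m) : \det M = 0 ->
  exists2 a : 'I_m -> C, (exists j, a j <> 0) & forall k, \sum_j M k j * a j = 0.
Proof.
move=> /eqP; rewrite -det_tr => /det0P[v v0 vM]; exists (fun j => v 0 j).
  have /rV0Pn[j vj] := v0; by exists j; apply/eqP.
move=> k; have := congr1 (fun A : 'rV[C]_m => A 0 k) vM; rewrite [X in X = _]mxE [X in _ = X]mxE.
by move=> E; rewrite -[RHS]E; apply: eq_bigr => j _; rewrite mxE mulrC.
Qed.

End LinearAlgebra.

(** * Jost solutions of (A), (B), (C) at the branch point *)

Section JostSolutions.
Variable R : realType.
Notation C := R[i].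
Variables (om s : R) (F : R -> R -> R -> R) (U0 : R -> R).
Hypotheses (om0 : 0 < om) (oms : om < s).
Implicit Types (p q f : R -> C) (n c d : C).
Let s0 : 0 < s. Proof. exact: lt_trans oms. Qed.
Let lbr : C := 0 +i* s.
Let A0 x : R := d1 (d1 F) (U0 x ^+ 2) 0 0 * U0 x ^+ 2.
Let B0 x : R := d1 F (U0 x ^+ 2) 0 0.
Let E0 x : R := d2 F (U0 x ^+ 2) 0 0.
Let n1 : C := (Num.sqrt (om + s))%:C.
Let n2 : C := 'i * (Num.sqrt (s - om))%:C.
Let n3 : C := (Num.sqrt (2 * s))%:C.
Let nnA : 'I_2 -> C := cpair n1 n2.

Lemma n1_sqr : n1 ^+ 2 = (om + s)%:C.
Proof. by rewrite -rmorphXn /= sqr_sqrtr // addr_ge0 // ltW. Qed.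

Lemma n2_sqr : n2 ^+ 2 = (om - s)%:C.
Proof.
rewrite exprMn sqr_i mulN1r -rmorphXn /= sqr_sqrtr ?subr_ge0 ?(ltW oms) //.
by rewrite -rmorphN opprB.
Qed.

Lemma n3_sqr : n3 ^+ 2 = (2 * s)%:C.
Proof. by rewrite -rmorphXn /= sqr_sqrtr // mulr_ge0 // ltW. Qed.

Lemma re_n1 : 0 < complex.Re n1.
Proof. by rewrite /= sqrtr_gt0 addr_gt0. Qed.

Lemma re_n2 : complex.Re n2 = 0.
Proof. by rewrite reM /= mul0r mulr0 subr0. Qed.

Lemma re_n3 : 0 < complex.Re n3.
Proof. by rewrite /= sqrtr_gt0 mulr_gt0. Qed.

Lemma solves_A_sys p q : solves_A om F U0 lbr p q ->
  sys nnA (BA A0 B0) (cpair p q) (cpair (cderiv p) (cderiv q)).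
Proof.
move=> [dp dq e]; split; apply: ord2P => x; rewrite /cpair /=; try exact: ctwice_isd.
- apply: (isd_eq (ctwice_isd2 x dp)); rewrite sum_ord2 /BA /cpair /= n1_sqr.
  have [+ _] := e x; rewrite i_lbr => h.
  rewrite (_ : (om + s)%:C = om%:C - (- s)%:C); last by rewrite -rmorphB opprK.
  rewrite mulrBl -h -/(A0 x) -/(B0 x) (_ : (A0 x + B0 x)%:C = (A0 x)%:C + (B0 x)%:C) ?rmorphD //.
  by move: (cderiv _ x) (p x) (q x) om%:C (A0 x)%:C (B0 x)%:C => *; ring.
- apply: (isd_eq (ctwice_isd2 x dq)); rewrite sum_ord2 /BA /cpair /= n2_sqr.
  have [_] := e x; rewrite mulNr i_lbr => h.
  rewrite (_ : (om - s)%:C = om%:C - (- - s)%:C); last by rewrite -rmorphB opprK.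
  rewrite mulrBl (rmorphN _ (- s)) -h -/(A0 x) -/(B0 x).
  rewrite (_ : (A0 x + B0 x)%:C = (A0 x)%:C + (B0 x)%:C) ?rmorphD //.
  by move: (cderiv _ x) (p x) (q x) om%:C (A0 x)%:C (B0 x)%:C => *; ring.
Qed.

Lemma solves_S_sys (n : C) (m : R) p : ctwice_derivable p -> n ^+ 2 = m%:C ->
  (forall x, - cderiv (cderiv p) x + s%:C * p x - (E0 x)%:C * p x = (s - m)%:C * p x) ->
  sys (csingle n) (BS E0) (csingle p) (csingle (cderiv p)).
Proof.
move=> dp nm e; split => j x; rewrite /csingle; first exact: ctwice_isd.
apply: (isd_eq (ctwice_isd2 x dp)); rewrite big_ord1 /BS nm.
rewrite (_ : m%:C = s%:C - (s - m)%:C); last by rewrite -rmorphB; congr (_ %:C); ring.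
by rewrite mulrBl -e; ring.
Qed.

Lemma solves_C_sys p : solves_C s F U0 lbr p ->
  sys (csingle n3) (BS E0) (csingle p) (csingle (cderiv p)).
Proof.
move=> [dp e]; apply: (solves_S_sys dp n3_sqr) => x; rewrite e i_lbr.
by congr (_ %:C * _); ring.
Qed.

Lemma solves_B_sys p : solves_B s F U0 lbr p ->
  sys (csingle 0) (BS E0) (csingle p) (csingle (cderiv p)).
Proof.
move=> [dp e]; apply: (@solves_S_sys 0 0) => //; first by rewrite expr0n.
by move=> x; rewrite e mulNr i_lbr -rmorphN opprK subr0.
Qed.

Lemma like_minus n f c : lim_minus n f c -> like_exp n (fun x => f (- x)) c.
Proof. by move=> h e e0; exact: lim_minus_eps h e e0. Qed.

Lemma like_plus n f c : lim_plus n f c -> like_exp n f c.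
Proof. by move=> h e e0; exact: lim_plus_eps h e e0. Qed.

Lemma like_expN n f c : like_exp n f c -> like_exp n (fun x => - f x) (- c).
Proof.
move=> h; have := like_expZ (-1) h; rewrite mulN1r.
by under eq_fun do rewrite mulN1r.
Qed.

Lemma jost_A_left n c d p q : jost_A_minus om F U0 lbr n c d p q ->
  [/\ sys nnA (BA A0 B0) (cpair p q) (cpair (cderiv p) (cderiv q)),
      forall j, like_exp n (refl (cpair p q) j) (cpair c d j) &
      forall j, like_exp n (reflN (cpair (cderiv p) (cderiv q)) j) (- (n * cpair c d j))].
Proof.
move=> [/solves_A_sys h1 h2 h3 h4 h5]; split => //; apply: ord2P; rewrite /refl /reflN /=.
- exact: (like_minus h2).
- exact: (like_minus h3).
- exact: (like_expN (like_minus h4)).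
- exact: (like_expN (like_minus h5)).
Qed.

Lemma jost_A_right n c d p q : jost_A_plus om F U0 lbr n c d p q ->
  [/\ sys nnA (BA A0 B0) (cpair p q) (cpair (cderiv p) (cderiv q)),
      forall j, like_exp n (cpair p q j) (cpair c d j) &
      forall j, like_exp n (cpair (cderiv p) (cderiv q) j) (- (n * cpair c d j))].
Proof.
move=> [/solves_A_sys h1 h2 h3 h4 h5]; split => //; apply: ord2P => /=.
- exact: (like_plus h2).
- exact: (like_plus h3).
- by rewrite -mulNr; exact: (like_plus h4).
- by rewrite -mulNr; exact: (like_plus h5).
Qed.

Section Matrix.
Variables p1 q1 p2 q2 p5 q5 p6 q6 : R -> C.
Hypothesis EA : evans_A p1 q1 p2 q2 p5 q5 p6 q6 <> 0.

Lemma wronsk_pair (f f' : 'I_2 -> R -> C) (p q p' q' : R -> C) x :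
  wronsk f f' (cpair p q) (cpair p' q') x = f' ord0 x * p x - f ord0 x * p' x
    + (f' ord_max x * q x - f ord_max x * q' x).
Proof. by rewrite /wronsk sum_ord2. Qed.

(** The row [(f0', f1', - f0, - f1)] at 0, times the matrix of [evans_A], lists the four Wronskians;
    inverting the matrix recovers the jet. *)
Lemma spanA : jets_span (cpair (cpair p1 q1) (cpair p2 q2))
  (cpair (cpair (cderiv p1) (cderiv q1)) (cpair (cderiv p2) (cderiv q2)))
  (cpair (cpair p5 q5) (cpair p6 q6))
  (cpair (cpair (cderiv p5) (cderiv q5)) (cpair (cderiv p6) (cderiv q6))).
Proof.
have [K K0 H] := det_neq0_bound EA; exists (4 * K); first by rewrite mulr_ge0.
move=> f f' t hm hp.
pose y : 'rV[C]_4 := \row_(k < 4) nth 0 [:: f' ord0 0; f' ord_max 0; - f ord0 0; - f ord_max 0] k.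
have Hy := H y t _; rewrite /jet0 sum_ord2.
have {}Hy : forall k, cabs (y 0 k) <= K * t.
  apply: Hy => i.
  have hm0 : cabs (wronsk f f' (cpair p1 q1) (cpair (cderiv p1) (cderiv q1)) 0) <= t := hm ord0.
  have hm1 : cabs (wronsk f f' (cpair p2 q2) (cpair (cderiv p2) (cderiv q2)) 0) <= t :=
    hm ord_max.
  have hp0 : cabs (wronsk f f' (cpair p5 q5) (cpair (cderiv p5) (cderiv q5)) 0) <= t := hp ord0.
  have hp1 : cabs (wronsk f f' (cpair p6 q6) (cpair (cderiv p6) (cderiv q6)) 0) <= t :=
    hp ord_max.
  rewrite wronsk_pair in hm0; rewrite wronsk_pair in hm1.
  rewrite wronsk_pair in hp0; rewrite wronsk_pair in hp1.
  rewrite mxE !big_ord_recl big_ord0 /y !mxE /=.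
  case: i => [[|[|[|[|//]]]] i4] /=.
  - apply: le_trans hm0; rewrite le_eqVlt; apply/orP; left; apply/eqP; congr cabs.
    by move: (f' _ _) (f' ord_max _) (f _ _) (f ord_max _) (p1 _) (q1 _) (cderiv p1 _) (cderiv q1 _) => *; ring.
  - apply: le_trans hm1; rewrite le_eqVlt; apply/orP; left; apply/eqP; congr cabs.
    by move: (f' _ _) (f' ord_max _) (f _ _) (f ord_max _) (p2 _) (q2 _) (cderiv p2 _) (cderiv q2 _) => *; ring.
  - apply: le_trans hp0; rewrite le_eqVlt; apply/orP; left; apply/eqP; congr cabs.
    by move: (f' _ _) (f' ord_max _) (f _ _) (f ord_max _) (p5 _) (q5 _) (cderiv p5 _) (cderiv q5 _) => *; ring.
  - apply: le_trans hp1; rewrite le_eqVlt; apply/orP; left; apply/eqP; congr cabs.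
    by move: (f' _ _) (f' ord_max _) (f _ _) (f ord_max _) (p6 _) (q6 _) (cderiv p6 _) (cderiv q6 _) => *; ring.
have h0 := Hy (@Ordinal 4 0 isT); have h1 := Hy (@Ordinal 4 1 isT).
have h2 := Hy (@Ordinal 4 2 isT); have h3 := Hy (@Ordinal 4 3 isT).
rewrite /y !mxE /= ?cabsN in h0 h1 h2 h3.
have -> : 4 * K * t = K * t + K * t + (K * t + K * t) by ring.
by rewrite !lerD.
Qed.

(** The jets of the four Jost solutions form a basis of the initial data, which serves to decompose
    an arbitrary solution of (A). *)
Lemma coordsA (b0 b1 b2 b3 : C) : exists a1 a2 a5 a6 : C,
  [/\ b0 = a1 * p1 0 + a2 * p2 0 + a5 * p5 0 + a6 * p6 0,
      b1 = a1 * q1 0 + a2 * q2 0 + a5 * q5 0 + a6 * q6 0,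
      b2 = a1 * cderiv p1 0 + a2 * cderiv p2 0 + a5 * cderiv p5 0 + a6 * cderiv p6 0 &
      b3 = a1 * cderiv q1 0 + a2 * cderiv q2 0 + a5 * cderiv q5 0 + a6 * cderiv q6 0].
Proof.
have [a H] := det_neq0_solve (\col_(k < 4) nth 0 [:: b0; b1; b2; b3] k) EA.
exists (a ord0), (a (lift ord0 ord0)), (a (lift ord0 (lift ord0 ord0))),
  (a (lift ord0 (lift ord0 (lift ord0 ord0)))).
have h0 := H (@Ordinal 4 0 isT); have h1 := H (@Ordinal 4 1 isT).
have h2 := H (@Ordinal 4 2 isT); have h3 := H (@Ordinal 4 3 isT).
rewrite !big_ord_recl !big_ord0 !mxE /= in h0 h1 h2 h3.
by split; [rewrite h0|rewrite h1|rewrite h2|rewrite h3]; ring.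
Qed.

End Matrix.

Lemma evans_2E (pm pp : R -> C) : evans_2 pm pp = pm 0 * cderiv pp 0 - pp 0 * cderiv pm 0 :> C.
Proof.
rewrite /evans_2 (expand_det_row _ ord0) !big_ord_recl big_ord0 /cofactor !det_mx11 !mxE /=.
by rewrite expr0 expr1; ring.
Qed.

Lemma spanC p3 p7 : evans_2 p3 p7 <> 0 -> jets_span (fun=> csingle p3)
  (fun=> csingle (cderiv p3)) (fun=> csingle p7) (fun=> csingle (cderiv p7)).
Proof.
move=> E; have [K K0 H] := det_neq0_bound E; exists (2 * K); first by rewrite mulr_ge0.
move=> f f' t hm hp.
pose y : 'rV[C]_2 := \row_(k < 2) nth 0 [:: f' ord0 0; - f ord0 0] k.
have Hy : forall k, cabs (y 0 k) <= K * t.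
  apply: H => i.
  have hm0 := hm ord0; have hp0 := hp ord0.
  rewrite /wronsk !big_ord1 /csingle /= in hm0 hp0.
  rewrite mxE !big_ord_recl big_ord0 /y !mxE /=.
  case: i => [[|[|//]] i4] /=.
  - by apply: le_trans hm0; rewrite addr0 mulNr.
  - by apply: le_trans hp0; rewrite addr0 mulNr.
have h0 := Hy ord0; have h1 := Hy ord_max.
rewrite /y !mxE /= ?cabsN in h0 h1.
have -> : 2 * K * t = K * t + K * t by ring.
by rewrite /jet0 big_ord1 lerD.
Qed.

End JostSolutions.

Section Wronskians.
Variable R : realType.
Notation C := R[i].
Variable n : nat.
Implicit Types (nn : 'I_n -> C) (B : 'I_n -> 'I_n -> R -> R) (P Q : 'I_n -> R -> C).

Lemma wronskD P P' S S' Q Q' x :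
  wronsk (fun j x => P j x + S j x) (fun j x => P' j x + S' j x) Q Q' x =
  wronsk P P' Q Q' x + wronsk S S' Q Q' x :> C.
Proof. by rewrite /wronsk -big_split /=; apply: eq_bigr => j _; ring. Qed.

Lemma wronskZ a P P' Q Q' x :
  wronsk (fun j x => a * P j x) (fun j x => a * P' j x) Q Q' x = a * wronsk P P' Q Q' x :> C.
Proof. by rewrite /wronsk mulr_sumr; apply: eq_bigr => j _; ring. Qed.

Lemma wronskC P P' Q Q' x : wronsk P P' Q Q' x = - wronsk Q Q' P P' x :> C.
Proof. by rewrite /wronsk -sumrN; apply: eq_bigr => j _; ring. Qed.

Lemma wronsk_self P P' x : wronsk P P' P P' x = 0 :> C.
Proof. by rewrite /wronsk big1 // => j _; ring. Qed.

Definition half_bounded (f : R -> C) : Prop :=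
  exists K : R, forall x, 0 <= x -> cabs (f x) <= K.

Lemma tends0_mulb (f g : R -> C) : half_bounded f -> tends0 g -> tends0 (fun x => f x * g x).
Proof.
move=> [K fK] hg e e0; have K1 : 0 < `|K| + 1 by rewrite ltr_wpDl.
have [X XP] := hg _ (divr_gt0 e0 K1); exists (Num.max 0 X) => x; rewrite ge_max => /andP[x0 /XP H].
have fx : cabs (f x) <= `|K| + 1.
  by rewrite (le_trans (fK x x0)) // (le_trans (ler_norm K)) // lerDl.
rewrite cabsM (le_trans (ler_pM (cabs_ge0 _) (cabs_ge0 _) fx H)) //.
by rewrite mulrC divfK // gt_eqF.
Qed.

Lemma tends0_cst (c : C) : tends0 (fun=> c) -> c = 0.
Proof.
move=> h; apply/eqP; apply/negPn/negP => /eqP/cabs_gt0 c0.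
have [X /(_ X (lexx _))] := h (cabs c / 2) (divr_gt0 c0 (ltr0Sn _ 1)).
by rewrite ler_pdivlMr // => ?; lra.
Qed.

Lemma tends0_sum m (f : 'I_m -> R -> C) : (forall j, tends0 (f j)) ->
  tends0 (fun x => \sum_j f j x).
Proof.
move=> h; elim: (index_enum _) => [|j r IHr].
  by move=> e e0; exists 0 => x _; rewrite big_nil cabs0 ltW.
by under eq_fun do rewrite big_cons; exact: tends0D.
Qed.

(** The Wronskian is constant and, being a sum of products of a bounded and a vanishing factor,
    tends to 0 at +oo. *)
Lemma wronsk_vanish nn B P P' Q Q' : symB B -> sys nn B P P' -> sys nn B Q Q' ->
  (forall j, half_bounded (P j)) -> (forall j, half_bounded (P' j)) ->
  (forall j, tends0 (Q j)) -> (forall j, tends0 (Q' j)) -> wronsk P P' Q Q' 0 = 0.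
Proof.
move=> sB sP sQ bP bP' tQ tQ'; apply: tends0_cst.
apply: (@tends0_eq _ (wronsk P P' Q Q')); first exact: (wronsk_const sB sP sQ).
apply: tends0_sum => j; apply: (@tends0_eq _ (fun x => P' j x * Q j x + (-1) * (P j x * Q' j x))).
  by move=> x; rewrite mulN1r.
by apply: tends0D; [exact: tends0_mulb|apply: tends0Z; exact: tends0_mulb].
Qed.

Lemma like_expM (a b c d : C) (f g : R -> C) : like_exp a f c -> like_exp b g d ->
  like_exp (a + b) (fun x => f x * g x) (c * d).
Proof.
move=> hf hg e e0.
have [N NE] : exists N : R, N = cabs c + 1 + cabs d by eexists.
have c0 := cabs_ge0 c; have d0 := cabs_ge0 d.
have N0 : 0 < N by rewrite NE; lra.
have [X0 X0P] := hf 1 ltr01.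
have [X XP] := hf _ (divr_gt0 e0 N0); have [Y YP] := hg _ (divr_gt0 e0 N0).
exists (Num.max X0 (Num.max X Y)) => x; rewrite !ge_max => /and3P[/X0P h0 /XP h1 /YP h2].
rewrite mulrDl cexpD.
have -> : cexp (a * x%:C) * cexp (b * x%:C) * (f x * g x) - c * d =
  (cexp (a * x%:C) * f x) * (cexp (b * x%:C) * g x - d) + d * (cexp (a * x%:C) * f x - c).
  by ring.
have h3 : cabs (cexp (a * x%:C) * f x) <= cabs c + 1.
  by have := cabsD (cexp (a * x%:C) * f x - c) c; rewrite subrK => h; lra.
rewrite (le_trans (cabsD _ _)) // (cabsM (cexp (a * x%:C) * f x) _) (cabsM d _).
have -> : e = (cabs c + 1) * (e / N) + cabs d * (e / N).
  by rewrite -mulrDl -NE mulrC divfK // gt_eqF.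
by apply: lerD; [apply: ler_pM; rewrite ?cabs_ge0|exact: ler_wpM2l].
Qed.

Lemma like_exp_sum m (a : C) (f : 'I_m -> R -> C) (c : 'I_m -> C) :
  (forall j, like_exp a (f j) (c j)) -> like_exp a (fun x => \sum_j f j x) (\sum_j c j).
Proof.
move=> h; elim: (index_enum _) => [|j r IHr].
  by move=> e e0; exists 0 => x _; rewrite !big_nil mulr0 subrr cabs0 ltW.
rewrite big_cons; under eq_fun do rewrite big_cons; exact: like_expD.
Qed.

Lemma like_exp_cst (a c : C) : like_exp 0 (fun=> a) c -> a = c.
Proof.
move=> h; apply/eqP; rewrite -subr_eq0; apply/eqP; apply: tends0_cst => e /h[X XP].
by exists X => x /XP; rewrite mul0r cexp0 mul1r.
Qed.

End Wronskians.

Lemma le_sum_each (R : realFieldType) (a b c d : R) : 0 <= a -> 0 <= b -> 0 <= c -> 0 <= d ->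
  [/\ a <= a + b + c + d, b <= a + b + c + d, c <= a + b + c + d & d <= a + b + c + d].
Proof. by move=> ? ? ? ?; split; lra. Qed.

(** * Boundedness of [(p2, q2)] on the whole line *)

Section OscillatingSolution.
Variable R : realType.
Notation C := R[i].
Variables (om s : R) (F : R -> R -> R -> R) (U0 : R -> R).
Hypotheses (om0 : 0 < om) (oms : om < s).
Let lbr : C := 0 +i* s.
Let A0 x : R := d1 (d1 F) (U0 x ^+ 2) 0 0 * U0 x ^+ 2.
Let B0 x : R := d1 F (U0 x ^+ 2) 0 0.
Let E0 x : R := d2 F (U0 x ^+ 2) 0 0.
Let n1 : C := (Num.sqrt (om + s))%:C.
Let n2 : C := 'i * (Num.sqrt (s - om))%:C.
Let nnA : 'I_2 -> C := cpair n1 n2.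
Variables (C0 : R) (p1 q1 p2 q2 p5 q5 p6 q6 : R -> C).
Hypotheses (Ab : forall x, `|A0 x| <= C0) (Bb : forall x, `|B0 x| <= C0).
Hypotheses (j1 : jost_A_minus om F U0 lbr n1 1 0 p1 q1)
  (j2 : jost_A_minus om F U0 lbr n2 0 1 p2 q2)
  (j5 : jost_A_plus om F U0 lbr n1 1 0 p5 q5)
  (j6 : jost_A_plus om F U0 lbr n2 0 1 p6 q6)
  (p51 : forall x, p5 x = p1 (- x) /\ q5 x = q1 (- x))
  (W25 : cderiv p2 0 * p5 0 + cderiv q2 0 * q5 0 - p2 0 * cderiv p5 0 - q2 0 * cderiv q5 0 = 0)
  (EA : evans_A p1 q1 p2 q2 p5 q5 p6 q6 <> 0) (D1 : Delta p1 q1 <> 0).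
Let P1 := cpair p1 q1.
Let P2 := cpair p2 q2.
Let P5 := cpair p5 q5.
Let P6 := cpair p6 q6.
Let P1' := cpair (cderiv p1) (cderiv q1).
Let P2' := cpair (cderiv p2) (cderiv q2).
Let P5' := cpair (cderiv p5) (cderiv q5).
Let P6' := cpair (cderiv p6) (cderiv q6).

Let BAb j k x : `|BA A0 B0 j k x| <= C0 + C0.
Proof.
rewrite /BA; case: ifP => _; first by rewrite (le_trans (ler_normD _ _)) // lerD.
by rewrite (le_trans (Ab x)) // lerDl (le_trans (normr_ge0 _) (Ab x)).
Qed.

Lemma conj_nnA j : conjc (nnA j ^+ 2) = nnA j ^+ 2.
Proof.
have H (z : C) (r : R) : z = r%:C -> conjc z = z.
  by move=> ->; apply: complexP => //=; exact: oppr0.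
by move: j; apply: ord2P; [exact: H (n1_sqr om0 oms)|exact: H (n2_sqr oms)].
Qed.

(* Conjugation exchanges the two oscillating behaviours at +oo, so the conjugate of
   [(p6, q6)] is a combination of [(p1, q1)], [(p2, q2)], [(p5, q5)], [(p6, q6)];
   pairing with [(p5, q5)] shows that [(p1, q1)] does not enter, and pairing with
   [(p6, q6)] that [(p2, q2)] does. *)
Lemma oscillating_bounded : exists Bp : R,
  forall j x, cabs (P2 j x) <= Bp /\ cabs (P2' j x) <= Bp.
Proof.
have [s1 l1 l1'] := jost_A_left om0 oms j1; have [s2 l2 l2'] := jost_A_left om0 oms j2.
have [s5 l5 l5'] := jost_A_right om0 oms j5; have [s6 l6 l6'] := jost_A_right om0 oms j6.
have sB : symB (BA A0 B0) by exact: symBA.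
have re1 := re_n1 om0 oms; have re2 : 0 <= complex.Re n2 by rewrite re_n2.
have t5 j : tends0 (P5 j) by exact: like_exp_decay re1 (l5 j).
have t5' j : tends0 (P5' j) by exact: like_exp_decay re1 (l5' j).
have d_ (P P' : 'I_2 -> R -> C) : sys nnA (BA A0 B0) P P' ->
    (forall j x, exists d, isd (P j) x d) /\ (forall j x, exists d, isd (P' j) x d).
  by move=> [h1 h2]; split => j x; [exists (P' j x); exact: h1|eexists; exact: h2].
have b5 j : half_bounded (P5 j) by exact: like_exp_bounded (ltW re1) ((d_ _ _ s5).1 j) (l5 j).
have b5' j : half_bounded (P5' j) by exact: like_exp_bounded (ltW re1) ((d_ _ _ s5).2 j) (l5' j).
have b6 j : half_bounded (P6 j) by exact: like_exp_bounded re2 ((d_ _ _ s6).1 j) (l6 j).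
have b6' j : half_bounded (P6' j) by exact: like_exp_bounded re2 ((d_ _ _ s6).2 j) (l6' j).
pose Q j x := conjc (P6 j x); pose Q' j x := conjc (P6' j x).
have sQ : sys nnA (BA A0 B0) Q Q' by exact: sys_conj conj_nnA s6.
have bQ j : half_bounded (Q j).
  by have [K KP] := b6 j; exists K => x x0; rewrite cabs_conj KP.
have bQ' j : half_bounded (Q' j).
  by have [K KP] := b6' j; exists K => x x0; rewrite cabs_conj KP.
have [a1 [a2 [a5 [a6 [e0 e1 e2 e3]]]]] :=
  coordsA EA (Q ord0 0) (Q ord_max 0) (Q' ord0 0) (Q' ord_max 0).
pose S j x := a1 * P1 j x + a2 * P2 j x + a5 * P5 j x + a6 * P6 j x.
pose S' j x := a1 * P1' j x + a2 * P2' j x + a5 * P5' j x + a6 * P6' j x.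
have sS : sys nnA (BA A0 B0) S S'.
  exact: sysD (sysD (sysD (sysZ a1 s1) (sysZ a2 s2)) (sysZ a5 s5)) (sysZ a6 s6).
have QS j x : Q j x = S j x /\ Q' j x = S' j x.
  have [|h1 h2] := sys_unique BAb (sysD sQ (sysZ (-1) sS)) _ j x.
    apply: ord2P; rewrite !mulN1r.
      by split; apply/eqP; rewrite subr_eq0; apply/eqP; [exact: e0|exact: e2].
    by split; apply/eqP; rewrite subr_eq0; apply/eqP; [exact: e1|exact: e3].
  by split; apply/eqP; rewrite -subr_eq0 -mulN1r; apply/eqP; [exact: h1|exact: h2].
have WS (T T' : 'I_2 -> R -> C) : wronsk Q Q' T T' 0 = a1 * wronsk P1 P1' T T' 0
    + a2 * wronsk P2 P2' T T' 0 + a5 * wronsk P5 P5' T T' 0 + a6 * wronsk P6 P6' T T' 0.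
  have -> : wronsk Q Q' T T' 0 = wronsk S S' T T' 0.
    by apply: eq_bigr => j _; have [-> ->] := QS j 0.
  by rewrite /S /S' !wronskD !wronskZ.
have w65 : wronsk P6 P6' P5 P5' 0 = 0 by exact: wronsk_vanish sB s6 s5 b6 b6' t5 t5'.
have wQ5 : wronsk Q Q' P5 P5' 0 = 0 by exact: wronsk_vanish sB sQ s5 bQ bQ' t5 t5'.
have w25 : wronsk P2 P2' P5 P5' 0 = 0.
  rewrite -W25 /wronsk sum_ord2 /P2 /P5 /P2' /P5' /cpair /=; ring.
have d51 : cderiv p5 0 = - cderiv p1 0 /\ cderiv q5 0 = - cderiv q1 0.
  have der (p p' : R -> C) : (forall x, isd p x (p' x)) -> cderiv (fun x => p (- x)) 0 = - p' 0.
    by move=> dp; apply: cderivE; have := @isd_opp R p 0 _ (dp (- 0)); rewrite oppr0.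
  have [h1 _] := s1.
  have -> : p5 = fun x => p1 (- x) by apply/funext => x; have [] := p51 x.
  have -> : q5 = fun x => q1 (- x) by apply/funext => x; have [] := p51 x.
  by split; apply: der; [exact: (h1 ord0)|exact: (h1 ord_max)].
(* Reflection gives [P1] and [P5] equal values and opposite derivatives at 0; this is how [Delta_1]
   enters. *)
have w15 : wronsk P1 P1' P5 P5' 0 = 2 * Delta p1 q1.
  rewrite /wronsk sum_ord2 /P1 /P5 /P1' /P5' /cpair /= /Delta.
  have [-> ->] := d51; have [-> ->] := p51 0; rewrite oppr0; ring.
have a10 : a1 = 0.
  have := WS P5 P5'; rewrite wQ5 w25 w65 w15 wronsk_self !mulr0 !addr0 => /esym/eqP.
  by rewrite mulf_eq0 => /orP[/eqP//|]; rewrite mulf_eq0 pnatr_eq0 /= => /eqP.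
(* The Wronskian of the conjugate of [P6] with [P6] equals [n2 - conjc n2], which is not zero; it
   would vanish if only [P5] and [P6] entered the combination. *)
have a20 : a2 <> 0.
  move=> a20; have := WS P6 P6'; rewrite a10 a20 wronsk_self [wronsk P5 _ _ _ _]wronskC w65.
  rewrite !mul0r oppr0 !mulr0 !addr0 => W0.
  have wc := wronsk_const sB sQ s6.
  have L : like_exp (conjc n2 + n2) (wronsk Q Q' P6 P6')
     (\sum_j (conjc (- (n2 * cpair 0 1 j)) * cpair 0 1 j + -1 * (conjc (cpair 0 1 j) * - (n2 * cpair 0 1 j)))).
    apply: (@like_exp_sum R 2 _ (fun j x => Q' j x * P6 j x - Q j x * P6' j x)) => j.
    have -> : (fun x => Q' j x * P6 j x - Q j x * P6' j x) =
       (fun x => Q' j x * P6 j x + -1 * (Q j x * P6' j x)).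
      by apply/funext => x; rewrite mulN1r.
    apply: like_expD; first exact: like_expM (like_exp_conj (l6' j)) (l6 j).
    by apply: like_expZ; exact: like_expM (like_exp_conj (l6 j)) (l6' j).
  have n20 : conjc n2 + n2 = 0.
    by apply: complexP; rewrite /n2 !(reD, imD, reM, imM) /=; ring.
  rewrite n20 (_ : wronsk Q Q' P6 P6' = fun=> 0) in L; last first.
    by apply/funext => x; rewrite wc W0.
  have /esym := like_exp_cst L; rewrite sum_ord2 /cpair /=.
  have k0 : 0 < Num.sqrt (s - om) by rewrite sqrtr_gt0 subr_gt0.
  rewrite !(mulr0, mul0r, mulr1, oppr0, add0r).
  move=> /(congr1 (@complex.Im R)); rewrite /n2 !(reD, imD, reM, imM, reN, imN) /= => h.
  by have ? := k0; lra.
(* Solving the combination for [P2] bounds it on the right; on the left it behaves like [exp (n2 x)]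
   with [Re n2 = 0]. *)
have key (f q g5 g6 : R -> C) : (forall x, q x = a2 * f x + a5 * g5 x + a6 * g6 x) ->
    half_bounded q -> half_bounded g5 -> half_bounded g6 -> half_bounded f.
  move=> E [K KP] [K5 K5P] [K6 K6P].
  exists (cabs a2^-1 * (K + cabs a5 * K5 + cabs a6 * K6)) => x x0.
  have -> : f x = a2^-1 * (q x - a5 * g5 x - a6 * g6 x).
    rewrite E (_ : _ - _ - _ = a2 * f x) ?mulKf //; first by apply/eqP.
    by ring.
  rewrite cabsM ler_wpM2l ?cabs_ge0 // (le_trans (cabsB _ _)) // lerD //.
    by rewrite (le_trans (cabsB _ _)) // lerD ?KP // cabsM ler_wpM2l ?cabs_ge0 ?K5P.
  by rewrite cabsM ler_wpM2l ?cabs_ge0 ?K6P.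
have r2 j : half_bounded (P2 j).
  apply: (key _ (Q j) (P5 j) (P6 j)) => // x; have [-> _] := QS j x.
  by rewrite /S a10 mul0r add0r.
have r2' j : half_bounded (P2' j).
  apply: (key _ (Q' j) (P5' j) (P6' j)) => // x; have [_ ->] := QS j x.
  by rewrite /S' a10 mul0r add0r.
have sr := sys_refl s2.
have m2 j : half_bounded (refl P2 j).
  apply: (like_exp_bounded re2 _ (l2 j)) => x; eexists; exact: sr.1.
have m2' j : half_bounded (reflN P2' j).
  apply: (like_exp_bounded re2 _ (l2' j)) => x; eexists; exact: sr.2.
have glue (f : R -> C) : half_bounded f -> half_bounded (fun x => f (- x)) ->
    exists2 K : R, 0 <= K & forall x, cabs (f x) <= K.
  move=> [K KP] [L LP]; exists (`|K| + `|L|) => [|x]; first by rewrite addr_ge0.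
  have nK := ler_norm K; have nL := ler_norm L; have K0 := normr_ge0 K; have L0 := normr_ge0 L.
  have [x0|x0] := leP 0 x; first by rewrite (le_trans (KP x x0)) // (le_trans nK) // lerDl.
  have := LP (- x); rewrite opprK => /(_ ltac:(by rewrite oppr_ge0 ltW)) h.
  by rewrite (le_trans h) // (le_trans nL) // lerDr.
have m2'' j : half_bounded (fun x => P2' j (- x)).
  by have [K KP] := m2' j; exists K => x x0; rewrite -cabsN KP.
have [K0 K00 H0] := glue _ (r2 ord0) (m2 ord0).
have [K1 K10 H1] := glue _ (r2 ord_max) (m2 ord_max).
have [K2 K20 H2] := glue _ (r2' ord0) (m2'' ord0).
have [K3 K30 H3] := glue _ (r2' ord_max) (m2'' ord_max).
exists (K0 + K1 + K2 + K3); apply: ord2P => x.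
- by have [? _ ? _] := le_sum_each K00 K10 K20 K30;
  split; [exact: le_trans (H0 x) _|exact: le_trans (H2 x) _].
- by have [_ ? _ ?] := le_sum_each K00 K10 K20 K30;
  split; [exact: le_trans (H1 x) _|exact: le_trans (H3 x) _].
Qed.

End OscillatingSolution.

(** * The bounded solution of (B) at the threshold *)

Section ThresholdSolution.
Variable R : realType.
Notation C := R[i].
Variables (s : R) (F : R -> R -> R -> R) (U0 : R -> R) (C0 : R).
Implicit Types p : R -> C.
Let lbr : C := 0 +i* s.
Let E0 x : R := d2 F (U0 x ^+ 2) 0 0.
Hypothesis Eb : forall x, `|E0 x| <= C0.

Lemma lam_of0 : lam_of s 0 = lbr :> C.
Proof. by rewrite /lam_of expr0n mulr0 subr0. Qed.

Lemma single_trivial (n : C) p : sys (csingle n) (BS E0) (csingle p) (csingle (cderiv p)) ->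
  p 0 = 0 -> cderiv p 0 = 0 -> forall x, p x = 0.
Proof.
move=> sp p0 p0' x.
by have [//|h _] := @sys_unique R 1 _ _ _ _ C0 (fun _ _ y => Eb y) sp _ ord0 x.
Qed.

Lemma like_exp_nontrivial (n : C) (f : R -> C) : like_exp n f 1 -> ~ forall x, f x = 0.
Proof.
move=> h f0; have [X /(_ X (lexx _))] := h (1 / 2) ltac:(by []).
by rewrite f0 mulr0 sub0r cabsN cabs1 => ?; lra.
Qed.

Lemma jet_pos (n : C) p : sys (csingle n) (BS E0) (csingle p) (csingle (cderiv p)) ->
  (~ forall x, p x = 0) -> 0 < cabs (p 0) ^+ 2 + cabs (cderiv p 0) ^+ 2.
Proof.
move=> sp nt; rewrite lt_def addr_ge0 ?sqr_ge0 // andbT; apply/negP.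
rewrite paddr_eq0 ?sqr_ge0 // !sqrf_eq0 => /andP[/eqP/cabs_eq0 h1 /eqP/cabs_eq0 h2].
by apply: nt; exact: (single_trivial sp h1 h2).
Qed.

Variables p4 p8 : R -> C.
Hypotheses (j4 : jost_B_minus s F U0 (lam_of s 0) 0 p4)
  (j8 : jost_B_plus s F U0 (lam_of s 0) 0 p8) (EB : evans_2 p4 p8 = 0).
Hypotheses (om : R) (om0 : 0 < om) (oms : om < s).

Let s4 : sys (csingle 0) (BS E0) (csingle p4) (csingle (cderiv p4)).
Proof. by have [+ _ _] := j4; rewrite lam_of0; exact: solves_B_sys. Qed.
Let s8 : sys (csingle 0) (BS E0) (csingle p8) (csingle (cderiv p8)).
Proof. by have [+ _ _] := j8; rewrite lam_of0; exact: solves_B_sys. Qed.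
Let l4 : like_exp 0 (fun x => p4 (- x)) 1.
Proof. by have [_ h _] := j4; exact: like_minus h. Qed.
Let l8 : like_exp 0 p8 1.
Proof. by have [_ h _] := j8; exact: like_plus h. Qed.

Lemma p4_nontrivial : ~ forall x, p4 x = 0.
Proof. by move=> h; apply: (like_exp_nontrivial l4) => x; exact: h. Qed.

Lemma p4_jet : 0 < cabs (p4 0) ^+ 2 + cabs (cderiv p4 0) ^+ 2.
Proof. exact: jet_pos s4 p4_nontrivial. Qed.

Lemma p4_jost : jost_right (csingle 0) (reflB (BS E0)) (refl (csingle p4))
  (reflN (csingle (cderiv p4))).
Proof.
apply: (@jost_right_of_like R 1 _ _ _ _ 0 (fun=> 1) (sys_refl s4)) => // j.
- by rewrite /csingle subrr mul0r.
- by rewrite mul0r; have [_ _ h] := j4; exact: like_expN (like_minus h).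
Qed.

Lemma p4_far : exists X : R, 0 <= X /\ forall x, x <= - X -> 1 / 2 <= cabs (p4 x).
Proof.
have [X XP] := l4 (e := 1 / 2) ltac:(by []).
exists (Num.max 0 X); rewrite le_max lexx; split => // x; rewrite lerNr ge_max => /andP[_ /XP].
rewrite opprK mul0r cexp0 mul1r => h.
by have := cabs_sub 1 (p4 x); rewrite cabs1 cabs_subC; lra.
Qed.

(** [E_B = 0] makes the jets of [p4] and [p8] at 0 dependent; as [p8] is not identically zero, one
    of its two initial values can be divided by. *)
Lemma p4_proportional : exists c : C, forall x, p4 x = c * p8 x.
Proof.
have E : p4 0 * cderiv p8 0 = p8 0 * cderiv p4 0.
  by apply/eqP; rewrite -subr_eq0 -evans_2E EB.
have n8 : ~ forall x, p8 x = 0 by exact: like_exp_nontrivial l8.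
have [c [c1 c2]] : exists c : C, p4 0 = c * p8 0 /\ cderiv p4 0 = c * cderiv p8 0.
  have [z|/eqP z] := eqVneq (p8 0) 0; last first.
    exists (p4 0 / p8 0); split; first by rewrite divfK //; exact/eqP.
    by rewrite mulrAC E mulrC mulKf //; exact/eqP.
  have z' : cderiv p8 0 != 0 by apply/eqP => z'; apply: n8; exact: single_trivial s8 z z'.
  exists (cderiv p4 0 / cderiv p8 0); split; last by rewrite divfK.
  by move/eqP: E; rewrite z mul0r mulf_eq0 (negPf z') orbF mulr0 => /eqP.
exists c => x; apply/eqP; rewrite -subr_eq0 -mulN1r; apply/eqP.
have [|h _] := @sys_unique R 1 _ _ _ _ C0 (fun _ _ y => Eb y)
  (sysD s4 (sysZ (-1) (sysZ c s8))) _ ord0 x; last exact: h.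
by move=> j; rewrite /csingle c1 c2 !mulN1r !subrr.
Qed.

(** [p4] tends to 1 on the left and is a multiple of [p8], which tends to 1 on the right. The
    threshold solution does not decay, but its bound suffices for the coupling integral. *)
Lemma p4_bounded : exists M : R, forall x, cabs (p4 x) <= M.
Proof.
have d (p : R -> C) n : sys (csingle n) (BS E0) (csingle p) (csingle (cderiv p)) ->
    forall x, exists d, isd p x d.
  by move=> [h _] x; exists (cderiv p x); exact: (h ord0 x).
have z0 : 0 <= complex.Re (0 : C) by [].
have [K KP] : half_bounded p8 by exact: (like_exp_bounded z0 (d _ _ s8) l8).
have [L LP] : half_bounded (fun x => p4 (- x)).
  apply: (like_exp_bounded z0 _ l4) => x.
  by have [e h] := d _ _ s4 (- x); exists (- e); exact: isd_opp.
have [c cP] := p4_proportional.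
exists (Num.max L (cabs c * K)) => x; rewrite le_max; have [x0|x0] := leP 0 x.
  by rewrite cP cabsM ler_wpM2l ?cabs_ge0 ?orbT // KP.
by apply/orP; left; rewrite -[x]opprK LP // oppr_ge0 ltW.
Qed.

Lemma p4_derivs : (forall x, isd p4 x (cderiv p4 x)) /\
  (forall x, isd (cderiv p4) x (- ((E0 x)%:C * p4 x))).
Proof.
have [h1 h2] := s4; split => x; first exact: (h1 ord0).
by apply: (isd_eq (h2 ord0 x)); rewrite big_ord1 /csingle /BS expr0n mul0r sub0r.
Qed.

End ThresholdSolution.

Section Coupling.
Variable R : realType.
Notation C := R[i].

Lemma cprimitive (f : R -> C) (c b : R) : 0 < b -> ccont f ->
  (forall x, cabs (f x) <= c * expR (- b * `|x|)) ->
  exists G : R -> C, (forall x, isd G x (f x)) /\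
    tends0 (fun x => G x - G (- x) - cint_line f).
Proof.
move=> b0 [cr ci] fb.
have le1 (x y t : R) : x ^+ 2 <= t ^+ 2 -> 0 <= t -> t <= y -> `|x| <= y.
  move=> h t0; apply: le_trans; rewrite -(@ler_pXn2r _ 2) ?nnegrE //.
  by rewrite real_normK ?num_real.
have ir := integrable_decay b0 cr (fun x => le1 _ _ _ _ (cabs_ge0 _) (fb x)).
have ii := integrable_decay b0 ci (fun x => le1 _ _ _ _ (cabs_ge0 _) (fb x)).
have {}ir := ir (fun x => ltac:(by rewrite cabs2 lerDl sqr_ge0)).
have {}ii := ii (fun x => ltac:(by rewrite cabs2 lerDr sqr_ge0)).
have [P [dP Py PNy]] := line_primitive cr ir.
have [Q [dQ Qy QNy]] := line_primitive ci ii.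
exists (fun x => P x +i* Q x); split => [x|e e0].
  by split; [exact: dP|exact: dQ].
have e4 : 0 < e / 4 by rewrite divr_gt0.
have [X1 H1] := cvgy_eps Py e4; have [X2 H2] := cvgNy_eps PNy e4.
have [X3 H3] := cvgy_eps Qy e4; have [X4 H4] := cvgNy_eps QNy e4.
exists (Num.max X1 (Num.max (- X2) (Num.max X3 (- X4)))) => x.
rewrite !ge_max => /and4P[/H1 h1 x2 /H3 h3 x4].
have h2 := H2 (- x) ltac:(by rewrite lerNl); have h4 := H4 (- x) ltac:(by rewrite lerNl).
rewrite subr0 in h2; rewrite subr0 in h4.
have -> : (P x +i* Q x) - (P (- x) +i* Q (- x)) - cint_line f =
   (P x - int_line (reF f) - P (- x))%:C + 'i * (Q x - int_line (imF f) - Q (- x))%:C.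
  by apply: complexP; rewrite /cint_line !(reD, imD, reM, imM, reN, imN) /=; ring.
rewrite (le_trans (cabsD _ _)) // cabsM !cabs_real.
have -> : cabs ('i : C) = 1 by rewrite /= expr0n expr1n add0r sqrtr1.
rewrite mul1r; have := ler_normB (P x - int_line (reF f)) (P (- x)).
have := ler_normB (Q x - int_line (imF f)) (Q (- x)).
by clear -h1 h2 h3 h4; lra.
Qed.

End Coupling.

(** * Zeros of the Evans function and conclusion *)

Section Resonance.
Variable R : realType.
Notation C := R[i].
Variables (om s : R) (F : R -> R -> R -> R) (m : R) (U V : R -> R) (Cb : R).
Hypotheses (om0 : 0 < om) (oms : om < s).
Let lbr : C := 0 +i* s.
Notation al := (alF F m U V).
Notation be := (beF F m U V).
Notation c := (cF F m U V).
Notation d := (dF F m U V).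
Notation e := (eF F m U V).
Hypothesis coef_bnd : forall x, [/\ `|al x| <= Cb, `|be x| <= Cb, `|c x| <= Cb,
  `|d x| <= Cb & `|e x| <= Cb].

Definition exponent4 (j : 'I_(2 + 2)) : C :=
  nth 0 [:: (Num.sqrt (om + s))%:C; 'i * (Num.sqrt (s - om))%:C; (Num.sqrt (2 * s))%:C; 0] j.

Definition B4 (k j : 'I_(2 + 2)) (x : R) : R :=
  if (k < 2)%N then
    (if (j < 2)%N then (if k == j then al x + be x else al x) else c x)
  else if (j < 2)%N then c x else (if k == j then d x + e x else d x).

Lemma exponent4_re j : 0 <= complex.Re (exponent4 j).
Proof.
have s0 := lt_trans om0 oms.
move: j; apply: ord4P; rewrite /exponent4 /= ?sqrtr_ge0 // !(mul0r, mulr0) ?subr0 ?subrr //.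
Qed.

Lemma nu_exponent4 (j : 'I_(2 + 2)) : nu om s j lbr = exponent4 j.
Proof.
have s0 := lt_trans om0 oms.
by move: j; apply: ord4P; rewrite /nu /exponent4 /=; [exact: (nu1_br om0 oms)|exact: (nu2_br oms)|exact: (nu3_br om0 oms)|exact: nu4_br].
Qed.

Lemma B4_bnd k j x : `|B4 k j x| <= Cb + Cb.
Proof.
have [h1 h2 h3 h4 h5] := coef_bnd x; have C0 := le_trans (normr_ge0 _) h1.
have le2 (t : R) : `|t| <= Cb -> `|t| <= Cb + Cb by move=> h; rewrite (le_trans h) // lerDl.
have le3 (t u : R) : `|t| <= Cb -> `|u| <= Cb -> `|t + u| <= Cb + Cb.
  by move=> ? ?; rewrite (le_trans (ler_normD _ _)) // lerD.
by rewrite /B4; do !case: ifP => _; (exact: le2 || exact: le3).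
Qed.

Lemma rhsk_B4 k x (v : 'I_(2 + 2) -> C) : rhsk om s F m U V lbr k x v =
  exponent4 k ^+ 2 * v k - \sum_j (B4 k j x)%:C * v j.
Proof.
have E1 : (om%:C - 'i * lbr) = (om + s)%:C by rewrite i_lbr -rmorphB opprK.
have E2 : (om%:C + 'i * lbr) = (om - s)%:C by rewrite i_lbr -rmorphD.
have E3 : (s%:C - 'i * lbr) = (2 * s)%:C by rewrite i_lbr -rmorphB opprK mulr_natl mulr2n.
have E4 : (s%:C + 'i * lbr) = 0 by rewrite i_lbr -rmorphD subrr.
have D2 (a b : R) : (a + b)%:C = a%:C + b%:C by exact: rmorphD.
move: k; apply: ord4P; rewrite sum_ord4 /rhsk /B4 /exponent4 /=.
- rewrite (n1_sqr om0 oms) /rhs0 E1 (D2 (al x)).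
  by move: (v i4_0) (v i4_1) (v i4_2) (v i4_3) (al x)%:C (be x)%:C (c x)%:C => *; ring.
- rewrite (n2_sqr oms) /rhs1 E2 (D2 (al x)).
  by move: (v i4_0) (v i4_1) (v i4_2) (v i4_3) (al x)%:C (be x)%:C (c x)%:C => *; ring.
- rewrite (n3_sqr om0 oms) /rhs2 E3 (D2 (d x)).
  by move: (v i4_0) (v i4_1) (v i4_2) (v i4_3) (d x)%:C (e x)%:C (c x)%:C => *; ring.
- rewrite /rhs3 E4 (D2 (d x)) expr0n /= !mul0r.
  by move: (v i4_0) (v i4_1) (v i4_2) (v i4_3) (d x)%:C (e x)%:C (c x)%:C => *; ring.
Qed.

Lemma solves_L_sys (psi : R -> 'cV[C]_(2 + 2)) : solves_L om s F m U V lbr psi ->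
  sys exponent4 B4 (entry psi) (fun k => cderiv (entry psi k)).
Proof.
move=> [dpsi e4]; split => k x; first exact: ctwice_isd.
apply: (isd_eq (ctwice_isd2 x (dpsi k))).
have := Lop_rhsk (e4 x) k; rewrite rhsk_B4 => <-.
rewrite /vderiv mxE; congr (cderiv _ x); apply/funext => y; by rewrite /entry mxE.
Qed.

Lemma like_exp_of_bound (n : C) (f : R -> C) (k : C) (K b : R) : 0 < b ->
  (forall x, 0 <= x -> cabs (cexp (n * x%:C) * f x - k) <= K * expR (- b * x)) ->
  like_exp n f k.
Proof.
move=> b0 H e' e0; have K1 : 0 < `|K| + 1 by rewrite ltr_wpDl.
have [X [X0 XP]] := expR_small b0 (divr_gt0 e0 K1); exists X => x Xx.
rewrite (le_trans (H x (le_trans X0 Xx))) //.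
rewrite (@le_trans _ _ ((`|K| + 1) * expR (- b * x))) //.
  by rewrite ler_wpM2r ?expR_ge0 // (le_trans (ler_norm K)) // lerDl.
by rewrite mulrC -ler_pdivlMr // XP.
Qed.

Lemma jost_minus_like j (psi : R -> 'cV[C]_(2 + 2)) : jost_minus om s F m U V lbr j psi ->
  [/\ sys exponent4 B4 (entry psi) (fun k => cderiv (entry psi k)),
      forall k, like_exp (exponent4 j) (fun x => entry psi k (- x)) (k == j)%:R &
      forall k, like_exp (exponent4 j) (fun x => - cderiv (entry psi k) (- x))
        (- (exponent4 j * (k == j)%:R))].
Proof.
rewrite /jost_minus nu_exponent4 => -[/solves_L_sys sy [K [b [b0 H]]]]; split => // k.
- apply: (like_exp_of_bound (K := K) b0) => x x0.
  have := H (- x) (lshift _ k); rewrite oppr_le0 => /(_ x0).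
  by rewrite cabs_le /jet !col_mxEu mxE andbT rmorphN /= mulrN mulNr opprK mulNr mulrN.
- apply: (like_exp_of_bound (K := K) b0) => x x0.
  have := H (- x) (rshift _ k); rewrite oppr_le0 => /(_ x0).
  rewrite cabs_le /jet !col_mxEd !mxE andbT rmorphN /= mulrN mulNr opprK mulNr mulrN.
  have -> : cexp (exponent4 j * x%:C) * - cderiv (entry psi k) (- x)
      - - (exponent4 j * (k == j)%:R) =
    - (cexp (exponent4 j * x%:C) * cderiv (entry psi k) (- x) - exponent4 j * (k == j)%:R).
    by ring.
  by rewrite cabsN.
Qed.

Lemma jost_plus_like j (psi : R -> 'cV[C]_(2 + 2)) : jost_plus om s F m U V lbr j psi ->
  [/\ sys exponent4 B4 (entry psi) (fun k => cderiv (entry psi k)),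
      forall k, like_exp (exponent4 j) (entry psi k) (k == j)%:R &
      forall k, like_exp (exponent4 j) (cderiv (entry psi k))
        (- (exponent4 j * (k == j)%:R))].
Proof.
rewrite /jost_plus nu_exponent4 => -[/solves_L_sys sy [K [b [b0 H]]]]; split => // k.
- apply: (like_exp_of_bound (K := K) b0) => x x0.
  by have := H x (lshift _ k) x0; rewrite cabs_le /jet !col_mxEu mxE andbT.
- apply: (like_exp_of_bound (K := K) b0) => x x0.
  have := H x (rshift _ k) x0.
  by rewrite cabs_le /jet !col_mxEd !mxE andbT mulNr.
Qed.

Lemma like_exp_weaken (n n' : C) (f : R -> C) : complex.Re n' <= complex.Re n ->
  like_exp n f 0 -> like_exp n' f 0.
Proof.
move=> nn h e' /h[X XP]; exists (Num.max 0 X) => x; rewrite ge_max => /andP[x0 /XP].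
rewrite !subr0 !cabs_cexpM; apply: le_trans; rewrite ler_wpM2r ?cabs_ge0 // ler_expR.
by rewrite !reM /= !mulr0 !subr0 ler_wpM2r.
Qed.

Lemma like_exp_zero (n k : C) : like_exp n (fun=> 0) k -> k = 0.
Proof.
move=> h; apply/eqP; rewrite -oppr_eq0; apply/eqP; apply: tends0_cst => e' /h[X XP].
by exists X => x /XP; rewrite mulr0 sub0r.
Qed.

Section Combination.
Variables (f f' : 'I_(2 + 2) -> 'I_(2 + 2) -> R -> C) (a : 'I_(2 + 2) -> C).
Hypotheses (lf : forall j k, like_exp (exponent4 j) (f j k) (k == j)%:R)
  (lf' : forall j k, like_exp (exponent4 j) (f' j k) (- (exponent4 j * (k == j)%:R))).
Let g k x := \sum_j a j * f j k x.
Let g' k x := \sum_j a j * f' j k x.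

(** Component [k] of the [j]-th Jost solution, [j <> k], is negligible against [exp (- n_j x)]. Read
    at the rate of [k], component [k] thus isolates [a k] provided no slower solution is left. Hence
    the order: the two exponents with zero real part, then index 0, then index 2, since
    [om + s <= 2 s]. *)
Lemma combination_independent : (forall k x, g k x = 0) -> forall j, a j = 0.
Proof.
move=> g0.
have key k : (forall j, j <> k -> a j = 0 \/ complex.Re (exponent4 k) <= complex.Re (exponent4 j)) ->
    a k = 0.
  move=> H; have L : like_exp (exponent4 k) (fun x => \sum_j a j * f j k x)
      (\sum_j a j * (k == j)%:R).
    apply: like_exp_sum => j; have [->|jk] := eqVneq j k.
      by apply: like_expZ; have := lf k k; rewrite eqxx.
    have [a0|re] := H j ltac:(exact/eqP).
      by rewrite a0 => e' e0; exists 0 => x _; rewrite !mul0r mulr0 subrr cabs0 ltW.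
    apply: like_expZ; apply: like_exp_weaken re _.
    by have := lf j k; rewrite eq_sym (negPf jk).
  have E : (fun x => \sum_j a j * f j k x) = fun=> 0 by apply/funext => x; exact: g0.
  rewrite E in L; have := like_exp_zero L; rewrite (bigD1 k) //= eqxx mulr1 big1 ?addr0 //.
  by move=> j jk; rewrite eq_sym (negPf jk) mulr0.
have r0 j := exponent4_re j.
have re1 : complex.Re (exponent4 i4_1) = 0 by rewrite /exponent4 /= mul0r mulr0 subr0.
have re3 : complex.Re (exponent4 i4_3) = 0 by [].
have a1 : a i4_1 = 0 by apply: key => j _; right; rewrite re1.
have a3 : a i4_3 = 0 by apply: key => j _; right; rewrite re3.
have re02 : complex.Re (exponent4 i4_0) <= complex.Re (exponent4 i4_2).
  have s0 := lt_trans om0 oms.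
  rewrite /exponent4 /= ler_sqrt ?mulr_ge0 ?(ltW s0) // mulr_natl mulr2n lerD2r.
  exact: ltW.
have a0 : a i4_0 = 0.
  by apply: key; apply: ord4P => ne; [by case: ne|left|right|left].
have a2 : a i4_2 = 0.
  by apply: key; apply: ord4P => ne; [left|left|by case: ne|left].
exact: ord4P.
Qed.

Lemma combination_outgoing k : tends0 (fun x => g' k x + exponent4 k * g k x).
Proof.
apply: (@tends0_eq _ (fun x => \sum_j a j * (f' j k x + exponent4 k * f j k x))).
  by move=> x; rewrite /g' /g mulr_sumr -big_split /=; apply: eq_bigr => j _; ring.
apply: tends0_sum => j; apply: tends0Z; apply: (like_exp_tends0 (exponent4_re j)).
have := like_expD (lf' j k) (like_expZ (exponent4 k) (lf j k)).
by case: eqVneq => [->|_]; rewrite ?mulr1 ?mulr0 ?oppr0 ?addr0 ?addNr.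
Qed.

Lemma combination_decay k : 0 < complex.Re (exponent4 k) -> tends0 (g k).
Proof.
move=> k0; apply: tends0_sum => j; apply: tends0Z.
have [jk|jk] := eqVneq k j; first by subst j; exact: like_exp_decay k0 (lf k k).
by apply: (like_exp_tends0 (exponent4_re j)); have := lf j k; rewrite (negPf jk).
Qed.

Lemma half_bounded_sum n' (h : 'I_n' -> R -> C) : (forall j, half_bounded (h j)) ->
  half_bounded (fun x => \sum_j h j x).
Proof.
move=> /choice[K KP]; exists (\sum_j K j) => x x0; rewrite (le_trans (cabs_sum _ _ _)) //.
by apply: ler_sum => j _; exact: KP.
Qed.

Lemma half_boundedZ (z : C) (h : R -> C) : half_bounded h -> half_bounded (fun x => z * h x).
Proof.
by move=> [K KP]; exists (cabs z * K) => x x0; rewrite cabsM ler_wpM2l ?cabs_ge0 // KP.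
Qed.

Lemma combination_bounded k : (forall j x, exists d, isd (f j k) x d) ->
  (forall j x, exists d, isd (f' j k) x d) -> half_bounded (g k) /\ half_bounded (g' k).
Proof.
move=> h1 h2; split; apply: half_bounded_sum => j; apply: half_boundedZ.
- exact: like_exp_bounded (exponent4_re j) (h1 j) (lf j k).
- exact: like_exp_bounded (exponent4_re j) (h2 j) (lf' j k).
Qed.

End Combination.

(** The cuts leave the branch points towards negative real parts, so [i s] itself belongs to the
    slit domain. *)
Lemma off_cuts_br : off_cuts om s lbr.
Proof.
move=> b t Hb t0 /(congr1 (@complex.Re R)) /=; have ? := t0.
by case: Hb => -> /=; rewrite ?oppr0 ?sub0r ?add0r ?subr0 => ?; lra.
Qed.

Lemma resonance_solution (E : C -> C) : evans_near om s F m U V lbr E -> E lbr = 0 ->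
  exists f f' : 'I_(2 + 2) -> R -> C,
  [/\ forall k x, isd (f k) x (f' k x),
      forall k x, isd (f' k) x (rhsk om s F m U V lbr k x (fun j => f j x)),
      forall k, [/\ half_bounded (f k), half_bounded (f' k), half_bounded (fun x => f k (- x)) &
                    half_bounded (fun x => f' k (- x))],
      forall k, [/\ tends0 (fun x => f' k x + exponent4 k * f k x),
                    tends0 (fun x => f' k (- x) - exponent4 k * f k (- x)) &
                    0 < complex.Re (exponent4 k) -> tends0 (f k) /\ tends0 (fun x => f k (- x))] &
      ~ forall k x, f k x = 0].
Proof.
move=> [r [r0 [psim [psip [_ J Edet]]]]] E0.
have Dbr : `|lbr - lbr| < r%:C /\ off_cuts om s lbr.
  by split; [rewrite subrr normr0 ltcR|exact: off_cuts_br].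
have Jm j := jost_minus_like (J j lbr Dbr).1; have Jp j := jost_plus_like (J j lbr Dbr).2.
have := Edet lbr Dbr; rewrite E0 => /esym/det_eq0_dependent[a anz aM].
(* The sign in [ap] moves the right Jost columns to the other side of the equality. *)
pose am j := a (lshift (2 + 2) j); pose ap j := - a (rshift (2 + 2) j).
pose f k x := \sum_j am j * entry (psim j lbr) k x.
pose f' k x := \sum_j am j * cderiv (entry (psim j lbr) k) x.
pose g k x := \sum_j ap j * entry (psip j lbr) k x.
pose g' k x := \sum_j ap j * cderiv (entry (psip j lbr) k) x.
have sysS (b : 'I_(2 + 2) -> C) (P P' : 'I_(2 + 2) -> 'I_(2 + 2) -> R -> C) :
    (forall j, sys exponent4 B4 (P j) (P' j)) ->
    sys exponent4 B4 (fun k x => \sum_j b j * P j k x) (fun k x => \sum_j b j * P' j k x).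
  move=> sP; split => k x; first by apply: isd_sum => j; apply: isdZ; exact: (sP j).1.
  apply: (isd_eq (isd_sum (fun j => isdZ (b j) ((sP j).2 k x)))).
  under eq_bigr do rewrite mulrBr; rewrite sumrB mulr_sumr; congr (_ - _).
    by apply: eq_bigr => j _; ring.
  under eq_bigr do rewrite mulr_sumr; rewrite exchange_big /=; apply: eq_bigr => i _.
  by rewrite mulr_sumr; apply: eq_bigr => j _; ring.
have sf : sys exponent4 B4 f f' by apply: sysS => j; have [] := Jm j.
have sg : sys exponent4 B4 g g' by apply: sysS => j; have [] := Jp j.
have jet_eq k : f k 0 = g k 0 /\ f' k 0 = g' k 0.
  split; apply/eqP; rewrite -subr_eq0 /f /g /f' /g'; apply/eqP.
    rewrite -[RHS](aM (lshift (2 + 2) k)) [RHS]big_split_ord /=; congr (_ + _).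
      apply: eq_bigr => j _. by rewrite row_mxEl mxE /jet col_mxEu mulrC.
    rewrite -sumrN; apply: eq_bigr => j _; rewrite row_mxEr mxE /jet col_mxEu /ap.
    by rewrite mulNr opprK mulrC.
  rewrite -[RHS](aM (rshift (2 + 2) k)) [RHS]big_split_ord /=; congr (_ + _).
    by apply: eq_bigr => j _; rewrite row_mxEl mxE /jet col_mxEd mxE mulrC.
  rewrite -sumrN; apply: eq_bigr => j _; rewrite row_mxEr mxE /jet col_mxEd mxE /ap.
  by rewrite mulNr opprK mulrC.
have fg k x : f k x = g k x /\ f' k x = g' k x.
  have [|h1 h2] := sys_unique B4_bnd (sysD sf (sysZ (-1) sg)) _ k x.
    by move=> j; have [-> ->] := jet_eq j; rewrite !mulN1r !subrr.
  by split; apply/eqP; rewrite -subr_eq0 -mulN1r; apply/eqP; [exact: h1|exact: h2].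
have lm j k : like_exp (exponent4 j) (fun x => entry (psim j lbr) k (- x)) (k == j)%:R.
  by have [_ h _] := Jm j; exact: h.
have lm' j k : like_exp (exponent4 j) (fun x => - cderiv (entry (psim j lbr) k) (- x))
    (- (exponent4 j * (k == j)%:R)) by have [_ _ h] := Jm j; exact: h.
have lp j k : like_exp (exponent4 j) (entry (psip j lbr) k) (k == j)%:R.
  by have [_ h _] := Jp j; exact: h.
have lp' j k : like_exp (exponent4 j) (cderiv (entry (psip j lbr) k))
    (- (exponent4 j * (k == j)%:R)) by have [_ _ h] := Jp j; exact: h.
have fE k : f k = g k by apply/funext => x; have [] := fg k x.
have f'E k : f' k = g' k by apply/funext => x; have [] := fg k x.
have dp j k x : exists d, isd (entry (psip j lbr) k) x d.
  by have [[h _] _ _] := Jp j; eexists; exact: h.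
have dp' j k x : exists d, isd (cderiv (entry (psip j lbr) k)) x d.
  by have [[_ h] _ _] := Jp j; eexists; exact: h.
have dm j k x : exists d, isd (fun x => entry (psim j lbr) k (- x)) x d.
  by have [[h _] _ _] := Jm j; eexists; exact: isd_opp (h k (- x)).
have dm' j k x : exists d, isd (fun x => - cderiv (entry (psim j lbr) k) (- x)) x d.
  by have [[_ h] _ _] := Jm j; eexists; exact: isdN (isd_opp (h k (- x))).
have f'N k x : f' k (- x) = - \sum_j am j * (- cderiv (entry (psim j lbr) k) (- x)).
  by rewrite -sumrN; apply: eq_bigr => j _; rewrite mulrN opprK.
exists f, f'; split.
- exact: sf.1.
- by move=> k x; apply: (isd_eq (sf.2 k x)); rewrite rhsk_B4.
- move=> k.
  have [b1 b2] := combination_bounded ap lp lp' (fun j => dp j k) (fun j => dp' j k).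
  have [b3 b4] := combination_bounded am lm lm' (fun j => dm j k) (fun j => dm' j k).
  split; [by rewrite fE|by rewrite f'E|exact: b3|].
  by have [K KP] := b4; exists K => x x0; rewrite f'N cabsN; exact: KP.
- move=> k; split.
  + by rewrite fE f'E; exact: (combination_outgoing ap lp lp' k).
  + have := tends0Z (-1) (combination_outgoing am lm lm' k); apply: tends0_eq => x.
    by rewrite f'N mulN1r opprD.
  + move=> k0; split; first by rewrite fE; exact: (combination_decay ap lp k0).
    exact: (combination_decay am lm k0).
- move=> f0; have [j aj] := anz.
  have am0 := combination_independent lm (a := am) (fun k x => f0 k (- x)).
  have ap0 := combination_independent lp (a := ap) (fun k x => etrans (esym (fg k x).1) (f0 k x)).
  case: (split_ordP j) aj => i -> aj; apply: aj; first exact: am0.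
  by apply/eqP; rewrite -oppr_eq0; apply/eqP; exact: ap0.
Qed.

End Resonance.

(** * From eigenfunctions and resonances to waves *)

Section Waves.
Variable R : realType.
Notation C := R[i].
Variables (om s : R).
Hypotheses (om0 : 0 < om) (oms : om < s).

Lemma root_re (w : C) : exists k : C, k ^+ 2 = w /\ 0 <= complex.Re k.
Proof.
have E : (sqrtc w) ^+ 2 = w by exact: sqr_sqrtc.
have [h|/ltW h] := leP 0 (complex.Re (sqrtc w)); first by exists (sqrtc w).
by exists (- sqrtc w); rewrite sqrrN reN oppr_ge0.
Qed.

(** [ka2 = i q] with [q] the root of [s - om - z] of nonnegative real part, so [Im ka2 = Re q] and
    [Re ka2 = - Im q]. The sign of the latter is where [Im z >= 0] is used, through
    [2 Re q Im q = - Im z]. *)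
Lemma wave_exponents (z : C) : 0 <= complex.Im z -> cabs z <= (s - om) / 2 ->
  exists ka1 ka2 ka3 ka4 : C,
  [/\ [/\ ka1 ^+ 2 = (om + s)%:C - z, ka2 ^+ 2 = (om - s)%:C + z,
          ka3 ^+ 2 = (2 * s)%:C - z & ka4 ^+ 2 = z],
      [/\ 0 <= complex.Re ka1, 0 <= complex.Re ka2, 0 <= complex.Re ka3 &
          0 <= complex.Re ka4] &
      0 <= complex.Im ka2].
Proof.
move=> z0 zs.
have [k1 [e1 r1]] := root_re ((om + s)%:C - z); have [k3 [e3 r3]] := root_re ((2 * s)%:C - z).
have [k4 [e4 r4]] := root_re z; have [q [e2 r2]] := root_re ((s - om)%:C - z).
exists k1, ('i * q), k3, k4; split; last by rewrite imM /= mul0r mul1r add0r.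
  split => //; rewrite exprMn sqr_i e2 mulN1r opprB addrC.
  by congr (_ + _); rewrite -rmorphN opprB.
split => //; rewrite reM /= mul0r mul1r sub0r oppr_ge0.
have re := congr1 (@complex.Re R) e2; have im := congr1 (@complex.Im R) e2.
rewrite expr2 reM imM reD imD reN imN /= in re im.
have rz := re_le_cabs z; rewrite leNgt; apply/negP => q0.
have q20 : 0 < complex.Im q * complex.Im q by rewrite mulr_gt0.
have qq : 0 <= complex.Re q * complex.Im q by rewrite mulr_ge0 // ltW.
have i0 : complex.Re q * complex.Im q = 0.
  by apply/eqP; rewrite eq_le qq andbT; lra.
have r0 : complex.Re q = 0.
  by apply/eqP; move/eqP: i0; rewrite mulf_eq0 (gt_eqF q0) orbF.
have ? := oms; rewrite r0 in re; lra.
Qed.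

Section Modes.
Variables (al be c d e : R -> R).
Implicit Types f : 'I_(2 + 2) -> R -> C.

Definition modes (z : C) f f' : Prop :=
  (forall k x, isd (f k) x (f' k x)) /\ forall x, [/\
    isd (f' i4_0) x (((om + s)%:C - z) * f i4_0 x - ((al x)%:C * (f i4_0 x + f i4_1 x)
      + (be x)%:C * f i4_0 x + (c x)%:C * (f i4_2 x + f i4_3 x))),
    isd (f' i4_1) x (((om - s)%:C + z) * f i4_1 x - ((al x)%:C * (f i4_0 x + f i4_1 x)
      + (be x)%:C * f i4_1 x + (c x)%:C * (f i4_2 x + f i4_3 x))),
    isd (f' i4_2) x (((2 * s)%:C - z) * f i4_2 x - ((c x)%:C * (f i4_0 x + f i4_1 x)
      + (d x)%:C * (f i4_2 x + f i4_3 x) + (e x)%:C * f i4_2 x)) &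
    isd (f' i4_3) x (z * f i4_3 x - ((c x)%:C * (f i4_0 x + f i4_1 x)
      + (d x)%:C * (f i4_2 x + f i4_3 x) + (e x)%:C * f i4_3 x))].

(** The coefficients are real, so conjugation affects [z] only. Outgoing conditions are kept out of
    [modes] because conjugation does not preserve the one with an oscillating exponent. *)
Lemma modes_conj z f f' : modes z f f' ->
  modes (conjc z) (fun k x => conjc (f k x)) (fun k x => conjc (f' k x)).
Proof.
move=> [h1 h2]; split => [k x|x]; first exact: isd_conj (h1 k x).
have cD (u v : C) : conjc (u + v) = conjc u + conjc v by exact: rmorphD.
have cN (u : C) : conjc (- u) = - conjc u by exact: rmorphN.
have cM (u v : C) : conjc (u * v) = conjc u * conjc v by exact: rmorphM.
have cR (r : R) : conjc r%:C = r%:C by exact: conjc_real.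
have [g0 g1 g2 g3] := h2 x; split.
- by apply: (isd_eq (isd_conj g0)); rewrite !(cD, cN, cM, cR).
- by apply: (isd_eq (isd_conj g1)); rewrite !(cD, cN, cM, cR).
- by apply: (isd_eq (isd_conj g2)); rewrite !(cD, cN, cM, cR).
- by apply: (isd_eq (isd_conj g3)); rewrite !(cD, cN, cM, cR).
Qed.

End Modes.

Lemma rhsk_modes (F : R -> R -> R -> R) (m : R) (U V : R -> R) (lam : C) f f' :
  (forall k x, isd (f k) x (f' k x)) ->
  (forall k x, isd (f' k) x (rhsk om s F m U V lam k x (fun j => f j x))) ->
  modes (alF F m U V) (beF F m U V) (cF F m U V) (dF F m U V) (eF F m U V)
    ('i * lam + s%:C) f f'.
Proof.
move=> h1 h2; split => // x; split.
- apply: (isd_eq (h2 i4_0 x)); rewrite /rhsk /= /rhs0; congr (_ * _ - _).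
  by rewrite (_ : (om + s)%:C = om%:C + s%:C) ?rmorphD //; move: om%:C s%:C => *; ring.
- apply: (isd_eq (h2 i4_1 x)); rewrite /rhsk /= /rhs1; congr (_ * _ - _).
  by rewrite (_ : (om - s)%:C = om%:C - s%:C) ?rmorphB //; move: om%:C s%:C => *; ring.
- apply: (isd_eq (h2 i4_2 x)); rewrite /rhsk /= /rhs2; congr (_ * _ - _).
  rewrite (_ : (2 * s)%:C = s%:C + s%:C); last by rewrite mulr_natl mulr2n rmorphD.
  by move: s%:C => *; ring.
- by apply: (isd_eq (h2 i4_3 x)); rewrite /rhsk /= /rhs3; congr (_ * _ - _); exact: addrC.
Qed.

Variables (al be c d e : R -> R -> R).

Lemma modes_wave eps (z ka1 ka2 ka3 ka4 : C) f f' :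
  modes (al eps) (be eps) (c eps) (d eps) (e eps) z f f' ->
  [/\ ka1 ^+ 2 = (om + s)%:C - z, ka2 ^+ 2 = (om - s)%:C + z,
      ka3 ^+ 2 = (2 * s)%:C - z & ka4 ^+ 2 = z] ->
  [/\ 0 <= complex.Re ka1, 0 <= complex.Re ka2, 0 <= complex.Re ka3 & 0 <= complex.Re ka4] ->
  0 <= complex.Im ka2 ->
  (forall k, half_bounded (f k) /\ half_bounded (fun x => f k (- x))) ->
  [/\ tends0 (fun x => f' i4_0 x + ka1 * f i4_0 x), tends0 (fun x => f' i4_1 x + ka2 * f i4_1 x),
      tends0 (fun x => f' i4_2 x + ka3 * f i4_2 x) & tends0 (fun x => f' i4_3 x + ka4 * f i4_3 x)] ->
  [/\ tends0 (fun x => f' i4_0 (- x) - ka1 * f i4_0 (- x)),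
      tends0 (fun x => f' i4_1 (- x) - ka2 * f i4_1 (- x)),
      tends0 (fun x => f' i4_2 (- x) - ka3 * f i4_2 (- x)) &
      tends0 (fun x => f' i4_3 (- x) - ka4 * f i4_3 (- x))] ->
  wave om s al be c d e eps z ka1 ka2 ka3 ka4 (f i4_0) (f i4_1) (f i4_2) (f i4_3)
    (f' i4_0) (f' i4_1) (f' i4_2) (f' i4_3).
Proof.
move=> [h1 h2] hk hr hi hb hy hNy; split => //.
- by move=> x; have [-> -> -> ->] := hk; exact: h2.
- have /choice[K KP] : forall k, exists K : R, forall x, cabs (f k x) <= K.
    move=> k; have [[K KP] [L LP]] := hb k; exists (Num.max K L) => x; rewrite le_max.
    have [/KP ->//|x0] := leP 0 x; rewrite -[x]opprK LP ?orbT // oppr_ge0; exact: ltW.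
  exists (`|K i4_0| + `|K i4_1| + (`|K i4_2| + `|K i4_3|)) => x.
  have a0 := normr_ge0 (K i4_0); have a1 := normr_ge0 (K i4_1).
  have a2 := normr_ge0 (K i4_2); have a3 := normr_ge0 (K i4_3).
  have le (k : 'I_(2 + 2)) := le_trans (KP k x) (ler_norm (K k)).
  split; [apply: le_trans (le i4_0) _|apply: le_trans (le i4_1) _|apply: le_trans (le i4_2) _
    |apply: le_trans (le i4_3) _]; lra.
Qed.

Lemma derR0_const (g : R -> R) : (forall x : R, derR g x (0 : R)) -> forall x, g x = g 0.
Proof.
move=> dg x.
have H (a b : R) : a <= b -> g b = g a.
  move=> ab; apply/eqP; rewrite eq_le; apply/andP; split.
    have := derR_le ab (fun t _ => dg t) (fun t _ => derR_cst 0 t) (fun t _ => lexx 0).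
    by rewrite subrr subr_le0.
  exact: derR_ge0 ab (fun t _ => dg t) (fun t _ => lexx 0).
by have [/H|/ltW/H] := leP 0 x.
Qed.

Lemma half_bounded_conj (g : R -> C) : half_bounded g -> half_bounded (fun x => conjc (g x)).
Proof. by move=> [K KP]; exists K => x /KP; rewrite cabs_conj. Qed.

Lemma tends0_conj (g : R -> C) : tends0 g -> tends0 (fun x => conjc (g x)).
Proof. by move=> h e' /h[X XP]; exists X => x /XP; rewrite cabs_conj. Qed.

(* The flux tends to [- k |f2|^2] at +oo and to [k |f2|^2] at -oo. *)
Lemma flux_vanish eps z ka1 (k : R) ka3 ka4 f1 f2 f3 f4 f1' f2' f3' f4' :
  wave om s al be c d e eps z ka1 ('i * k%:C) ka3 ka4 f1 f2 f3 f4 f1' f2' f3' f4' ->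
  complex.Im z = 0 -> 0 < k ->
  [/\ tends0 f1, tends0 f3, tends0 f4' & [/\ half_bounded f1', half_bounded f2, half_bounded f3' &
      half_bounded f4]] ->
  [/\ tends0 (fun x => f1 (- x)), tends0 (fun x => f3 (- x)), tends0 (fun x => f4' (- x)) &
      [/\ half_bounded (fun x => f1' (- x)), half_bounded (fun x => f2 (- x)),
          half_bounded (fun x => f3' (- x)) & half_bounded (fun x => f4 (- x))]] ->
  [/\ tends0 f2, tends0 f2', tends0 (fun x => f2 (- x)) & tends0 (fun x => f2' (- x))].
Proof.
move=> wv z0 k0 [t1 t3 t4 [b1 b2 b3 b4]] [m1 m3 m4 [c1 c2 c3 c4]].
have [_ y2 _ _] := wave_y wv; have [_ n2 _ _] := wave_Ny wv.
pose W := imF (fun x => conjc (f1 x) * f1' x + conjc (f2 x) * f2' x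
                      + (conjc (f3 x) * f3' x + conjc (f4 x) * f4' x)).
have Wc x : W x = W 0.
  apply: derR0_const => y; apply: (derR_eq (flux y wv)); by rewrite z0 mul0r.
have Sy : tends0 (fun x => conjc (f1 x) * f1' x + conjc (f2 x) * (f2' x + 'i * k%:C * f2 x)
                      + (conjc (f3 x) * f3' x + conjc (f4 x) * f4' x)).
  apply: tends0D; apply: tends0D.
  - by under eq_fun do rewrite mulrC; apply: tends0_mulb => //; exact: tends0_conj.
  - by apply: tends0_mulb => //; exact: half_bounded_conj.
  - by under eq_fun do rewrite mulrC; apply: tends0_mulb => //; exact: tends0_conj.
  - by apply: tends0_mulb => //; exact: half_bounded_conj.
have Sn : tends0 (fun x => conjc (f1 (- x)) * f1' (- x)
     + conjc (f2 (- x)) * (f2' (- x) - 'i * k%:C * f2 (- x))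
     + (conjc (f3 (- x)) * f3' (- x) + conjc (f4 (- x)) * f4' (- x))).
  apply: tends0D; apply: tends0D.
  - by under eq_fun do rewrite mulrC; apply: tends0_mulb => //; exact: tends0_conj.
  - by apply: tends0_mulb => //; exact: half_bounded_conj.
  - by under eq_fun do rewrite mulrC; apply: tends0_mulb => //; exact: tends0_conj.
  - by apply: tends0_mulb => //; exact: half_bounded_conj.
have Iy x : complex.Im (conjc (f1 x) * f1' x + conjc (f2 x) * (f2' x + 'i * k%:C * f2 x)
                      + (conjc (f3 x) * f3' x + conjc (f4 x) * f4' x)) =
    W x + k * cabs (f2 x) ^+ 2.
  rewrite /W /imF cabs2; move: (f1 x) (f2 x) (f3 x) (f4 x) (f1' x) (f2' x) (f3' x) (f4' x).
  by move=> [? ?] [? ?] [? ?] [? ?] [? ?] [? ?] [? ?] [? ?] /=; ring.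
have In x : complex.Im (conjc (f1 (- x)) * f1' (- x)
     + conjc (f2 (- x)) * (f2' (- x) - 'i * k%:C * f2 (- x))
     + (conjc (f3 (- x)) * f3' (- x) + conjc (f4 (- x)) * f4' (- x))) =
    W (- x) - k * cabs (f2 (- x)) ^+ 2.
  rewrite /W /imF cabs2.
  move: (f1 _) (f2 _) (f3 _) (f4 _) (f1' _) (f2' _) (f3' _) (f4' _).
  by move=> [? ?] [? ?] [? ?] [? ?] [? ?] [? ?] [? ?] [? ?] /=; ring.
have ni (t : C) : - complex.Im t <= cabs t by rewrite -imN -cabsN im_le_cabs.
have p2 x : 0 <= k * cabs (f2 x) ^+ 2 by rewrite mulr_ge0 ?sqr_ge0 // ltW.
(* Being constant, the flux is nonpositive from one end and nonnegative from the other. *)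
have W0 : W 0 = 0.
  apply/eqP; rewrite eq_le; apply/andP; split; apply/ler_addgt0Pr => e' /[dup] /Sy [X XP] /Sn [Y YP].
    have := le_trans (im_le_cabs _) (XP X (lexx _)); rewrite Iy Wc add0r.
    by apply: le_trans; rewrite lerDl.
  have := le_trans (ni _) (YP Y (lexx _)); rewrite In Wc opprB => h.
  by have := p2 (- Y); lra.
have small (t e' : R) : 0 < e' -> 0 <= t -> k * t ^+ 2 <= k * e' ^+ 2 -> t <= e'.
  by move=> e0 t0; rewrite ler_pM2l // ler_pXn2r ?nnegrE // ltW.
have ke (e' : R) : 0 < e' -> 0 < k * e' ^+ 2 by move=> ?; rewrite mulr_gt0 // exprn_gt0.
have T2 : tends0 f2.
  move=> e' e0; have [X XP] := Sy _ (ke _ e0); exists X => x /XP h; apply: small => //.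
    exact: cabs_ge0.
  by have := le_trans (im_le_cabs _) h; rewrite Iy Wc W0 add0r.
have N2 : tends0 (fun x => f2 (- x)).
  move=> e' e0; have [X XP] := Sn _ (ke _ e0); exists X => x /XP h; apply: small => //.
    exact: cabs_ge0.
  by have := le_trans (ni _) h; rewrite In Wc W0 sub0r opprK.
split => //.
- have := tends0D y2 (tends0Z (- ('i * k%:C)) T2); apply: tends0_eq => x.
  by rewrite mulNr addrK.
- have := tends0D n2 (tends0Z ('i * k%:C) N2); apply: tends0_eq => x.
  by rewrite subrK.
Qed.

End Waves.

Section Continuity.
Variable R : realType.

Lemma wave_coefficients_continuous (F : R -> R -> R -> R) (m : R) (U V : R -> R) :
  standing1 F -> continuous U -> continuous V ->
  [/\ continuous (alF F m U V), continuous (beF F m U V), continuous (cF F m U V),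
      continuous (dF F m U V) & continuous (eF F m U V)].
Proof.
move=> /standing1_Ck[F1 F2 F11 F12 F22] cU cV.
have cU2 := rcontX (n := 2) cU; have cV2 := rcontX (n := 2) cV.
split.
- apply: (rcontM _ cU2); exact: (@Ck0_comp R _ _ _ m (Ck1_cont F11) cU2 cV2).
- exact: (@Ck0_comp R _ _ _ m (Ck1_cont F1) cU2 cV2).
- apply: (rcontM _ cV); apply: (rcontM _ cU); exact: (@Ck0_comp R _ _ _ m (Ck1_cont F12) cU2 cV2).
- apply: (rcontM _ cV2); exact: (@Ck0_comp R _ _ _ m (Ck1_cont F22) cU2 cV2).
- exact: (@Ck0_comp R _ _ _ m (Ck1_cont F2) cU2 cV2).
Qed.

Lemma im_conj (z : R[i]) : complex.Im (conjc z) = - complex.Im z.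
Proof. by case: z. Qed.

Lemma decay_le1 (b x : R) : 0 < b -> 0 <= expR (- b * `|x|) <= 1.
Proof. by move=> b0; rewrite expR_ge0 -expR0 ler_expR mulNr oppr_le0 mulr_ge0 // ltW. Qed.

Lemma cabs_i_mul (z : R[i]) : cabs ('i * z) = cabs z.
Proof. by rewrite cabsM (_ : cabs 'i = 1) ?mul1r //= expr0n expr1n add0r sqrtr1. Qed.

Lemma le_split (u v k : R) : `|u - v| <= k -> `|v| <= k -> `|u| <= k + k.
Proof. by move=> uv vC; rewrite -[u](subrK v) (le_trans (ler_normD _ _)) // lerD. Qed.

Lemma le_shrink (C r w t : R) : 0 <= C -> 0 <= r <= 1 -> 0 <= w <= 1 -> t <= C * r * w ->
  t <= C.
Proof.
move=> C0 /andP[r0 r1] /andP[w0 w1] h; apply: (le_trans h).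
by rewrite -mulrA ler_piMr // mulr_ile1.
Qed.

Lemma decay_product (c p q p4 : R[i]) (C w B M : R) : cabs c <= C * w -> cabs p <= B ->
  cabs q <= B -> cabs p4 <= M -> cabs (c * (p + q) * p4) <= C * (B + B) * M * w.
Proof.
move=> h1 h2 h3 h4; rewrite 2!cabsM.
have -> : C * (B + B) * M * w = C * w * (B + B) * M by ring.
rewrite ler_pM ?mulr_ge0 ?cabs_ge0 // ler_pM ?cabs_ge0 //.
by rewrite (le_trans (cabsD _ _)) // lerD.
Qed.

End Continuity.

Unset Implicit Arguments.
Set Strict Implicit.

Theorem theorem2p13 (R : realType) (om s : R) (F : R -> R -> R -> R)
    (U : R -> R -> R) (V1 phi11 phi12 : R -> R) (Ueps Veps : R -> R -> R)
    (p1 q1 p2 q2 p5 q5 p6 q6 p3 p7 : R -> R[i]) (p4 p8 : R[i] -> R -> R[i]) :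
  let U0 := U om in
  let U2 := U2_of F U0 V1 phi11 phi12 in
  let a2 := a2bar F U0 V1 in
  let b2 := b2bar F U0 V1 U2 in
  let mubar : R := - b2 / a2 in
  let lbr : R[i] := 0 +i* s in
  let n1 := nu1 om lbr in
  let n2 := nu2 om lbr in
  let n3 := nu3 s lbr in
  0 < om -> 0 < s -> om < s ->
  standing1 F ->
  (\forall w \near om, ground_state F w (U w)) ->
  standing3 F s U0 V1 ->
  variational_U F om U0 phi11 -> phi11 0 = 1 -> derive1 phi11 0 = 0 ->
  variational_U F om U0 phi12 -> phi12 0 = 0 -> derive1 phi12 0 = 1 ->
  a2 <> 0 -> b2 <> 0 ->
  derivable (fun w => mass (U w)) om 1 ->
  0 < derive1 (fun w => mass (U w)) om ->
  bifurcated_family F om s mubar U0 V1 U2 Ueps Veps ->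
  jost_A_minus om F U0 lbr n1 1 0 p1 q1 ->
  jost_A_minus om F U0 lbr n2 0 1 p2 q2 ->
  jost_A_plus om F U0 lbr n1 1 0 p5 q5 ->
  jost_A_plus om F U0 lbr n2 0 1 p6 q6 ->
  jost_C_minus s F U0 lbr n3 p3 ->
  jost_C_plus s F U0 lbr n3 p7 ->
  jost_B_near s F U0 p4 p8 ->
  (forall x, p5 x = p1 (- x) /\ q5 x = q1 (- x)) ->
  (forall x, cderiv p2 x * p5 x + cderiv q2 x * q5 x
             - p2 x * cderiv p5 x - q2 x * cderiv q5 x = 0) ->
  evans_2 (p4 0) (p8 0) = 0 ->
  simple_zero (fun gam => evans_2 (p4 gam) (p8 gam)) 0 ->
  evans_A p1 q1 p2 q2 p5 q5 p6 q6 <> 0 ->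
  evans_2 p3 p7 <> 0 ->
  Delta p1 q1 <> 0 ->
  coupling_int F U0 V1 p2 q2 (p4 0) <> 0 ->
  exists e0 : R, exists delta : R, [/\ 0 < e0, 0 < delta &
    forall e : R, 0 < e < e0 ->
      let mu : R := mubar * e ^+ 2 in
      (forall lam : R[i], `|lam - lbr| < delta%:C ->
         ~ L_eigenvalue om s F mu (Ueps e) (Veps e) lam)
      /\ ~ resonance_pole om s F mu (Ueps e) (Veps e) lbr].
Proof.
move=> U0 U2 a2 b2 mubar lbr n1 n2 n3 om0 s0 oms F1 gsn st3 _ _ _ _ _ _ _ _ _ _ bif.
have gs : ground_state F om U0 := nbhs_singleton gsn.
have so : 0 < (s - om) / 2 by rewrite divr_gt0 // subr_gt0.
have k0 : 0 < Num.sqrt (s - om) by rewrite sqrtr_gt0 subr_gt0.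
have n1E : n1 = (Num.sqrt (om + s))%:C by exact: (nu1_br om0 oms).
have n2E : n2 = 'i * (Num.sqrt (s - om))%:C by exact: (nu2_br oms).
have n3E : n3 = (Num.sqrt (2 * s))%:C by exact: (nu3_br om0 oms).
rewrite n1E n2E n3E => j1 j2 j5 j6 j3 j7 jB p51 W25 EB _ EA EC D1 I2.
have [j4 j8 _] := nbhs_singleton jB.
have [b [C0 [e1 [sg [[b0 bn1 bn3] [C00 e10 e11 sg1] unp pert cont]]]]] :=
  coefficient_estimates om0 oms F1 gs st3 bif.
have w1 (x : R) : 0 <= expR (- b * `|x|) <= 1 by exact: decay_le1.
have i01 : 0 <= (1 : R) <= 1 by rewrite ler01 lexx.
have cw (t x : R) : t <= C0 * expR (- b * `|x|) -> t <= C0.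
  by rewrite -[C0 in C0 * _]mulr1; exact: le_shrink C00 i01 (w1 x).
have Ab x := let: And4 h _ _ _ := unp x in cw _ x h.
have Bb x := let: And4 _ h _ _ := unp x in cw _ x h.
have Eb x := let: And4 _ _ _ h := unp x in cw _ x h.
have [sA1 lA1 lA1'] := jost_A_left om0 oms j1; have [sA2 lA2 lA2'] := jost_A_left om0 oms j2.
have [sA5 lA5 lA5'] := jost_A_right om0 oms j5; have [sA6 lA6 lA6'] := jost_A_right om0 oms j6.
have r1 := ltW (re_n1 om0 oms); have r3 := ltW (re_n3 om0 oms).
have r2 : 0 <= complex.Re ('i * (Num.sqrt (s - om))%:C) by rewrite re_n2.
(* The leading coefficients [(1, 0)] and [(0, 1)] sit on the component that owns the exponent, as
   [jost_right_of_like] asks. *)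
have k1 (z w : R[i]) : forall j, (cpair z w j - z) * cpair 1 0 j = 0.
  by apply: ord2P; rewrite /cpair /= ?subrr ?mul0r ?mulr0.
have k2 (z w : R[i]) : forall j, (cpair z w j - w) * cpair 0 1 j = 0.
  by apply: ord2P; rewrite /cpair /= ?subrr ?mul0r ?mulr0.
pose PmA := cpair (cpair p1 q1) (cpair p2 q2).
pose PmA' := cpair (cpair (cderiv p1) (cderiv q1)) (cpair (cderiv p2) (cderiv q2)).
pose PpA := cpair (cpair p5 q5) (cpair p6 q6).
pose PpA' := cpair (cpair (cderiv p5) (cderiv q5)) (cpair (cderiv p6) (cderiv q6)).
have jmA i : jost_right (cpair (Num.sqrt (om + s))%:C ('i * (Num.sqrt (s - om))%:C))
    (reflB (BA (fun x => d1 (d1 F) (U0 x ^+ 2) 0 0 * U0 x ^+ 2) (fun x => d1 F (U0 x ^+ 2) 0 0)))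
    (refl (PmA i)) (reflN (PmA' i)).
  move: i; apply: ord2P; rewrite /PmA /PmA' /=.
    exact: (jost_right_of_like (sys_refl sA1) r1 (k1 _ _) lA1 lA1').
  exact: (jost_right_of_like (sys_refl sA2) r2 (k2 _ _) lA2 lA2').
have jpA i : jost_right (cpair (Num.sqrt (om + s))%:C ('i * (Num.sqrt (s - om))%:C))
    (BA (fun x => d1 (d1 F) (U0 x ^+ 2) 0 0 * U0 x ^+ 2) (fun x => d1 F (U0 x ^+ 2) 0 0))
    (PpA i) (PpA' i).
  move: i; apply: ord2P; rewrite /PpA /PpA' /=.
    exact: (jost_right_of_like sA5 r1 (k1 _ _) lA5 lA5').
  exact: (jost_right_of_like sA6 r2 (k2 _ _) lA6 lA6').
have sC3 := let: And3 h _ _ := j3 in solves_C_sys om0 oms h.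
have sC7 := let: And3 h _ _ := j7 in solves_C_sys om0 oms h.
have jmC (i : 'I_1) : jost_right (csingle (Num.sqrt (2 * s))%:C)
    (reflB (BS (fun x => d2 F (U0 x ^+ 2) 0 0))) (refl (csingle p3)) (reflN (csingle (cderiv p3))).
  have [_ h h'] := j3; apply: (jost_right_of_like (c := fun=> 1) (sys_refl sC3) r3) => j.
  - by rewrite /csingle subrr mul0r.
  - exact: (like_minus h).
  - by rewrite mulr1; exact: (like_expN (like_minus h')).
have jpC (i : 'I_1) : jost_right (csingle (Num.sqrt (2 * s))%:C)
    (BS (fun x => d2 F (U0 x ^+ 2) 0 0)) (csingle p7) (csingle (cderiv p7)).
  have [_ h h'] := j7; apply: (jost_right_of_like (c := fun=> 1) sC7 r3) => j.
  - by rewrite /csingle subrr mul0r.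
  - exact: (like_plus h).
  - by rewrite mulr1; exact: (like_plus h').
have [dp4 ddp4] := p4_derivs j4.
have pj := p4_jet Eb j4; have pf := p4_far j4; have jB4 := p4_jost j4.
have [Mp p4M] := p4_bounded Eb j4 j8 EB.
have [Bp P2B] := oscillating_bounded om0 oms Ab Bb j1 j2 j5 j6 p51 (W25 0) EA D1.
have cU0 : continuous U0 by have [h _ _ _ _] := gs; exact: twice_cont.
have cV1 : continuous V1 by have [h _ _ _ _] := st3; exact: twice_cont.
have cc0 : continuous (fun x => d1 (d2 F) (U0 x ^+ 2) 0 0 * U0 x * V1 x).
  have [_ _ _ F12 _] := standing1_Ck F1; apply: (rcontM _ cV1); apply: (rcontM _ cU0).
  apply: (@Ck0_comp R _ _ _ 0 (Ck1_cont F12) (rcontX (n := 2) cU0)) => x; exact: cst_continuous.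
have cp2 : ccont p2 by apply: isd_ccont; exact: (sA2.1 ord0).
have cq2 : ccont q2 by apply: isd_ccont; exact: (sA2.1 ord_max).
have cp4 : ccont (p4 0) by exact: isd_ccont dp4.
(* A primitive of the integrand of [I_2], which decays exponentially because its coefficient does
   and [p2], [q2], [p4] are bounded. *)
have [G [dG GI]] : exists G : R -> R[i],
    (forall x, isd G x ((d1 (d2 F) (U0 x ^+ 2) 0 0 * U0 x * V1 x)%:C * (p2 x + q2 x) * p4 0 x)) /\
    tends0 (fun x => G x - G (- x) - coupling_int F U0 V1 p2 q2 (p4 0)).
  apply: (@cprimitive R _ (C0 * (Bp + Bp) * Mp) b b0).
    by apply: (ccontM _ cp4); apply: ccontM; [exact: ccont_real|exact: ccontD].
  move=> x; have [_ _ h _] := unp x.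
  apply: decay_product (P2B ord0 x).1 (P2B ord_max x).1 (p4M x).
  by rewrite cabs_real.
pose al eps := alF F (mubar * eps ^+ 2) (Ueps eps) (Veps eps).
pose be eps := beF F (mubar * eps ^+ 2) (Ueps eps) (Veps eps).
pose c eps := cF F (mubar * eps ^+ 2) (Ueps eps) (Veps eps).
pose d eps := dF F (mubar * eps ^+ 2) (Ueps eps) (Veps eps).
pose e eps := eF F (mubar * eps ^+ 2) (Ueps eps) (Veps eps).
have [del1 del10 [eps1 eps10 HU]] := @unstable_trivial R om s b C0 e1 sg _ _ _ _ al be c d e
  om0 oms b0 bn1 bn3 C00 e10 e11 sg1 unp pert PmA PmA' PpA PpA' _ _ _ _ _ _ jmA jpA
  (spanA EA) jmC jpC (spanC EC) jB4 dp4 ddp4 pj pf.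
have [del2 del20 [eps2 eps20 HE]] := @embedded_trivial R om s b C0 e1 sg _ _ _ _ al be c d e
  om0 oms b0 bn1 bn3 C00 e10 e11 sg1 unp pert PmA PmA' PpA PpA' _ _ _ _ _ _ jmA jpA
  (spanA EA) jmC jpC (spanC EC) jB4 dp4 ddp4 pj (PmA ord_max) (PmA' ord_max) G Bp _
  sA2.1 sA2.2 P2B dG GI I2.
(* [z = i (lam - lbr)], so the radius bounds [|z|] directly; the term [(s - om) / 2] is the
   smallness required by [wave_exponents]. *)
exists (Num.min e1 (Num.min eps1 eps2)), (Num.min (Num.min del1 del2) ((s - om) / 2)); split.
- by rewrite !lt_min e10 eps10.
- by rewrite !lt_min del10 del20.
move=> eps; rewrite !lt_min => /andP[p /and3P[pe1 peps1 peps2]] mu.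
have pe : 0 < eps < e1 by rewrite p.
have [cU cV] := cont eps pe.
split.
- move=> lam; rewrite cabs_lt !lt_min => /andP[/andP[l1 l2] l3].
  have [cal cbe cc cd ce] := wave_coefficients_continuous mu F1 cU cV.
  move=> /(eigen_classical cal cbe cc cd ce)[f [f' [df df' tf nz]]].
  have zE : 'i * lam + s%:C = 'i * (lam - lbr).
    by rewrite mulrBr i_lbr rmorphN opprK.
  have cz : cabs ('i * lam + s%:C) = cabs (lam - lbr).
    by rewrite zE cabs_i_mul.
  have md := rhsk_modes df df'.
  (* Stated for arbitrary modes, so as to serve for an eigenfunction and for its conjugate. *)
  have trivial_modes (z : R[i]) (g g' : 'I_(2 + 2) -> R -> R[i]) :
      modes om s (al eps) (be eps) (c eps) (d eps) (e eps) z g g' ->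
      cabs z = cabs (lam - lbr) -> 0 <= complex.Im z ->
      (forall k, [/\ tends0 (g k), tends0 (fun x => g k (- x)), tends0 (g' k) &
                     tends0 (fun x => g' k (- x))]) ->
      forall k x, g k x = 0.
    move=> mg zz iz tg.
    have [ka1 [ka2 [ka3 [ka4 [hk hr hi]]]]] := wave_exponents oms iz ltac:(by rewrite zz ltW).
    (* As [g] and [g'] vanish at infinity, the outgoing condition holds whatever the exponent. *)
    have T k (ka : R[i]) : tends0 (fun x => g' k x + ka * g k x).
      by have [h1 _ h3 _] := tg k; exact: tends0D h3 (tends0Z ka h1).
    have N k (ka : R[i]) : tends0 (fun x => g' k (- x) - ka * g k (- x)).
      have [_ h2 _ h4] := tg k; apply: tends0_eq (tends0D h4 (tends0Z (- ka) h2)) => x.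
      by rewrite mulNr.
    have hb k : half_bounded (g k) /\ half_bounded (fun x => g k (- x)).
      have [h1 h2 _ _] := tg k; have [dg _] := mg.
      have [X XP] := h1 1 ltr01; have [Y YP] := h2 1 ltr01; split.
        by apply: (bounded_half _ XP) => x; exists (g' k x).
      by apply: (bounded_half _ YP) => x; exists (- g' k (- x)); exact: isd_opp.
    have wv := @modes_wave R om s al be c d e eps z ka1 ka2 ka3 ka4 g g' mg hk hr hi hb
      (And4 (T _ _) (T _ _) (T _ _) (T _ _)) (And4 (N _ _) (N _ _) (N _ _) (N _ _)).
    have [q0 m0 q0' m0'] := tg i4_0; have [q1' m1 q1'' m1'] := tg i4_1.
    have [q2' m2 q2'' m2'] := tg i4_2; have [q3 m3 q3' m3'] := tg i4_3.
    have pe1' : 0 < eps < eps1 by rewrite p.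
    have pe2 : 0 < eps < eps2 by rewrite p.
    have zd1 : cabs z <= del1 by rewrite zz ltW.
    have zd2 : cabs z <= del2 by rewrite zz ltW.
    have all0 : forall x, [/\ g i4_0 x = 0, g i4_1 x = 0, g i4_2 x = 0 & g i4_3 x = 0].
      move: iz; rewrite le_eqVlt => /orP[/eqP/esym iz|iz].
        exact: (HE _ _ _ _ _ _ _ _ _ _ _ _ _ _ pe2 zd2 iz wv q1' q1'' m1 m1').
      exact: (HU _ _ _ _ _ _ _ _ _ _ _ _ _ _ pe1' zd1 iz wv (And4 q0' q1'' q2'' q3')
        (And4 m0' m1' m2' m3')).
    by move=> k x; have [? ? ? ?] := all0 x; move: k; exact: ord4P.
  apply: nz => k x.
  (* For [Im z < 0] the conjugate modes take over, with the same modulus of [z]. *)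
  have [iz|/ltW iz] := leP 0 (complex.Im ('i * lam + s%:C)).
    exact: (trivial_modes _ _ _ md cz iz tf).
  have : conjc (f k x) = 0.
    have cz' : cabs (conjc ('i * lam + s%:C)) = cabs (lam - lbr) by rewrite cabs_conj.
    have iz' : 0 <= complex.Im (conjc ('i * lam + s%:C)).
      by rewrite im_conj oppr_ge0.
    apply: (trivial_modes _ _ _ (modes_conj md) cz' iz') => j.
    have [h1 h2 h3 h4] := tf j.
    split; [exact: (tends0_conj h1)|exact: (tends0_conj h2)|exact: (tends0_conj h3)
      |exact: (tends0_conj h4)].
  by case: (f k x) => u v /= [-> /eqP]; rewrite oppr_eq0 => /eqP ->.
- case=> E [ev E0 _].
  have bnd x : [/\ `|alF F mu (Ueps eps) (Veps eps) x| <= C0 + C0,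
      `|beF F mu (Ueps eps) (Veps eps) x| <= C0 + C0,
      `|cF F mu (Ueps eps) (Veps eps) x| <= C0 + C0,
      `|dF F mu (Ueps eps) (Veps eps) x| <= C0 + C0 &
      `|eF F mu (Ueps eps) (Veps eps) x| <= C0 + C0].
    have [g1 g2 g3 g4] := unp x; have [h1 h2 h3 h4 h5] := pert eps pe x.
    have p1' : eps <= 1 by exact: le_trans (ltW pe1) e11.
    have e2 : eps ^+ 2 <= 1 by exact: (exprn_ile1 2 (ltW p) p1').
    have sm (t r : R) : 0 <= r <= 1 -> t <= C0 * r * expR (- b * `|x|) -> t <= C0.
      by move=> r01; exact: le_shrink C00 r01 (w1 x).
    have ep : 0 <= eps <= 1 by rewrite (ltW p).
    have ep2 : 0 <= eps ^+ 2 <= 1 by rewrite sqr_ge0.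
    split.
    - exact: le_split (sm _ _ ep h1) (cw _ _ g1).
    - exact: le_split (sm _ _ ep h2) (cw _ _ g2).
    - apply: le_split (sm _ _ ep2 h3) _; rewrite !normrM sg1 mul1r (ger0_norm (ltW p)) -!normrM.
      apply: le_trans (cw _ _ g3).
      by rewrite ler_piMl ?normr_ge0.
    - by apply: le_trans (sm _ _ ep h4) _; rewrite lerDl.
    - exact: le_split (sm _ _ ep h5) (cw _ _ (let: And4 _ _ _ h := unp x in h)).
  have [f [f' [df df' fb ft nz]]] := resonance_solution om0 oms bnd ev E0.
  have md := rhsk_modes df df'.
  have z0 : 'i * lbr + s%:C = 0 by rewrite i_lbr -rmorphD addNr.
  rewrite z0 in md.
  have [y0 y0' y0''] := ft i4_0; have [y1 y1' _] := ft i4_1.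
  have [y2 y2' y2''] := ft i4_2; have [y3 y3' _] := ft i4_3.
  have [d0 d0'] := y0'' (re_n1 om0 oms); have [d2_ d2'] := y2'' (re_n3 om0 oms).
  have hk : [/\ exponent4 om s i4_0 ^+ 2 = (om + s)%:C - 0,
      exponent4 om s i4_1 ^+ 2 = (om - s)%:C + 0,
      exponent4 om s i4_2 ^+ 2 = (2 * s)%:C - 0 & exponent4 om s i4_3 ^+ 2 = 0].
    rewrite !subr0 addr0; split; [exact: (n1_sqr om0 oms)|exact: (n2_sqr oms)
      |exact: (n3_sqr om0 oms)|by rewrite expr0n].
  have re4 := exponent4_re om0 oms.
  have hi : 0 <= complex.Im (exponent4 om s i4_1).
    by rewrite imM /= mul0r mul1r add0r sqrtr_ge0.
  have hb k : half_bounded (f k) /\ half_bounded (fun x => f k (- x)).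
    by have [h1 _ h3 _] := fb k.
  have wv := @modes_wave R om s al be c d e eps 0 _ _ _ _ f f' md hk
    (And4 (re4 _) (re4 _) (re4 _) (re4 _)) hi hb (And4 y0 y1 y2 y3) (And4 y0' y1' y2' y3').
  (* At the threshold the exponent of component 4 is 0, so its outgoing condition says that the
     derivative vanishes at infinity. *)
  have y3f : tends0 (f' i4_3).
    by apply: tends0_eq y3 => x; rewrite /exponent4 /= mul0r addr0.
  have y3f' : tends0 (fun x => f' i4_3 (- x)).
    by apply: tends0_eq y3' => x; rewrite /exponent4 /= mul0r subr0.
  have [b0_ b0' b0n b0n'] := fb i4_0; have [b1_ _ b1n _] := fb i4_1.
  have [_ b2' _ b2n'] := fb i4_2; have [b3_ _ b3n _] := fb i4_3.
  have [v1 v2 v3 v4] := flux_vanish wv erefl k0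
    (And4 d0 d2_ y3f (And4 b0' b1_ b2' b3_)) (And4 d0' d2' y3f' (And4 b0n' b1n b2n' b3n)).
  apply: nz => k x.
  have [? ? ? ?] : [/\ f i4_0 x = 0, f i4_1 x = 0, f i4_2 x = 0 & f i4_3 x = 0].
    have pe2 : 0 < eps < eps2 by rewrite p.
    have zd2 : cabs (0 : R[i]) <= del2 by rewrite cabs0 ltW.
    exact: (HE _ _ _ _ _ _ _ _ _ _ _ _ _ _ pe2 zd2 erefl wv v1 v2 v3 v4).
  by move: k; exact: ord4P.
Qed.
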